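(* Let $N\ge1$ be an integer and $\chi$ a primitive even Dirichlet character modulo $N$ (for $N=1$, $\chi=1$ and $\chi(0)=1$). Let $F^\chi_\tau(u,v)$ be the twisted Kronecker series defined in the context, with $q=e^{2\pi i\tau}$, $\xi=e^u$, $\eta=e^v$. Then: (1) For $|q|<|\xi|<1$ and $|q|<|\eta|<1$, $$F^\chi_\tau(u,v)=\frac12\sum_{h=0}^{N}\chi(h)\Big(\frac{\eta^h}{\eta^N-1}+\frac{\xi^h}{\xi^N-1}\Big)-\frac12\sum_{m,n\ge1}(\chi(n)+\chi(m))\big(\xi^m\eta^n-\chi(-1)\xi^{-m}\eta^{-n}\big)q^{mn}.$$ (2) $$F^\chi_\tau(u,v)=\frac{1}{2W(\overline\chi)}\sum_{h=0}^{N-1}\overline\chi(h)\Big(F_\tau\big(u+2\pi i\tfrac hN,v\big)+F_\tau\big(u,v+2\pi i\tfrac hN\big)\Big).$$ (3) $F^\chi_\tau(u,v)$ can be continued analytically to all $\tau\in\mathbb H$ and meromorphically to all $u,v\in\mathbb C$. Its poles are at $u=\frac{2\pi i r}{N}+2\pi i n\tau$ with $r,n\in\mathbb Z$, $\gcd(r,N)=1$; at $u=2\pi i r+2\pi i n\tau$ with $r,n\in\mathbb Z$, $\gcd(n,N)=1$; at $v=\frac{2\pi i s}{N}+2\pi i m\tau$ with $s,m\in\mathbb Z$, $\gcd(s,N)=1$; and at $v=2\pi i s+2\pi i m\tau$ with $s,m\in\mathbb Z$, $\gcd(m,N)=1$. (4) (Laurent expansion at $u=v=0$) $$F^\chi_\tau(u,v)=\chi(0)\Big(\frac1u+\frac1v\Big)-\sum_{\substack{r,s\ge0\\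 r+s\ \mathrm{odd}}}\Big(\frac{1}{2\pi i}\frac{d}{d\tau}\Big)^{\min\{r,s\}}\Big(G_{|r-s|+1,\overline\chi}(\tau)+H_{|r-s|+1,\chi}(\tau)\Big)\frac{u^r}{r!}\frac{v^s}{s!}.$$ (5) (Fourier expansion) For $|q|<|\xi|<1$ and $|q|<|\eta|<1$, $$F^\chi_\tau(u,v)=\frac12\sum_{a=0}^{N}\chi(a)\Big(\frac{\xi^a}{\xi^N-1}+\frac{\eta^a}{\eta^N-1}\Big)-\sum_{n\ge1}\sum_{d|n}\Big(\chi(d)+\chi\big(\tfrac nd\big)\Big)\sinh\Big(du+\frac nd v\Big)q^n.$$ (6) (elliptic property) For all $m,n,r,s\in\mathbb Z$, $$F^\chi_\tau\big(u+2\pi i(nN\tau+s),\,v+2\pi i(mN\tau+r)\big)=q^{-N^2mn}\xi^{-Nm}\eta^{-Nn}F^\chi_\tau(u,v).$$ (7) (modular property) For all $\begin{pmatrix}a&b\\c&d\end{pmatrix}\in\Gamma_0(N)$, $$F^\chi_{\frac{a\tau+b}{c\tau+d}}\Big(\frac{u}{c\tau+d},\frac{v}{c\tau+d}\Big)=\chi(d)\,(c\tau+d)\,e^{\frac{cuv}{2\pi i(c\tau+d)}}\,F^\chi_\tau(u,v).$$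
   Context: For $\tau\in\mathbb H$, $q=e^{2\pi i\tau}$, $\xi=e^u$, $\eta=e^v$ with $|q|<|\xi|<1$ and $|q|<|\eta|<1$, the twisted Kronecker series is $$F^\chi_\tau(u,v)=\frac12\Big(\sum_{n\in\mathbb Z}\chi(n)\frac{\eta^n}{\xi q^n-1}+\sum_{m\in\mathbb Z}\chi(m)\frac{\xi^m}{\eta q^m-1}\Big).$$ In parts (4), (6), (7) it denotes the continued function. The classical Kronecker series is $F_\tau(u,v)=\sum_{n\in\mathbb Z}\frac{\eta^n}{q^n\xi-1}$ (for the same region), equivalently the meromorphic function $\frac{\theta'(0)\theta(u+v)}{\theta(u)\theta(v)}$ with $\theta(u)=q^{1/8}(\xi^{1/2}-\xi^{-1/2})\prod_{n\ge1}(1-q^n)(1-q^n\xi)(1-q^n\xi^{-1})$. $W(\chi)=\sum_{h\bmod N}\chi(h)e^{2\pi ih/N}$ is the Gauss sum. The twisted Bernoulli numbers are $B_{k,\chi}=N^{k-1}\sum_{h\bmod N}\chi(h)B_k(h/N)$, with $B_k(x)$ the Bernoulli polynomials. For even $k\ge2$ and a primitive even character $\psi$ modulo $N$ the Eisenstein series are $$G_{k,\psi}(\tau)=-\frac{B_{k,\overline\psi}}{2k}+\sum_{n\ge1}\sum_{0<d|n}\overline\psi(d)d^{k-1}q^n,\qquad H_{k,\psi}(\tau)=\sum_{n\ge1}\sum_{0<d|n}\psi\big(\tfrac nd\big)d^{k-1}q^n\quad(N>1),$$ while for $N=1$, $G_{k,1}=H_{k,1}=G_k=-\frac{B_k}{2k}+\sum_{n\ge1}\sigma_{k-1}(n)q^n$.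 *)

(* Defs.v *)
From Stdlib Require Import Reals ZArith Arith.
From Coquelicot Require Export Coquelicot.

Open Scope C_scope.

Definition Cexp (z : C) : C := (exp (Re z) * cos (Im z), exp (Re z) * sin (Im z))%R.

Definition Csinh (z : C) : C := (Cexp z - Cexp (- z)) / 2.

Definition Cpowz (z : C) (n : Z) : C :=
  if (0 <=? n)%Z then z ^ Z.to_nat n else / (z ^ Z.to_nat (- n)).

Definition nome (tau : C) : C := Cexp (2 * PI * Ci * tau).

(* Coquelicot's [Series] is real valued; [CSeries a] is the sum of [a] whenever
   the complex series converges. *)
Definition CSeries (a : nat -> C) : C :=
  (Series (fun n => Re (a n)), Series (fun n => Im (a n))).

Definition CSeriesZ (a : Z -> C) : C :=
  CSeries (fun k => a (Z.of_nat k)) + CSeries (fun k => a (- Z.of_nat (S k))%Z).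

(* The double series of [a] converges absolutely, with sum [l].  Once the
   moduli are summable, all orders of summation agree, so the limit of the
   square partial sums is the sum. *)
Definition is_double_series (a : nat -> nat -> C) (l : C) : Prop :=
  (exists M : R, forall K : nat,
     (sum_n (fun i => sum_n (fun j => Cmod (a i j)) K) K <= M)%R) /\
  filterlim (fun K => sum_n (fun i => sum_n (fun j => a i j) K) K)
    eventually (locally (T := C_UniformSpace) l).

(* A character modulo [N], as an [N]-periodic function on the integers. *)
Definition dirichlet_character (N : nat) (chi : Z -> C) : Prop :=
  (forall n : Z, chi (n + Z.of_nat N)%Z = chi n) /\
  (forall m n : Z, chi (m * n)%Z = chi m * chi n) /\
  (forall n : Z, chi n <> 0 <-> Z.gcd n (Z.of_nat N) = 1%Z).

(* [chi] is not induced by a character modulo a proper divisor of [N].  For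
   [N = 1] this leaves exactly [chi = 1], with [chi 0 = 1]. *)
Definition primitive_character (N : nat) (chi : Z -> C) : Prop :=
  dirichlet_character N chi /\
  forall M : nat, (1 <= M < N)%nat -> Nat.divide M N ->
    ~ exists psi : Z -> C, dirichlet_character M psi /\
        forall n : Z, Z.gcd n (Z.of_nat N) = 1%Z -> chi n = psi n.

Definition even_character (chi : Z -> C) : Prop := chi (-1)%Z = 1.

Definition conj_character (chi : Z -> C) : Z -> C := fun n => Cconj (chi n).

(* Sums over [h mod N] use the representatives [0, ..., N - 1]. *)
Definition gauss_sum (N : nat) (chi : Z -> C) : C :=
  sum_n (fun h => chi (Z.of_nat h) * Cexp (2 * PI * Ci * INR h / INR N)) (N - 1).

(* [bernoulli_upto x n k] is B_k(x) for [k <= n], by the recursion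
   sum_{j <= n} binom(n+1, j) B_j(x) = (n+1) x^n, which is the coefficientwise
   form of the generating function t e^(xt) / (e^t - 1). *)
Fixpoint bernoulli_upto (x : R) (n : nat) : nat -> R :=
  match n with
  | O => fun _ => 1%R
  | S m =>
      let b := bernoulli_upto x m in
      fun k =>
        if (k <=? m)%nat then b k
        else (x ^ n - sum_n (fun j => Binomial.C (S n) j * b j) m / INR (S n))%R
  end.

Definition bernoulli_poly (k : nat) (x : R) : R := bernoulli_upto x k k.

Definition twisted_bernoulli (N : nat) (chi : Z -> C) (k : nat) : C :=
  INR N ^ (k - 1) *
  sum_n (fun h => chi (Z.of_nat h) * bernoulli_poly k (INR h / INR N)) (N - 1).

Definition divisor_sum (n : nat) (f : nat -> C) : C :=
  sum_n_m (fun d => if (n mod d =? 0)%nat then f d else RtoC 0) 1 n.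

Definition eisenstein_G (N : nat) (psi : Z -> C) (k : nat) (tau : C) : C :=
  - (twisted_bernoulli N (conj_character psi) k / (2 * INR k)) +
  CSeries (fun i =>
    divisor_sum (S i) (fun d => conj_character psi (Z.of_nat d) * INR d ^ (k - 1))
    * nome tau ^ S i).

(* For [N = 1], [eisenstein_G] is the level one series G_k, as B_{k,1} = B_k(0). *)
Definition eisenstein_H (N : nat) (psi : Z -> C) (k : nat) (tau : C) : C :=
  if (N =? 1)%nat then eisenstein_G N psi k tau
  else CSeries (fun i =>
    divisor_sum (S i) (fun d => psi (Z.of_nat (S i / d)) * INR d ^ (k - 1))
    * nome tau ^ S i).

Fixpoint Dtau_iter (n : nat) (f : C -> C) : C -> C :=
  match n with
  | O => f
  | S m => fun tau => C_derive (Dtau_iter m f) tau / (2 * PI * Ci)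
  end.

Definition kronecker_region (tau u v : C) : Prop :=
  (0 < Im tau)%R /\
  (Cmod (nome tau) < Cmod (Cexp u) < 1)%R /\
  (Cmod (nome tau) < Cmod (Cexp v) < 1)%R.

(* In [kronecker_region] no denominator below vanishes and the bilateral
   series converge absolutely. *)
Definition kronecker (tau u v : C) : C :=
  CSeriesZ (fun n => Cpowz (Cexp v) n / (Cpowz (nome tau) n * Cexp u - 1)).

Definition twisted_kronecker (chi : Z -> C) (tau u v : C) : C :=
  / 2 *
  (CSeriesZ (fun n => chi n * (Cpowz (Cexp v) n / (Cexp u * Cpowz (nome tau) n - 1))) +
   CSeriesZ (fun m => chi m * (Cpowz (Cexp u) m / (Cexp v * Cpowz (nome tau) m - 1)))).

Definition polar_value (N : nat) (tau w : C) : Prop :=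
  exists r n : Z,
    (Z.gcd r (Z.of_nat N) = 1%Z /\
     w = 2 * PI * Ci * IZR r / INR N + 2 * PI * Ci * IZR n * tau) \/
    (Z.gcd n (Z.of_nat N) = 1%Z /\
     w = 2 * PI * Ci * IZR r + 2 * PI * Ci * IZR n * tau).

Definition polar_point (N : nat) (tau u v : C) : Prop :=
  polar_value N tau u \/ polar_value N tau v.

Definition holomorphic_at {U : NormedModule C_AbsRing} (f : U -> C) (p : U) : Prop :=
  locally p (fun x => ex_filterdiff (V := C_NormedModule) f (locally x)).

(* The germ at [p] of a meromorphic function is a quotient [g / h] with [h] a
   nonzero germ.  Functions are total, and the values of [f] on the zero set of
   the denominator are irrelevant. *)
Definition meromorphic_at {U : NormedModule C_AbsRing} (f : U -> C) (p : U) : Prop :=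
  exists g h : U -> C,
    holomorphic_at g p /\ holomorphic_at h p /\
    ~ locally p (fun x => h x = 0) /\
    locally p (fun x => h x <> 0 -> f x = g x / h x).

(* [f] agrees with a holomorphic function near [p], off the zero set of a
   nonzero holomorphic germ. *)
Definition removable_at {U : NormedModule C_AbsRing} (f : U -> C) (p : U) : Prop :=
  exists g h : U -> C,
    holomorphic_at g p /\ holomorphic_at h p /\
    ~ locally p (fun x => h x = 0) /\
    locally p (fun x => h x <> 0 -> f x = g x).

(* In several variables the polar set includes the points of indeterminacy. *)
Definition pole_at {U : NormedModule C_AbsRing} (f : U -> C) (p : U) : Prop :=
  meromorphic_at f p /\ ~ removable_at f p.

Definition C2 : NormedModule C_AbsRing :=
  prod_NormedModule C_AbsRing C_NormedModule C_NormedModule.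

Definition C3 : NormedModule C_AbsRing :=
  prod_NormedModule C_AbsRing C_NormedModule C2.

Definition on_C2 (f : C -> C -> C) : C2 -> C := fun p => f (fst p) (snd p).

Definition on_C3 (f : C -> C -> C -> C) : C3 -> C :=
  fun p => f (fst p) (fst (snd p)) (snd (snd p)).

(* Main.v *)
(* Write x_n = xi q^n and y_n = eta q^n.  Splitting double geometric series along their diagonal rewrites
   sum_n chi(n) eta^n / (x_n - 1) as
     sum_n chi(n) eta^n x_n^n / (x_n - 1) + 1/W(conj chi) sum_h conj chi(h) sum_n xi^n z_{n,h}^(n+1) / (z_{n,h} - 1),
   with z_{n,h} = e^(2 pi i h / N) y_n.  Its terms decay like q^(n^2), so this is the continuation: shifting n
   gives the elliptic property, and the poles, all simple in u or in v, are read off term by term.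

   For N = 1 the difference of the two sides of the modular law is a quasi-periodic function of u with
   removable singularities; an exponential factor makes it bounded, hence constant by Liouville's theorem, and
   its multipliers force it to vanish.  Averaging over v + 2 pi i h / N with the Gauss sum, reindexing
   h -> d h, and continuity give the twisted law.

   For the Laurent expansion, sinh is expanded in the double series; the coefficients
   sum (chi(m) + chi(n)) m^r n^s q^(m n) are iterated derivatives of divisor sums, and the polar part is
   expanded with the generating function of the Bernoulli polynomials. *)

Require Import Defs.
From Stdlib Require Import Reals ZArith Znumtheory Arith Lia Lra Psatz List Permutation Classical ClassicalEpsilon.
From Coquelicot Require Import Coquelicot.
From Corelib Require Import ssreflect.

Open Scope C_scope.

(** * Unconditional summation *)

(** All rearrangements (splitting quadrants along diagonals, grouping by products mn = k, exchanging
    (m, n) with (r, s)) use unconditional sums over arbitrary index types; ordered series appear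
    only at the end. The diagonal of the double series may be attributed to either half of the
    continuation, and more generally both halves carry an integer offset [a] in their exponents. A
    translation by N tau shifts the index and changes this offset, so the elliptic property rests on
    independence of [a]. Where a polar line in u crosses one in v, several terms are singular at
    once: moving v slightly leaves a single singular term, whose coefficient is nonzero. In the
    twisted modular law the torsion shifts may hit poles of the classical function, so the law is
    first proved at points with generic real part. Joint holomorphy in (tau, u, v) is obtained by
    transporting one-variable Cauchy theory along complex lines to normed spaces, where holomorphic
    terms with a summable majorant can be summed and differentiated term by term. *)

Definition sumC {I : Type} (f : I -> C) (l : list I) : C :=
  fold_right (fun i s => f i + s) 0 l.

Definition sumR {I : Type} (f : I -> R) (l : list I) : R :=
  fold_right (fun i s => (f i + s)%R) 0%R l.

Definition classic_eq_dec {I : Type} (x y : I) : {x = y} + {x <> y} :=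
  excluded_middle_informative (x = y).

Lemma sumC_app {I} (f : I -> C) l1 l2 : sumC f (l1 ++ l2) = sumC f l1 + sumC f l2.
Proof. elim: l1 => [|x l IH] /=; [by rewrite Cplus_0_l | by rewrite IH Cplus_assoc]. Qed.

Lemma sumR_app {I} (f : I -> R) l1 l2 : (sumR f (l1 ++ l2) = sumR f l1 + sumR f l2)%R.
Proof. elim: l1 => [|x l IH] /=; [by rewrite Rplus_0_l | by rewrite IH Rplus_assoc]. Qed.

Lemma sumC_perm {I} (f : I -> C) l1 l2 : Permutation l1 l2 -> sumC f l1 = sumC f l2.
Proof.
elim=> [|x l l' _ IH|x y l|l l' l'' _ IH1 _ IH2] //=.
- by rewrite IH.
- ring.
- by rewrite IH1.
Qed.

Lemma sumR_perm {I} (f : I -> R) l1 l2 : Permutation l1 l2 -> sumR f l1 = sumR f l2.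
Proof.
elim=> [|x l l' _ IH|x y l|l l' l'' _ IH1 _ IH2] //=.
- by rewrite IH.
- ring.
- by rewrite IH1.
Qed.

Lemma sumC_ext {I} (f g : I -> C) l : (forall i, In i l -> f i = g i) -> sumC f l = sumC g l.
Proof.
elim: l => [|x l IH] //= H.
rewrite H; last by left.
by rewrite IH // => i Hi; apply: H; right.
Qed.

Lemma sumC_map {I J} (f : I -> C) (p : J -> I) l : sumC f (map p l) = sumC (fun j => f (p j)) l.
Proof. by elim: l => [|x l /= ->]. Qed.

Lemma sumR_map {I J} (f : I -> R) (p : J -> I) l : sumR f (map p l) = sumR (fun j => f (p j)) l.
Proof. by elim: l => [|x l /= ->]. Qed.

Lemma sumC_plus {I} (f g : I -> C) l : sumC (fun i => f i + g i) l = sumC f l + sumC g l.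
Proof. elim: l => [|x l /= ->] /=; ring. Qed.

Lemma sumC_mult_l {I} (c : C) (f : I -> C) l : sumC (fun i => c * f i) l = c * sumC f l.
Proof. elim: l => [|x l /= ->] /=; ring. Qed.

Lemma sumC_zero {I} (f : I -> C) l : (forall i, In i l -> f i = 0) -> sumC f l = 0.
Proof.
elim: l => [|x l IH] //= H.
rewrite IH ?H; [ring | by left | by move=> i Hi; apply: H; right].
Qed.

Lemma sumC_swap {I J} (f : I -> J -> C) l1 l2 :
  sumC (fun i => sumC (f i) l2) l1 = sumC (fun j => sumC (fun i => f i j) l1) l2.
Proof.
elim: l1 => [|x l IH] /=.
- by rewrite sumC_zero.
- by rewrite IH sumC_plus.
Qed.

Lemma Cmod_sumC {I} (f : I -> C) l : (Cmod (sumC f l) <= sumR (fun i => Cmod (f i)) l)%R.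
Proof.
elim: l => [|x l IH] /=; first by rewrite Cmod_0; lra.
have := Cmod_triangle (f x) (sumC f l); lra.
Qed.

Lemma sumR_le {I} (f g : I -> R) l :
  (forall i, In i l -> (f i <= g i)%R) -> (sumR f l <= sumR g l)%R.
Proof.
elim: l => [|x l IH] /= H; first lra.
apply: Rplus_le_compat; [by apply: H; left | by apply: IH => i Hi; apply: H; right].
Qed.

Lemma sumR_ge0 {I} (f : I -> R) l : (forall i, In i l -> (0 <= f i)%R) -> (0 <= sumR f l)%R.
Proof.
elim: l => [|x l IH] /= H; first lra.
apply: Rplus_le_le_0_compat; [by apply: H; left | by apply: IH => i Hi; apply: H; right].
Qed.

Lemma sumR_mult_l {I} (c : R) (f : I -> R) l : (sumR (fun i => c * f i) l = c * sumR f l)%R.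
Proof. elim: l => [|x l /= ->] /=; ring. Qed.

Lemma sumR_plus {I} (f g : I -> R) l : (sumR (fun i => f i + g i) l = sumR f l + sumR g l)%R.
Proof. elim: l => [|x l /= ->] /=; ring. Qed.

Lemma sumR_const {I} (c : R) (l : list I) : (sumR (fun _ => c) l = INR (length l) * c)%R.
Proof.
elim: l => [|x l IH]; first by rewrite /=; ring.
rewrite [length _]/= S_INR /= IH; ring.
Qed.

(** Comparing partial sums over nested index sets requires the larger one to be written as the
    smaller one plus a remainder; the order is immaterial. *)
Lemma incl_permutation {I} (l0 l : list I) :
  NoDup l0 -> incl l0 l -> exists l', Permutation l (l0 ++ l').
Proof.
intros H; revert l; induction H as [|x l1 Hx HN IH]; intros l Hi; first by exists l.
have [a [b E]] := in_split x l (Hi x (or_introl eq_refl)).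
subst l.
have Hi' : incl l1 (a ++ b).
  move=> y Hy; have : In y (a ++ x :: b) by apply: Hi; right.
  rewrite !in_app_iff /= => -[?|[E|?]]; [by left| |by right].
  by subst y.
have [l' P] := IH _ Hi'.
exists l' => /=.
apply: perm_trans; first by apply: Permutation_sym; apply: Permutation_middle.
by constructor.
Qed.

Lemma sumR_incl {I} (f : I -> R) l0 l :
  (forall i, (0 <= f i)%R) -> NoDup l0 -> incl l0 l -> (sumR f l0 <= sumR f l)%R.
Proof.
move=> Hf Hn Hi; have [l' P] := incl_permutation l0 l Hn Hi.
rewrite (sumR_perm _ _ _ P) sumR_app.
have := sumR_ge0 f l' (fun i _ => Hf i); lra.
Qed.

(* Convergence along the directed set of finite subsets of [I]. *)
Definition has_sum {I : Type} (f : I -> C) (s : C) : Prop :=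
  forall eps : R, (0 < eps)%R -> exists L0 : list I,
    forall L, NoDup L -> incl L0 L -> (Cmod (sumC f L - s) < eps)%R.

Definition bounded_sums {I : Type} (f : I -> R) (M : R) : Prop :=
  forall L, NoDup L -> (sumR f L <= M)%R.

Definition abs_summable {I : Type} (f : I -> C) : Prop :=
  exists M, bounded_sums (fun i => Cmod (f i)) M.

Lemma nodup_over {I} (L0 : list I) : exists L, NoDup L /\ incl L0 L /\ incl L L0.
Proof.
exists (nodup classic_eq_dec L0); split; first exact: NoDup_nodup.
split=> x; by rewrite nodup_In.
Qed.

Lemma has_sum_unique {I} (f : I -> C) s t : has_sum f s -> has_sum f t -> s = t.
Proof.
move=> Hs Ht; apply: NNPP => ne.
have d0 : (0 < Cmod (s - t))%R.
  apply/Cmod_gt_0 => E; apply: ne; by rewrite -(Cplus_0_r t) -E; ring.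
have [|L1 H1] := Hs (Cmod (s - t) / 2)%R; first lra.
have [|L2 H2] := Ht (Cmod (s - t) / 2)%R; first lra.
have [L [HL [Hi _]]] := nodup_over (L1 ++ L2).
have h1 := H1 L HL (fun x hx => Hi x (in_or_app _ _ _ (or_introl hx))).
have h2 := H2 L HL (fun x hx => Hi x (in_or_app _ _ _ (or_intror hx))).
have : (Cmod (s - t) <= Cmod (sumC f L - t) + Cmod (sumC f L - s))%R.
  rewrite -(Cmod_opp (sumC f L - s)).
  have -> : s - t = (sumC f L - t) + (- (sumC f L - s)) by ring.
  exact: Cmod_triangle.
lra.
Qed.

Lemma has_sum_ext {I} (f g : I -> C) s : (forall i, f i = g i) -> has_sum f s -> has_sum g s.
Proof.
move=> E H eps He; have [L0 H0] := H eps He; exists L0 => L HL Hi.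
by rewrite -(sumC_ext f g) //; apply: H0.
Qed.

Lemma has_sum_plus {I} (f g : I -> C) s t :
  has_sum f s -> has_sum g t -> has_sum (fun i => f i + g i) (s + t).
Proof.
move=> Hs Ht eps He.
have [|L1 H1] := Hs (eps / 2)%R; first lra.
have [|L2 H2] := Ht (eps / 2)%R; first lra.
exists (L1 ++ L2) => L HL Hi.
have h1 := H1 L HL (fun x hx => Hi x (in_or_app _ _ _ (or_introl hx))).
have h2 := H2 L HL (fun x hx => Hi x (in_or_app _ _ _ (or_intror hx))).
rewrite sumC_plus.
have -> : sumC f L + sumC g L - (s + t) = (sumC f L - s) + (sumC g L - t) by ring.
have := Cmod_triangle (sumC f L - s) (sumC g L - t); lra.
Qed.

Lemma has_sum_mult_l {I} (c : C) (f : I -> C) s :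
  has_sum f s -> has_sum (fun i => c * f i) (c * s).
Proof.
move=> Hs eps He.
(* The added 1 keeps the divisor positive when [c] is zero; the same device recurs below. *)
have p : (0 < Cmod c + 1)%R by have := Cmod_ge_0 c; lra.
have [|L1 H1] := Hs (eps / (Cmod c + 1))%R; first by apply: Rdiv_lt_0_compat.
exists L1 => L HL Hi.
rewrite sumC_mult_l.
have -> : c * sumC f L - c * s = c * (sumC f L - s) by ring.
rewrite Cmod_mult.
have h := H1 L HL Hi.
have : (Cmod (sumC f L - s) * (Cmod c + 1) < eps)%R.
  apply: (Rlt_le_trans _ (eps / (Cmod c + 1) * (Cmod c + 1))%R).
  - by apply: Rmult_lt_compat_r.
  - by right; field; lra.
have := Cmod_ge_0 (sumC f L - s); nra.
Qed.

Lemma has_sum_opp {I} (f : I -> C) s : has_sum f s -> has_sum (fun i => - f i) (- s).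
Proof.
move=> H; have := has_sum_mult_l (-(1)) _ _ H.
have -> : - (1) * s = - s by ring.
apply: has_sum_ext => i; ring.
Qed.

Lemma has_sum_minus {I} (f g : I -> C) s t :
  has_sum f s -> has_sum g t -> has_sum (fun i => f i - g i) (s - t).
Proof. by move=> H1 H2; apply: has_sum_plus => //; apply: has_sum_opp. Qed.

Lemma has_sum_0 {I} : has_sum (fun _ : I => 0) 0.
Proof.
move=> eps He; exists nil => L _ _; rewrite sumC_zero //.
by have -> : 0 - 0 = 0 by [ring]; rewrite Cmod_0.
Qed.

Lemma has_sum_sumC {I J} (f : J -> I -> C) (s : J -> C) l :
  (forall j, In j l -> has_sum (f j) (s j)) ->
  has_sum (fun i => sumC (fun j => f j i) l) (sumC s l).
Proof.
elim: l => [|x l IH] H /=; first exact: has_sum_0.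
apply: has_sum_plus; first by apply: H; left.
by apply: IH => j Hj; apply: H; right.
Qed.

Lemma has_sum_finite {I} (f : I -> C) l :
  NoDup l -> (forall i, ~ In i l -> f i = 0) -> has_sum f (sumC f l).
Proof.
move=> Hn H eps He; exists l => L HL Hi.
(* Removing [l] from [L] leaves only zero terms. *)
have [l' P] := incl_permutation l L Hn Hi.
rewrite (sumC_perm _ _ _ P) sumC_app [sumC f l']sumC_zero.
  have -> : sumC f l + 0 - sumC f l = 0 by ring.
  by rewrite Cmod_0.
move=> i Hil; apply: H => Hi2.
have : NoDup (l ++ l') by apply: (Permutation_NoDup P).
move=> N; have [a [b E]] := in_split _ _ Hil; subst l'.
rewrite app_assoc in N.
by apply: (NoDup_remove_2 _ _ _ N); rewrite -app_assoc; apply: in_or_app; left.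
Qed.

(** Partial sums of nonnegative terms grow with the index set, so they converge to their
    supremum. *)
Lemma bounded_sums_lub {I} (g : I -> R) M :
  (forall i, (0 <= g i)%R) -> bounded_sums g M ->
  exists S, (S <= M)%R /\ forall eps, (0 < eps)%R -> exists L0, forall L, NoDup L -> incl L0 L ->
    (Rabs (sumR g L - S) < eps)%R.
Proof.
move=> Hg HM.
pose E := fun x => exists L, NoDup L /\ x = sumR g L.
have [S [U1 U2]] : {S | is_lub E S}.
  apply: completeness.
  - by exists M => x [L [HL ->]]; apply: HM.
  - by exists 0%R; exists nil; split; [constructor|].
exists S; split; first by apply: U2 => x [L [HL ->]]; apply: HM.
move=> eps He.
have [L0 [HL0 h0]] : exists L0, NoDup L0 /\ (S - eps < sumR g L0)%R.
  apply: NNPP => Hc.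
  have : (S <= S - eps)%R.
    apply: U2 => x [L [HL ->]].
    apply: Rnot_lt_le => h; apply: Hc; by exists L.
  lra.
exists L0 => L HL Hi.
have h1 := sumR_incl g L0 L Hg HL0 Hi.
have h2 : (sumR g L <= S)%R by apply: U1; exists L.
by apply: Rabs_def1; lra.
Qed.

Lemma sumC_pair {I} (f : I -> C) l :
  sumC f l = (sumR (fun i => fst (f i)) l, sumR (fun i => snd (f i)) l).
Proof. by elim: l => [|x l /= ->]. Qed.

Lemma Cmod_le_sum (z : C) : (Cmod z <= Rabs (fst z) + Rabs (snd z))%R.
Proof.
have E : z = RtoC (fst z) + RtoC (snd z) * Ci.
  by case: z => a b; rewrite /RtoC /Ci /Cplus /Cmult /=; f_equal; ring.
rewrite {1}E.
have := Cmod_triangle (fst z) (snd z * Ci); rewrite Cmod_mult !Cmod_R Cmod_Ci; lra.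
Qed.

Lemma fst_le_Cmod (z : C) : (Rabs (fst z) <= Cmod z)%R.
Proof. have := Rmax_Cmod z; have := Rmax_l (Rabs (fst z)) (Rabs (snd z)); lra. Qed.

Lemma snd_le_Cmod (z : C) : (Rabs (snd z) <= Cmod z)%R.
Proof. have := Rmax_Cmod z; have := Rmax_r (Rabs (fst z)) (Rabs (snd z)); lra. Qed.

(** Writing g as (g + h) - h reduces the signed family to two nonnegative ones. *)
Lemma bounded_sums_real {I} (g h : I -> R) M :
  (forall i, (Rabs (g i) <= h i)%R) -> bounded_sums h M ->
  exists S, forall eps, (0 < eps)%R -> exists L0, forall L, NoDup L -> incl L0 L ->
    (Rabs (sumR g L - S) < eps)%R.
Proof.
move=> Hg HM.
have [S1 [_ H1]] : exists S, (S <= M)%R /\ forall eps, (0 < eps)%R -> exists L0, forall L,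
    NoDup L -> incl L0 L -> (Rabs (sumR h L - S) < eps)%R.
  apply: bounded_sums_lub => // i; have := Hg i; have := Rabs_pos (g i); lra.
have [S2 [_ H2]] : exists S, (S <= 2 * M)%R /\ forall eps, (0 < eps)%R -> exists L0, forall L,
    NoDup L -> incl L0 L -> (Rabs (sumR (fun i => g i + h i)%R L - S) < eps)%R.
  apply: bounded_sums_lub => [i|L HL].
  - have := Hg i; have := Rle_abs (- g i); rewrite Rabs_Ropp; lra.
  - rewrite sumR_plus; have := HM L HL.
    have : (sumR g L <= sumR h L)%R.
      by apply: sumR_le => i _; have := Hg i; have := Rle_abs (g i); lra.
    lra.
exists (S2 - S1)%R => eps He.
have [|L1 h1] := H1 (eps / 2)%R; first lra.
have [|L2 h2] := H2 (eps / 2)%R; first lra.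
exists (L1 ++ L2) => L HL Hi.
have := h1 L HL (fun x hx => Hi x (in_or_app _ _ _ (or_introl hx))).
have := h2 L HL (fun x hx => Hi x (in_or_app _ _ _ (or_intror hx))).
rewrite sumR_plus => /Rabs_def2 [a1 a2] /Rabs_def2 [b1 b2].
by apply: Rabs_def1; lra.
Qed.

Lemma abs_summable_has_sum {I} (f : I -> C) : abs_summable f -> exists s, has_sum f s.
Proof.
move=> [M HM].
have [a Ha] := bounded_sums_real (fun i => fst (f i)) _ M (fun i => fst_le_Cmod (f i)) HM.
have [b Hb] := bounded_sums_real (fun i => snd (f i)) _ M (fun i => snd_le_Cmod (f i)) HM.
exists (a, b) => eps He.
have [|L1 h1] := Ha (eps / 2)%R; first lra.
have [|L2 h2] := Hb (eps / 2)%R; first lra.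
exists (L1 ++ L2) => L HL Hi.
have := h1 L HL (fun x hx => Hi x (in_or_app _ _ _ (or_introl hx))).
have := h2 L HL (fun x hx => Hi x (in_or_app _ _ _ (or_intror hx))).
have := Cmod_le_sum (sumC f L - (a, b)).
rewrite sumC_pair /=; rewrite -!/(Rminus _ _); lra.
Qed.

Lemma abs_summable_le {I} (f : I -> C) (g : I -> R) M :
  (forall i, (Cmod (f i) <= g i)%R) -> bounded_sums g M -> abs_summable f.
Proof.
move=> H HM; exists M => L HL; have := HM L HL.
have : (sumR (fun i => Cmod (f i)) L <= sumR g L)%R by apply: sumR_le => i _; apply: H.
lra.
Qed.

Lemma has_sum_bound {I} (f : I -> C) (g : I -> R) M s :
  (forall i, (Cmod (f i) <= g i)%R) -> bounded_sums g M -> has_sum f s -> (Cmod s <= M)%R.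
Proof.
move=> H HM Hs; apply: Rnot_lt_le => h.
have [|L0 H0] := Hs (Cmod s - M)%R; first lra.
have [L [HL [Hi _]]] := nodup_over L0.
have := H0 L HL Hi; have := Cmod_sumC f L; have := HM L HL.
have : (sumR (fun i => Cmod (f i)) L <= sumR g L)%R by apply: sumR_le => i _; apply: H.
have : (Cmod s <= Cmod (sumC f L) + Cmod (sumC f L - s))%R.
  rewrite -(Cmod_opp (sumC f L - s)).
  by have := Cmod_triangle (sumC f L) (- (sumC f L - s));
    have -> : sumC f L + - (sumC f L - s) = s by ring.
lra.
Qed.

Lemma has_sum_bij {I J} (f : I -> C) (p : J -> I) (r : I -> J) s :
  (forall j, r (p j) = j) -> (forall i, p (r i) = i) ->
  has_sum (fun j => f (p j)) s -> has_sum f s.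
Proof.
move=> rp pr H eps He; have [L0 H0] := H eps He.
exists (map p L0) => L HL Hi.
have E : L = map p (map r L).
  rewrite map_map -{1}(map_id L); by apply: map_ext => x; rewrite pr.
rewrite E sumC_map; apply: H0.
- apply: FinFun.Injective_map_NoDup => //.
  by move=> x y Exy; rewrite -(pr x) Exy pr.
- move=> j Hj; rewrite -(rp j); apply: in_map; apply: Hi; exact: in_map.
Qed.

Lemma bounded_sums_inj {I J} (f : I -> R) (p : J -> I) M :
  (forall x y, p x = p y -> x = y) -> bounded_sums f M -> bounded_sums (fun j => f (p j)) M.
Proof.
move=> inj H L HL; rewrite -sumR_map; apply: H.
by apply: FinFun.Injective_map_NoDup.
Qed.

(** Serves to detach a first term, over [unit + nat], and to join the two halves of Z, over
    [nat + nat]. *)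
Lemma has_sum_sum {I J} (f : I + J -> C) a b :
  has_sum (fun i => f (inl i)) a -> has_sum (fun j => f (inr j)) b -> has_sum f (a + b).
Proof.
move=> Ha Hb eps He.
have [|L1 h1] := Ha (eps / 2)%R; first lra.
have [|L2 h2] := Hb (eps / 2)%R; first lra.
exists (map inl L1 ++ map inr L2) => L HL Hi.
(* A finite index set splits into its traces on the two summands; the equivalence [Q] transfers the
   inclusion of [L1] and [L2]. *)
have [l1 [l2 [N1 [N2 [P Q]]]]] : exists (l1 : list I) (l2 : list J), NoDup l1 /\ NoDup l2 /\
   (sumC f L = sumC (fun i => f (inl i)) l1 + sumC (fun j => f (inr j)) l2) /\
   (forall x, In x L <-> match x with inl i => In i l1 | inr j => In j l2 end).
  clear Hi; elim: HL => [|x l Hx _ [l1 [l2 [N1 [N2 [P Q]]]]]].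
    exists nil, nil; split; first by constructor.
    split; first by constructor.
    split; first by rewrite /= Cplus_0_l.
    by case.
  case: x Hx => [i|j] Hx.
  - exists (i :: l1), l2; split.
      by constructor => //; rewrite -(Q (inl i)).
    split=> //; split; first by rewrite /= P; ring.
    case=> [x|x] /=; rewrite Q; first by split=> -[|]; auto; [case=> ->; left| move=> ->; left].
    by split; [case|right].
  - exists l1, (j :: l2); split=> //; split.
      by constructor => //; rewrite -(Q (inr j)).
    split; first by rewrite /= P; ring.
    case=> [x|x] /=; rewrite Q; first by split; [case|right].
    by split=> -[|]; auto; [case=> ->; left| move=> ->; left].
have := h1 l1 N1; have := h2 l2 N2.
have i2 : incl L2 l2.
  by move=> x Hx; apply/(Q (inr x)); apply: Hi; apply: in_or_app; right; apply: in_map.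
have i1 : incl L1 l1.
  by move=> x Hx; apply/(Q (inl x)); apply: Hi; apply: in_or_app; left; apply: in_map.
move=> /(_ i2) g2 /(_ i1) g1.
rewrite P.
set X := sumC _ l1 in g1 *; set Y := sumC _ l2 in g2 *.
have -> : X + Y - (a + b) = (X - a) + (Y - b) by ring.
have := Cmod_triangle (X - a) (Y - b); lra.
Qed.

Lemma NoDup_flat_map {I J} (g : J -> list I) l :
  NoDup l -> (forall j, In j l -> NoDup (g j)) ->
  (forall i j j', In i (g j) -> In i (g j') -> j = j') -> NoDup (flat_map g l).
Proof.
move=> H HN Hd; elim: H HN => [|x l1 Hx _ IH] HN /=; first by constructor.
apply: NoDup_app.
- by apply: HN; left.
- by apply: IH => j Hj; apply: HN; right.
- move=> i Hi /in_flat_map [j [Hj Hij]].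
  by apply: Hx; rewrite (Hd _ _ _ Hi Hij).
Qed.

Lemma sumC_flat_map {I J} (f : I -> C) (g : J -> list I) l :
  sumC f (flat_map g l) = sumC (fun j => sumC f (g j)) l.
Proof. by elim: l => [|x l IH] //=; rewrite sumC_app IH. Qed.

Lemma sumR_flat_map {I J} (f : I -> R) (g : J -> list I) l :
  sumR f (flat_map g l) = sumR (fun j => sumR f (g j)) l.
Proof. by elim: l => [|x l IH] //=; rewrite sumR_app IH. Qed.

(** Grouping along finite fibres: by the product mn for divisor sums, by m + n for Cauchy
    products. *)
Lemma has_sum_fiber {I J} (f : I -> C) (p : I -> J) (fib : J -> list I) s :
  (forall j, NoDup (fib j)) -> (forall i j, In i (fib j) <-> p i = j) ->
  has_sum f s -> has_sum (fun j => sumC f (fib j)) s.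
Proof.
move=> HN Hf H eps He; have [L0 H0] := H eps He.
exists (map p L0) => L HL Hi; rewrite -sumC_flat_map; apply: H0.
- apply: NoDup_flat_map => // i j j'; rewrite !Hf; congruence.
- move=> i Hii; apply/in_flat_map; exists (p i); split; last by rewrite Hf.
  by apply: Hi; apply: in_map.
Qed.

(** A finite set of rows is completed by finite column sets, one per row, that contain the
    prescribed indices and nearly exhaust the row. The double sum over their union is then close to
    [s] and to the sum of the row sums. *)
Lemma has_sum_fubini {I J} (f : I * J -> C) (g : I -> C) s :
  has_sum f s -> (forall i, has_sum (fun j => f (i, j)) (g i)) -> has_sum g s.
Proof.
move=> H Hr eps He.
have [|L0 H0] := H (eps / 2)%R; first lra.
exists (map fst L0) => L HL Hi.
(* The row errors then add up to at most eps / 2; the added 1 covers an empty set of rows. *)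
pose e := (eps / 2 / (INR (length L) + 1))%R.
have p1 : (0 < INR (length L) + 1)%R by have := pos_INR (length L); lra.
have e0 : (0 < e)%R by apply: Rdiv_lt_0_compat; lra.
have [c Hc] : exists c : I -> list J, forall i, NoDup (c i) /\
    (forall j, In (i, j) L0 -> In j (c i)) /\ (Cmod (sumC (fun j => f (i, j)) (c i) - g i) < e)%R.
  apply: (choice (fun i l => NoDup l /\ (forall j, In (i, j) L0 -> In j l) /\
      (Cmod (sumC (fun j => f (i, j)) l - g i) < e)%R)) => i.
  have [Li Hli] := Hr i e e0.
  have [l [Hl [Hil _]]] := nodup_over (Li ++ map snd L0).
  exists l; split=> //; split.
  - move=> j Hj; apply: Hil; apply: in_or_app; right.
    by have := in_map snd _ _ Hj.
  - by apply: Hli => // x Hx; apply: Hil; apply: in_or_app; left.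
pose LL := flat_map (fun i => map (pair i) (c i)) L.
have NL : NoDup LL.
  apply: NoDup_flat_map => //.
  - move=> i _; apply: FinFun.Injective_map_NoDup; last by case: (Hc i).
    by move=> x y [].
  - by move=> ij j j' /in_map_iff [x [<- _]] /in_map_iff [y [[-> _] _]].
have iL : incl L0 LL.
  move=> [i j] Hij; apply/in_flat_map; exists i; split.
  - by apply: Hi; have := in_map fst _ _ Hij.
  - by apply: in_map; have [_ [h _]] := Hc i; apply: h.
have h := H0 LL NL iL.
rewrite /LL sumC_flat_map in h.
have h2 : (Cmod (sumC (fun j => sumC f (map (pair j) (c j))) L - sumC g L) <= INR (length L) * e)%R.
  rewrite -(sumR_const e L).
  have -> : forall X, X - sumC g L = sumC (fun i => - g i) L + X.
    move=> X; rewrite (sumC_ext (fun i => - g i) (fun i => -(1) * g i)); last by move=> i _ /=; ring.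
    by rewrite sumC_mult_l; ring.
  rewrite -sumC_plus.
  apply: Rle_trans (Cmod_sumC _ _) _; apply: sumR_le => i _.
  rewrite sumC_map.
  have [_ [_ hh]] := Hc i.
  by rewrite Cplus_comm; left.
have h3 : (INR (length L) * e <= eps / 2)%R.
  have -> : (eps / 2 = (INR (length L) + 1) * e)%R by rewrite /e; field; lra.
  nra.
move: h h2; set X := sumC _ L => h h2.
have -> : sumC g L - s = (X - s) + - (X - sumC g L) by ring.
have := Cmod_triangle (X - s) (- (X - sumC g L)); rewrite Cmod_opp; lra.
Qed.

(** A finite set of pairs lies in the product of its two projections, where the rows can be bounded
    one at a time. *)
Lemma bounded_sums_prod {I J} (f : I * J -> R) (g : I -> R) M :
  (forall x, (0 <= f x)%R) ->
  (forall i, bounded_sums (fun j => f (i, j)) (g i)) -> bounded_sums g M -> bounded_sums f M.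
Proof.
move=> Hp Hr HM L HL.
have [L1 [N1 [i1 _]]] := nodup_over (map fst L).
have [L2 [N2 [i2 _]]] := nodup_over (map snd L).
apply: (Rle_trans _ (sumR f (flat_map (fun i => map (pair i) L2) L1))).
- apply: sumR_incl => // -[i j] Hij; apply/in_flat_map; exists i; split.
  + by apply: i1; have := in_map fst _ _ Hij.
  + by apply: in_map; apply: i2; have := in_map snd _ _ Hij.
- rewrite sumR_flat_map; apply: Rle_trans; last by apply: HM N1.
  apply: sumR_le => i _; rewrite sumR_map; exact: Hr.
Qed.

Lemma bounded_sums_le {I} (f g : I -> R) M :
  (forall i, (f i <= g i)%R) -> bounded_sums g M -> bounded_sums f M.
Proof.
move=> H HM L HL; apply: Rle_trans (HM L HL); exact: sumR_le.
Qed.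

Lemma bounded_sums_mult_l {I} (c : R) (f : I -> R) M :
  (0 <= c)%R -> bounded_sums f M -> bounded_sums (fun i => (c * f i)%R) (c * M).
Proof. by move=> Hc H L HL; rewrite sumR_mult_l; apply: Rmult_le_compat_l => //; apply: H. Qed.

Lemma bounded_sums_plus {I} (f g : I -> R) M M' :
  bounded_sums f M -> bounded_sums g M' -> bounded_sums (fun i => (f i + g i)%R) (M + M').
Proof. by move=> H H' L HL; rewrite sumR_plus; apply: Rplus_le_compat; [apply: H|apply: H']. Qed.

(** * Sums and series over the naturals and the integers *)

Lemma sumR_seq (f : nat -> R) n : sumR f (seq 0 (S n)) = sum_n f n.
Proof.
elim: n => [|n IH]; first by rewrite /= sum_O; ring.
rewrite seq_S sumR_app IH sum_Sn /= /plus /=; ring.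
Qed.

Lemma sumC_seq (f : nat -> C) n : sumC f (seq 0 (S n)) = sum_n f n.
Proof.
elim: n => [|n IH]; first by rewrite /= sum_O; ring.
rewrite seq_S sumC_app IH sum_Sn /= /plus /=; ring.
Qed.

Lemma incl_seq (L : list nat) : exists n, incl L (seq 0 n).
Proof.
elim: L => [|x l [n Hn]]; first by exists 0%nat.
exists (Nat.max n (S x)) => y [<-|Hy]; apply/in_seq; first lia.
have /in_seq := Hn _ Hy; lia.
Qed.

Lemma bounded_sums_nat (f : nat -> R) M :
  (forall i, (0 <= f i)%R) -> (forall n, (sum_n f n <= M)%R) -> bounded_sums f M.
Proof.
move=> Hf H L HL; have [n Hn] := incl_seq L.
apply: Rle_trans (H n); rewrite -sumR_seq; apply: sumR_incl => // x /Hn /in_seq Hx.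
apply/in_seq; lia.
Qed.

Lemma geom_sum_n (r : R) n : (0 <= r < 1)%R -> (sum_n (fun k => r ^ k) n <= / (1 - r))%R.
Proof.
move=> Hr.
have -> : (sum_n (fun k => r ^ k) n = (1 - r ^ S n) / (1 - r))%R.
  elim: n => [|n IH]; first by rewrite sum_O /=; field; lra.
  rewrite sum_Sn IH /plus /=; field; lra.
rewrite /Rdiv -{2}(Rmult_1_l (/ (1 - r))).
apply: Rmult_le_compat_r; first by left; apply: Rinv_0_lt_compat; lra.
have := pow_le r (S n) (proj1 Hr); lra.
Qed.

Lemma bounded_sums_geom (r : R) :
  (0 <= r < 1)%R -> bounded_sums (fun n => (r ^ n)%R) (/ (1 - r)).
Proof.
move=> Hr; apply: bounded_sums_nat => n; first by apply: pow_le; lra.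
exact: geom_sum_n.
Qed.

Lemma has_sum_geom (z : C) : (Cmod z < 1)%R -> has_sum (fun n => z ^ n) (/ (1 - z)).
Proof.
move=> Hz.
have nz : 1 - z <> 0.
  move=> E; have : z = 1 by rewrite -(Cplus_0_r z) -E; ring.
  by move=> E1; rewrite E1 Cmod_1 in Hz; lra.
have [s Hs] : exists s, has_sum (fun n => z ^ n) s.
  apply: abs_summable_has_sum; exists (/ (1 - Cmod z))%R.
  apply: (bounded_sums_le _ (fun n => (Cmod z ^ n)%R)).
  - by move=> i; rewrite Cmod_pow; lra.
  - by apply: bounded_sums_geom; split=> //; apply: Cmod_ge_0.
have <- : s = / (1 - z); last exact: Hs.
have H1 := has_sum_mult_l z _ _ Hs.
(* Shifting the index: [s = 1 + z s]. *)
have H2 : has_sum (fun n => z ^ n) (1 + z * s).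
  pose p := fun x : unit + nat => match x with inl _ => O | inr n => S n end.
  pose r := fun n : nat => match n with O => inl tt | S n => inr n end.
  apply: (has_sum_bij _ p r); [by case=> [[]|n] | by case | ].
  apply: has_sum_sum; last exact: H1.
  have := has_sum_finite (fun _ : unit => z ^ 0) (tt :: nil).
  rewrite /= Cplus_0_r; apply; first by repeat constructor; case.
  by case=> h; case: h; left.
have E := has_sum_unique _ _ _ Hs H2.
have E2 : (1 - z) * s = 1.
  by transitivity (s - z * s); [ring | rewrite {1}E; ring].
transitivity (((1 - z) * s) / (1 - z)); [by field | rewrite E2; by field].
Qed.

Lemma is_filterlim_C (u : nat -> C) (s : C) :
  (forall eps, (0 < eps)%R -> exists n0, forall n, (n0 <= n)%nat -> (Cmod (u n - s) < eps)%R) ->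
  filterlim u eventually (locally (T := C_UniformSpace) s).
Proof.
move=> H P [eps HP].
have [n0 Hn] := H eps (cond_pos eps).
exists n0 => n Hn0; apply: HP; apply: C_NormedModule_mixin_compat1; exact: Hn.
Qed.

Lemma has_sum_is_series (f : nat -> C) s : has_sum f s -> is_series (V := C_NormedModule) f s.
Proof.
move=> H; apply: is_filterlim_C => eps He.
have [L0 H0] := H eps He; have [n0 Hn0] := incl_seq L0.
exists n0 => n Hn; rewrite -sumC_seq; apply: H0; first exact: seq_NoDup.
move=> x /Hn0 /in_seq Hx; apply/in_seq; lia.
Qed.

Lemma fst_sum_n (f : nat -> C) n : fst (sum_n f n) = sum_n (fun k => fst (f k)) n.
Proof. by elim: n => [|n IH]; rewrite ?sum_O // !sum_Sn -IH. Qed.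

Lemma snd_sum_n (f : nat -> C) n : snd (sum_n f n) = sum_n (fun k => snd (f k)) n.
Proof. by elim: n => [|n IH]; rewrite ?sum_O // !sum_Sn -IH. Qed.

Lemma has_sum_CSeries (f : nat -> C) s : has_sum f s -> CSeries f = s.
Proof.
move=> H.
have Hl : forall eps, (0 < eps)%R -> exists n0, forall n, (n0 <= n)%nat -> (Cmod (sum_n f n - s) < eps)%R.
  move=> eps He.
  have [L0 H0] := H eps He; have [n0 Hn0] := incl_seq L0.
  exists n0 => n Hn; rewrite -sumC_seq; apply: H0; first exact: seq_NoDup.
  move=> x /Hn0 /in_seq Hx; apply/in_seq; lia.
rewrite /CSeries [s]surjective_pairing; congr (_, _); apply: is_series_unique => P [eps HP];
  have [n0 Hn] := Hl eps (cond_pos eps); exists n0 => n Hn0; apply: HP; have h := Hn n Hn0.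
- rewrite /ball /= /AbsRing_ball /abs /minus /plus /opp /= -fst_sum_n.
  have := fst_le_Cmod (sum_n f n - s); rewrite /=; lra.
- rewrite /ball /= /AbsRing_ball /abs /minus /plus /opp /= -snd_sum_n.
  have := snd_le_Cmod (sum_n f n - s); rewrite /=; lra.
Qed.

Definition Z_of_sum (x : nat + nat) : Z :=
  match x with inl k => Z.of_nat k | inr k => (- Z.of_nat (S k))%Z end.

Definition sum_of_Z (z : Z) : nat + nat :=
  if (0 <=? z)%Z then inl (Z.to_nat z) else inr (Z.to_nat (- z - 1)).

Lemma sum_of_ZK z : Z_of_sum (sum_of_Z z) = z.
Proof. rewrite /sum_of_Z; case: Z.leb_spec => h /=; lia. Qed.

Lemma Z_of_sumK x : sum_of_Z (Z_of_sum x) = x.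
Proof. rewrite /sum_of_Z /Z_of_sum; case: x => k; case: Z.leb_spec => h; try lia; f_equal; lia. Qed.

Lemma has_sum_Z (f : Z -> C) a b :
  has_sum (fun k => f (Z.of_nat k)) a -> has_sum (fun k => f (- Z.of_nat (S k))%Z) b ->
  has_sum f (a + b).
Proof.
move=> Ha Hb; apply: (has_sum_bij f Z_of_sum sum_of_Z) => [x|x|].
- exact: Z_of_sumK.
- exact: sum_of_ZK.
- exact: has_sum_sum.
Qed.

Lemma has_sum_CSeriesZ (f : Z -> C) a b :
  has_sum (fun k => f (Z.of_nat k)) a -> has_sum (fun k => f (- Z.of_nat (S k))%Z) b ->
  CSeriesZ f = a + b.
Proof. by move=> Ha Hb; rewrite /CSeriesZ (has_sum_CSeries _ _ Ha) (has_sum_CSeries _ _ Hb). Qed.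

Lemma has_sum_is_double_series (a : nat -> nat -> C) s :
  abs_summable (fun x => a (fst x) (snd x)) -> has_sum (fun x => a (fst x) (snd x)) s ->
  is_double_series a s.
Proof.
move=> [M HM] H.
(* The index set of the K-th square partial sum; these squares eventually contain every finite set
   of pairs. *)
pose Q K := flat_map (fun i => map (pair i) (seq 0 (S K))) (seq 0 (S K)).
have NQ K : NoDup (Q K).
  apply: NoDup_flat_map; first exact: seq_NoDup.
  - move=> i _; apply: FinFun.Injective_map_NoDup; last exact: seq_NoDup.
    by move=> x y [].
  - by move=> ij j j' /in_map_iff [x [<- _]] /in_map_iff [y [[-> _] _]].
split.
- exists M => K; apply: Rle_trans (HM (Q K) (NQ K)); right.
  rewrite /Q sumR_flat_map sumR_seq; apply: sum_n_ext => i.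
  by rewrite sumR_map sumR_seq.
- apply: is_filterlim_C => eps He.
  have [L0 H0] := H eps He.
  have [n1 Hn1] := incl_seq (map fst L0); have [n2 Hn2] := incl_seq (map snd L0).
  exists (n1 + n2)%nat => K HK.
  have := H0 (Q K) (NQ K).
  have -> : sumC (fun x => a (fst x) (snd x)) (Q K) = sum_n (fun i => sum_n (fun j => a i j) K) K.
    rewrite /Q sumC_flat_map sumC_seq; apply: sum_n_ext => i.
    by rewrite sumC_map sumC_seq.
  apply=> -[i j] Hij; apply/in_flat_map; exists i.
  have /Hn1 /in_seq h1 := in_map fst _ _ Hij.
  have /Hn2 /in_seq h2 := in_map snd _ _ Hij.
  rewrite /= in h1 h2.
  split; last apply: in_map; apply/in_seq; lia.
Qed.

(** * Path integrals *)

Definition rcont (g : R -> C) (t : R) : Prop :=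
  forall eps, (0 < eps)%R -> exists d, (0 < d)%R /\
    forall s, (Rabs (s - t) < d)%R -> (Cmod (g s - g t) < eps)%R.

(** The increment form avoids a quotient, so s = t need not be excluded and chain rules need no case
    distinction. [cdiff] and later [Fdiff] follow the same pattern. *)
Definition rdiff (g : R -> C) (t : R) (l : C) : Prop :=
  forall eps, (0 < eps)%R -> exists d, (0 < d)%R /\
    forall s, (Rabs (s - t) < d)%R ->
      (Cmod (g s - g t - RtoC (s - t) * l) <= eps * Rabs (s - t))%R.

Definition ccont (f : C -> C) (z : C) : Prop :=
  forall eps, (0 < eps)%R -> exists d, (0 < d)%R /\
    forall y, (Cmod (y - z) < d)%R -> (Cmod (f y - f z) < eps)%R.

Definition cdiff (f : C -> C) (z l : C) : Prop :=
  forall eps, (0 < eps)%R -> exists d, (0 < d)%R /\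
    forall y, (Cmod (y - z) < d)%R ->
      (Cmod (f y - f z - l * (y - z)) <= eps * Cmod (y - z))%R.

Definition cdiffable (f : C -> C) (z : C) : Prop := exists l, cdiff f z l.

Lemma Cmod_minus_sym x y : Cmod (x - y) = Cmod (y - x).
Proof. by rewrite -Cmod_opp; f_equal; ring. Qed.

Lemma Cmod_tri_minus x y z : (Cmod (x - z) <= Cmod (x - y) + Cmod (y - z))%R.
Proof. have -> : x - z = (x - y) + (y - z) by ring. exact: Cmod_triangle. Qed.

Lemma Cmod_minus_le x y : (Cmod x - Cmod y <= Cmod (x - y))%R.
Proof.
have := Cmod_triangle (x - y) y.
have -> : x - y + y = x by ring.
lra.
Qed.

Lemma Cmod_le_0 x : (Cmod x <= 0)%R -> x = 0.
Proof. move=> H; apply: Cmod_eq_0; have := Cmod_ge_0 x; lra. Qed.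

Lemma Cminus_neq_0 (x y : C) : x <> y -> x - y <> 0.
Proof. move=> H E; apply: H; by rewrite -(Cplus_0_r y) -E; ring. Qed.

Lemma rcont_continuous g t : rcont g t -> continuous (U := C_R_CompleteNormedModule) g t.
Proof.
move=> H P [eps HP]; have [d [d0 Hd]] := H eps (cond_pos eps).
exists (mkposreal d d0) => s Hs; apply: HP.
apply: C_NormedModule_mixin_compat1; exact: Hd.
Qed.

Lemma rdiff_is_derive g t l : rdiff g t l -> is_derive (V := C_R_NormedModule) g t l.
Proof.
move=> H; split; first exact: is_linear_scal_l.
move=> x Hx eps.
have <- : t = x by apply: (is_filter_lim_locally_unique (V := R_NormedModule)).
have [d [d0 Hd]] := H eps (cond_pos eps).
exists (mkposreal d d0) => s Hs.
apply: Rle_trans (Hd s Hs); right; rewrite -Cmod_norm; congr Cmod.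
by rewrite scal_R_Cmult.
Qed.

Definition cint (g : R -> C) (a b : R) : C := RInt (V := C_R_CompleteNormedModule) g a b.

Lemma cint_is g a b : (a <= b)%R -> (forall t, (a <= t <= b)%R -> rcont g t) ->
  is_RInt (V := C_R_CompleteNormedModule) g a b (cint g a b).
Proof.
move=> Hab H; apply: RInt_correct; apply: ex_RInt_continuous.
rewrite Rmin_left // Rmax_right // => z Hz; apply: rcont_continuous; exact: H.
Qed.

Lemma cint_unique g a b l : is_RInt (V := C_R_CompleteNormedModule) g a b l -> cint g a b = l.
Proof. exact: is_RInt_unique. Qed.

Lemma cint_bound g a b M : (a <= b)%R -> (forall t, (a <= t <= b)%R -> rcont g t) ->
  (forall t, (a <= t <= b)%R -> (Cmod (g t) <= M)%R) -> (Cmod (cint g a b) <= (b - a) * M)%R.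
Proof.
move=> Hab H HM; rewrite Cmod_norm.
apply: (norm_RInt_le_const g a b (cint g a b) M Hab); last exact: cint_is.
by move=> x Hx; rewrite -Cmod_norm; apply: HM.
Qed.

Lemma cint_plus f g a b : (a <= b)%R -> (forall t, (a <= t <= b)%R -> rcont f t) ->
  (forall t, (a <= t <= b)%R -> rcont g t) ->
  cint (fun t => f t + g t) a b = cint f a b + cint g a b.
Proof.
move=> Hab Hf Hg; apply: cint_unique; apply: (is_RInt_plus (V := C_R_CompleteNormedModule)); exact: cint_is.
Qed.

Lemma cint_ftc G g a b : (a <= b)%R -> (forall t, (a <= t <= b)%R -> rdiff G t (g t)) ->
  (forall t, (a <= t <= b)%R -> rcont g t) -> cint g a b = G b - G a.
Proof.
move=> Hab HG Hg; apply: cint_unique.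
apply: (is_RInt_derive (V := C_R_CompleteNormedModule)); rewrite Rmin_left // Rmax_right // => x Hx.
- by apply: rdiff_is_derive; apply: HG.
- by apply: rcont_continuous; apply: Hg.
Qed.

Lemma cint_ext f g a b : (a <= b)%R -> (forall t, (a <= t <= b)%R -> f t = g t) -> cint f a b = cint g a b.
Proof.
move=> Hab H; apply: (RInt_ext (V := C_R_CompleteNormedModule)); rewrite Rmin_left // Rmax_right // => x Hx; apply: H; lra.
Qed.

Lemma ccont_rcont f a d t : ccont f (a + RtoC t * d) -> rcont (fun s => f (a + RtoC s * d)) t.
Proof.
move=> H eps He; have [e [e0 h]] := H eps He.
have p : (0 < Cmod d + 1)%R by have := Cmod_ge_0 d; lra.
exists (e / (Cmod d + 1))%R; split; first by apply: Rdiv_lt_0_compat.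
move=> s Hs; apply: h.
have -> : a + RtoC s * d - (a + RtoC t * d) = RtoC (s - t) * d by rewrite RtoC_minus; ring.
rewrite Cmod_mult Cmod_R.
have : (Rabs (s - t) * (Cmod d + 1) < e)%R.
  apply: (Rlt_le_trans _ (e / (Cmod d + 1) * (Cmod d + 1))%R).
  - by apply: Rmult_lt_compat_r.
  - by right; field; lra.
have := Rabs_pos (s - t); nra.
Qed.

Lemma rcont_const c t : rcont (fun _ => c) t.
Proof.
move=> eps He; exists 1%R; split; first lra.
move=> s _; by have -> : c - c = 0 by [ring]; rewrite Cmod_0.
Qed.

Lemma rcont_plus f g t : rcont f t -> rcont g t -> rcont (fun s => f s + g s) t.
Proof.
move=> Hf Hg eps He.
have [|d1 [p1 h1]] := Hf (eps / 2)%R; first lra.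
have [|d2 [p2 h2]] := Hg (eps / 2)%R; first lra.
exists (Rmin d1 d2); split; first exact: Rmin_glb_lt.
move=> s Hs.
have := h1 s (Rlt_le_trans _ _ _ Hs (Rmin_l _ _)).
have := h2 s (Rlt_le_trans _ _ _ Hs (Rmin_r _ _)).
have -> : f s + g s - (f t + g t) = (f s - f t) + (g s - g t) by ring.
have := Cmod_triangle (f s - f t) (g s - g t); lra.
Qed.

Lemma rcont_mult f g t : rcont f t -> rcont g t -> rcont (fun s => f s * g s) t.
Proof.
move=> Hf Hg eps He.
pose A := (Cmod (f t) + 1)%R; pose B := (Cmod (g t) + 1)%R.
have pA : (1 <= A)%R by rewrite /A; have := Cmod_ge_0 (f t); lra.
have pB : (1 <= B)%R by rewrite /B; have := Cmod_ge_0 (g t); lra.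
pose e := Rmin 1 (eps / (A + B)).
have e0 : (0 < e)%R by apply: Rmin_glb_lt; [lra|apply: Rdiv_lt_0_compat; lra].
have e1 : (e * (A + B) <= eps)%R.
  apply: (Rle_trans _ (eps / (A + B) * (A + B))%R).
  - by apply: Rmult_le_compat_r; [lra | exact: Rmin_r].
  - by right; field; lra.
have e2 : (e <= 1)%R by exact: Rmin_l.
have [d1 [p1 h1]] := Hf e e0.
have [d2 [p2 h2]] := Hg e e0.
exists (Rmin d1 d2); split; first exact: Rmin_glb_lt.
move=> s Hs.
have a1 := h1 s (Rlt_le_trans _ _ _ Hs (Rmin_l _ _)).
have a2 := h2 s (Rlt_le_trans _ _ _ Hs (Rmin_r _ _)).
have -> : f s * g s - f t * g t = (f s - f t) * g s + f t * (g s - g t) by ring.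
have := Cmod_triangle ((f s - f t) * g s) (f t * (g s - g t)); rewrite !Cmod_mult.
have := Cmod_minus_le (g s) (g t).
have := Cmod_ge_0 (f s - f t); have := Cmod_ge_0 (g s - g t).
have := Cmod_ge_0 (f t); have := Cmod_ge_0 (g s).
rewrite /A /B in e1 *; move=> q1 q2 q3 q4 q5 q6.
have b1 : (Cmod (f s - f t) * Cmod (g s) <= Cmod (f s - f t) * (Cmod (g t) + 1))%R.
  by apply: Rmult_le_compat_l; lra.
have b2 : (Cmod (f s - f t) * (Cmod (g t) + 1) < e * (Cmod (g t) + 1))%R.
  by apply: Rmult_lt_compat_r => //; rewrite /B in pB; lra.
have b3 : (Cmod (f t) * Cmod (g s - g t) <= Cmod (f t) * e)%R.
  by apply: Rmult_le_compat_l; lra.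
nra.
Qed.

Lemma cdiff_ccont f z l : cdiff f z l -> ccont f z.
Proof.
move=> H eps He; have [|d [d0 h]] := H 1%R; first lra.
have p : (0 < Cmod l + 2)%R by have := Cmod_ge_0 l; lra.
exists (Rmin d (eps / (Cmod l + 2))); split.
  by apply: Rmin_glb_lt => //; apply: Rdiv_lt_0_compat.
move=> y Hy.
have := h y (Rlt_le_trans _ _ _ Hy (Rmin_l _ _)).
have Hy2 := Rlt_le_trans _ _ _ Hy (Rmin_r _ _).
have E : (Cmod (y - z) * (Cmod l + 2) < eps)%R.
  apply: (Rlt_le_trans _ (eps / (Cmod l + 2) * (Cmod l + 2))%R).
  - by apply: Rmult_lt_compat_r.
  - by right; field; lra.
have := Cmod_triangle (f y - f z - l * (y - z)) (l * (y - z)).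
have -> : f y - f z - l * (y - z) + l * (y - z) = f y - f z by ring.
rewrite Cmod_mult; have := Cmod_ge_0 (y - z).
move: E; nra.
Qed.

Lemma cdiffable_ccont f z : cdiffable f z -> ccont f z.
Proof. by move=> [l H]; apply: cdiff_ccont H. Qed.

(** The line integral of f(z) dz along the straight segment from a to b. *)
Definition seg (f : C -> C) (a b : C) : C := (b - a) * cint (fun t => f (a + RtoC t * (b - a))) 0 1.

Definition seg_cont f a b := forall t, (0 <= t <= 1)%R -> ccont f (a + RtoC t * (b - a)).

(** The integral is that of a real vector space, so a complex factor has to be pulled out through
    real and imaginary parts. *)
Lemma cint_mult_l c g a b : (a <= b)%R -> (forall t, (a <= t <= b)%R -> rcont g t) ->
  cint (fun t => c * g t) a b = c * cint g a b.
Proof.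
move=> Hab Hg.
have H := cint_is g a b Hab Hg.
have e1 := is_RInt_fct_extend_fst (U := R_NormedModule) (V := R_NormedModule) _ _ _ _ H.
have e2 := is_RInt_fct_extend_snd (U := R_NormedModule) (V := R_NormedModule) _ _ _ _ H.
apply: cint_unique.
apply: (is_RInt_fct_extend_pair (U := R_NormedModule) (V := R_NormedModule)) => /=.
- apply: (is_RInt_minus (V := R_NormedModule)); exact: (is_RInt_scal (V := R_NormedModule)).
- apply: (is_RInt_plus (V := R_NormedModule)); exact: (is_RInt_scal (V := R_NormedModule)).
Qed.

Lemma cint_comp_lin g u v a b : (a <= b)%R -> (u * a + v <= u * b + v)%R ->
  (forall t, (u * a + v <= t <= u * b + v)%R -> rcont g t) ->
  (forall t, (a <= t <= b)%R -> rcont (fun t => g (u * t + v)%R) t) ->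
  RtoC u * cint (fun t => g (u * t + v)%R) a b = cint g (u * a + v) (u * b + v).
Proof.
move=> Hab Huv Hg Hg'.
rewrite -cint_mult_l //; symmetry; symmetry; apply: cint_unique.
have := is_RInt_comp_lin (V := C_R_CompleteNormedModule) g u v a b _ (cint_is g _ _ Huv Hg).
apply: is_RInt_ext => x _; exact: scal_R_Cmult.
Qed.

Lemma cint_chasles g a b c : (a <= b)%R -> (b <= c)%R ->
  (forall t, (a <= t <= c)%R -> rcont g t) -> cint g a c = cint g a b + cint g b c.
Proof.
move=> Hab Hbc Hg; apply: cint_unique.
apply: (is_RInt_Chasles (V := C_R_CompleteNormedModule) _ _ b); apply: cint_is => // t Ht; apply: Hg; lra.
Qed.

Lemma seg_rcont f a b t : (0 <= t <= 1)%R -> seg_cont f a b -> rcont (fun s => f (a + RtoC s * (b - a))) t.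
Proof. move=> Ht H; apply: ccont_rcont; exact: H. Qed.

Lemma seg_opp f a b : seg_cont f a b -> seg f b a = - seg f a b.
Proof.
move=> H; rewrite /seg.
have E : cint (fun t => f (b + RtoC t * (a - b))) 0 1 = cint (fun t => f (a + RtoC t * (b - a))) 0 1.
  apply: cint_unique.
  have h1 := cint_is (fun t => f (a + RtoC t * (b - a))) 0 1 Rle_0_1 (fun t Ht => seg_rcont f a b t Ht H).
  have h2 := is_RInt_swap _ _ _ _ h1.
  have h3 := is_RInt_comp_lin (V := C_R_CompleteNormedModule) (fun t => f (a + RtoC t * (b - a))) (-1) 1 0 1
    (opp (cint (fun t => f (a + RtoC t * (b - a))) 0 1)).
  have e0 : (-1 * 0 + 1 = 1)%R by ring.
  have e1 : (-1 * 1 + 1 = 0)%R by ring.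
  rewrite e0 e1 in h3; have h4 := is_RInt_opp _ _ _ _ (h3 h2).
  rewrite opp_opp in h4; move: h4; apply: is_RInt_ext => x _.
  rewrite scal_R_Cmult.
  have -> : RtoC (-1) = - (1) by rewrite RtoC_opp.
  rewrite /opp /=.
  have -> : a + RtoC (-1 * x + 1) * (b - a) = b + RtoC x * (a - b).
    rewrite RtoC_plus RtoC_mult; ring.
  have N1 : forall z : C, - (- (1) * z) = z by move=> z; ring.
  exact: N1.
rewrite E; ring.
Qed.

Lemma seg_split f a b s : (0 <= s <= 1)%R -> seg_cont f a b ->
  seg f a b = seg f a (a + RtoC s * (b - a)) + seg f (a + RtoC s * (b - a)) b.
Proof.
move=> Hs H; rewrite /seg.
set m := a + RtoC s * (b - a).
pose g t := f (a + RtoC t * (b - a)).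
have Hg t : (0 <= t <= 1)%R -> rcont g t by move=> Ht; apply: seg_rcont.
rewrite -/g (cint_chasles g 0 s 1); [|lra|lra|exact: Hg].
have E1 : RtoC s * cint (fun t => f (a + RtoC t * (m - a))) 0 1 = cint g 0 s.
  have := cint_comp_lin g s 0 0 1; rewrite Rmult_0_r Rplus_0_r Rmult_1_r Rplus_0_r => <-; try lra.
  - congr (_ * _); apply: cint_ext; first lra.
    move=> t _; rewrite /g /m; congr f; rewrite RtoC_plus RtoC_mult; ring.
  - move=> t Ht; apply: Hg; lra.
  - move=> t Ht eps He.
    have [|d [d0 Hd]] := Hg (s * t + 0)%R _ eps He; first nra.
    exists d; split=> // x Hx; apply: Hd.
    have -> : (s * x + 0 - (s * t + 0) = s * (x - t))%R by ring.
    rewrite Rabs_mult Rabs_pos_eq; last lra.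
    have := Rabs_pos (x - t); nra.
have E2 : RtoC (1 - s) * cint (fun t => f (m + RtoC t * (b - m))) 0 1 = cint g s 1.
  have := cint_comp_lin g (1 - s) s 0 1.
  have -> : ((1 - s) * 0 + s = s)%R by ring.
  have -> : ((1 - s) * 1 + s = 1)%R by ring.
  move=> <-; try lra.
  - congr (_ * _); apply: cint_ext; first lra.
    move=> t _; rewrite /g /m; congr f; rewrite RtoC_plus RtoC_mult RtoC_minus; ring.
  - move=> t Ht; apply: Hg; lra.
  - move=> t Ht eps He.
    have [|d [d0 Hd]] := Hg ((1 - s) * t + s)%R _ eps He; first nra.
    exists d; split=> // x Hx; apply: Hd.
    have -> : ((1 - s) * x + s - ((1 - s) * t + s) = (1 - s) * (x - t))%R by ring.
    rewrite Rabs_mult Rabs_pos_eq; last lra.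
    have := Rabs_pos (x - t); nra.
rewrite Cmult_plus_distr_l -E1 -E2.
have -> : m - a = RtoC s * (b - a) by rewrite /m; ring.
have -> : b - m = RtoC (1 - s) * (b - a) by rewrite /m RtoC_minus; ring.
ring.
Qed.

Lemma seg_bound f a b M : seg_cont f a b ->
  (forall t, (0 <= t <= 1)%R -> (Cmod (f (a + RtoC t * (b - a))%C) <= M)%R) ->
  (Cmod (seg f a b) <= Cmod (b - a) * M)%R.
Proof.
move=> H HM; rewrite /seg Cmod_mult; apply: Rmult_le_compat_l; first exact: Cmod_ge_0.
have := cint_bound (fun t => f (a + RtoC t * (b - a))) 0 1 M.
rewrite Rminus_0_r Rmult_1_l; apply=> //; first lra.
by move=> t Ht; apply: seg_rcont.
Qed.

Lemma ccont_plus f g z : ccont f z -> ccont g z -> ccont (fun w => f w + g w) z.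
Proof.
move=> Hf Hg eps He.
have [|d1 [p1 h1]] := Hf (eps / 2)%R; first lra.
have [|d2 [p2 h2]] := Hg (eps / 2)%R; first lra.
exists (Rmin d1 d2); split; first exact: Rmin_glb_lt.
move=> s Hs.
have := h1 s (Rlt_le_trans _ _ _ Hs (Rmin_l _ _)).
have := h2 s (Rlt_le_trans _ _ _ Hs (Rmin_r _ _)).
have -> : f s + g s - (f z + g z) = (f s - f z) + (g s - g z) by ring.
have := Cmod_triangle (f s - f z) (g s - g z); lra.
Qed.

Lemma seg_plus f g a b : seg_cont f a b -> seg_cont g a b ->
  seg (fun z => f z + g z) a b = seg f a b + seg g a b.
Proof.
move=> Hf Hg; rewrite /seg cint_plus; [ring|lra| |]; move=> t Ht; exact: seg_rcont.
Qed.

Lemma cdiff_affine k l z : cdiff (fun w => k + l * w) z l.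
Proof.
move=> eps He; exists 1%R; split; first lra.
move=> y _.
have -> : k + l * y - (k + l * z) - l * (y - z) = 0 by ring.
rewrite Cmod_0; have := Cmod_ge_0 (y - z); nra.
Qed.

Lemma seg_ftc F f a b :
  (forall t, (0 <= t <= 1)%R -> cdiff F (a + RtoC t * (b - a)) (f (a + RtoC t * (b - a)))) ->
  seg_cont f a b -> seg f a b = F b - F a.
Proof.
move=> HF Hf; rewrite /seg -cint_mult_l; [|lra|by move=> t Ht; apply: seg_rcont].
rewrite (cint_ftc (fun t => F (a + RtoC t * (b - a)))); first 1 last.
- lra.
- move=> t Ht eps He.
  have p : (0 < Cmod (b - a) + 1)%R by have := Cmod_ge_0 (b - a); lra.
  have [|d [d0 h]] := HF t Ht (eps / (Cmod (b - a) + 1))%R; first by apply: Rdiv_lt_0_compat.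
  exists (d / (Cmod (b - a) + 1))%R; split; first by apply: Rdiv_lt_0_compat.
  move=> s Hs.
  have E : a + RtoC s * (b - a) - (a + RtoC t * (b - a)) = RtoC (s - t) * (b - a).
    rewrite RtoC_minus; ring.
  have q0 := Rabs_pos (s - t); have q1 := Cmod_ge_0 (b - a).
  have q2 : (Rabs (s - t) * (Cmod (b - a) + 1) < d)%R.
    apply: (Rlt_le_trans _ (d / (Cmod (b - a) + 1) * (Cmod (b - a) + 1))%R).
    - by apply: Rmult_lt_compat_r.
    - by right; field; lra.
  have := h (a + RtoC s * (b - a)); rewrite E Cmod_mult Cmod_R.
  have -> : f (a + t * (b - a)) * (RtoC (s - t) * (b - a)) = RtoC (s - t) * ((b - a) * f (a + t * (b - a))) by ring.
  move=> /(_ ltac:(nra)) h2; apply: Rle_trans h2 _.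
  rewrite /Rdiv Rmult_assoc; apply: Rmult_le_compat_l; first lra.
  have -> : (Rabs (s - t) = / (Cmod (b - a) + 1) * (Rabs (s - t) * (Cmod (b - a) + 1)))%R by field; lra.
  apply: Rmult_le_compat_l; first by left; apply: Rinv_0_lt_compat.
  have -> : (/ (Cmod (b - a) + 1) * (Rabs (s - t) * (Cmod (b - a) + 1)) = Rabs (s - t))%R by field; lra.
  nra.
- move=> t Ht; apply: rcont_mult; [exact: rcont_const|exact: seg_rcont].
have -> : a + RtoC 1 * (b - a) = b by ring.
by have -> : a + RtoC 0 * (b - a) = a by ring.
Qed.

(** * Goursat's theorem *)

Definition convexC (D : C -> Prop) : Prop :=
  forall x y t, D x -> D y -> (0 <= t <= 1)%R -> D (x + RtoC t * (y - x)).

Definition closedC (D : C -> Prop) : Prop :=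
  forall p, (forall eps, (0 < eps)%R -> exists y, D y /\ (Cmod (y - p) < eps)%R) -> D p.

(** The steps form an absolutely summable family, and the telescoped bound 2 K / 2^n on later
    distances survives in the limit. *)
Lemma geometric_steps_converge (a : nat -> C) (K : R) :
  (forall n, (Cmod (a (S n) - a n) <= K * (/ 2) ^ n)%R) ->
  exists p, forall n, (Cmod (a n - p) <= 2 * K * (/ 2) ^ n)%R.
Proof.
move=> H.
have K0 : (0 <= K)%R by have := H O; have := Cmod_ge_0 (a 1%nat - a O); rewrite /=; lra.
have [s Hs] : exists s, has_sum (fun n => a (S n) - a n) s.
  apply: abs_summable_has_sum.
  apply: (abs_summable_le _ (fun n => (K * (/ 2) ^ n)%R) (K * / (1 - / 2))%R) => //.
  by apply: bounded_sums_mult_l => //; apply: bounded_sums_geom; lra.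
have T n : sumC (fun n => a (S n) - a n) (seq 0 n) = a n - a O.
  elim: n => [|n IH]; first by rewrite /=; ring.
  rewrite seq_S sumC_app IH /=; ring.
have B n k : (Cmod (a n - a (n + k)%nat) <= 2 * K * (/ 2) ^ n - 2 * K * (/ 2) ^ (n + k))%R.
  elim: k => [|k IH].
    by rewrite Nat.add_0_r; have -> : a n - a n = 0 by [ring]; rewrite Cmod_0; lra.
  have := Cmod_tri_minus (a n) (a (n + k)%nat) (a (n + S k)%nat).
  have := H (n + k)%nat; rewrite Nat.add_succ_r Cmod_minus_sym [((/2) ^ (S _))%R]/=; lra.
exists (a O + s) => n; apply: Rnot_lt_le => h.
have [|L0 H0] := Hs (Cmod (a n - (a O + s)) - 2 * K * (/ 2) ^ n)%R; first lra.
have [n1 Hn1] := incl_seq L0.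
have := H0 (seq 0 (n + n1)) (seq_NoDup _ _).
rewrite T => /(_ ltac:(by move=> x /Hn1 /in_seq Hx; apply/in_seq; lia)).
have -> : a (n + n1)%nat - a O - s = a (n + n1)%nat - (a O + s) by ring.
have := Cmod_tri_minus (a n) (a (n + n1)%nat) (a O + s); have := B n n1.
have : (0 <= 2 * K * (/ 2) ^ (n + n1))%R.
  by apply: Rmult_le_pos; [lra | apply: pow_le; lra].
lra.
Qed.

Definition tri f a b c := seg f a b + seg f b c + seg f c a.

Definition perim a b c := (Cmod (b - a) + Cmod (c - b) + Cmod (a - c))%R.

Lemma convex_seg_cont (D : C -> Prop) f a b :
  convexC D -> (forall z, D z -> ccont f z) -> D a -> D b -> seg_cont f a b.
Proof. by move=> HD Hf Ha Hb t Ht; apply: Hf; apply: HD. Qed.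

Lemma Cmod_half z : (Cmod (RtoC (/ 2) * z) = Cmod z / 2)%R.
Proof. rewrite Cmod_mult Cmod_R Rabs_pos_eq; lra. Qed.

Lemma RtoC_half : RtoC (/ 2) + RtoC (/ 2) = 1.
Proof. by rewrite -RtoC_plus; congr RtoC; lra. Qed.

(** The integrals over the four midpoint triangles add up to the whole, since inner edges cancel, so
    one of them carries at least a quarter. The bound on a' - a is what makes the first vertices of
    the iterated triangles converge. *)
Lemma triangle_bisection (D : C -> Prop) f a b c :
  convexC D -> (forall z, D z -> ccont f z) -> D a -> D b -> D c ->
  exists a' b' c', (D a' /\ D b' /\ D c') /\ (perim a' b' c' = perim a b c / 2)%R /\
    (Cmod (a' - a) <= perim a b c)%R /\ (Cmod (tri f a b c) <= 4 * Cmod (tri f a' b' c'))%R.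
Proof.
move=> HD Hf Ha Hb Hc.
have h2 : (0 <= / 2 <= 1)%R by lra.
have Hs x y : D x -> D y -> seg_cont f x y by apply: convex_seg_cont.
pose x := a + RtoC (/ 2) * (b - a).
pose y := b + RtoC (/ 2) * (c - b).
pose z := c + RtoC (/ 2) * (a - c).
have Dx : D x by apply: HD.
have Dy : D y by apply: HD.
have Dz : D z by apply: HD.
have E : tri f a b c = tri f a x z + tri f x b y + tri f z y c + tri f x y z.
  rewrite /tri.
  rewrite (seg_split f a b (/ 2)) -/x; [|lra|by apply: Hs].
  rewrite (seg_split f b c (/ 2)) -/y; [|lra|by apply: Hs].
  rewrite (seg_split f c a (/ 2)) -/z; [|lra|by apply: Hs].
  rewrite (seg_opp f x y) ?(seg_opp f y z) ?(seg_opp f x z); try by apply: Hs.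
  ring.
have hC : RtoC (/ 2) = 1 - RtoC (/ 2) by rewrite -RtoC_half; ring.
have e1 : x - a = RtoC (/ 2) * (b - a) by rewrite /x; ring.
have e2 : b - x = RtoC (/ 2) * (b - a) by rewrite /x {2}hC; ring.
have e3 : y - b = RtoC (/ 2) * (c - b) by rewrite /y; ring.
have e4 : c - y = RtoC (/ 2) * (c - b) by rewrite /y {2}hC; ring.
have e5 : z - c = RtoC (/ 2) * (a - c) by rewrite /z; ring.
have e6 : a - z = RtoC (/ 2) * (a - c) by rewrite /z {2}hC; ring.
have e7 : z - x = RtoC (/ 2) * (c - b).
  have -> : z - x = (a - x) - (a - z) by ring.
  rewrite e6; have -> : a - x = - (x - a) by ring.
  rewrite e1; transitivity ((RtoC (/ 2)) * (c - b) + (RtoC (/2) + RtoC (/2) - 1) * 0); first by ring.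
  by ring.
have e8 : y - x = RtoC (/ 2) * (c - a).
  have -> : y - x = (y - b) + (b - x) by ring.
  rewrite e3 e2; ring.
have e9 : y - z = RtoC (/ 2) * (b - a).
  have -> : y - z = - (c - y) - (z - c) by ring.
  rewrite e4 e5; ring.
have P0 : (0 <= Cmod (b - a))%R by exact: Cmod_ge_0.
have P1 : (0 <= Cmod (c - b))%R by exact: Cmod_ge_0.
have P2 : (0 <= Cmod (a - c))%R by exact: Cmod_ge_0.
have Ex : (Cmod (x - a) <= perim a b c)%R by rewrite e1 Cmod_half /perim; lra.
have Ez : (Cmod (z - a) <= perim a b c)%R by rewrite Cmod_minus_sym e6 Cmod_half /perim; lra.
have Ea : (Cmod (a - a) <= perim a b c)%R.
  by have -> : a - a = 0 by [ring]; rewrite Cmod_0 /perim; lra.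
apply: NNPP => Hn.
have hx a' b' c' : D a' -> D b' -> D c' -> (perim a' b' c' = perim a b c / 2)%R ->
    (Cmod (a' - a) <= perim a b c)%R -> (4 * Cmod (tri f a' b' c') < Cmod (tri f a b c))%R.
  move=> h3 h4 h5 h6 h7; apply: Rnot_le_lt => h8; apply: Hn; by exists a', b', c'.
have g1 : (4 * Cmod (tri f a x z) < Cmod (tri f a b c))%R.
  by apply: hx => //; rewrite /perim e1 e6 e7 !Cmod_half; lra.
have g2 : (4 * Cmod (tri f x b y) < Cmod (tri f a b c))%R.
  by apply: hx => //; rewrite /perim e2 e3 (Cmod_minus_sym x y) e8 !Cmod_half (Cmod_minus_sym c a); lra.
have g3 : (4 * Cmod (tri f z y c) < Cmod (tri f a b c))%R.
  by apply: hx => //; rewrite /perim e9 e4 e5 !Cmod_half; lra.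
have g4 : (4 * Cmod (tri f x y z) < Cmod (tri f a b c))%R.
  apply: hx => //; rewrite /perim e8 (Cmod_minus_sym z y) e9 (Cmod_minus_sym x z) e7 !Cmod_half (Cmod_minus_sym c a); lra.
rewrite E in g1 g2 g3 g4.
have := Cmod_triangle (tri f a x z + tri f x b y + tri f z y c) (tri f x y z).
have := Cmod_triangle (tri f a x z + tri f x b y) (tri f z y c).
have := Cmod_triangle (tri f a x z) (tri f x b y).
lra.
Qed.

(** An affine function has a quadratic primitive. In Goursat's argument it absorbs the first-order
    part of f at the limit point. *)
Lemma tri_affine k l a b c : tri (fun w => k + l * w) a b c = 0.
Proof.
have Hc z : ccont (fun w => k + l * w) z by apply: cdiff_ccont (cdiff_affine k l z).
have S x y : seg (fun w => k + l * w) x y = (k * y + l * y * y / 2) - (k * x + l * x * x / 2).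
  apply: (seg_ftc (fun w => k * w + l * w * w / 2)); last by move=> t _; exact: Hc.
  move=> t _; move: (x + RtoC t * (y - x)) => z eps He.
  pose L := (Cmod (l / 2) + 1)%R.
  have pL : (0 < L)%R by rewrite /L; have := Cmod_ge_0 (l / 2); lra.
  exists (eps / L)%R; split; first exact: Rdiv_lt_0_compat.
  move=> w Hw.
  have -> : k * w + l * w * w / 2 - (k * z + l * z * z / 2) - (k + l * z) * (w - z) = (l / 2) * (w - z) * (w - z) by field.
  rewrite !(Cmod_mult _ (w - z)); apply: Rmult_le_compat_r; first exact: Cmod_ge_0.
  have h : (Cmod (w - z) * L < eps)%R.
    apply: (Rlt_le_trans _ (eps / L * L)%R).
    - by apply: Rmult_lt_compat_r.
    - by right; field; lra.
  have h0 := Cmod_ge_0 (w - z); move: h; rewrite /L => h; nra.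
rewrite /tri !S; ring.
Qed.

Lemma perim_ge0 a b c : (0 <= perim a b c)%R.
Proof.
by rewrite /perim; have := Cmod_ge_0 (b - a); have := Cmod_ge_0 (c - b); have := Cmod_ge_0 (a - c); lra.
Qed.

(** After n bisections the integral is at least 4^(-n) times the original, while the perimeter and
    the distance to the limit point p are of order 2^(-n). Near p the deviation of f from its
    tangent is an arbitrarily small multiple of the distance, so the integral is also at most a
    small multiple of 4^(-n). Convexity keeps the triangles in D and closedness puts p in D. *)
Theorem goursat (D : C -> Prop) f a b c :
  convexC D -> closedC D -> (forall z, D z -> cdiffable f z) -> D a -> D b -> D c ->
  tri f a b c = 0.
Proof.
move=> HD Hcl Hf Ha Hb Hc.
have Hcont z : D z -> ccont f z by move=> /Hf; apply: cdiffable_ccont.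
pose T (x : C * C * C) := x.
pose fa (x : C * C * C) := fst (fst x). pose fb (x : C * C * C) := snd (fst x). pose fc (x : C * C * C) := snd x.
pose DD x := D (fa x) /\ D (fb x) /\ D (fc x).
pose per x := perim (fa x) (fb x) (fc x).
pose TT x := Cmod (tri f (fa x) (fb x) (fc x)).
(* One bisection step as a function on all triples, with an arbitrary value for triples outside
   D. *)
have [g Hg] : exists g : C * C * C -> C * C * C, forall x, DD x -> DD (g x) /\
   (per (g x) = per x / 2)%R /\ (Cmod (fa (g x) - fa x) <= per x)%R /\ (TT x <= 4 * TT (g x))%R.
  apply: (choice (fun x y => DD x -> DD y /\
   (per y = per x / 2)%R /\ (Cmod (fa y - fa x) <= per x)%R /\ (TT x <= 4 * TT y)%R)) => -[[x y] z].
  case: (classic (DD (x, y, z))) => h; last by exists (x, y, z).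
  have [h1 [h2 h3]] := h.
  have [x' [y' [z' [h4 [h5 [h6 h7]]]]]] := triangle_bisection D f x y z HD Hcont h1 h2 h3.
  by exists (x', y', z').
pose X n := Nat.iter n g (a, b, c).
pose P0 := perim a b c.
have HX n : DD (X n) /\ (per (X n) = P0 * (/ 2) ^ n)%R /\ (TT (X O) * (/ 4) ^ n <= TT (X n))%R.
  elim: n => [|n [h1 [h2 h3]]].
    split; first by split; [|split].
    by rewrite /= !Rmult_1_r; split; [|apply: Rle_refl].
  have [h4 [h5 [h6 h7]]] := Hg _ h1.
  split; first exact: h4.
  split; first by rewrite [X _]/= -/(X n) h5 h2 /=; lra.
  rewrite [X (S n)]/= -/(X n) [((/ 4) ^ (S n))%R]/=; lra.
have [p Hp] : exists p, forall n, (Cmod (fa (X n) - p) <= 2 * P0 * (/ 2) ^ n)%R.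
  apply: geometric_steps_converge => n.
  have [h1 [h2 h3]] := HX n; have [_ [_ [h6 _]]] := Hg _ h1.
  by rewrite -h2.
have P0p : (0 <= P0)%R by exact: perim_ge0.
have small eps : (0 < eps)%R -> exists n, (3 * P0 * (/ 2) ^ n < eps)%R.
  move=> He.
  have q : (0 < eps / (3 * P0 + 1))%R by apply: Rdiv_lt_0_compat; lra.
  have [|n Hn] := pow_lt_1_zero (/ 2) _ _ q; first by rewrite Rabs_pos_eq; lra.
  exists n; have := Hn n (Nat.le_refl n); rewrite Rabs_pos_eq; last by apply: pow_le; lra.
  move=> h; have h' : ((/ 2) ^ n * (3 * P0 + 1) < eps)%R.
    apply: (Rlt_le_trans _ (eps / (3 * P0 + 1) * (3 * P0 + 1))%R).
    - by apply: Rmult_lt_compat_r; lra.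
    - by right; field; lra.
  have : (0 <= (/ 2) ^ n)%R by apply: pow_le; lra.
  nra.
have Dp : D p.
  apply: Hcl => eps He; have [n Hn] := small eps He.
  exists (fa (X n)); split; first by case: (HX n) => -[].
  have := Hp n.
  have : (0 <= P0 * (/ 2) ^ n)%R by apply: Rmult_le_pos => //; apply: pow_le; lra.
  lra.
have [l Hl] := Hf p Dp.
apply: Cmod_eq_0; apply: Rle_antisym; last exact: Cmod_ge_0.
apply: le_epsilon => e He; rewrite Rplus_0_l.
(* The integral will be bounded by the perimeter P0 r times e1 times 3 P0 r, so e1 is chosen to keep
   3 P0 P0 e1 below e. *)
have e1p : (0 < e / (3 * P0 * P0 + 1))%R by apply: Rdiv_lt_0_compat => //; nra.
set e1 := (e / (3 * P0 * P0 + 1))%R in e1p.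
have [d [d0 Hd]] := Hl _ e1p.
have [n Hn] := small d d0.
have [[D1 [D2 D3]] [h2 h3]] := HX n.
move: h2 h3 D1 D2 D3 (Hp n); rewrite /per /TT.
move: (fa (X n)) (fb (X n)) (fc (X n)) => x y z h2 h3 D1 D2 D3 Hpn.
set r := ((/ 2) ^ n)%R in h2 h3 Hn Hpn.
have r0 : (0 <= r)%R by apply: pow_le; lra.
pose h w := f w + (- f p + l * p + (- l) * w).
have Ef : tri f x y z = tri h x y z.
  have Hs u v : D u -> D v -> seg_cont f u v by apply: convex_seg_cont.
  have Ha' u v : seg_cont (fun w => - f p + l * p + (- l) * w) u v.
    by move=> t _; exact: cdiff_ccont (cdiff_affine _ _ _).
  have : tri h x y z = tri f x y z + tri (fun w => - f p + l * p + (- l) * w) x y z.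
    rewrite /tri /h !(seg_plus f (fun w => - f p + l * p + (- l) * w)); try (by apply: Hs); try (by apply: Ha').
    ring.
  by rewrite (tri_affine (- f p + l * p) (- l)) => ->; ring.
have Bh u v : D u -> D v -> (Cmod (u - p) <= 3 * P0 * r)%R -> (Cmod (v - p) <= 3 * P0 * r)%R ->
    (Cmod (seg h u v) <= Cmod (v - u) * (e1 * (3 * P0 * r)))%R.
  move=> Du Dv Bu Bv; apply: seg_bound.
    move=> t Ht; apply: ccont_plus; last exact: cdiff_ccont (cdiff_affine _ _ _).
    by apply: Hcont; apply: HD.
  move=> t Ht; set w := u + RtoC t * (v - u).
  have Bw : (Cmod (w - p) <= 3 * P0 * r)%R.
    have -> : w - p = RtoC (1 - t) * (u - p) + RtoC t * (v - p) by rewrite /w RtoC_minus; ring.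
    apply: Rle_trans (Cmod_triangle _ _) _; rewrite !Cmod_mult !Cmod_R !Rabs_pos_eq; try lra.
    nra.
  have := Hd w; have -> : f w - f p - l * (w - p) = h w by rewrite /h; ring.
  move=> /(_ ltac:(lra)) q; apply: Rle_trans q _.
  by apply: Rmult_le_compat_l => //; lra.
(* The first vertex is within 2 P0 r of p, and the others are at most one perimeter P0 r further
   away. *)
have rx : (Cmod (x - p) <= 3 * P0 * r)%R by have := Rmult_le_pos _ _ P0p r0; lra.
have c1 : (0 <= Cmod (y - x))%R by exact: Cmod_ge_0.
have c2 : (0 <= Cmod (z - y))%R by exact: Cmod_ge_0.
have c3 : (0 <= Cmod (x - z))%R by exact: Cmod_ge_0.
have ry : (Cmod (y - p) <= 3 * P0 * r)%R.
  have := Cmod_tri_minus y x p; rewrite /perim in h2; lra.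
have rz : (Cmod (z - p) <= 3 * P0 * r)%R.
  have := Cmod_tri_minus z x p; rewrite (Cmod_minus_sym z x); rewrite /perim in h2; lra.
have B1 := Bh x y D1 D2 rx ry; have B2 := Bh y z D2 D3 ry rz; have B3 := Bh z x D3 D1 rz rx.
have Bt : (Cmod (tri f x y z) <= perim x y z * (e1 * (3 * P0 * r)))%R.
  rewrite Ef /tri /perim.
  have := Cmod_triangle (seg h x y + seg h y z) (seg h z x).
  have := Cmod_triangle (seg h x y) (seg h y z).
  nra.
rewrite h2 in Bt.
have E4 : ((/ 4) ^ n = r * r)%R by rewrite /r -Rpow_mult_distr; congr (_ ^ _)%R; lra.
rewrite E4 in h3.
have rp : (0 < r)%R by apply: pow_lt; lra.
have : (TT (X O) * (r * r) <= e1 * (3 * P0 * P0) * (r * r))%R by rewrite /TT; lra.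
move=> /(Rmult_le_reg_r _ _ _ (Rmult_lt_0_compat _ _ rp rp)) hfin.
apply: Rle_trans hfin _.
have -> : (e = e1 * (3 * P0 * P0 + 1))%R by rewrite /e1; field; nra.
nra.
Qed.

(** * Primitives on discs *)

Lemma Cmod_convex (x y : C) t B : (0 <= t <= 1)%R -> (Cmod x <= B)%R -> (Cmod y <= B)%R ->
  (Cmod (x + RtoC t * (y - x)) <= B)%R.
Proof.
move=> Ht Hx Hy.
have -> : x + RtoC t * (y - x) = RtoC (1 - t) * x + RtoC t * y by rewrite RtoC_minus; ring.
apply: Rle_trans (Cmod_triangle _ _) _; rewrite !Cmod_mult !Cmod_R !Rabs_pos_eq; try lra.
have := Cmod_ge_0 x; have := Cmod_ge_0 y; nra.
Qed.

Lemma disc_convex c R : convexC (fun w => (Cmod (w - c) <= R)%R).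
Proof.
move=> x y t Hx Hy Ht.
have -> : x + RtoC t * (y - x) - c = (x - c) + RtoC t * ((y - c) - (x - c)) by ring.
exact: Cmod_convex.
Qed.

Lemma open_disc_convex c R : convexC (fun w => (Cmod (w - c) < R)%R).
Proof.
move=> x y t Hx Hy Ht.
have -> : x + RtoC t * (y - x) - c = (x - c) + RtoC t * ((y - c) - (x - c)) by ring.
apply: (Rle_lt_trans _ (Rmax (Cmod (x - c)) (Cmod (y - c)))); last exact: Rmax_lub_lt.
by apply: Cmod_convex => //; [exact: Rmax_l | exact: Rmax_r].
Qed.

(** The real scalar product of the plane; a lower bound on it cuts out a half-plane that avoids a
    given point. *)
Definition inner (a d : C) : R := Re (a * Cconj d).

Lemma inner_le a d : (Rabs (inner a d) <= Cmod a * Cmod d)%R.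
Proof. by rewrite /inner -(Cmod_conj d) -Cmod_mult; apply: re_le_Cmod. Qed.

Lemma inner_plus a b d : inner (a + b) d = (inner a d + inner b d)%R.
Proof. rewrite /inner /=; ring. Qed.

Lemma inner_scal t a d : inner (RtoC t * a) d = (t * inner a d)%R.
Proof. rewrite /inner /=; ring. Qed.

Lemma inner_self d : inner d d = (Cmod d ^ 2)%R.
Proof. rewrite /inner Cmod2_alt /=; rewrite /Re /Im; ring. Qed.

(** Differentiability may fail at z, so Goursat does not apply to the triangle itself. It applies to
    the trapezoid left after cutting off a small copy at the vertex z, and the copy contributes
    arbitrarily little because k is bounded near z. The condition on y - x puts y in the open
    half-plane of x as seen from z. *)
Lemma star_triangle c R z x y k :
  (Cmod (z - c) < R)%R -> (Cmod (x - c) < R)%R -> (Cmod (y - c) < R)%R ->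
  (forall w, (Cmod (w - c) < R)%R -> w <> z -> cdiffable k w) -> ccont k z ->
  x <> z -> (Cmod (y - x) < Cmod (x - z))%R -> tri k z x y = 0.
Proof.
move=> Hz Hx Hy Hk Hkz nxz Hyx.
have Hc w : (Cmod (w - c) < R)%R -> ccont k w.
  move=> Hw; case: (classic (w = z)) => [->//|n]; apply: cdiffable_ccont; exact: Hk.
have Hs u v : (Cmod (u - c) < R)%R -> (Cmod (v - c) < R)%R -> seg_cont k u v.
  by move=> Hu Hv; apply: (convex_seg_cont (fun w => (Cmod (w - c) < R)%R)) => //; exact: open_disc_convex.
pose d := x - z.
have dp : (0 < Cmod d)%R by apply/Cmod_gt_0; apply: Cminus_neq_0.
pose kx := inner (x - z) d. pose ky := inner (y - z) d.
have kx0 : (0 < kx)%R by rewrite /kx inner_self; apply: pow_lt.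
have ky0 : (0 < ky)%R.
  rewrite /ky; have -> : y - z = (y - x) + d by rewrite /d; ring.
  rewrite inner_plus inner_self; have := inner_le (y - x) d.
  have := Rle_abs (- inner (y - x) d); rewrite Rabs_Ropp => h1 h2.
  have : (Cmod (y - x) * Cmod d < Cmod d * Cmod d)%R by apply: Rmult_lt_compat_r.
  rewrite /=; lra.
pose rho := Rmax (Cmod (z - c)) (Rmax (Cmod (x - c)) (Cmod (y - c))).
have rR : (rho < R)%R by rewrite /rho; repeat apply: Rmax_lub_lt.
have rz : (Cmod (z - c) <= rho)%R by exact: Rmax_l.
have rx : (Cmod (x - c) <= rho)%R by apply: Rle_trans (Rmax_r _ _); exact: Rmax_l.
have ry : (Cmod (y - c) <= rho)%R by apply: Rle_trans (Rmax_r _ _); exact: Rmax_r.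
(* The trapezoid is cut into the triangles xs x y and xs y ys, both in a half-plane section of a
   closed disc that does not contain z. *)
have key s : (0 < s < 1)%R -> tri k z x y = tri k z (z + RtoC s * (x - z)) (z + RtoC s * (y - z)).
  move=> Hs1; set xs := z + RtoC s * (x - z); set ys := z + RtoC s * (y - z).
  have hs : (0 <= s <= 1)%R by lra.
  pose K0 := Rmin (s * kx) (s * ky).
  have K0p : (0 < K0)%R by apply: Rmin_glb_lt; nra.
  pose D w := (Cmod (w - c) <= rho)%R /\ (K0 <= inner (w - z) d)%R.
  have cD : convexC D.
    move=> u v t [u1 u2] [v1 v2] Ht; split; first exact: disc_convex.
    have -> : u + RtoC t * (v - u) - z = RtoC (1 - t) * (u - z) + RtoC t * (v - z) by rewrite RtoC_minus; ring.
    rewrite inner_plus !inner_scal; nra.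
  have clD : closedC D.
    move=> p Hp; split; apply: Rnot_lt_le => h.
    - have [|w [[w1 _] w2]] := Hp (Cmod (p - c) - rho)%R; first lra.
      have := Cmod_tri_minus p w c; rewrite (Cmod_minus_sym p w); lra.
    - have q : (0 < (K0 - inner (p - z) d) / Cmod d)%R by apply: Rdiv_lt_0_compat; lra.
      have [w [[_ w1] w2]] := Hp _ q.
      have E : w - z = (w - p) + (p - z) by ring.
      rewrite E inner_plus in w1.
      have := inner_le (w - p) d; have := Rle_abs (inner (w - p) d).
      have : (Cmod (w - p) * Cmod d < K0 - inner (p - z) d)%R.
        apply: (Rlt_le_trans _ ((K0 - inner (p - z) d) / Cmod d * Cmod d)%R).
        + by apply: Rmult_lt_compat_r.
        + by right; field; lra.
      lra.
  have Dxs : D xs.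
    split; first exact: disc_convex.
    have -> : xs - z = RtoC s * (x - z) by rewrite /xs; ring.
    rewrite inner_scal; exact: Rmin_l.
  have Dys : D ys.
    split; first exact: disc_convex.
    have -> : ys - z = RtoC s * (y - z) by rewrite /ys; ring.
    rewrite inner_scal; exact: Rmin_r.
  have Dx : D x by split=> //; apply: (Rle_trans _ (s * kx)%R); [exact: Rmin_l | rewrite -/kx; nra].
  have Dy : D y by split=> //; apply: (Rle_trans _ (s * ky)%R); [exact: Rmin_r | rewrite -/ky; nra].
  have kD w : D w -> cdiffable k w.
    move=> [w1 w2]; apply: Hk; first lra.
    move=> E; rewrite E in w2; have E2 : z - z = RtoC 0 * d by ring.
    rewrite E2 inner_scal in w2; lra.
  have g1 := goursat D k xs x y cD clD kD Dxs Dx Dy.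
  have g2 := goursat D k xs y ys cD clD kD Dxs Dy Dys.
  have D1 w : D w -> (Cmod (w - c) < R)%R by move=> [w1 _]; lra.
  move: g1 g2; rewrite /tri.
  rewrite (seg_split k z x s) -/xs //; last by apply: Hs.
  rewrite (seg_opp k z y); last by apply: Hs.
  rewrite (seg_split k z y s) -/ys //; last by apply: Hs.
  rewrite (seg_opp k z ys); last by apply: Hs => //; apply: D1.
  rewrite (seg_opp k xs ys); last by apply: Hs; apply: D1.
  rewrite (seg_opp k xs y); last by apply: Hs; apply: D1.
  rewrite (seg_opp k ys y); last by apply: Hs; apply: D1.
  move: (seg k xs x) (seg k x y) (seg k xs y) (seg k xs ys) (seg k ys y) (seg k z xs) (seg k z ys) => A B E F G H I g1 g2.
  transitivity (H + F + - I + (A + B + - E) + (E + - G + - F)); first by ring.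
  rewrite g1 g2; ring.
have [|dl [dl0 Hd]] := Hkz 1%R; first lra.
apply: Cmod_le_0; apply: le_epsilon => e He; rewrite Rplus_0_l.
pose P := perim z x y. pose M := (Cmod (k z) + 1)%R.
have P0 : (0 <= P)%R by exact: perim_ge0.
have M0 : (0 < M)%R by rewrite /M; have := Cmod_ge_0 (k z); lra.
(* The three bounds give s < 1, keep the small triangle where k is bounded by M, and make its
   contribution s M P at most e. *)
pose s := Rmin (/ 2) (Rmin (dl / (P + 1)) (e / (M * P + 1))).
have s1 : (s <= / 2)%R by exact: Rmin_l.
have s2 : (s * (P + 1) <= dl)%R.
  apply: (Rle_trans _ (dl / (P + 1) * (P + 1))%R); last by right; field; lra.
  apply: Rmult_le_compat_r; first lra.
  by apply: Rle_trans (Rmin_r _ _) _; exact: Rmin_l.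
have s3 : (s * (M * P + 1) <= e)%R.
  have : (0 <= M * P)%R by nra.
  move=> q; apply: (Rle_trans _ (e / (M * P + 1) * (M * P + 1))%R); last by right; field; lra.
  apply: Rmult_le_compat_r; first lra.
  by apply: Rle_trans (Rmin_r _ _) _; exact: Rmin_r.
have s0 : (0 < s)%R.
  have : (0 <= M * P)%R by nra.
  move=> q; repeat apply: Rmin_glb_lt; try lra; apply: Rdiv_lt_0_compat; lra.
rewrite (key s); last lra.
set xs := z + RtoC s * (x - z); set ys := z + RtoC s * (y - z).
have exs : xs - z = RtoC s * (x - z) by rewrite /xs; ring.
have eys : ys - z = RtoC s * (y - z) by rewrite /ys; ring.
have Rxs : (Cmod (xs - c) < R)%R by apply: open_disc_convex => //; lra.
have Rys : (Cmod (ys - c) < R)%R by apply: open_disc_convex => //; lra.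
have nx : (Cmod (x - z) <= P)%R.
  rewrite /P /perim; have := Cmod_ge_0 (y - x); have := Cmod_ge_0 (z - y); lra.
have ny : (Cmod (y - z) <= P)%R.
  rewrite /P /perim (Cmod_minus_sym y z); have := Cmod_ge_0 (y - x); have := Cmod_ge_0 (x - z); lra.
have bx : (Cmod (xs - z) <= s * P)%R.
  rewrite exs Cmod_mult Cmod_R Rabs_pos_eq; last lra; nra.
have by_ : (Cmod (ys - z) <= s * P)%R.
  rewrite eys Cmod_mult Cmod_R Rabs_pos_eq; last lra; nra.
have bz : (Cmod (z - z) <= s * P)%R.
  have -> : z - z = 0 by ring.
  rewrite Cmod_0; nra.
have Bseg u v : (Cmod (u - c) < R)%R -> (Cmod (v - c) < R)%R -> (Cmod (u - z) <= s * P)%R ->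
    (Cmod (v - z) <= s * P)%R -> (Cmod (seg k u v) <= Cmod (v - u) * M)%R.
  move=> Hu Hv bu bv; apply: seg_bound; first by apply: Hs.
  move=> t Ht; set w := u + RtoC t * (v - u).
  have bw : (Cmod (w - z) <= s * P)%R.
    have -> : w - z = (u - z) + RtoC t * ((v - z) - (u - z)) by rewrite /w; ring.
    exact: Cmod_convex.
  have := Hd w; move=> /(_ ltac:(lra)) h.
  have := Cmod_minus_le (k w) (k z); rewrite /M; lra.
have B1 := Bseg z xs Hz Rxs bz bx.
have B2 := Bseg xs ys Rxs Rys bx by_.
have B3 := Bseg ys z Rys Hz by_ bz.
rewrite exs Cmod_mult Cmod_R Rabs_pos_eq in B1; last lra.
have E2 : ys - xs = RtoC s * (y - x) by rewrite /xs /ys; ring.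
rewrite E2 Cmod_mult Cmod_R Rabs_pos_eq in B2; last lra.
have E3 : z - ys = RtoC s * (z - y) by rewrite /ys; ring.
rewrite E3 Cmod_mult Cmod_R Rabs_pos_eq in B3; last lra.
have := Cmod_triangle (seg k z xs + seg k xs ys) (seg k ys z).
have := Cmod_triangle (seg k z xs) (seg k xs ys).
move=> q2 q1.
apply: (Rle_trans _ (s * (M * P))%R); last by nra.
have -> : (s * (M * P) = s * Cmod (x - z) * M + s * Cmod (y - x) * M + s * Cmod (z - y) * M)%R.
  rewrite /P /perim; ring.
move: q1; rewrite /tri; lra.
Qed.

(** For y near x the triangle z x y turns the increment of the candidate primitive into the integral
    over the segment from x to y, on which k differs little from k x. *)
Lemma star_primitive c R z k :
  (Cmod (z - c) < R)%R ->
  (forall w, (Cmod (w - c) < R)%R -> w <> z -> cdiffable k w) -> ccont k z ->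
  forall x, (Cmod (x - c) < R)%R -> cdiff (fun y => seg k z y) x (k x).
Proof.
move=> Hz Hk Hkz x Hx.
have Hc w : (Cmod (w - c) < R)%R -> ccont k w.
  move=> Hw; case: (classic (w = z)) => [->//|n]; apply: cdiffable_ccont; exact: Hk.
have Hs u v : (Cmod (u - c) < R)%R -> (Cmod (v - c) < R)%R -> seg_cont k u v.
  by move=> Hu Hv; apply: (convex_seg_cont (fun w => (Cmod (w - c) < R)%R)) => //; exact: open_disc_convex.
have local y : (Cmod (y - c) < R)%R -> (x <> z -> (Cmod (y - x) < Cmod (x - z))%R) ->
    seg k z y - seg k z x = seg k x y.
  move=> Hy h; case: (classic (x = z)) => [->|n].
    have -> : seg k z z = 0 by rewrite /seg; ring.
    by ring.
  have := star_triangle c R z x y k Hz Hx Hy Hk Hkz n (h n).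
  rewrite /tri (seg_opp k z y); last by apply: Hs.
  move=> E; transitivity (seg k z y - seg k z x + (seg k z x + seg k x y + - seg k z y)); last by ring.
  by rewrite E; ring.
have cst q u v : seg (fun _ => q) u v = q * (v - u).
  rewrite (seg_ftc (fun w => 0 + q * w)); first by ring.
  - by move=> t _; exact: cdiff_affine.
  - move=> t _ eps He; exists 1%R; split; first lra.
    by move=> y _; have -> : q - q = 0 by [ring]; rewrite Cmod_0.
move=> eps He.
have [d [d0 Hd]] := Hc x Hx eps He.
pose d1 := Rmin d (R - Cmod (x - c)).
have d1p : (0 < d1)%R by apply: Rmin_glb_lt; lra.
(* At x = z the increment formula is trivial and no smallness of y - x is required. *)
have [d2 [d2p d2h]] : exists d2, (0 < d2)%R /\ (x <> z -> (d2 <= Cmod (x - z))%R).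
  case: (classic (x = z)) => n; first by exists 1%R; split; [lra|].
  by exists (Cmod (x - z)); split; [apply/Cmod_gt_0; apply: Cminus_neq_0 | lra].
exists (Rmin d1 d2); split; first exact: Rmin_glb_lt.
move=> y Hy.
have y1 := Rlt_le_trans _ _ _ Hy (Rmin_l _ _).
have y2 := Rlt_le_trans _ _ _ Hy (Rmin_r _ _).
have y3 := Rlt_le_trans _ _ _ y1 (Rmin_l _ _).
have y4 := Rlt_le_trans _ _ _ y1 (Rmin_r _ _).
have Ry : (Cmod (y - c) < R)%R by have := Cmod_tri_minus y x c; lra.
rewrite local //; last by move=> n; have := d2h n; lra.
have cc q u v : seg_cont (fun _ => q) u v.
  move=> t _ e e0; exists 1%R; split; first lra.
  by move=> y' _; have -> : q - q = 0 by [ring]; rewrite Cmod_0.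
have -> : seg k x y - k x * (y - x) = seg (fun w => k w + - k x) x y.
  rewrite seg_plus //; last by apply: Hs.
  by rewrite cst; ring.
rewrite Rmult_comm; apply: seg_bound.
- move=> t Ht; apply: ccont_plus; first by apply: (Hs x y Hx Ry).
  exact: (cc (- k x) x y t Ht).
- move=> t Ht; left; apply: Hd.
  have -> : x + RtoC t * (y - x) - x = RtoC t * (y - x) by ring.
  rewrite Cmod_mult Cmod_R Rabs_pos_eq; last lra.
  have := Cmod_ge_0 (y - x); nra.
Qed.

(** * Cauchy's formula and Taylor expansions *)

(** Once absolute summability is known, the unconditional sum can be identified along initial
    segments only. *)
Lemma has_sum_nat_limit (f : nat -> C) l :
  abs_summable f ->
  (forall eps, (0 < eps)%R -> exists n0, forall n, (n0 <= n)%nat -> (Cmod (sumC f (seq 0 n) - l) < eps)%R) ->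
  has_sum f l.
Proof.
move=> Hs Hl; have [s Hss] := abs_summable_has_sum f Hs.
have <- : s = l; last exact: Hss.
apply: NNPP => ne; have p : (0 < Cmod (s - l))%R by apply/Cmod_gt_0; apply: Cminus_neq_0.
have [|L0 H0] := Hss (Cmod (s - l) / 2)%R; first lra.
have [|n0 Hn0] := Hl (Cmod (s - l) / 2)%R; first lra.
have [n1 Hn1] := incl_seq L0.
have h1 := Hn0 (n0 + n1)%nat (Nat.le_add_r _ _).
have := H0 (seq 0 (n0 + n1)) (seq_NoDup _ _).
move=> /(_ ltac:(by move=> x /Hn1 /in_seq Hx; apply/in_seq; lia)) h2.
have := Cmod_tri_minus s (sumC f (seq 0 (n0 + n1))) l; rewrite (Cmod_minus_sym s (sumC _ _)); lra.
Qed.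

Lemma cdiff_unique_ext f g z l : cdiff f z l ->
  (exists d, (0 < d)%R /\ forall y, (Cmod (y - z) < d)%R -> f y = g y) -> cdiff g z l.
Proof.
move=> H [d [d0 E]] eps He; have [d1 [d1p Hd]] := H eps He.
exists (Rmin d d1); split; first exact: Rmin_glb_lt.
move=> y Hy; rewrite -!E; first by apply: Hd; apply: Rlt_le_trans Hy (Rmin_r _ _).
- by have -> : z - z = 0 by [ring]; rewrite Cmod_0.
- exact: Rlt_le_trans Hy (Rmin_l _ _).
Qed.

Lemma cdiff_const c z : cdiff (fun _ => c) z 0.
Proof.
move=> eps He; exists 1%R; split; first lra.
move=> y _; have -> : c - c - 0 * (y - z) = 0 by ring.
rewrite Cmod_0; have := Cmod_ge_0 (y - z); nra.
Qed.

Lemma cdiff_id z : cdiff (fun w => w) z 1.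
Proof.
move=> eps He; exists 1%R; split; first lra.
move=> y _; have -> : y - z - 1 * (y - z) = 0 by ring.
rewrite Cmod_0; have := Cmod_ge_0 (y - z); nra.
Qed.

Lemma cdiff_plus f g z l m : cdiff f z l -> cdiff g z m -> cdiff (fun w => f w + g w) z (l + m).
Proof.
move=> Hf Hg eps He.
have [|d1 [p1 h1]] := Hf (eps / 2)%R; first lra.
have [|d2 [p2 h2]] := Hg (eps / 2)%R; first lra.
exists (Rmin d1 d2); split; first exact: Rmin_glb_lt.
move=> y Hy.
have a1 := h1 y (Rlt_le_trans _ _ _ Hy (Rmin_l _ _)).
have a2 := h2 y (Rlt_le_trans _ _ _ Hy (Rmin_r _ _)).
have -> : f y + g y - (f z + g z) - (l + m) * (y - z) =
  (f y - f z - l * (y - z)) + (g y - g z - m * (y - z)) by ring.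
have := Cmod_triangle (f y - f z - l * (y - z)) (g y - g z - m * (y - z)); lra.
Qed.

Lemma cdiff_lip f z l : cdiff f z l -> exists d, (0 < d)%R /\
  forall y, (Cmod (y - z) < d)%R -> (Cmod (f y - f z) <= (Cmod l + 1) * Cmod (y - z))%R.
Proof.
move=> H; have [|d [d0 h]] := H 1%R; first lra.
exists d; split=> // y Hy; have := h y Hy.
have := Cmod_triangle (f y - f z - l * (y - z)) (l * (y - z)).
have -> : f y - f z - l * (y - z) + l * (y - z) = f y - f z by ring.
rewrite Cmod_mult; lra.
Qed.

Lemma cdiff_comp f g z l m : cdiff f z l -> cdiff g (f z) m -> cdiff (fun w => g (f w)) z (m * l).
Proof.
move=> Hf Hg eps He.
have [dL [dL0 HL]] := cdiff_lip f z l Hf.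
pose A := (Cmod l + 1)%R; pose B := (Cmod m + 1)%R.
have A0 : (1 <= A)%R by rewrite /A; have := Cmod_ge_0 l; lra.
have B0 : (1 <= B)%R by rewrite /B; have := Cmod_ge_0 m; lra.
have e1 : (0 < eps / (2 * A))%R by apply: Rdiv_lt_0_compat; lra.
have e2 : (0 < eps / (2 * B))%R by apply: Rdiv_lt_0_compat; lra.
have [d1 [p1 h1]] := Hg _ e1.
have [d2 [p2 h2]] := Hf _ e2.
have q : (0 < d1 / A)%R by apply: Rdiv_lt_0_compat; lra.
exists (Rmin dL (Rmin d2 (d1 / A))); split; first by repeat apply: Rmin_glb_lt.
move=> y Hy.
have y1 := Rlt_le_trans _ _ _ Hy (Rmin_l _ _).
have y2 := Rlt_le_trans _ _ _ Hy (Rmin_r _ _).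
have y3 := Rlt_le_trans _ _ _ y2 (Rmin_l _ _).
have y4 := Rlt_le_trans _ _ _ y2 (Rmin_r _ _).
have a1 := HL y y1; rewrite -/A in a1.
have a2 := h2 y y3.
have c0 := Cmod_ge_0 (y - z).
have a3 : (Cmod (f y - f z) < d1)%R.
  apply: (Rle_lt_trans _ _ _ a1); apply: (Rlt_le_trans _ (A * (d1 / A))%R).
  - by apply: Rmult_lt_compat_l; lra.
  - by right; field; lra.
have a4 := h1 _ a3.
have -> : g (f y) - g (f z) - m * l * (y - z) =
  (g (f y) - g (f z) - m * (f y - f z)) + m * (f y - f z - l * (y - z)) by ring.
apply: Rle_trans (Cmod_triangle _ _) _; rewrite (Cmod_mult m).
have b1 : (Cmod (g (f y) - g (f z) - m * (f y - f z)) <= eps / 2 * Cmod (y - z))%R.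
  apply: Rle_trans a4 _.
  apply: (Rle_trans _ (eps / (2 * A) * (A * Cmod (y - z)))%R).
  - by apply: Rmult_le_compat_l => //; lra.
  - by right; field; lra.
have b2 : (Cmod m * Cmod (f y - f z - l * (y - z)) <= eps / 2 * Cmod (y - z))%R.
  apply: (Rle_trans _ (B * (eps / (2 * B) * Cmod (y - z)))%R).
  - apply: Rmult_le_compat => //; try exact: Cmod_ge_0.
    by rewrite /B; lra.
  - by right; field; lra.
lra.
Qed.

Lemma cdiff_sqr z : cdiff (fun w => w * w) z (2 * z).
Proof.
move=> eps He; exists eps; split=> // y Hy.
have -> : y * y - z * z - 2 * z * (y - z) = (y - z) * (y - z) by ring.
rewrite Cmod_mult; have := Cmod_ge_0 (y - z); nra.
Qed.

Lemma cdiff_scal c f z l : cdiff f z l -> cdiff (fun w => c * f w) z (c * l).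
Proof.
move=> H; apply: (cdiff_comp f (fun w => c * w) z l c H).
apply: (cdiff_unique_ext (fun w => 0 + c * w)); first exact: cdiff_affine.
by exists 1%R; split; [lra | move=> y _; ring].
Qed.

(* Polarization: [f g = ((f + g)^2 - f^2 - g^2) / 2]. *)
Lemma cdiff_mult f g z l m : cdiff f z l -> cdiff g z m -> cdiff (fun w => f w * g w) z (l * g z + f z * m).
Proof.
move=> Hf Hg.
have S h n : cdiff h z n -> cdiff (fun w => h w * h w) z (2 * h z * n).
  by move=> Hh; apply: (cdiff_comp h (fun w => w * w)) => //; exact: cdiff_sqr.
have H1 := S _ _ (cdiff_plus _ _ _ _ _ Hf Hg).
have H2 := cdiff_scal (-(1)) _ _ _ (S _ _ Hf).
have H3 := cdiff_scal (-(1)) _ _ _ (S _ _ Hg).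
have H := cdiff_scal (/ 2) _ _ _ (cdiff_plus _ _ _ _ _ (cdiff_plus _ _ _ _ _ H1 H2) H3).
have E : / 2 * (2 * (f z + g z) * (l + m) + - (1) * (2 * f z * l) + - (1) * (2 * g z * m)) = l * g z + f z * m.
  by field.
rewrite E in H; apply: cdiff_unique_ext H _.
by exists 1%R; split; [lra | move=> y _; field].
Qed.

Lemma cdiff_inv (z : C) : z <> 0 -> cdiff Cinv z (- / (z * z)).
Proof.
move=> nz eps He.
have zp : (0 < Cmod z)%R by exact: (proj1 (Cmod_gt_0 z) nz).
pose K := (2 / (Cmod z * Cmod z * Cmod z))%R.
have zzz : (0 < Cmod z * Cmod z * Cmod z)%R by repeat apply: Rmult_lt_0_compat.
have K0 : (0 < K)%R by apply: Rdiv_lt_0_compat; lra.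
exists (Rmin (Cmod z / 2) (eps / K)); split.
  by apply: Rmin_glb_lt; [lra | apply: Rdiv_lt_0_compat].
move=> y Hy.
have y1 := Rlt_le_trans _ _ _ Hy (Rmin_l _ _).
have y2 := Rlt_le_trans _ _ _ Hy (Rmin_r _ _).
have yp : (Cmod z / 2 <= Cmod y)%R.
  have := Cmod_minus_le z y; rewrite Cmod_minus_sym; lra.
have ny : y <> 0 by apply/Cmod_gt_0; lra.
have -> : / y - / z - - / (z * z) * (y - z) = (y - z) * (y - z) * / (z * z * y) by field.
rewrite !Cmod_mult Cmod_inv; last by repeat apply: Cmult_neq_0.
rewrite !Cmod_mult.
have q : (/ (Cmod z * Cmod z * Cmod y) <= K)%R.
  rewrite /K /Rdiv; apply: (Rmult_le_reg_l (Cmod z * Cmod z * Cmod y)).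
    by repeat apply: Rmult_lt_0_compat; lra.
  rewrite Rinv_r; last by apply: Rgt_not_eq; repeat apply: Rmult_lt_0_compat; lra.
  have -> : (Cmod z * Cmod z * Cmod y * (2 * / (Cmod z * Cmod z * Cmod z)) = 2 * Cmod y / Cmod z)%R by field; lra.
  apply: (Rmult_le_reg_r (Cmod z)) => //.
  have -> : (2 * Cmod y / Cmod z * Cmod z = 2 * Cmod y)%R by field; lra.
  lra.
have c0 := Cmod_ge_0 (y - z).
apply: (Rle_trans _ (Cmod (y - z) * Cmod (y - z) * K)%R).
  by apply: Rmult_le_compat_l => //; nra.
have : (Cmod (y - z) * K < eps)%R.
  apply: (Rlt_le_trans _ (eps / K * K)%R).
  - by apply: Rmult_lt_compat_r.
  - by right; field; lra.
nra.
Qed.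

Lemma cdiffable_const c z : cdiffable (fun _ => c) z.
Proof. by eexists; apply: cdiff_const. Qed.

Lemma cdiffable_id z : cdiffable (fun w => w) z.
Proof. by eexists; apply: cdiff_id. Qed.

Lemma cdiffable_plus f g z : cdiffable f z -> cdiffable g z -> cdiffable (fun w => f w + g w) z.
Proof. by move=> [l Hl] [m Hm]; eexists; apply: cdiff_plus Hl Hm. Qed.

Lemma cdiffable_mult f g z : cdiffable f z -> cdiffable g z -> cdiffable (fun w => f w * g w) z.
Proof. by move=> [l Hl] [m Hm]; eexists; apply: cdiff_mult Hl Hm. Qed.

Lemma cdiffable_opp f z : cdiffable f z -> cdiffable (fun w => - f w) z.
Proof.
move=> [l Hl]; exists (-(1) * l).
apply: cdiff_unique_ext (cdiff_scal (-(1)) _ _ _ Hl) _.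
by exists 1%R; split; [lra | move=> y _; ring].
Qed.

Lemma cdiffable_minus f g z : cdiffable f z -> cdiffable g z -> cdiffable (fun w => f w - g w) z.
Proof. by move=> Hf Hg; apply: cdiffable_plus => //; apply: cdiffable_opp. Qed.

Lemma cdiffable_inv f z : cdiffable f z -> f z <> 0 -> cdiffable (fun w => / f w) z.
Proof. by move=> [l Hl] n; eexists; apply: (cdiff_comp f Cinv) Hl _; apply: cdiff_inv. Qed.

Lemma cdiffable_div f g z : cdiffable f z -> cdiffable g z -> g z <> 0 -> cdiffable (fun w => f w / g w) z.
Proof. by move=> Hf Hg n; apply: cdiffable_mult => //; apply: cdiffable_inv. Qed.

Lemma cdiffable_pow f z n : cdiffable f z -> cdiffable (fun w => f w ^ n) z.
Proof.
move=> H; elim: n => [|n IH]; first exact: cdiffable_const.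
exact: cdiffable_mult.
Qed.

Lemma cdiffable_ext f g z : cdiffable f z ->
  (exists d, (0 < d)%R /\ forall y, (Cmod (y - z) < d)%R -> f y = g y) -> cdiffable g z.
Proof. by move=> [l Hl] H; exists l; apply: cdiff_unique_ext Hl H. Qed.

(** * The unit circle and paths in the plane *)

Definition cis (t : R) : C := (cos t, sin t).

Lemma Cmod_cis t : Cmod (cis t) = 1%R.
Proof.
rewrite /Cmod /cis /=.
have -> : (cos t * (cos t * 1) + sin t * (sin t * 1) = 1)%R by have := sin2_cos2 t; rewrite /Rsqr; lra.
exact: sqrt_1.
Qed.

Lemma cis_0 : cis 0 = 1.
Proof. by rewrite /cis cos_0 sin_0. Qed.

Lemma cis_plus a b : cis (a + b) = cis a * cis b.
Proof. by rewrite /cis /Cmult /= cos_plus sin_plus; congr (_, _); ring. Qed.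

Lemma cis_nz t : cis t <> 0.
Proof. by apply/Cmod_gt_0; rewrite Cmod_cis; lra. Qed.

Lemma cis_opp t : cis (- t) = / cis t.
Proof.
have n := cis_nz t.
have E : cis (- t) * cis t = 1 by rewrite -cis_plus -cis_0; congr cis; ring.
by transitivity (cis (- t) * cis t * / cis t); [field | rewrite E; field].
Qed.

Lemma cis_INR_mult n t : cis (INR n * t) = cis t ^ n.
Proof.
elim: n => [|n IH]; first by rewrite /= Rmult_0_l cis_0.
by rewrite S_INR Rmult_plus_distr_r Rmult_1_l cis_plus IH /= Cmult_comm.
Qed.

Lemma cis_2PI n : cis (INR n * (2 * PI)) = 1.
Proof.
have -> : (INR n * (2 * PI) = 0 + 2 * INR n * PI)%R by ring.
by rewrite /cis cos_period sin_period cos_0 sin_0.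
Qed.

Lemma rdiff_pair (g : R -> C) t l :
  is_derive (fun s => fst (g s)) t (fst l) -> is_derive (fun s => snd (g s)) t (snd l) -> rdiff g t l.
Proof.
move=> /is_derive_Reals H1 /is_derive_Reals H2 eps He.
have [|d1 h1] := H1 (eps / 2)%R; first lra.
have [|d2 h2] := H2 (eps / 2)%R; first lra.
exists (Rmin d1 d2); split; first by apply: Rmin_glb_lt; apply: cond_pos.
move=> s Hs.
case: (Req_dec (s - t) 0) => E.
  have -> : s = t by lra.
  have -> : g t - g t - RtoC (t - t) * l = 0 by rewrite RtoC_minus; ring.
  by rewrite Cmod_0 Rminus_diag Rabs_R0; lra.
have b1 := h1 _ E (Rlt_le_trans _ _ _ Hs (Rmin_l _ _)).
have b2 := h2 _ E (Rlt_le_trans _ _ _ Hs (Rmin_r _ _)).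
have ts : (t + (s - t) = s)%R by ring.
rewrite ts in b1 b2.
have ap : (0 < Rabs (s - t))%R by apply: Rabs_pos_lt.
have c a b k : (Rabs ((a - b) / (s - t) - k) < eps / 2)%R ->
    (Rabs (a - b - (s - t) * k) <= eps / 2 * Rabs (s - t))%R.
  move=> h; have -> : (a - b - (s - t) * k = ((a - b) / (s - t) - k) * (s - t))%R by field.
  by rewrite Rabs_mult; apply: Rmult_le_compat_r; lra.
have d1' := c _ _ _ b1; have d2' := c _ _ _ b2.
apply: Rle_trans (Cmod_le_sum _) _.
have E1 : fst (g s - g t - RtoC (s - t) * l) = (fst (g s) - fst (g t) - (s - t) * fst l)%R by rewrite /=; ring.
have E2 : snd (g s - g t - RtoC (s - t) * l) = (snd (g s) - snd (g t) - (s - t) * snd l)%R by rewrite /=; ring.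
rewrite E1 E2; lra.
Qed.

Lemma rdiff_cis m t : rdiff (fun s => cis (m * s)) t (RtoC m * Ci * cis (m * t)).
Proof.
apply: rdiff_pair; rewrite /=; auto_derive => //; ring.
Qed.

Lemma rdiff_rcont g t l : rdiff g t l -> rcont g t.
Proof.
move=> H eps He; have [|d [d0 h]] := H 1%R; first lra.
have p : (0 < Cmod l + 2)%R by have := Cmod_ge_0 l; lra.
exists (Rmin d (eps / (Cmod l + 2))); split.
  by apply: Rmin_glb_lt => //; apply: Rdiv_lt_0_compat.
move=> s Hs.
have h1 := h s (Rlt_le_trans _ _ _ Hs (Rmin_l _ _)).
have Hs2 := Rlt_le_trans _ _ _ Hs (Rmin_r _ _).
have E : (Rabs (s - t) * (Cmod l + 2) < eps)%R.
  apply: (Rlt_le_trans _ (eps / (Cmod l + 2) * (Cmod l + 2))%R).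
  - by apply: Rmult_lt_compat_r.
  - by right; field; lra.
have := Cmod_triangle (g s - g t - RtoC (s - t) * l) (RtoC (s - t) * l).
have -> : g s - g t - RtoC (s - t) * l + RtoC (s - t) * l = g s - g t by ring.
rewrite Cmod_mult Cmod_R; have := Rabs_pos (s - t).
move: E h1; nra.
Qed.

Lemma rcont_comp f g t : rcont g t -> ccont f (g t) -> rcont (fun s => f (g s)) t.
Proof.
move=> Hg Hf eps He; have [d [d0 h]] := Hf eps He; have [d1 [p1 h1]] := Hg d d0.
by exists d1; split=> // s Hs; apply: h; apply: h1.
Qed.

Lemma rdiff_comp f g t l m : rdiff g t l -> cdiff f (g t) m -> rdiff (fun s => f (g s)) t (m * l).
Proof.
move=> Hg Hf eps He.
have gc := rdiff_rcont g t l Hg.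
pose A := (Cmod l + 1)%R; pose B := (Cmod m + 1)%R.
have A0 : (1 <= A)%R by rewrite /A; have := Cmod_ge_0 l; lra.
have B0 : (1 <= B)%R by rewrite /B; have := Cmod_ge_0 m; lra.
have e1 : (0 < eps / (2 * A))%R by apply: Rdiv_lt_0_compat; lra.
have e2 : (0 < eps / (2 * B))%R by apply: Rdiv_lt_0_compat; lra.
have [d1 [p1 h1]] := Hf _ e1.
have [d2 [p2 h2]] := Hg _ e2.
have [d3 [p3 h3]] := gc _ p1.
have [|d4 [p4 h4]] := Hg 1%R; first lra.
exists (Rmin d2 (Rmin d3 d4)); split; first by repeat apply: Rmin_glb_lt.
move=> s Hs.
have a2 := h2 s (Rlt_le_trans _ _ _ Hs (Rmin_l _ _)).
have Hs' := Rlt_le_trans _ _ _ Hs (Rmin_r _ _).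
have a3 := h3 s (Rlt_le_trans _ _ _ Hs' (Rmin_l _ _)).
have a4 := h4 s (Rlt_le_trans _ _ _ Hs' (Rmin_r _ _)).
have a1 := h1 _ a3.
have c0 := Rabs_pos (s - t).
have a5 : (Cmod (g s - g t) <= A * Rabs (s - t))%R.
  have := Cmod_triangle (g s - g t - RtoC (s - t) * l) (RtoC (s - t) * l).
  have -> : g s - g t - RtoC (s - t) * l + RtoC (s - t) * l = g s - g t by ring.
  rewrite Cmod_mult Cmod_R /A; lra.
have -> : f (g s) - f (g t) - RtoC (s - t) * (m * l) =
  (f (g s) - f (g t) - m * (g s - g t)) + m * (g s - g t - RtoC (s - t) * l) by ring.
apply: Rle_trans (Cmod_triangle _ _) _; rewrite (Cmod_mult m).
have b1 : (Cmod (f (g s) - f (g t) - m * (g s - g t)) <= eps / 2 * Rabs (s - t))%R.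
  apply: Rle_trans a1 _.
  apply: (Rle_trans _ (eps / (2 * A) * (A * Rabs (s - t)))%R).
  - by apply: Rmult_le_compat_l => //; lra.
  - by right; field; lra.
have b2 : (Cmod m * Cmod (g s - g t - RtoC (s - t) * l) <= eps / 2 * Rabs (s - t))%R.
  apply: (Rle_trans _ (B * (eps / (2 * B) * Rabs (s - t)))%R).
  - apply: Rmult_le_compat => //; try exact: Cmod_ge_0.
    by rewrite /B; lra.
  - by right; field; lra.
lra.
Qed.

Definition circle (c : C) (r t : R) : C := c + RtoC r * cis t.

Lemma rdiff_circle c r t : rdiff (circle c r) t (RtoC r * Ci * cis t).
Proof.
apply: rdiff_pair; rewrite /circle /cis /=; auto_derive => //; ring.
Qed.

Section Taylor.

Variables (f : C -> C) (c : C) (R0 r : R).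

Hypothesis (Hr : (0 < r < R0)%R) (Hf : forall w, (Cmod (w - c) < R0)%R -> cdiffable f w).

Lemma circle_in t : (Cmod (circle c r t - c) = r)%R.
Proof.
have -> : circle c r t - c = RtoC r * cis t by rewrite /circle; ring.
rewrite Cmod_mult Cmod_cis Cmod_R Rabs_pos_eq; lra.
Qed.

Lemma rcont_f_circle t : rcont (fun s => f (circle c r s)) t.
Proof.
apply: rcont_comp; first exact: rdiff_rcont (rdiff_circle c r t).
by apply: cdiffable_ccont; apply: Hf; rewrite circle_in; lra.
Qed.

Definition omega (t : R) : C := RtoC r * cis t.

Lemma omega_nz t : omega t <> 0.
Proof. by apply/Cmod_gt_0; rewrite /omega Cmod_mult Cmod_cis Cmod_R Rabs_pos_eq; lra. Qed.

Lemma Cmod_omega t : Cmod (omega t) = r.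
Proof. rewrite /omega Cmod_mult Cmod_cis Cmod_R Rabs_pos_eq; lra. Qed.

Lemma rcont_omega t : rcont omega t.
Proof.
apply: rcont_mult; first exact: rcont_const.
move=> eps He; have [d [d0 h]] := rdiff_rcont _ _ _ (rdiff_cis 1 t) eps He.
by exists d; split=> // s Hs; have := h s Hs; rewrite !Rmult_1_l.
Qed.

Lemma rcont_omega_inv t : rcont (fun s => / omega s) t.
Proof.
apply: (rcont_comp Cinv); first exact: rcont_omega.
by apply: cdiff_ccont (cdiff_inv _ (omega_nz t)).
Qed.

Lemma rcont_pow (g : R -> C) n t : rcont g t -> rcont (fun s => g s ^ n) t.
Proof.
move=> H; elim: n => [|n IH]; first exact: rcont_const.
exact: rcont_mult.
Qed.

(** Cauchy's kernel: on the circle w = c + omega, dw / (w - z) equals i times this times dt, with zt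
    = z - c. *)
Definition kern (zt : C) (t : R) : C := omega t / (omega t - zt).

Lemma omega_sub_ge zt t : (Cmod zt < r)%R -> (r - Cmod zt <= Cmod (omega t - zt))%R.
Proof. by move=> h; have := Cmod_minus_le (omega t) zt; rewrite Cmod_omega; lra. Qed.

Lemma omega_sub_nz zt t : (Cmod zt < r)%R -> omega t - zt <> 0.
Proof. by move=> h; apply/Cmod_gt_0; have := omega_sub_ge zt t h; lra. Qed.

Lemma rcont_kern zt t : (Cmod zt < r)%R -> rcont (kern zt) t.
Proof.
move=> h; apply: rcont_mult; first exact: rcont_omega.
apply: (rcont_comp Cinv).
- by apply: rcont_plus; [exact: rcont_omega | exact: rcont_const].
- by apply: cdiff_ccont (cdiff_inv _ (omega_sub_nz zt t h)).
Qed.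

Lemma kern_bound zt t : (Cmod zt < r)%R -> (Cmod (kern zt t) <= r / (r - Cmod zt))%R.
Proof.
move=> h; rewrite /kern Cmod_div; last exact: omega_sub_nz.
rewrite Cmod_omega; apply: Rmult_le_compat_l; first lra.
by apply: Rinv_le_contravar; [lra | exact: omega_sub_ge].
Qed.

Lemma twopi_ge0 : (0 <= 2 * PI)%R.
Proof. have := PI_RGT_0; lra. Qed.

(** Iterating kern = 1 + (zt / omega) kern gives a finite geometric expansion with an exact
    remainder, so no infinite sum is exchanged with an integral. *)
Lemma kern_expand (g : R -> C) zt n : (Cmod zt < r)%R -> (forall t, rcont g t) ->
  cint (fun t => g t * kern zt t) 0 (2 * PI) =
  sumC (fun j => zt ^ j * cint (fun t => g t * (/ omega t) ^ j) 0 (2 * PI)) (seq 0 n) +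
  zt ^ n * cint (fun t => g t * (/ omega t) ^ n * kern zt t) 0 (2 * PI).
Proof.
move=> Hz Hg.
have q m t : rcont (fun t => g t * (/ omega t) ^ m) t.
  by apply: rcont_mult => //; apply: rcont_pow; exact: rcont_omega_inv.
elim: n => [|n IH].
  rewrite /= Cplus_0_l Cmult_1_l; apply: cint_ext; first exact: twopi_ge0.
  move=> t _ /=; ring.
rewrite seq_S sumC_app IH [sumC _ (_ :: nil)]/= Cplus_0_r -Cplus_assoc; congr (_ + _).
have -> : cint (fun t => g t * (/ omega t) ^ n * kern zt t) 0 (2 * PI) =
   cint (fun t => g t * (/ omega t) ^ n + zt * (g t * (/ omega t) ^ S n * kern zt t)) 0 (2 * PI).
  apply: cint_ext; first exact: twopi_ge0.
  move=> t _; rewrite /kern /=; field; split; [exact: omega_sub_nz | exact: omega_nz].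
rewrite cint_plus; [|exact: twopi_ge0|by move=> t _; exact: q|].
  rewrite cint_mult_l; [rewrite /=; ring|exact: twopi_ge0|].
  by move=> t _; apply: rcont_mult; [exact: q|exact: rcont_kern].
move=> t _; apply: rcont_mult; first exact: rcont_const.
by apply: rcont_mult; [exact: q|exact: rcont_kern].
Qed.

Lemma kern_remainder (g : R -> C) zt n M : (Cmod zt < r)%R -> (forall t, rcont g t) ->
  (forall t, (0 <= t <= 2 * PI)%R -> (Cmod (g t) <= M)%R) ->
  (Cmod (zt ^ n * cint (fun t => (g t * (/ omega t) ^ n * kern zt t)%C) 0 (2 * PI)) <=
    2 * PI * M * (r / (r - Cmod zt)) * (Cmod zt / r) ^ n)%R.
Proof.
move=> Hz Hg HM.
have B := cint_bound (fun t => g t * (/ omega t) ^ n * kern zt t) 0 (2 * PI)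
   (M * (/ r) ^ n * (r / (r - Cmod zt)))%R twopi_ge0.
rewrite Cmod_mult Cmod_pow.
have M0 : (0 <= M)%R by have := HM 0%R (conj (Rle_refl 0) twopi_ge0); have := Cmod_ge_0 (g 0%R); lra.
have rn : (0 <= (/ r) ^ n)%R by apply: pow_le; left; apply: Rinv_0_lt_compat; lra.
apply: (Rle_trans _ (Cmod zt ^ n * ((2 * PI - 0) * (M * (/ r) ^ n * (r / (r - Cmod zt)))))%R).
  apply: Rmult_le_compat_l; first by apply: pow_le; exact: Cmod_ge_0.
  apply: B.
  - move=> t _; apply: rcont_mult; last exact: rcont_kern.
    by apply: rcont_mult => //; apply: rcont_pow; exact: rcont_omega_inv.
  - move=> t Ht; rewrite (Cmod_mult _ (kern zt t)) (Cmod_mult (g t)) Cmod_pow Cmod_inv ?Cmod_omega; last exact: omega_nz.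
    apply: Rmult_le_compat; [|exact: Cmod_ge_0| |exact: kern_bound].
    + by apply: Rmult_le_pos => //; exact: Cmod_ge_0.
    + by apply: Rmult_le_compat_r => //; exact: HM.
right; rewrite /Rdiv Rpow_mult_distr; ring.
Qed.

Lemma pow_small x B : (0 <= x < 1)%R -> forall eps, (0 < eps)%R -> exists n0, forall n, (n0 <= n)%nat ->
  (B * x ^ n < eps)%R.
Proof.
move=> Hx eps He.
have q : (0 < eps / (Rabs B + 1))%R.
  by apply: Rdiv_lt_0_compat => //; have := Rabs_pos B; lra.
have [|n0 Hn] := pow_lt_1_zero x _ _ q; first by rewrite Rabs_pos_eq; lra.
exists n0 => n Hle; have := Hn n Hle.
rewrite Rabs_pos_eq; last by apply: pow_le; lra.
have px : (0 <= x ^ n)%R by apply: pow_le; lra.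
move=> h; have : (x ^ n * (Rabs B + 1) < eps)%R.
  apply: (Rlt_le_trans _ (eps / (Rabs B + 1) * (Rabs B + 1))%R).
  - by apply: Rmult_lt_compat_r => //; have := Rabs_pos B; lra.
  - by right; field; have := Rabs_pos B; lra.
have := Rle_abs B; nra.
Qed.

(** In the expansion of the constant 1 only the term j = 0 survives, since negative powers of omega
    have periodic primitives; the remainder tends to zero. *)
Lemma kern_integral zt : (Cmod zt < r)%R -> cint (kern zt) 0 (2 * PI) = RtoC (2 * PI).
Proof.
move=> Hz.
have E n : cint (kern zt) 0 (2 * PI) = RtoC (2 * PI) +
   zt ^ S n * cint (fun t => 1 * (/ omega t) ^ S n * kern zt t) 0 (2 * PI).
  have := kern_expand (fun _ => 1) zt (S n) Hz (fun t => rcont_const 1 t).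
  have -> : cint (fun t => 1 * kern zt t) 0 (2 * PI) = cint (kern zt) 0 (2 * PI).
    by apply: cint_ext; [exact: twopi_ge0 | move=> t _; ring].
  move=> ->; congr (_ + _).
  rewrite [seq _ _]/= [sumC _ _]/= sumC_zero.
    rewrite Cplus_0_r Cmult_1_l.
    rewrite (cint_ftc (fun t => RtoC t)); first by ring.
    - exact: twopi_ge0.
    - move=> t _; apply: rdiff_pair; rewrite /=; auto_derive => //; ring.
    - move=> t _; apply: rcont_mult; exact: rcont_const.
  move=> j /in_seq [j1 _].
  have jn : INR j <> 0%R by apply: not_0_INR; lia.
  have ir : / RtoC r = RtoC (/ r) by rewrite RtoC_inv //; lra.
  have io t : (/ omega t) ^ j = RtoC (/ r) ^ j * cis (- INR j * t).
    have -> : (- INR j * t = INR j * - t)%R by ring.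
    rewrite cis_INR_mult cis_opp -Cpow_mult_l /omega -ir; congr (_ ^ _).
    field; split; [exact: cis_nz | by move=> h; have := RtoC_inj _ _ h; lra].
  rewrite (cint_ext _ (fun t => RtoC (/ r) ^ j * cis (- INR j * t))); [|exact: twopi_ge0|]; last first.
    by move=> t _; rewrite Cmult_1_l io.
  rewrite (cint_ftc (fun t => (RtoC (/ r) ^ j * (Ci * RtoC (/ INR j))) * cis (- INR j * t))); first 1 last.
  - exact: twopi_ge0.
  - move=> t _.
    have h := rdiff_cis (- INR j) t.
    have -> : RtoC (/ r) ^ j * cis (- INR j * t) =
       (RtoC (/ r) ^ j * (Ci * RtoC (/ INR j))) * (RtoC (- INR j) * Ci * cis (- INR j * t)).
      rewrite RtoC_opp (RtoC_inv (INR j)) //.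
      have n0 : RtoC (INR j) <> 0 by move=> h0; apply: jn; exact: RtoC_inj h0.
      transitivity (- (Ci * Ci) * RtoC (/ r) ^ j * cis (- INR j * t)); last by field.
      have -> : Ci * Ci = - (1) by rewrite /Ci /Cmult /Copp /RtoC /=; congr (_, _); ring.
      ring.
    have cd : cdiff (fun w => (RtoC (/ r) ^ j * (Ci * RtoC (/ INR j))) * w) (cis (- INR j * t)) (RtoC (/ r) ^ j * (Ci * RtoC (/ INR j))).
      have := cdiff_scal (RtoC (/ r) ^ j * (Ci * RtoC (/ INR j))) _ _ _ (cdiff_id (cis (- INR j * t))).
      by rewrite Cmult_1_r.
    exact: (rdiff_comp _ _ t _ _ h cd).
  - move=> t _; apply: rcont_mult; first exact: rcont_const.
    exact: rdiff_rcont (rdiff_cis _ _).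
  have -> : (- INR j * (2 * PI) = - (INR j * (2 * PI)))%R by ring.
  rewrite cis_opp cis_2PI Rmult_0_r cis_0; field.
apply: NNPP => ne.
have p : (0 < Cmod (cint (kern zt) 0 (2 * PI) - RtoC (2 * PI)))%R by apply/Cmod_gt_0; apply: Cminus_neq_0.
have x1 : (0 <= Cmod zt / r < 1)%R.
  split; first by apply: Rmult_le_pos; [exact: Cmod_ge_0 | left; apply: Rinv_0_lt_compat; lra].
  by apply: (Rmult_lt_reg_r r); [lra | rewrite /Rdiv Rmult_assoc Rinv_l; lra].
have [n0 Hn] := pow_small _ (2 * PI * 1 * (r / (r - Cmod zt)))%R x1 _ p.
have := Hn (S n0) (Nat.le_succ_diag_r _).
have := kern_remainder (fun _ => 1) zt (S n0) 1 Hz (fun t => rcont_const 1 t)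
   (fun _ _ => Req_le _ _ Cmod_1).
have := E n0.
set I := zt ^ S n0 * _ => ->.
have -> : RtoC (2 * PI) + I - RtoC (2 * PI) = I by ring.
lra.
Qed.

(** The difference quotient at z, completed by the derivative, is continuous at z and differentiable
    elsewhere. It therefore has a primitive on the disc and integrates to zero over the circle;
    [kern_integral] evaluates the remaining part. *)
Lemma cauchy_formula z : (Cmod (z - c) < r)%R ->
  cint (fun t => f (circle c r t) * kern (z - c) t) 0 (2 * PI) = RtoC (2 * PI) * f z.
Proof.
move=> Hz.
have [l Hl] : cdiffable f z by apply: Hf; lra.
pose k w := match classic_eq_dec w z with left _ => l | right _ => (f w - f z) / (w - z) end.
have HzR : (Cmod (z - c) < R0)%R by lra.
have kc : ccont k z.
  move=> eps He; have [|d [d0 h]] := Hl (eps / 2)%R; first lra.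
  exists d; split=> // y Hy; rewrite /k; case: (classic_eq_dec z z) => // _.
  case: (classic_eq_dec y z) => [_|n].
    by have -> : l - l = 0 by [ring]; rewrite Cmod_0.
  have n' : y - z <> 0 by apply: Cminus_neq_0.
  have -> : (f y - f z) / (y - z) - l = (f y - f z - l * (y - z)) / (y - z) by field.
  rewrite Cmod_div //.
  have p : (0 < Cmod (y - z))%R by apply/Cmod_gt_0.
  apply: (Rle_lt_trans _ (eps / 2)%R); last lra.
  apply: (Rmult_le_reg_r (Cmod (y - z))) => //.
  rewrite /Rdiv Rmult_assoc Rinv_l; last lra.
  by have := h y Hy; rewrite /Rdiv; lra.
have kd w : (Cmod (w - c) < R0)%R -> w <> z -> cdiffable k w.
  move=> Hw n.
  apply: (cdiffable_ext (fun y => (f y - f z) / (y - z))).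
    apply: cdiffable_div; [| |exact: Cminus_neq_0].
    - by apply: cdiffable_minus; [exact: Hf | exact: cdiffable_const].
    - by apply: cdiffable_minus; [exact: cdiffable_id | exact: cdiffable_const].
  exists (Cmod (w - z)); split; first by apply/Cmod_gt_0; apply: Cminus_neq_0.
  move=> y Hy; rewrite /k; case: (classic_eq_dec y z) => // E.
  by rewrite E Cmod_minus_sym in Hy; lra.
have prim := star_primitive c R0 z k HzR kd kc.
have kcont w : (Cmod (w - c) < R0)%R -> ccont k w.
  move=> Hw; case: (classic (w = z)) => [->//|n]; apply: cdiffable_ccont; exact: kd.
have inR t : (Cmod (circle c r t - c) < R0)%R by rewrite circle_in; lra.
have I0 : cint (fun t => k (circle c r t) * (RtoC r * Ci * cis t)) 0 (2 * PI) = 0.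
  rewrite (cint_ftc (fun t => seg k z (circle c r t))); first 1 last.
  - exact: twopi_ge0.
  - move=> t _; apply: (rdiff_comp (fun y => seg k z y) (circle c r)); first exact: rdiff_circle.
    exact: prim.
  - move=> t _; apply: rcont_mult.
      apply: rcont_comp; first exact: rdiff_rcont (rdiff_circle c r t).
      exact: kcont.
    have -> : (fun s => RtoC r * Ci * cis s) = (fun s => Ci * omega s).
      by apply: FunctionalExtensionality.functional_extensionality => s; rewrite /omega; ring.
    by apply: rcont_mult; [exact: rcont_const | exact: rcont_omega].
  have -> : circle c r (2 * PI) = circle c r 0.
    by rewrite /circle cis_0; have := cis_2PI 1; rewrite /= Rmult_1_l => ->.
  ring.
have I1 : Ci * cint (fun t => f (circle c r t) * kern (z - c) t + (- f z) * kern (z - c) t) 0 (2 * PI) = 0.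
  rewrite -I0 -cint_mult_l; [|exact: twopi_ge0|]; last first.
    move=> t _; apply: rcont_plus; apply: rcont_mult; try exact: rcont_kern.
    - exact: rcont_f_circle.
    - exact: rcont_const.
  apply: cint_ext; first exact: twopi_ge0.
  move=> t _; rewrite /k; case: (classic_eq_dec _ _) => [E|n].
    by have := circle_in t; rewrite E; lra.
  rewrite /kern.
  have -> : circle c r t = c + omega t by [].
  have n1 := omega_sub_nz (z - c) t Hz.
  have n2 : c + omega t - z <> 0 by move=> h; apply: n1; rewrite -h; ring.
  rewrite -/(omega t); have -> : RtoC r * Ci * cis t = Ci * omega t by rewrite /omega; ring.
  by field.
have I2 : cint (fun t => f (circle c r t) * kern (z - c) t + (- f z) * kern (z - c) t) 0 (2 * PI) = 0.
  rewrite -(Cmult_1_l (cint _ _ _)).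
  have -> : (1 : C) = - Ci * Ci by rewrite /Ci /Cmult /Copp /RtoC /=; congr (_, _); ring.
  rewrite -Cmult_assoc I1; ring.
move: I2; rewrite cint_plus; [|exact: twopi_ge0| |]; first 1 last.
- by move=> t _; apply: rcont_mult; [exact: rcont_f_circle | exact: rcont_kern].
- by move=> t _; apply: rcont_mult; [exact: rcont_const | exact: rcont_kern].
rewrite cint_mult_l; [|exact: twopi_ge0|by move=> t _; exact: rcont_kern].
rewrite kern_integral // => E.
set J := cint _ _ _ in E *.
transitivity (J + - f z * RtoC (2 * PI) + RtoC (2 * PI) * f z); first by ring.
by rewrite E; ring.
Qed.

Definition taylor_coeff (j : nat) : C := / RtoC (2 * PI) * cint (fun t => f (circle c r t) * (/ omega t) ^ j) 0 (2 * PI).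

Lemma twopi_nz : RtoC (2 * PI) <> 0.
Proof. by move=> h; have := RtoC_inj _ _ h; have := PI_RGT_0; lra. Qed.

Lemma taylor_coeff_bound M : (forall t, (0 <= t <= 2 * PI)%R -> (Cmod (f (circle c r t)) <= M)%R) ->
  forall j, (Cmod (taylor_coeff j) * r ^ j <= M)%R.
Proof.
move=> HM j; rewrite /taylor_coeff Cmod_mult Cmod_inv; last exact: twopi_nz.
rewrite Cmod_R Rabs_pos_eq; last exact: twopi_ge0.
have := cint_bound (fun t => f (circle c r t) * (/ omega t) ^ j) 0 (2 * PI) (M * (/ r) ^ j)%R twopi_ge0.
move=> /(_ ltac:(by move=> t _; apply: rcont_mult; [exact: rcont_f_circle | apply: rcont_pow; exact: rcont_omega_inv])).
move=> H.
have h : (Cmod (cint (fun t : R => (f (circle c r t) * (/ omega t) ^ j)%C) 0 (2 * PI)) <=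
     (2 * PI - 0) * (M * (/ r) ^ j))%R.
  apply: H => t Ht; rewrite Cmod_mult Cmod_pow Cmod_inv ?Cmod_omega; last exact: omega_nz.
  apply: Rmult_le_compat_r; first by apply: pow_le; left; apply: Rinv_0_lt_compat; lra.
  exact: HM.
have rj : (0 < r ^ j)%R by apply: pow_lt; lra.
have pp := PI_RGT_0.
have ip : (0 < / (2 * PI))%R by apply: Rinv_0_lt_compat; lra.
apply: (Rle_trans _ (/ (2 * PI) * ((2 * PI - 0) * (M * (/ r) ^ j)) * r ^ j)%R).
  apply: Rmult_le_compat_r; first lra.
  by apply: Rmult_le_compat_l; first lra.
right; rewrite pow_inv; field; lra.
Qed.

Lemma circle_bounded : exists M, forall t, (0 <= t <= 2 * PI)%R -> (Cmod (f (circle c r t)) <= M)%R.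
Proof.
have [tm [Ht _]] : exists tm, (forall t, (0 <= t <= 2 * PI)%R ->
    (Cmod (f (circle c r t)) <= Cmod (f (circle c r tm)))%R) /\ (0 <= tm <= 2 * PI)%R.
  apply: (continuity_ab_maj (fun t => Cmod (f (circle c r t)))); first exact: twopi_ge0.
  move=> t _ eps He; have [d [d0 h]] := rcont_f_circle t eps He; exists d; split=> //.
  move=> s [_ Hs]; rewrite /= /Rdist.
  apply: Rle_lt_trans (h s Hs); apply: Rabs_le.
  have := Cmod_minus_le (f (circle c r s)) (f (circle c r t)).
  have := Cmod_minus_le (f (circle c r t)) (f (circle c r s)).
  rewrite (Cmod_minus_sym (f (circle c r t))); lra.
by exists (Cmod (f (circle c r tm))).
Qed.

Lemma taylor_has_sum z : (Cmod (z - c) < r)%R -> has_sum (fun j => taylor_coeff j * (z - c) ^ j) (f z).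
Proof.
move=> Hz; have [M HM] := circle_bounded.
have M0 : (0 <= M)%R by have := HM 0%R (conj (Rle_refl 0) twopi_ge0); have := Cmod_ge_0 (f (circle c r 0)); lra.
have x1 : (0 <= Cmod (z - c) / r < 1)%R.
  split; first by apply: Rmult_le_pos; [exact: Cmod_ge_0 | left; apply: Rinv_0_lt_compat; lra].
  by apply: (Rmult_lt_reg_r r); [lra | rewrite /Rdiv Rmult_assoc Rinv_l; lra].
apply: has_sum_nat_limit.
  apply: (abs_summable_le _ (fun j => M * (Cmod (z - c) / r) ^ j)%R (M * / (1 - Cmod (z - c) / r))%R).
  - move=> j; rewrite Cmod_mult Cmod_pow /Rdiv Rpow_mult_distr.
    have rj : (0 < r ^ j)%R by apply: pow_lt; lra.
    have := taylor_coeff_bound M HM j => h.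
    have p0 : (0 <= Cmod (z - c) ^ j)%R by apply: pow_le; exact: Cmod_ge_0.
    have -> : (M * (Cmod (z - c) ^ j * (/ r) ^ j) = (M * / r ^ j) * Cmod (z - c) ^ j)%R.
      by rewrite pow_inv; ring.
    apply: Rmult_le_compat_r => //.
    apply: (Rmult_le_reg_r (r ^ j)) => //.
    by rewrite Rmult_assoc Rinv_l; lra.
  - by apply: bounded_sums_mult_l => //; exact: bounded_sums_geom.
move=> eps He.
have [n0 Hn] := pow_small _ (M * (r / (r - Cmod (z - c))))%R x1 _ He.
exists n0 => n /Hn hn; apply: Rle_lt_trans hn.
have E := cauchy_formula z Hz.
rewrite (kern_expand _ _ n Hz rcont_f_circle) in E.
have B := kern_remainder (fun t => f (circle c r t)) (z - c) n M Hz rcont_f_circle HM.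
set I := (z - c) ^ n * _ in E B.
have nz := twopi_nz.
have -> : sumC (fun j => taylor_coeff j * (z - c) ^ j) (seq 0 n) - f z = - / RtoC (2 * PI) * I.
  have -> : f z = / RtoC (2 * PI) * (RtoC (2 * PI) * f z) by field.
  rewrite -E.
  have -> : sumC (fun j => taylor_coeff j * (z - c) ^ j) (seq 0 n) = / RtoC (2 * PI) *
     sumC (fun j => (z - c) ^ j * cint (fun t => f (circle c r t) * (/ omega t) ^ j) 0 (2 * PI)) (seq 0 n).
    by rewrite -sumC_mult_l; apply: sumC_ext => j _; rewrite /taylor_coeff; ring.
  ring.
rewrite Cmod_mult Cmod_opp Cmod_inv // Cmod_R Rabs_pos_eq; last exact: twopi_ge0.
have pp := PI_RGT_0.
apply: (Rmult_le_reg_l (2 * PI)); first lra.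
rewrite -Rmult_assoc Rinv_r; lra.
Qed.

End Taylor.

(** The first estimate supplies some bound. The second one is Cauchy's estimate, kept separately
    because Liouville's theorem and the Lipschitz bound need the constant to come from the values on
    the circle. *)
Theorem taylor f c R0 r : (0 < r < R0)%R -> (forall w, (Cmod (w - c) < R0)%R -> cdiffable f w) ->
  exists a : nat -> C,
    (exists M, forall j, (Cmod (a j) * r ^ j <= M)%R) /\
    (forall M, (forall w, Cmod (w - c) = r -> (Cmod (f w) <= M)%R) -> forall j, (Cmod (a j) * r ^ j <= M)%R) /\
    (forall z, (Cmod (z - c) < r)%R -> has_sum (fun j => a j * (z - c) ^ j) (f z)).
Proof.
move=> Hr Hf; exists (taylor_coeff f c r); split; [|split].
- have [M HM] := circle_bounded f c R0 r Hr Hf.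
  by exists M; apply: (taylor_coeff_bound f c R0 r Hr Hf).
- move=> M HM; apply: (taylor_coeff_bound f c R0 r Hr Hf) => t _; apply: HM; exact: (circle_in c R0).
- by move=> z; apply: (taylor_has_sum f c R0).
Qed.

(** * Liouville's theorem and removable singularities *)

Lemma has_sum_tail (f : nat -> C) s k : has_sum f s -> has_sum (fun n => f (k + n)%nat) (s - sumC f (seq 0 k)).
Proof.
move=> H eps He; have [L0 H0] := H eps He.
exists (map (fun n => (n - k)%nat) L0) => L HL Hi.
have N : NoDup (seq 0 k ++ map (fun n => (k + n)%nat) L).
  apply: NoDup_app.
  - exact: seq_NoDup.
  - by apply: FinFun.Injective_map_NoDup => // x y; lia.
  - move=> x /in_seq Hx /in_map_iff [y [E _]]; lia.
have := H0 _ N; rewrite sumC_app sumC_map.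
have -> : forall A B, A + B - s = B - (s - A) by move=> A B; ring.
apply=> x Hx; apply/in_app_iff.
case: (le_lt_dec k x) => h.
- right; apply/in_map_iff; exists (x - k)%nat; split; first lia.
  by apply: Hi; apply/in_map_iff; exists x.
- by left; apply/in_seq; lia.
Qed.

Lemma power_series_tail a (zt s : C) r M k : (0 < r)%R -> (Cmod zt < r)%R ->
  (forall j, (Cmod (a j) * r ^ j <= M)%R) -> has_sum (fun j => a j * zt ^ j) s ->
  (Cmod (s - sumC (fun j => (a j * zt ^ j)%C) (seq 0 k)) <= M * (Cmod zt / r) ^ k * (r / (r - Cmod zt)))%R.
Proof.
move=> r0 Hz Ha Hs.
have M0 : (0 <= M)%R by have := Ha O; have := Cmod_ge_0 (a O); rewrite /=; lra.
have x1 : (0 <= Cmod zt / r < 1)%R.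
  split; first by apply: Rmult_le_pos; [exact: Cmod_ge_0 | left; apply: Rinv_0_lt_compat; lra].
  by apply: (Rmult_lt_reg_r r); [lra | rewrite /Rdiv Rmult_assoc Rinv_l; lra].
have -> : (r / (r - Cmod zt) = / (1 - Cmod zt / r))%R by field; lra.
have px k' : (0 <= (Cmod zt / r) ^ k')%R by apply: pow_le; lra.
apply: (has_sum_bound _ (fun n => (M * (Cmod zt / r) ^ k * (Cmod zt / r) ^ n)%R) _ _ _ _ (has_sum_tail _ _ k Hs)).
- move=> n; rewrite Rmult_assoc -pow_add Cmod_mult Cmod_pow /Rdiv Rpow_mult_distr pow_inv.
  have rj : (0 < r ^ (k + n))%R by apply: pow_lt; lra.
  have p0 : (0 <= Cmod zt ^ (k + n))%R by apply: pow_le; exact: Cmod_ge_0.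
  have -> : (M * (Cmod zt ^ (k + n) * / r ^ (k + n)) = M * / r ^ (k + n) * Cmod zt ^ (k + n))%R by ring.
  apply: Rmult_le_compat_r => //.
  apply: (Rmult_le_reg_r (r ^ (k + n))) => //.
  by rewrite Rmult_assoc Rinv_l; have := Ha (k + n)%nat; lra.
- apply: bounded_sums_mult_l; first by apply: Rmult_le_pos.
  exact: bounded_sums_geom.
Qed.

Lemma taylor_at_center (a : nat -> C) c s : has_sum (fun j => a j * (c - c) ^ j) s -> a O = s.
Proof.
move=> H; apply: has_sum_unique H.
have E : sumC (fun j => a j * (c - c) ^ j) (O :: nil) = a O by rewrite /=; ring.
rewrite -E; apply: has_sum_finite; first by repeat constructor; case.
move=> [|i] Hi; first by case: Hi; left.
have -> : c - c = 0 by ring.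
rewrite /=; ring.
Qed.

(** Cauchy's estimates bound the Taylor series without its constant term by M times the geometric
    series of |z - c| / r starting at degree one. *)
Lemma schwarz_lipschitz f c R0 r M z : (0 < r < R0)%R -> (forall w, (Cmod (w - c) < R0)%R -> cdiffable f w) ->
  (forall w, Cmod (w - c) = r -> (Cmod (f w) <= M)%R) -> (Cmod (z - c) < r)%R ->
  (Cmod (f z - f c) <= M * (Cmod (z - c) / (r - Cmod (z - c))))%R.
Proof.
move=> Hr Hf HM Hz; have [a [_ [Ha Hs]]] := taylor f c R0 r Hr Hf.
have Hzz := Hs z Hz.
have a0 : a O = f c.
  apply: (taylor_at_center a c); apply: Hs.
  have -> : c - c = 0 by ring.
  by rewrite Cmod_0; lra.
have := power_series_tail a (z - c) (f z) r M 1 (proj1 Hr) Hz (Ha M HM) Hzz.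
rewrite [sumC _ _]/= Cmult_1_r Cplus_0_r a0 => h; apply: Rle_trans h _.
by right; field; lra.
Qed.

Lemma liouville f M : (forall w, cdiffable f w) -> (forall w, (Cmod (f w) <= M)%R) -> forall z, f z = f 0.
Proof.
move=> Hf HM z; apply: NNPP => ne.
have p : (0 < Cmod (f z - f 0))%R by apply/Cmod_gt_0; apply: Cminus_neq_0.
have M0 : (0 <= M)%R by have := HM 0; have := Cmod_ge_0 (f 0); lra.
set e := Cmod (f z - f 0) in p.
pose A := Cmod (z - 0).
have A0 : (0 <= A)%R by exact: Cmod_ge_0.
(* With this radius r - A = 1 + M A / e, and the Lipschitz bound would give e + M A <= M A. *)
pose r := (A + 1 + M * A / e)%R.
have q : (0 <= M * A / e)%R by apply: Rmult_le_pos; [nra | left; apply: Rinv_0_lt_compat].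
have := schwarz_lipschitz f 0 (r + 1) r M z.
rewrite -/A -/e => /(_ ltac:(rewrite /r; lra) (fun w _ => Hf w) (fun w _ => HM w) ltac:(rewrite /r; lra)).
have -> : (r - A = 1 + M * A / e)%R by rewrite /r; ring.
move=> h.
have h2 : (e * (1 + M * A / e) <= M * (A / (1 + M * A / e)) * (1 + M * A / e))%R by apply: Rmult_le_compat_r; lra.
have E1 : (M * (A / (1 + M * A / e)) * (1 + M * A / e) = M * A)%R by field; split; nra.
have E2 : (e * (1 + M * A / e) = e + M * A)%R by field; lra.
lra.
Qed.

(** Since f vanishes near c, the quotient f / (w - c)^n is still holomorphic, and it is at most B /
    r^n on the circle. The Lipschitz bound then yields a constant times (|z - c| / r)^n for every
    n. *)
Lemma identity_disc f c R0 d : (0 < d)%R -> (forall w, (Cmod (w - c) < R0)%R -> cdiffable f w) ->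
  (forall w, (Cmod (w - c) < d)%R -> f w = 0) -> forall z, (Cmod (z - c) < R0)%R -> f z = 0.
Proof.
move=> d0 Hf H0 z Hz.
case: (classic (z = c)) => [->|nzc].
  by apply: H0; have -> : c - c = 0 by [ring]; rewrite Cmod_0.
have zp : (0 < Cmod (z - c))%R by apply/Cmod_gt_0; apply: Cminus_neq_0.
pose r := ((Cmod (z - c) + R0) / 2)%R.
have Hr : (0 < r < R0)%R by rewrite /r; lra.
have zr : (Cmod (z - c) < r)%R by rewrite /r; lra.
have [B HB] : exists B, forall w, Cmod (w - c) = r -> (Cmod (f w) <= B)%R.
  have [a [[M HM] [_ Hs]]] := taylor f c R0 ((r + R0) / 2) ltac:(lra) Hf.
  set r' := ((r + R0) / 2)%R in HM Hs.
  have hr' : (r < r')%R by rewrite /r'; lra.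
  exists (M * (r' / (r' - r)))%R => w Hw.
  have := power_series_tail a (w - c) (f w) r' M 0 ltac:(lra) ltac:(lra) HM (Hs w ltac:(lra)).
  rewrite Hw [sumC _ _]/=; have -> : f w - 0 = f w by ring.
  by rewrite pow_O Rmult_1_r.
have B0 : (0 <= B)%R.
  have := HB (c + RtoC r); have -> : c + RtoC r - c = RtoC r by ring.
  rewrite Cmod_R Rabs_pos_eq; last lra.
  move=> /(_ eq_refl); have := Cmod_ge_0 (f (c + RtoC r)); lra.
pose g n w := f w * / (w - c) ^ n.
have gd n w : (Cmod (w - c) < R0)%R -> cdiffable (g n) w.
  move=> Hw; case: (classic (w = c)) => [->|n0].
    apply: (cdiffable_ext (fun _ => 0)); first exact: cdiffable_const.
    by exists d; split=> // y Hy; rewrite /g H0 //; ring.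
  apply: cdiffable_mult; first exact: Hf.
  apply: cdiffable_inv; last by apply: Cpow_nz; apply: Cminus_neq_0.
  by apply: cdiffable_pow; apply: cdiffable_minus; [exact: cdiffable_id | exact: cdiffable_const].
have rn n : (0 < r ^ n)%R by apply: pow_lt; lra.
have gB n w : Cmod (w - c) = r -> (Cmod (g n w) <= B / r ^ n)%R.
  move=> Hw; rewrite /g Cmod_mult Cmod_inv ?Cmod_pow ?Hw.
    by apply: Rmult_le_compat_r; [left; apply: Rinv_0_lt_compat | exact: HB].
  apply: Cpow_nz => E; rewrite E Cmod_0 in Hw; lra.
have gz n : (Cmod (f z) <= B * (Cmod (z - c) / (r - Cmod (z - c))) * (Cmod (z - c) / r) ^ n)%R.
  have := schwarz_lipschitz (g n) c R0 r (B / r ^ n) z Hr (gd n) (gB n) zr.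
  have -> : g n c = 0.
    rewrite /g H0; first ring.
    by have -> : c - c = 0 by [ring]; rewrite Cmod_0.
  have -> : g n z - 0 = g n z by ring.
  rewrite /g Cmod_mult Cmod_inv ?Cmod_pow; last by apply: Cpow_nz; apply: Cminus_neq_0.
  have zn : (0 < Cmod (z - c) ^ n)%R by apply: pow_lt.
  move=> h; apply: (Rmult_le_reg_r (/ Cmod (z - c) ^ n)); first exact: Rinv_0_lt_compat.
  apply: Rle_trans h _; right.
  rewrite /Rdiv Rpow_mult_distr pow_inv; have := rn n; move=> ?; field; lra.
apply: Cmod_le_0; apply: le_epsilon => e He; rewrite Rplus_0_l.
have x1 : (0 <= Cmod (z - c) / r < 1)%R.
  split; first by apply: Rmult_le_pos; [exact: Cmod_ge_0 | left; apply: Rinv_0_lt_compat; lra].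
  by apply: (Rmult_lt_reg_r r); [lra | rewrite /Rdiv Rmult_assoc Rinv_l; lra].
have [n0 Hn] := pow_small _ (B * (Cmod (z - c) / (r - Cmod (z - c))))%R x1 _ He.
have := Hn n0 (Nat.le_refl _); have := gz n0; lra.
Qed.

(** The product (w - c)^2 g, set to 0 at c, is differentiable on the whole disc. Its Taylor series
    starts in degree two, and dividing the square out again provides the value at c. *)
Lemma removable_singularity g c R0 M : (0 < R0)%R ->
  (forall w, (Cmod (w - c) < R0)%R -> w <> c -> cdiffable g w /\ (Cmod (g w) <= M)%R) ->
  exists v, cdiffable (fun w => match classic_eq_dec w c with left _ => v | right _ => g w end) c.
Proof.
move=> R0p Hg.
have M0 : (0 <= M)%R.
  have P1 : (Cmod (c + RtoC (R0 / 2) - c) < R0)%R.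
    have -> : c + RtoC (R0 / 2) - c = RtoC (R0 / 2) by ring.
    rewrite Cmod_R Rabs_pos_eq; lra.
  have P2 : c + RtoC (R0 / 2) <> c.
    move=> E; have E2 : RtoC (R0 / 2) = 0.
      by transitivity (c + RtoC (R0 / 2) - c); [ring | rewrite E; ring].
    have := RtoC_inj _ _ E2; lra.
  have [_ h] := Hg _ P1 P2; have := Cmod_ge_0 (g (c + RtoC (R0 / 2))); lra.
pose G w := match classic_eq_dec w c with left _ => RtoC 0 | right _ => (w - c) * (w - c) * g w end.
have GB y : (Cmod (y - c) < R0)%R -> (Cmod (G y) <= M * (Cmod (y - c) * Cmod (y - c)))%R.
  move=> Hy; rewrite /G; case: (classic_eq_dec y c) => n.
    rewrite Cmod_0; have := Cmod_ge_0 (y - c); nra.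
  rewrite !Cmod_mult; have [_ h] := Hg y Hy n; have := Cmod_ge_0 (y - c); nra.
have Gd w : (Cmod (w - c) < R0)%R -> cdiffable G w.
  move=> Hw; case: (classic (w = c)) => [->|n].
    exists 0 => eps He; exists (Rmin R0 (eps / (M + 1))); split.
      by apply: Rmin_glb_lt => //; apply: Rdiv_lt_0_compat; lra.
    move=> y Hy.
    have -> : G c = 0 by rewrite /G; case: (classic_eq_dec c c).
    have -> : G y - 0 - 0 * (y - c) = G y by ring.
    apply: Rle_trans (GB y (Rlt_le_trans _ _ _ Hy (Rmin_l _ _))) _.
    have : (Cmod (y - c) * (M + 1) < eps)%R.
      apply: (Rlt_le_trans _ (eps / (M + 1) * (M + 1))%R).
      - by apply: Rmult_lt_compat_r; [lra | exact: Rlt_le_trans Hy (Rmin_r _ _)].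
      - by right; field; lra.
    have := Cmod_ge_0 (y - c); nra.
  apply: (cdiffable_ext (fun w => (w - c) * (w - c) * g w)).
    apply: cdiffable_mult; last by case: (Hg w Hw n).
    by apply: cdiffable_mult; apply: cdiffable_minus; (exact: cdiffable_id || exact: cdiffable_const).
  exists (Cmod (w - c)); split; first by apply/Cmod_gt_0; apply: Cminus_neq_0.
  move=> y Hy; rewrite /G; case: (classic_eq_dec y c) => // E.
  by rewrite E Cmod_minus_sym in Hy; lra.
pose r := (R0 / 2)%R.
have rE : r = (R0 / 2)%R by [].
have r0 : (0 < r)%R by rewrite /r; lra.
have [a [[K HK] [_ Hs]]] := taylor G c R0 r ltac:(rewrite /r; lra) Gd.
have K0 : (0 <= K)%R by have := HK O; have := Cmod_ge_0 (a O); rewrite /=; lra.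
have a0 : a O = 0.
  have -> : (0 : C) = G c by rewrite /G; case: (classic_eq_dec c c).
  apply: (taylor_at_center a c); apply: Hs.
  have -> : c - c = 0 by ring.
  by rewrite Cmod_0.
have tail k z : (Cmod (z - c) < r / 2)%R ->
    (Cmod (G z - sumC (fun j => (a j * (z - c) ^ j)%C) (seq 0 k)) <= 2 * K * (Cmod (z - c) / r) ^ k)%R.
  move=> Hz; have := power_series_tail a (z - c) (G z) r K k r0 ltac:(lra) HK (Hs z ltac:(lra)).
  move=> h; apply: Rle_trans h _.
  have p : (0 <= (Cmod (z - c) / r) ^ k)%R.
    by apply: pow_le; apply: Rmult_le_pos; [exact: Cmod_ge_0 | left; apply: Rinv_0_lt_compat].
  have : (r / (r - Cmod (z - c)) <= 2)%R.
    apply: (Rmult_le_reg_r (r - Cmod (z - c))); first lra.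
    rewrite /Rdiv Rmult_assoc Rinv_l; lra.
  have : (0 <= K * (Cmod (z - c) / r) ^ k)%R by apply: Rmult_le_pos.
  nra.
(* The product is bounded by M |w - c|^2, which leaves no room for a linear term. *)
have a1 : a 1%nat = 0.
  apply: Cmod_le_0; apply: le_epsilon => e He; rewrite Rplus_0_l.
  pose B := (M + 2 * K / (r * r))%R.
  have B0 : (0 <= B)%R.
    have : (0 <= 2 * K / (r * r))%R by apply: Rmult_le_pos; [lra | left; apply: Rinv_0_lt_compat; nra].
    rewrite /B; lra.
  pose t := Rmin (r / 4) (e / (B + 1)).
  have t0 : (0 < t)%R by apply: Rmin_glb_lt; [lra | apply: Rdiv_lt_0_compat; lra].
  have t1 : (t <= r / 4)%R by exact: Rmin_l.
  have t2 : (t * (B + 1) <= e)%R.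
    apply: (Rle_trans _ (e / (B + 1) * (B + 1))%R); last by right; field; lra.
    by apply: Rmult_le_compat_r; [lra | exact: Rmin_r].
  have Ez : c + RtoC t - c = RtoC t by ring.
  have mz : Cmod (c + RtoC t - c) = t by rewrite Ez Cmod_R Rabs_pos_eq; lra.
  have h1 := tail 2%nat (c + RtoC t) ltac:(lra).
  have h2 := GB (c + RtoC t) ltac:(lra).
  rewrite mz in h1 h2.
  rewrite Ez /= a0 in h1.
  have E : a 1%nat * RtoC t = G (c + RtoC t) - (G (c + RtoC t) - (0 * 1 + (a 1%nat * (RtoC t * 1) + 0))) by ring.
  have h3 : (Cmod (a 1%nat) * t <= M * (t * t) + 2 * K * (t / r * (t / r * 1)))%R.
    have <- : Cmod (a 1%nat * RtoC t) = (Cmod (a 1%nat) * t)%R by rewrite Cmod_mult Cmod_R Rabs_pos_eq; lra.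
    rewrite E; apply: Rle_trans (Cmod_triangle _ _) _; rewrite Cmod_opp; lra.
  have h4 : (M * (t * t) + 2 * K * (t / r * (t / r * 1)) = B * t * t)%R by rewrite /B; field; lra.
  rewrite h4 in h3; have h5 := Rmult_le_reg_r _ _ _ t0 h3.
  nra.
(* After division by (w - c)^2, coefficients 2 and 3 become the value and the derivative; the tail
   from degree four leaves an error quadratic in |y - c|. *)
exists (a 2%nat), (a 3%nat) => eps He.
pose K4 := (2 * K / (r * r * (r * r)))%R.
have rr : (0 < r * r * (r * r))%R by apply: Rmult_lt_0_compat; nra.
have K40 : (0 <= K4)%R by apply: Rmult_le_pos; [lra | left; apply: Rinv_0_lt_compat].
exists (Rmin (r / 2) (eps / (K4 + 1))); split.
  by apply: Rmin_glb_lt; [lra | apply: Rdiv_lt_0_compat; lra].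
move=> y Hy; case: (classic_eq_dec c c) => // _.
case: (classic_eq_dec y c) => [->|n].
  have -> : a 2%nat - a 2%nat - a 3%nat * (c - c) = 0 by ring.
  rewrite Cmod_0; have := Cmod_ge_0 (c - c); nra.
have n' : y - c <> 0 by apply: Cminus_neq_0.
have yp : (0 < Cmod (y - c))%R by apply/Cmod_gt_0.
have h := tail 4%nat y (Rlt_le_trans _ _ _ Hy (Rmin_l _ _)).
have E : g y - a 2%nat - a 3%nat * (y - c) =
    (G y - sumC (fun j => a j * (y - c) ^ j) (seq 0 4)) / ((y - c) * (y - c)).
  rewrite /= a0 a1 /G; case: (classic_eq_dec y c) => // _; by field.
rewrite E Cmod_div; last exact: Cmult_neq_0.
rewrite Cmod_mult.
apply: (Rmult_le_reg_r (Cmod (y - c) * Cmod (y - c))); first exact: Rmult_lt_0_compat.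
rewrite /Rdiv Rmult_assoc Rinv_l ?Rmult_1_r; last by apply: Rgt_not_eq; apply: Rmult_lt_0_compat.
apply: Rle_trans h _.
set m := Cmod (y - c) in yp Hy *.
have -> : (2 * K * (m / r) ^ 4 = K4 * m * (m * m * m))%R by rewrite /K4; field; lra.
have : (m * (K4 + 1) < eps)%R.
  apply: (Rlt_le_trans _ (eps / (K4 + 1) * (K4 + 1))%R).
  - by apply: Rmult_lt_compat_r; [lra | exact: Rlt_le_trans Hy (Rmin_r _ _)].
  - by right; field; lra.
move=> q; have : (0 <= m * m * m)%R by repeat apply: Rmult_le_pos; lra.
move=> m3; have : (K4 * m <= eps)%R by nra.
nra.
Qed.

(** * Holomorphic functions on complex normed spaces *)

Section NormedSpace.

Context {U : NormedModule C_AbsRing}.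

Implicit Types (x y z p : U) (f g : U -> C).

Definition dist y x : R := norm (minus y x).

Lemma dist_ge0 x y : (0 <= dist x y)%R.
Proof. exact: norm_ge_0. Qed.

Lemma dist_self x : dist x x = 0%R.
Proof. by rewrite /dist minus_eq_zero norm_zero. Qed.

Lemma dist_tri x y z : (dist x z <= dist x y + dist y z)%R.
Proof. by rewrite /dist (minus_trans y); apply: norm_triangle. Qed.

Lemma near_locally x (P : U -> Prop) :
  (exists d, (0 < d)%R /\ forall y, (dist y x < d)%R -> P y) -> locally x P.
Proof.
by move=> [d [d0 H]]; apply: (locally_le_locally_norm x); exists (mkposreal d d0) => y Hy; apply: H.
Qed.

Lemma locally_near x (P : U -> Prop) :
  locally x P -> exists d, (0 < d)%R /\ forall y, (dist y x < d)%R -> P y.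
Proof.
by move=> /(locally_norm_le_locally x) [d H]; exists d; split; [apply: cond_pos | move=> y Hy; apply: H].
Qed.

Definition Fdiff f x (l : U -> C) : Prop :=
  is_linear (V := C_NormedModule) l /\ forall eps, (0 < eps)%R -> exists d, (0 < d)%R /\
    forall y, (dist y x < d)%R -> (Cmod (f y - f x - l (minus y x)) <= eps * dist y x)%R.

Lemma Fdiff_filterdiff f x l : Fdiff f x l <-> filterdiff (V := C_NormedModule) f (locally x) l.
Proof.
split=> -[Hl H]; split=> //.
- move=> x' Hx' eps.
  have <- : x = x' by apply: is_filter_lim_locally_unique.
  have [d [d0 Hd]] := H eps (cond_pos eps).
  by apply: near_locally; exists d; split=> // y Hy; apply: Hd.
- move=> eps He.
  exact: (locally_near _ _ (H x (fun P HP => HP) (mkposreal eps He))).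
Qed.

Definition Fdiffable f x : Prop := exists l, Fdiff f x l.

Lemma Fdiffable_ex f x : Fdiffable f x <-> ex_filterdiff (V := C_NormedModule) f (locally x).
Proof. by split=> -[l H]; exists l; apply/Fdiff_filterdiff. Qed.

Definition holo f p : Prop := exists d, (0 < d)%R /\ forall y, (dist y p < d)%R -> Fdiffable f y.

Lemma holo_holomorphic_at f p : holo f p <-> holomorphic_at f p.
Proof.
split.
- by move=> [d [d0 H]]; apply: near_locally; exists d; split=> // y Hy; apply/Fdiffable_ex; apply: H.
- by move=> /locally_near [d [d0 H]]; exists d; split=> // y Hy; apply/Fdiffable_ex; apply: H.
Qed.

Lemma Fdiff_lip f x l : Fdiff f x l -> exists K d, (1 <= K)%R /\ (0 < d)%R /\
  forall y, (dist y x < d)%R -> (Cmod (f y - f x) <= K * dist y x)%R.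
Proof.
move=> [Hl H]; have [M [M0 HM]] := linear_norm l Hl.
have [|d [d0 h]] := H 1%R; first lra.
exists (M + 1)%R, d; split; first lra.
split=> // y Hy; have := h y Hy; have := HM (minus y x).
have := Cmod_triangle (f y - f x - l (minus y x)) (l (minus y x)).
have -> : f y - f x - l (minus y x) + l (minus y x) = f y - f x by ring.
rewrite -/(dist y x); have -> : norm (K := C_AbsRing) (V := C_NormedModule) (l (minus y x)) = Cmod (l (minus y x)) by [].
lra.
Qed.

Lemma Fdiffable_cont f x : Fdiffable f x -> forall eps, (0 < eps)%R -> exists d, (0 < d)%R /\
  forall y, (dist y x < d)%R -> (Cmod (f y - f x) < eps)%R.
Proof.
move=> [l Hl] eps He; have [K [d [K1 [d0 h]]]] := Fdiff_lip f x l Hl.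
exists (Rmin d (eps / K)); split; first by apply: Rmin_glb_lt => //; apply: Rdiv_lt_0_compat; lra.
move=> y Hy; apply: Rle_lt_trans (h y (Rlt_le_trans _ _ _ Hy (Rmin_l _ _))) _.
apply: (Rlt_le_trans _ (K * (eps / K))%R); last by right; field; lra.
by apply: Rmult_lt_compat_l; [lra | exact: Rlt_le_trans Hy (Rmin_r _ _)].
Qed.

Lemma Fdiff_ext f g x l : Fdiff f x l -> (exists d, (0 < d)%R /\ forall y, (dist y x < d)%R -> f y = g y) ->
  Fdiff g x l.
Proof.
move=> [Hl H] [d [d0 E]]; split=> // eps He; have [d1 [d1p Hd]] := H eps He.
exists (Rmin d d1); split; first exact: Rmin_glb_lt.
move=> y Hy; rewrite -!E; first by apply: Hd; apply: Rlt_le_trans Hy (Rmin_r _ _).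
- by rewrite dist_self.
- exact: Rlt_le_trans Hy (Rmin_l _ _).
Qed.

Lemma Fdiffable_ext f g x : Fdiffable f x ->
  (exists d, (0 < d)%R /\ forall y, (dist y x < d)%R -> f y = g y) -> Fdiffable g x.
Proof. by move=> [l Hl] H; exists l; apply: Fdiff_ext Hl H. Qed.

Lemma is_linear_C (l : U -> C) : (forall x y, l (plus x y) = l x + l y) ->
  (forall (k : C) x, l (scal k x) = k * l x) ->
  (exists M, forall x, (Cmod (l x) <= M * norm x)%R) -> is_linear (V := C_NormedModule) l.
Proof.
move=> H1 H2 [M HM]; split=> //; exists (Rabs M + 1)%R; split; first by have := Rabs_pos M; lra.
move=> x; apply: Rle_trans (HM x) _; have := Rle_abs M; have := norm_ge_0 x; nra.
Qed.

Lemma linear_C_plus (l : U -> C) : is_linear (V := C_NormedModule) l -> forall x y, l (plus x y) = l x + l y.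
Proof. by move=> H x y; apply: (linear_plus l H). Qed.

Lemma linear_C_scal (l : U -> C) : is_linear (V := C_NormedModule) l -> forall (k : C) x, l (scal k x) = k * l x.
Proof. by move=> H k x; apply: (linear_scal l H). Qed.

Lemma linear_C_bound (l : U -> C) : is_linear (V := C_NormedModule) l -> exists M, (0 < M)%R /\ forall x, (Cmod (l x) <= M * norm x)%R.
Proof. by move=> H; apply: (linear_norm l H). Qed.

Lemma linear_C_minus (l : U -> C) : is_linear (V := C_NormedModule) l -> forall x y, l (minus x y) = l x - l y.
Proof.
move=> H x y.
have : l x = l (minus x y) + l y by rewrite -linear_C_plus // /minus -plus_assoc plus_opp_l plus_zero_r.
by move=> ->; ring.
Qed.

Lemma Fdiff_const c x : Fdiff (fun _ => c) x (fun _ => 0).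
Proof.
split.
- apply: is_linear_C => [*|*|]; try ring; exists 0%R => y; rewrite Cmod_0; lra.
- move=> eps He; exists 1%R; split; first lra.
  move=> y _; have -> : c - c - 0 = 0 by ring.
  by rewrite Cmod_0; have := dist_ge0 y x; nra.
Qed.

Lemma Fdiff_linear (l : U -> C) x : is_linear (V := C_NormedModule) l -> Fdiff l x l.
Proof.
move=> H; split=> // eps He; exists 1%R; split; first lra.
move=> y _; rewrite linear_C_minus //; have -> : l y - l x - (l y - l x) = 0 by ring.
by rewrite Cmod_0; have := dist_ge0 y x; nra.
Qed.

Lemma Fdiff_plus f g x l m : Fdiff f x l -> Fdiff g x m -> Fdiff (fun y => f y + g y) x (fun d => l d + m d).
Proof.
move=> [Ll Hf] [Lm Hg]; split.
- apply: is_linear_C.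
  + by move=> y z; rewrite !linear_C_plus //; ring.
  + by move=> k y; rewrite !linear_C_scal //; ring.
  + have [M [_ HM]] := linear_C_bound l Ll; have [M' [_ HM']] := linear_C_bound m Lm.
    exists (M + M')%R => y; have := Cmod_triangle (l y) (m y); have := HM y; have := HM' y; lra.
move=> eps He.
have [|d1 [p1 h1]] := Hf (eps / 2)%R; first lra.
have [|d2 [p2 h2]] := Hg (eps / 2)%R; first lra.
exists (Rmin d1 d2); split; first exact: Rmin_glb_lt.
move=> y Hy.
have a1 := h1 y (Rlt_le_trans _ _ _ Hy (Rmin_l _ _)).
have a2 := h2 y (Rlt_le_trans _ _ _ Hy (Rmin_r _ _)).
have -> : f y + g y - (f x + g x) - (l (minus y x) + m (minus y x)) =
  (f y - f x - l (minus y x)) + (g y - g x - m (minus y x)) by ring.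
have := Cmod_triangle (f y - f x - l (minus y x)) (g y - g x - m (minus y x)); lra.
Qed.

Lemma Fdiff_comp f x l phi m : Fdiff f x l -> cdiff phi (f x) m -> Fdiff (fun y => phi (f y)) x (fun d => m * l d).
Proof.
move=> Hf Hg.
have [A [dL [A0 [dL0 HL]]]] := Fdiff_lip f x l Hf.
case: Hf => Ll Hf; split.
- apply: is_linear_C.
  + by move=> y z; rewrite !linear_C_plus //; ring.
  + by move=> k y; rewrite !linear_C_scal //; ring.
  + have [M [_ HM]] := linear_C_bound l Ll.
    exists (Cmod m * M)%R => y; rewrite Cmod_mult Rmult_assoc; apply: Rmult_le_compat_l => //; exact: Cmod_ge_0.
move=> eps He.
pose B := (Cmod m + 1)%R.
have B0 : (1 <= B)%R by rewrite /B; have := Cmod_ge_0 m; lra.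
have e1 : (0 < eps / (2 * A))%R by apply: Rdiv_lt_0_compat; lra.
have e2 : (0 < eps / (2 * B))%R by apply: Rdiv_lt_0_compat; lra.
have [d1 [p1 h1]] := Hg _ e1.
have [d2 [p2 h2]] := Hf _ e2.
have q : (0 < d1 / A)%R by apply: Rdiv_lt_0_compat; lra.
exists (Rmin dL (Rmin d2 (d1 / A))); split; first by repeat apply: Rmin_glb_lt.
move=> y Hy.
have y1 := Rlt_le_trans _ _ _ Hy (Rmin_l _ _).
have y2 := Rlt_le_trans _ _ _ Hy (Rmin_r _ _).
have y3 := Rlt_le_trans _ _ _ y2 (Rmin_l _ _).
have y4 := Rlt_le_trans _ _ _ y2 (Rmin_r _ _).
have a1 := HL y y1.
have a2 := h2 y y3.
have c0 := dist_ge0 y x.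
have a3 : (Cmod (f y - f x) < d1)%R.
  apply: (Rle_lt_trans _ _ _ a1); apply: (Rlt_le_trans _ (A * (d1 / A))%R).
  - by apply: Rmult_lt_compat_l; lra.
  - by right; field; lra.
have a4 := h1 _ a3.
have -> : phi (f y) - phi (f x) - m * l (minus y x) =
  (phi (f y) - phi (f x) - m * (f y - f x)) + m * (f y - f x - l (minus y x)) by ring.
apply: Rle_trans (Cmod_triangle _ _) _; rewrite (Cmod_mult m).
have b1 : (Cmod (phi (f y) - phi (f x) - m * (f y - f x)) <= eps / 2 * dist y x)%R.
  apply: Rle_trans a4 _.
  apply: (Rle_trans _ (eps / (2 * A) * (A * dist y x))%R).
  - by apply: Rmult_le_compat_l => //; lra.
  - by right; field; lra.
have b2 : (Cmod m * Cmod (f y - f x - l (minus y x)) <= eps / 2 * dist y x)%R.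
  apply: (Rle_trans _ (B * (eps / (2 * B) * dist y x))%R).
  - apply: Rmult_le_compat => //; try exact: Cmod_ge_0.
    by rewrite /B; lra.
  - by right; field; lra.
lra.
Qed.

Lemma Fdiffable_const c x : Fdiffable (fun _ => c) x.
Proof. by eexists; apply: Fdiff_const. Qed.

Lemma Fdiffable_linear (l : U -> C) x : is_linear (V := C_NormedModule) l -> Fdiffable l x.
Proof. by move=> H; exists l; apply: Fdiff_linear. Qed.

Lemma Fdiffable_plus f g x : Fdiffable f x -> Fdiffable g x -> Fdiffable (fun y => f y + g y) x.
Proof. by move=> [l Hl] [m Hm]; eexists; apply: Fdiff_plus Hl Hm. Qed.

Lemma Fdiffable_comp phi f x : Fdiffable f x -> cdiffable phi (f x) -> Fdiffable (fun y => phi (f y)) x.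
Proof. by move=> [l Hl] [m Hm]; eexists; apply: Fdiff_comp Hl Hm. Qed.

Lemma Fdiffable_scal c f x : Fdiffable f x -> Fdiffable (fun y => c * f y) x.
Proof.
by move=> H; apply: (Fdiffable_comp (fun w => c * w)) H _; eexists; apply: cdiff_scal; apply: cdiff_id.
Qed.

Lemma Fdiffable_mult f g x : Fdiffable f x -> Fdiffable g x -> Fdiffable (fun y => f y * g y) x.
Proof.
move=> Hf Hg.
have S h : Fdiffable h x -> Fdiffable (fun y => h y * h y) x.
  by move=> Hh; apply: (Fdiffable_comp (fun w => w * w)) Hh _; eexists; apply: cdiff_sqr.
have H := Fdiffable_scal (/ 2) _ _ (Fdiffable_plus _ _ _ (Fdiffable_plus _ _ _ (S _ (Fdiffable_plus _ _ _ Hf Hg))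
   (Fdiffable_scal (-(1)) _ _ (S _ Hf))) (Fdiffable_scal (-(1)) _ _ (S _ Hg))).
by apply: Fdiffable_ext H _; exists 1%R; split; [lra | move=> y _; field].
Qed.

Lemma Fdiffable_sub f g x : Fdiffable f x -> Fdiffable g x -> Fdiffable (fun y => f y - g y) x.
Proof.
move=> Hf Hg; apply: (Fdiffable_ext (fun y => f y + (-(1)) * g y)).
  by apply: Fdiffable_plus => //; exact: Fdiffable_scal.
by exists 1%R; split; [lra | move=> y _; ring].
Qed.

Lemma Fdiffable_inv f x : Fdiffable f x -> f x <> 0 -> Fdiffable (fun y => / f y) x.
Proof. by move=> H n; apply: (Fdiffable_comp Cinv) H _; eexists; exact: cdiff_inv. Qed.

(** Restriction to complex lines is the device that carries one-variable theorems over to a normed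
    space. *)
Definition line x (d : U) (t : C) : U := plus x (scal t d).

Lemma line_minus x d s t : minus (line x d s) (line x d t) = scal (s - t) d.
Proof.
rewrite /line /minus opp_plus (plus_comm x) -plus_assoc (plus_assoc x) plus_opp_r plus_zero_l.
rewrite -scal_opp_l -scal_distr_r; reflexivity.
Qed.

Lemma dist_line x d s t : (dist (line x d s) (line x d t) <= Cmod (s - t) * norm d)%R.
Proof. by rewrite /dist line_minus; apply: (norm_scal (s - t)). Qed.

Lemma line_0 x d : line x d 0 = x.
Proof. by rewrite /line (scal_zero_l d) plus_zero_r. Qed.

Lemma line_1 x y : line x (minus y x) 1 = y.
Proof. by rewrite /line (scal_one (minus y x)) /minus plus_comm -plus_assoc plus_opp_l plus_zero_r. Qed.

Lemma cdiffable_line f x d t : Fdiffable f (line x d t) -> cdiffable (fun s => f (line x d s)) t.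
Proof.
move=> [l [Ll H]]; exists (l d) => eps He.
have p : (0 < norm d + 1)%R by have := norm_ge_0 d; lra.
have [|e [e0 h]] := H (eps / (norm d + 1))%R; first exact: Rdiv_lt_0_compat.
exists (e / (norm d + 1))%R; split; first exact: Rdiv_lt_0_compat.
move=> s Hs.
have nd := norm_ge_0 d; have c0 := Cmod_ge_0 (s - t).
have q : (Cmod (s - t) * (norm d + 1) < e)%R.
  apply: (Rlt_le_trans _ (e / (norm d + 1) * (norm d + 1))%R).
  - by apply: Rmult_lt_compat_r.
  - by right; field; lra.
have dl := dist_line x d s t.
have := h (line x d s) ltac:(nra); rewrite line_minus linear_C_scal //.
rewrite (Cmult_comm (s - t)) => h2; apply: Rle_trans h2 _.
apply: (Rle_trans _ (eps / (norm d + 1) * (Cmod (s - t) * (norm d + 1)))%R); last by right; field; lra.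
apply: Rmult_le_compat_l; last by nra.
by left; exact: Rdiv_lt_0_compat.
Qed.

(** On the complex line from p through y the parameter 1 corresponds to y, and the ball contains a
    parameter disc of radius R0 / 2 / dist y p, which exceeds 2. The one-variable estimate on that
    disc gives the claim. *)
Lemma bounded_holo_lipschitz f p R0 M : (0 < R0)%R -> (0 <= M)%R ->
  (forall y, (dist y p < R0)%R -> Fdiffable f y /\ (Cmod (f y) <= M)%R) ->
  forall y, (dist y p < R0 / 4)%R -> (Cmod (f y - f p) <= (4 * M / R0) * dist y p)%R.
Proof.
move=> R0p M0 H y Hy.
case: (Req_dec (dist y p) 0) => D0.
  rewrite D0 Rmult_0_r.
  have [[l Hl] _] := H p ltac:(rewrite dist_self; lra).
  have [K [d [K1 [d0 h]]]] := Fdiff_lip f p l Hl.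
  by have := h y; rewrite D0 Rmult_0_r; apply.
have Dp : (0 < dist y p)%R by have := dist_ge0 y p; lra.
pose d := minus y p.
have nd : norm d = dist y p by [].
pose r := (R0 / 2 / dist y p)%R.
pose rr := (R0 / dist y p)%R.
have rE : (r * dist y p = R0 / 2)%R by rewrite /r; field; lra.
have rrE : (rr * dist y p = R0)%R by rewrite /rr; field; lra.
have r2 : (2 < r)%R by apply: (Rmult_lt_reg_r (dist y p)) => //; lra.
have rlt : (r < rr)%R by apply: (Rmult_lt_reg_r (dist y p)) => //; lra.
have inB t : (Cmod (t - 0) < rr)%R -> (dist (line p d t) p < R0)%R.
  move=> Ht; have := dist_line p d t 0; rewrite line_0 nd => h; apply: Rle_lt_trans h _.
  by rewrite -rrE; apply: Rmult_lt_compat_r.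
have := schwarz_lipschitz (fun t => f (line p d t)) 0 rr r M 1 ltac:(lra).
rewrite /d line_1 line_0.
have -> : 1 - 0 = (1 : C) by ring.
rewrite Cmod_1 => h.
have h2 : (Cmod (f y - f p) <= M * (1 / (r - 1)))%R.
  apply: h; last lra.
  - by move=> w Hw; apply: cdiffable_line; case: (H (line p d w) (inB w Hw)).
  - by move=> w Hw; apply: (proj2 (H (line p d w) (inB w _))); lra.
apply: Rle_trans h2 _.
have -> : (4 * M / R0 * dist y p = M * (2 / r))%R by rewrite /r; field; lra.
apply: Rmult_le_compat_l => //.
apply: (Rmult_le_reg_r (r * (r - 1))); first by apply: Rmult_lt_0_compat; lra.
have -> : (1 / (r - 1) * (r * (r - 1)) = r)%R by field; lra.
have -> : (2 / r * (r * (r - 1)) = 2 * (r - 1))%R by field; lra.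
lra.
Qed.

Lemma bounded_sums_exhaust {I} (K : I -> R) M : (forall i, (0 <= K i)%R) -> bounded_sums K M ->
  forall eps, (0 < eps)%R -> exists L0, NoDup L0 /\ forall L, NoDup (L0 ++ L) -> (sumR K L < eps)%R.
Proof.
move=> HK HM eps He; have [S [_ HS]] := bounded_sums_lub K M HK HM.
have [|L0 H0] := HS (eps / 2)%R; first lra.
have [L1 [N1 [i1 _]]] := nodup_over L0.
exists L1; split=> // L HL.
have /Rabs_def2 [a1 a2] := H0 _ HL (fun i hi => in_or_app _ _ _ (or_introl (i1 i hi))).
have /Rabs_def2 [b1 b2] := H0 L1 N1 i1.
rewrite sumR_app in a1 a2; lra.
Qed.

(** Every term is Lipschitz at p with a constant proportional to its majorant, and so is its
    derivative. Outside a finite index set these constants have a small sum, and on the finite set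
    the terms are differentiable individually. *)
Theorem Fdiff_series {I} (f : I -> U -> C) (l : I -> U -> C) (s : U -> C) p R0 (M : I -> R) B :
  (0 < R0)%R -> bounded_sums M B ->
  (forall (i : I) (y : U), (dist y p < R0)%R -> Fdiffable (f i) y /\ (Cmod (f i y) <= M i)%R) ->
  (forall y, (dist y p < R0)%R -> has_sum (fun i : I => f i y) (s y)) ->
  (forall i : I, Fdiff (f i) p (l i)) ->
  exists l', Fdiff s p l' /\ forall d, has_sum (fun i => l i d) (l' d).
Proof.
move=> R0p HB Hf Hs Hl.
have M0 i : (0 <= M i)%R.
  have [|_ h] := Hf i p; first by rewrite dist_self.
  by have := Cmod_ge_0 (f i p); lra.
pose K i := (4 * M i / R0)%R.
have K0 i : (0 <= K i)%R.
  by apply: Rmult_le_pos; [have := M0 i; lra | left; apply: Rinv_0_lt_compat].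
have KB : bounded_sums K (4 / R0 * B).
  apply: (bounded_sums_le _ (fun i => 4 / R0 * M i)%R).
  - by move=> i; right; rewrite /K; field; lra.
  - by apply: bounded_sums_mult_l => //; apply: Rmult_le_pos; [lra | left; apply: Rinv_0_lt_compat].
have lip i y : (dist y p < R0 / 4)%R -> (Cmod (f i y - f i p) <= K i * dist y p)%R.
  by move=> Hy; apply: (bounded_holo_lipschitz (f i) p R0 (M i)) => //; apply: Hf.
(* A derivative inherits the Lipschitz constant of its function: compare both at a small multiple t
   of d. *)
have lK i d : (Cmod (l i d) <= K i * norm d)%R.
  case: (Hl i) => Ll Hd.
  apply: le_epsilon => e He.
  have nd := norm_ge_0 d.
  have [|dl [dl0 h]] := Hd (e / (norm d + 1))%R; first by apply: Rdiv_lt_0_compat; lra.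
  pose t := (Rmin dl (R0 / 4) / (norm d + 1))%R.
  have mp : (0 < Rmin dl (R0 / 4))%R by apply: Rmin_glb_lt; lra.
  have t0 : (0 < t)%R by apply: Rdiv_lt_0_compat; lra.
  have tE : (t * (norm d + 1) = Rmin dl (R0 / 4))%R by rewrite /t; field; lra.
  have dy : (dist (line p d (RtoC t)) p <= t * norm d)%R.
    have := dist_line p d (RtoC t) 0; rewrite line_0.
    have -> : RtoC t - 0 = RtoC t by ring.
    by rewrite Cmod_R Rabs_pos_eq; lra.
  have dy1 : (dist (line p d (RtoC t)) p < dl)%R by have := Rmin_l dl (R0 / 4); nra.
  have dy2 : (dist (line p d (RtoC t)) p < R0 / 4)%R by have := Rmin_r dl (R0 / 4); nra.
  have h1 := h _ dy1; have h2 := lip i _ dy2.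
  have lE : l i (minus (line p d (RtoC t)) p) = RtoC t * l i d.
    have := line_minus p d (RtoC t) 0; rewrite line_0 => ->.
    by rewrite linear_C_scal //; ring.
  rewrite lE in h1.
  have h3 : (Cmod (RtoC t * l i d) <= (K i + e / (norm d + 1)) * (t * norm d))%R.
    have -> : RtoC t * l i d = (f i (line p d (RtoC t)) - f i p) + - (f i (line p d (RtoC t)) - f i p - RtoC t * l i d) by ring.
    apply: Rle_trans (Cmod_triangle _ _) _; rewrite Cmod_opp.
    have : (0 <= e / (norm d + 1))%R by left; apply: Rdiv_lt_0_compat; lra.
    move=> ep; have := K0 i => Kp.
    apply: (Rle_trans _ ((K i + e / (norm d + 1)) * dist (line p d (RtoC t)) p)%R); first lra.
    by apply: Rmult_le_compat_l; lra.
  rewrite Cmod_mult Cmod_R Rabs_pos_eq in h3; last lra.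
  have h4 : (Cmod (l i d) <= (K i + e / (norm d + 1)) * norm d)%R.
    apply: (Rmult_le_reg_l t) => //; lra.
  apply: Rle_trans h4 _.
  have : (e / (norm d + 1) * norm d <= e)%R.
    apply: (Rle_trans _ (e / (norm d + 1) * (norm d + 1))%R); last by right; field; lra.
    by apply: Rmult_le_compat_l; [left; apply: Rdiv_lt_0_compat; lra | lra].
  lra.
have [l' Hl'] : exists l', forall d, has_sum (fun i => l i d) (l' d).
  apply: (choice (fun d v => has_sum (fun i => l i d) v)) => d.
  apply: abs_summable_has_sum; apply: (abs_summable_le _ (fun i => norm d * K i)%R (norm d * (4 / R0 * B))%R).
  - by move=> i; rewrite Rmult_comm; exact: lK.
  - by apply: bounded_sums_mult_l => //; exact: norm_ge_0.
exists l'; split=> //; split.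
- apply: is_linear_C.
  + move=> x y; apply: has_sum_unique (Hl' _) _.
    apply: has_sum_ext (has_sum_plus _ _ _ _ (Hl' x) (Hl' y)) => i.
    by rewrite linear_C_plus //; case: (Hl i).
  + move=> k x; apply: has_sum_unique (Hl' _) _.
    apply: has_sum_ext (has_sum_mult_l k _ _ (Hl' x)) => i.
    by rewrite linear_C_scal //; case: (Hl i).
  + exists (4 / R0 * B)%R => x; rewrite Rmult_comm.
    apply: (has_sum_bound _ (fun i => norm x * K i)%R _ _ _ _ (Hl' x)).
    * by move=> i; rewrite Rmult_comm; exact: lK.
    * by apply: bounded_sums_mult_l => //; exact: norm_ge_0.
move=> eps He.
have [|L0 [N0 HL0]] := bounded_sums_exhaust K _ K0 KB (eps / 4)%R; first lra.
pose e' := (eps / 2 / (INR (length L0) + 1))%R.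
have lp : (0 < INR (length L0) + 1)%R by have := pos_INR (length L0); lra.
have e'p : (0 < e')%R by apply: Rdiv_lt_0_compat; lra.
have [d [d0 Hd]] : exists d, (0 < d)%R /\ forall i y, In i L0 -> (dist y p < d)%R ->
    (Cmod (f i y - f i p - l i (minus y p)) <= e' * dist y p)%R.
  clear N0 HL0 lp; move: e' e'p => e' e'p.
  elim: L0 => [|i L IH]; first by exists 1%R; split; [lra | move=> i y []].
  have [d [d0 Hd]] := IH; have [_ /(_ e' e'p) [d1 [d1p Hd1]]] := Hl i.
  exists (Rmin d d1); split; first exact: Rmin_glb_lt.
  move=> j y [<-|Hj] Hy.
  - by apply: Hd1; apply: Rlt_le_trans Hy (Rmin_r _ _).
  - by apply: Hd => //; apply: Rlt_le_trans Hy (Rmin_l _ _).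
exists (Rmin d (R0 / 4)); split; first by apply: Rmin_glb_lt; lra.
move=> y Hy.
have y1 := Rlt_le_trans _ _ _ Hy (Rmin_l _ _).
have y2 := Rlt_le_trans _ _ _ Hy (Rmin_r _ _).
have yR : (dist y p < R0)%R by lra.
have pR : (dist p p < R0)%R by rewrite dist_self.
have HS := has_sum_minus _ _ _ _ (has_sum_minus _ _ _ _ (Hs y yR) (Hs p pR)) (Hl' (minus y p)).
have D0 := dist_ge0 y p.
have E1 i : (Cmod (f i y - f i p - l i (minus y p)) <= 2 * K i * dist y p)%R.
  have := Cmod_triangle (f i y - f i p) (- l i (minus y p)); rewrite Cmod_opp.
  have := lip i y y2; have := lK i (minus y p); rewrite -/(dist y p) /Cminus; lra.
apply: Rnot_lt_le => Hc.
set v := s y - s p - l' (minus y p) in HS Hc.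
have [|L1 H1] := HS (Cmod v - eps * dist y p)%R; first lra.
have [L2 [N2 [i2 _]]] := nodup_over (L0 ++ L1).
have [L3 P] := incl_permutation L0 L2 N0 (fun i hi => i2 i (in_or_app _ _ _ (or_introl hi))).
have := H1 L2 N2 (fun i hi => i2 i (in_or_app _ _ _ (or_intror hi))).
have bs : (Cmod (sumC (fun i => (f i y - f i p - l i (minus y p))%C) L2) <= eps * dist y p)%R.
  rewrite (sumC_perm _ _ _ P) sumC_app.
  apply: Rle_trans (Cmod_triangle _ _) _.
  have N3 : NoDup (L0 ++ L3) by apply: Permutation_NoDup P N2.
  have t3 := HL0 L3 N3.
  have b3 : (Cmod (sumC (fun i => (f i y - f i p - l i (minus y p))%C) L3) <= 2 * dist y p * sumR K L3)%R.
    apply: Rle_trans (Cmod_sumC _ _) _; rewrite -sumR_mult_l; apply: sumR_le => i _.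
    have := E1 i; lra.
  have b0 : (Cmod (sumC (fun i => (f i y - f i p - l i (minus y p))%C) L0) <= INR (length L0) * (e' * dist y p))%R.
    apply: Rle_trans (Cmod_sumC _ _) _; rewrite -sumR_const; apply: sumR_le => i Hi.
    exact: Hd.
  have b4 : (INR (length L0) * e' <= eps / 2)%R.
    have -> : (eps / 2 = (INR (length L0) + 1) * e')%R by rewrite /e'; field; lra.
    nra.
  have : (INR (length L0) * (e' * dist y p) <= eps / 2 * dist y p)%R.
    by rewrite -Rmult_assoc; apply: Rmult_le_compat_r.
  nra.
have := Cmod_tri_minus v (sumC (fun i => f i y - f i p - l i (minus y p)) L2) 0.
have -> : v - 0 = v by ring.
set w := sumC _ L2 in bs *.
have -> : w - 0 = w by ring.
rewrite (Cmod_minus_sym v w); lra.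
Qed.

Corollary Fdiffable_series {I} (f : I -> U -> C) (s : U -> C) p R0 (M : I -> R) B :
  (0 < R0)%R -> bounded_sums M B ->
  (forall (i : I) (y : U), (dist y p < R0)%R -> Fdiffable (f i) y /\ (Cmod (f i y) <= M i)%R) ->
  (forall y, (dist y p < R0)%R -> has_sum (fun i => f i y) (s y)) ->
  Fdiffable s p.
Proof.
move=> H1 H2 H3 H4.
have [l Hl] : exists l : I -> U -> C, forall i, Fdiff (f i) p (l i).
  by apply: (choice (fun i l => Fdiff (f i) p l)) => i; case: (H3 i p) => //; rewrite dist_self.
have [l' [Hl' _]] := Fdiff_series f l s p R0 M B H1 H2 H3 H4 Hl.
by exists l'.
Qed.

(** Vanishing is propagated from x to y along the complex line through them, by overlapping
    parameter discs centred on the real segment from 0 to 1. *)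
Theorem identity_ball f p R0 x d : (0 < d)%R -> (dist x p < R0)%R ->
  (forall y, (dist y p < R0)%R -> Fdiffable f y) ->
  (forall y, (dist y x < d)%R -> f y = 0) -> forall y, (dist y p < R0)%R -> f y = 0.
Proof.
move=> d0 Hx Hf H0 y Hy.
pose e := minus y x. pose n := (norm e + 1)%R.
have n1 : (1 <= n)%R by rewrite /n; have := norm_ge_0 e; lra.
pose rho := Rmax (dist x p) (dist y p).
have rR : (rho < R0)%R by exact: Rmax_lub_lt.
pose dl := ((R0 - rho) / n)%R.
have dlp : (0 < dl)%R by apply: Rdiv_lt_0_compat; lra.
have dlE : (dl * n = R0 - rho)%R by rewrite /dl; field; lra.
(* Points of the complex line within [dl] of the real segment stay in the ball. *)
have inB s t : (0 <= s <= 1)%R -> (Cmod (t - RtoC s) < dl)%R -> (dist (line x e t) p < R0)%R.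
  move=> Hs Ht.
  have h1 := dist_line x e t (RtoC s).
  have h2 : (dist (line x e (RtoC s)) p <= rho)%R.
    have E : minus (line x e (RtoC s)) p = plus (scal (RtoC (1 - s)) (minus x p)) (scal (RtoC s) (minus y p)).
      have -> : minus y p = plus e (minus x p) by rewrite /e -minus_trans.
      set a := minus x p.
      have -> : minus (line x e (RtoC s)) p = plus a (scal (RtoC s) e).
        by rewrite /line /a /minus (plus_comm _ (opp p)) plus_assoc (plus_comm (opp p)).
      have -> : RtoC (1 - s) = minus one (RtoC s) by rewrite RtoC_minus.
      rewrite (scal_distr_l _ e a) /minus scal_distr_r scal_one scal_opp_l.
      have G (a' X Y : U) : plus a' Y = plus (plus a' (opp X)) (plus Y X).
        by rewrite (plus_comm Y) plus_assoc -(plus_assoc a') plus_opp_l plus_zero_r.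
      exact: G.
    rewrite /dist E; apply: Rle_trans (norm_triangle _ _) _.
    have N a' (v : U) : (0 <= a')%R -> (norm (scal (RtoC a') v) <= a' * norm v)%R.
      move=> Ha; apply: Rle_trans (norm_scal (RtoC a') v) _; right; congr (_ * _)%R.
      by apply: (eq_trans (Cmod_R a')); apply: Rabs_pos_eq.
    apply: Rle_trans (Rplus_le_compat _ _ _ _ (N (1 - s)%R (minus x p) ltac:(lra)) (N s (minus y p) ltac:(lra))) _.
    have := Rmax_l (dist x p) (dist y p); have := Rmax_r (dist x p) (dist y p); rewrite -/rho /dist; nra.
  have := dist_tri (line x e t) (line x e (RtoC s)) p.
  have := Cmod_ge_0 (t - RtoC s); have := norm_ge_0 e; rewrite /n in dlE; nra.
pose phi t := f (line x e t).
have pd s t : (0 <= s <= 1)%R -> (Cmod (t - RtoC s) < dl)%R -> cdiffable phi t.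
  by move=> Hs Ht; apply: cdiffable_line; apply: Hf; apply: inB Hs Ht.
(* Steps of at most half the radius make each new disc share a disc of radius dl / 2 with the
   previous one. *)
pose h := Rmin (dl / 2) 1.
have hp : (0 < h)%R by apply: Rmin_glb_lt; lra.
have hd : (h <= dl / 2)%R by exact: Rmin_l.
have step m : forall s, (0 <= s <= 1)%R -> (s <= INR m * h)%R ->
    forall t, (Cmod (t - RtoC s) < dl)%R -> phi t = 0.
  elim: m => [|m IH] s Hs Hm.
    have -> : s = 0%R by rewrite /= in Hm; lra.
    apply: (identity_disc phi 0 dl (d / n)).
    - by apply: Rdiv_lt_0_compat; lra.
    - by move=> w Hw; apply: (pd 0%R) => //; lra.
    - move=> w Hw; apply: H0; have := dist_line x e w 0; rewrite line_0 => q.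
      apply: Rle_lt_trans q _.
      have : (Cmod (w - 0) * n < d)%R.
        apply: (Rlt_le_trans _ (d / n * n)%R); last by right; field; lra.
        by apply: Rmult_lt_compat_r; lra.
      have := Cmod_ge_0 (w - 0); rewrite /n; nra.
  case: (Rle_lt_dec s (INR m * h)) => hs; first exact: IH.
  pose s' := (INR m * h)%R.
  have s'0 : (0 <= s')%R by apply: Rmult_le_pos; [exact: pos_INR | lra].
  have ss : (s - s' <= h)%R by rewrite S_INR in Hm; rewrite /s'; lra.
  have IH' := IH s' ltac:(rewrite -/s' in hs; lra) (Rle_refl _).
  apply: (identity_disc phi (RtoC s) dl (dl / 2)).
  - lra.
  - by move=> w Hw; apply: (pd s).
  - move=> w Hw; apply: IH'.
    have := Cmod_tri_minus w (RtoC s) (RtoC s').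
    rewrite -RtoC_minus Cmod_R Rabs_pos_eq; rewrite -/s' in hs; lra.
have [m Hm] := INR_archimed h 1 hp.
have := step m 1%R ltac:(lra) ltac:(lra) 1.
rewrite /phi line_1; apply.
have -> : 1 - RtoC 1 = 0 by ring.
by rewrite Cmod_0.
Qed.

End NormedSpace.

(** * The complex exponential *)

Lemma Cexp_cis z : Cexp z = RtoC (exp (Re z)) * cis (Im z).
Proof. by rewrite /Cexp /cis /Cmult /=; congr (_, _); ring. Qed.

Lemma Cexp_plus z w : Cexp (z + w) = Cexp z * Cexp w.
Proof.
rewrite !Cexp_cis.
have -> : Re (z + w) = (Re z + Re w)%R by [].
have -> : Im (z + w) = (Im z + Im w)%R by [].
rewrite exp_plus cis_plus RtoC_mult; ring.
Qed.

Lemma Cexp_0 : Cexp 0 = 1.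
Proof. by rewrite Cexp_cis /= exp_0 cis_0; ring. Qed.

Lemma Cmod_Cexp z : Cmod (Cexp z) = exp (Re z).
Proof.
rewrite Cexp_cis Cmod_mult Cmod_cis Cmod_R Rabs_pos_eq ?Rmult_1_r //; left; exact: exp_pos.
Qed.

Lemma Cexp_nz z : Cexp z <> 0.
Proof. by apply/Cmod_gt_0; rewrite Cmod_Cexp; exact: exp_pos. Qed.

Lemma Cexp_opp z : Cexp (- z) = / Cexp z.
Proof.
have n := Cexp_nz z.
have E : Cexp (- z) * Cexp z = 1 by rewrite -Cexp_plus -Cexp_0; congr Cexp; ring.
by transitivity (Cexp (- z) * Cexp z * / Cexp z); [field | rewrite E; field].
Qed.

Lemma Cexp_pow z n : Cexp z ^ n = Cexp (RtoC (INR n) * z).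
Proof.
elim: n => [|n IH]; first by rewrite /= Cmult_0_l Cexp_0.
rewrite S_INR RtoC_plus /= IH -Cexp_plus; congr Cexp; ring.
Qed.

Lemma Cpowz_Cexp z n : Cpowz (Cexp z) n = Cexp (RtoC (IZR n) * z).
Proof.
rewrite /Cpowz; case: Z.leb_spec => h.
- by rewrite Cexp_pow INR_IZR_INZ Z2Nat.id.
- rewrite Cexp_pow INR_IZR_INZ Z2Nat.id; last lia.
  rewrite -(Cmult_1_l (/ _)) -[1 * / _]/(1 / _) /Cdiv Cmult_1_l -Cexp_opp; congr Cexp.
  rewrite opp_IZR RtoC_opp; ring.
Qed.

Definition twopii : C := 2 * PI * Ci.

Lemma twopii_nz : twopii <> 0.
Proof.
rewrite /twopii; apply: Cmult_neq_0; last exact: Ci_nz.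
by rewrite -RtoC_mult; exact: twopi_nz.
Qed.

Lemma twopii_Re (z : C) : Re (twopii * z) = (- (2 * PI * Im z))%R.
Proof. rewrite /twopii /Re /Im /=; ring. Qed.

Lemma twopii_Im (z : C) : Im (twopii * z) = (2 * PI * Re z)%R.
Proof. rewrite /twopii /Re /Im /=; ring. Qed.

Lemma Cexp_twopii_Z (k : Z) : Cexp (twopii * RtoC (IZR k)) = 1.
Proof.
have P n : Cexp (twopii * RtoC (INR n)) = 1.
  rewrite Cexp_cis twopii_Re twopii_Im im_RtoC re_RtoC Rmult_0_r Ropp_0 exp_0.
  by rewrite (Rmult_comm (2 * PI)) cis_2PI; ring.
case: (Z_le_gt_dec 0 k) => h.
- by rewrite -(Z2Nat.id k) // -INR_IZR_INZ P.
- have -> : k = (- Z.of_nat (Z.to_nat (- k)))%Z by lia.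
  rewrite opp_IZR RtoC_opp -INR_IZR_INZ.
  have -> : twopii * - RtoC (INR (Z.to_nat (- k))) = - (twopii * RtoC (INR (Z.to_nat (- k)))) by ring.
  rewrite Cexp_opp P; field.
Qed.

Lemma Cexp_period z (k : Z) : Cexp (z + twopii * RtoC (IZR k)) = Cexp z.
Proof. by rewrite Cexp_plus Cexp_twopii_Z Cmult_1_r. Qed.

Lemma Cexp_eq_1 z : Cexp z = 1 -> exists k : Z, z = twopii * RtoC (IZR k).
Proof.
move=> H.
have Hm : exp (Re z) = 1%R by rewrite -Cmod_Cexp H Cmod_1.
have Hr : Re z = 0%R by apply: exp_inv; rewrite exp_0.
rewrite Cexp_cis Hr exp_0 Cmult_1_l in H.
have Hc : cos (Im z) = 1%R by have := f_equal fst H.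
have Hs : sin (Im z) = 0%R by have := f_equal snd H.
have [k Hk] := sin_eq_0_0 _ Hs.
(* [cos (k PI) = 1] forces [k] to be even, as [cos (PI + 2 j PI) = -1]. *)
have [j Hj] : exists j : Z, k = (2 * j)%Z.
  case: (Z.Even_or_Odd k) => [[j Hj]|[j Hj]]; exists j => //.
  exfalso; have : cis (Im z) = - (1).
    rewrite Hk Hj plus_IZR mult_IZR.
    have -> : ((2 * IZR j + 1) * PI = 2 * PI * IZR j + PI)%R by ring.
    rewrite cis_plus.
    have -> : cis (2 * PI * IZR j) = 1.
      have := Cexp_twopii_Z j; rewrite Cexp_cis twopii_Re twopii_Im im_RtoC re_RtoC Rmult_0_r Ropp_0 exp_0.
      by rewrite Cmult_1_l.
    by rewrite /cis cos_PI sin_PI Cmult_1_l /Copp /RtoC /=; congr (_, _); ring.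
  by move=> /(f_equal fst) /=; lra.
exists j; rewrite [z]surjective_pairing -/(Re z) -/(Im z) Hr Hk Hj.
rewrite mult_IZR /twopii /Cmult /RtoC /Ci /=; congr (_, _); ring.
Qed.

Lemma cdiff_Cexp_0 : cdiff Cexp 0 1.
Proof.
move=> eps He.
have H1 : rdiff (fun t => RtoC (exp t)) 0 1.
  by apply: rdiff_pair; rewrite /=; auto_derive => //; rewrite exp_0; ring.
have H2 := rdiff_cis 1 0.
(* The remainder will consist of six pieces, each at most e times the modulus of w. *)
pose e := Rmin 1 (eps / 8).
have e0 : (0 < e)%R by apply: Rmin_glb_lt; lra.
have e1 : (e <= 1)%R by exact: Rmin_l.
have e8 : (e <= eps / 8)%R by exact: Rmin_r.
have [d1 [p1 h1]] := H1 e e0.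
have [d2 [p2 h2]] := H2 e e0.
exists (Rmin (Rmin d1 d2) e); split; first by apply: Rmin_glb_lt => //; apply: Rmin_glb_lt.
move=> w Hw.
have Hw1 := Rlt_le_trans _ _ _ Hw (Rmin_l _ _).
have Hwe := Rlt_le_trans _ _ _ Hw (Rmin_r _ _).
have w0 : w - 0 = w by ring.
rewrite w0 in Hw Hw1 Hwe *.
set m := Cmod w in Hw Hw1 Hwe *.
have m0 : (0 <= m)%R by exact: Cmod_ge_0.
pose x := Re w. pose y := Im w.
have xm : (Rabs x <= m)%R by exact: fst_le_Cmod.
have ym : (Rabs y <= m)%R by exact: snd_le_Cmod.
have x0 := Rabs_pos x; have y0 := Rabs_pos y.
have ex0 : (x - 0 = x)%R by ring.
have ey0 : (y - 0 = y)%R by ring.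
have g1 := h1 x ltac:(rewrite ex0; have := Rmin_l d1 d2; lra).
have g2 := h2 y ltac:(rewrite ey0; have := Rmin_r d1 d2; lra).
rewrite ex0 exp_0 in g1.
rewrite ey0 Rmult_0_r cis_0 Rmult_1_l in g2.
set r1 := RtoC (exp x) - 1 - RtoC x * 1 in g1.
set r2 := cis y - 1 - RtoC y * (RtoC 1 * Ci * 1) in g2.
have E : Cexp w - Cexp 0 - 1 * w = (r1 + r2) + (RtoC x * (RtoC y * Ci) + (RtoC x * r2 + (r1 * (RtoC y * Ci) + r1 * r2))).
  rewrite Cexp_0 Cexp_cis -/x -/y /r1 /r2.
  have -> : w = RtoC x + RtoC y * Ci.
    by rewrite /x /y; case: (w) => a b; rewrite /RtoC /Ci /Cplus /Cmult /=; congr (_, _); ring.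
  ring.
rewrite E.
have b1 : (Cmod r1 <= e * m)%R by apply: Rle_trans g1 _; apply: Rmult_le_compat_l; lra.
have b2 : (Cmod r2 <= e * m)%R by apply: Rle_trans g2 _; apply: Rmult_le_compat_l; lra.
have c1 := Cmod_ge_0 r1; have c2 := Cmod_ge_0 r2.
have t1 := Cmod_triangle (r1 + r2) (RtoC x * (RtoC y * Ci) + (RtoC x * r2 + (r1 * (RtoC y * Ci) + r1 * r2))).
have t2 := Cmod_triangle r1 r2.
have t3 := Cmod_triangle (RtoC x * (RtoC y * Ci)) (RtoC x * r2 + (r1 * (RtoC y * Ci) + r1 * r2)).
have t4 := Cmod_triangle (RtoC x * r2) (r1 * (RtoC y * Ci) + r1 * r2).
have t5 := Cmod_triangle (r1 * (RtoC y * Ci)) (r1 * r2).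
rewrite !Cmod_mult !Cmod_R !Cmod_Ci !Rmult_1_r in t1 t3 t4 t5.
have em : (0 <= e * m)%R by nra.
have em1 : (e * m <= m)%R by nra.
have q1 : (Rabs x * Rabs y <= e * m)%R by nra.
have q2 : (Rabs x * Cmod r2 <= e * m)%R by nra.
have q3 : (Cmod r1 * Rabs y <= e * m)%R by nra.
have q4 : (Cmod r1 * Cmod r2 <= e * m)%R by nra.
have : (6 * (e * m) <= eps * m)%R by nra.
lra.
Qed.

Lemma cdiff_Cexp z : cdiff Cexp z (Cexp z).
Proof.
have H : cdiff (fun w => Cexp z * Cexp (w - z)) z (Cexp z * (1 * 1)).
  apply: cdiff_scal; apply: (cdiff_comp (fun w => w - z)).
  - apply: (cdiff_unique_ext (fun w => - z + 1 * w)); first exact: cdiff_affine.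
    by exists 1%R; split; [lra | move=> y _; ring].
  - have -> : z - z = 0 by ring.
    exact: cdiff_Cexp_0.
rewrite !Cmult_1_r in H; apply: cdiff_unique_ext H _.
exists 1%R; split; first lra.
by move=> y _; rewrite -Cexp_plus; congr Cexp; ring.
Qed.

Lemma cdiffable_Cexp f z : cdiffable f z -> cdiffable (fun w => Cexp (f w)) z.
Proof. by move=> [l Hl]; eexists; apply: (cdiff_comp f Cexp) Hl _; exact: cdiff_Cexp. Qed.

Lemma Fdiffable_Cexp {U : NormedModule C_AbsRing} (f : U -> C) x :
  Fdiffable f x -> Fdiffable (fun y => Cexp (f y)) x.
Proof. by move=> H; apply: Fdiffable_comp => //; eexists; exact: cdiff_Cexp. Qed.

(** * One complex variable as a normed space, and the exponential series *)

Lemma dist_C (x y : C) : dist (U := C_NormedModule) x y = Cmod (x - y).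
Proof. by []. Qed.

Lemma Fdiff_C f (z l : C) : cdiff f z l <-> Fdiff (U := C_NormedModule) f z (fun d => d * l).
Proof.
split.
- move=> H; split.
  + apply: is_linear_C => [x y|k x|]; first by rewrite -[plus x y]/(x + y); ring.
      by rewrite -[scal k x]/(k * x); ring.
    by exists (Cmod l) => x; rewrite Cmod_mult Rmult_comm; right.
  + move=> eps He; have [d [d0 h]] := H eps He; exists d; split=> // y Hy.
    have := h y Hy; rewrite -[minus y z]/(y - z) dist_C; by rewrite (Cmult_comm l).
- move=> [_ H] eps He; have [d [d0 h]] := H eps He; exists d; split=> // y Hy.
  have := h y Hy; rewrite -[minus y z]/(y - z) dist_C; by rewrite (Cmult_comm l).
Qed.

Lemma Fdiffable_C f z : cdiffable f z <-> Fdiffable (U := C_NormedModule) f z.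
Proof.
split=> [[l Hl]|[l Hl]]; first by exists (fun d => d * l); apply/Fdiff_C.
exists (l (RtoC 1)); apply/Fdiff_C.
case: (Hl) => Ll H; split; last first.
  move=> eps He; have [d [d0 h]] := H eps He; exists d; split=> // y Hy.
  have := h y Hy.
  have -> : l (minus y z) = (minus y z) * l (RtoC 1).
    rewrite -(linear_C_scal (U := C_NormedModule) l Ll); congr l.
    by rewrite -[scal _ _]/(Cmult (minus y z) 1) Cmult_1_r.
  by [].
apply: is_linear_C => [x y|k x|]; first by rewrite -[plus x y]/(x + y); ring.
  by rewrite -[scal k x]/(k * x); ring.
by exists (Cmod (l (RtoC 1))) => x; rewrite Cmod_mult Rmult_comm; right.
Qed.

Theorem cdiff_series {I} (f : I -> C -> C) (f' : I -> C) (s : C -> C) p R0 (M : I -> R) B :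
  (0 < R0)%R -> bounded_sums M B ->
  (forall i y, (Cmod (y - p) < R0)%R -> cdiffable (f i) y /\ (Cmod (f i y) <= M i)%R) ->
  (forall y, (Cmod (y - p) < R0)%R -> has_sum (fun i => f i y) (s y)) ->
  (forall i, cdiff (f i) p (f' i)) ->
  exists s', cdiff s p s' /\ has_sum f' s'.
Proof.
move=> H1 H2 H3 H4 H5.
have [l' [Hl' Hs]] := Fdiff_series (U := C_NormedModule) f (fun i d => d * f' i) s p R0 M B H1 H2
  (fun i y Hy => conj (proj1 (Fdiffable_C _ _) (proj1 (H3 i y Hy))) (proj2 (H3 i y Hy))) H4
  (fun i => proj1 (Fdiff_C _ _ _) (H5 i)).
have h1 := Hs (RtoC 1).
have E : has_sum f' (l' (RtoC 1)) by apply: has_sum_ext h1 => i; ring.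
exists (l' (RtoC 1)); split=> //; apply/Fdiff_C.
case: Hl' => Ll H; split.
  apply: is_linear_C => [x y|k x|]; first by rewrite -[plus x y]/(x + y); ring.
    by rewrite -[scal k x]/(k * x); ring.
  by exists (Cmod (l' (RtoC 1))) => x; rewrite Cmod_mult Rmult_comm; right.
move=> eps He; have [d [d0 h]] := H eps He; exists d; split=> // y Hy.
have := h y Hy.
have -> : l' (minus y p) = (minus y p) * l' (RtoC 1).
  rewrite -(linear_C_scal (U := C_NormedModule) l' Ll); congr l'.
  by rewrite -[scal _ _]/(Cmult (minus y p) 1) Cmult_1_r.
by [].
Qed.

Lemma cdiff_pow n z : cdiff (fun w => w ^ S n) z (RtoC (INR (S n)) * z ^ n).
Proof.
elim: n => [|n IH].
  rewrite /= Cmult_1_l; apply: (cdiff_unique_ext (fun w => w)); first exact: cdiff_id.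
  by exists 1%R; split; [lra | move=> y _; ring].
have := cdiff_mult (fun w => w) (fun w => w ^ S n) z _ _ (cdiff_id z) IH.
have -> : 1 * z ^ S n + z * (RtoC (INR (S n)) * z ^ n) = RtoC (INR (S (S n))) * z ^ S n.
  rewrite (S_INR (S n)) RtoC_plus /=; ring.
by [].
Qed.

Lemma INR_fact_nz n : RtoC (INR (fact n)) <> 0.
Proof. by move=> h; have := RtoC_inj _ _ h; exact: INR_fact_neq_0. Qed.

Lemma exp_terms_bounded x : (0 <= x)%R -> exists B, bounded_sums (fun n => (x ^ n / INR (fact n))%R) B.
Proof.
move=> Hx; exists (exp x); apply: bounded_sums_nat => n.
  apply: Rmult_le_pos; first exact: pow_le.
  by left; apply: Rinv_0_lt_compat; exact: INR_fact_lt_0.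
have Hs : is_series (fun n => (x ^ n / INR (fact n))%R) (exp x).
  apply: is_series_ext (is_exp_Reals x) => k.
  rewrite /scal /= /mult /= pow_n_pow /Rdiv; ring.
apply: (is_lim_seq_incr_compare (sum_n (fun n => (x ^ n / INR (fact n))%R))); first exact: Hs.
move=> k; rewrite sum_Sn /plus /=.
have : (0 <= x ^ S k / INR (fact (S k)))%R.
  apply: Rmult_le_pos; first exact: pow_le.
  by left; apply: Rinv_0_lt_compat; exact: INR_fact_lt_0.
rewrite /=; lra.
Qed.

(** The sum E of the power series satisfies E' = E and E 0 = 1 by termwise differentiation, so E(w)
    exp(-w) has derivative zero and equals 1. *)
Lemma has_sum_Cexp z : has_sum (fun n => z ^ n / RtoC (INR (fact n))) (Cexp z).
Proof.
have bnd (R0 : R) w n : (Cmod w <= R0)%R -> (Cmod (w ^ n / RtoC (INR (fact n))) <= R0 ^ n / INR (fact n))%R.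
  move=> Hw; rewrite Cmod_div; last exact: INR_fact_nz.
  rewrite Cmod_pow Cmod_R Rabs_pos_eq; last exact: pos_INR.
  apply: Rmult_le_compat_r; first by left; apply: Rinv_0_lt_compat; exact: INR_fact_lt_0.
  by apply: pow_incr; split=> //; exact: Cmod_ge_0.
have [E HE] : exists E : C -> C, forall w, has_sum (fun n => w ^ n / RtoC (INR (fact n))) (E w).
  apply: (choice (fun w v => has_sum (fun n => w ^ n / RtoC (INR (fact n))) v)) => w.
  have [B HB] := exp_terms_bounded (Cmod w) (Cmod_ge_0 w).
  apply: abs_summable_has_sum; apply: abs_summable_le HB => n.
  by apply: bnd; lra.
have dE p : cdiff E p (E p).
  pose R0 := (Cmod p + 1)%R.
  have R0p : (0 <= R0)%R by rewrite /R0; have := Cmod_ge_0 p; lra.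
  have [B HB] := exp_terms_bounded R0 R0p.
  pose f' n := match n with O => RtoC 0 | S m => p ^ m / RtoC (INR (fact m)) end.
  have [s' [h1 h2]] : exists s', cdiff E p s' /\ has_sum f' s'.
    apply: (cdiff_series (fun n w => w ^ n / RtoC (INR (fact n))) f' E p 1 _ B _ HB); first lra.
    - move=> n y Hy; split.
        apply: cdiffable_div; [|exact: cdiffable_const|exact: INR_fact_nz].
        by apply: cdiffable_pow; exact: cdiffable_id.
      by apply: bnd; have := Cmod_minus_le y p; rewrite /R0; lra.
    - by move=> y _; exact: HE.
    - move=> [|n] /=.
        apply: (cdiff_unique_ext (fun _ => 1 / RtoC (INR (fact 0)))); first exact: cdiff_const.
        by exists 1%R; split; [lra | ].
      have H := cdiff_scal (/ RtoC (INR (fact (S n)))) _ _ _ (cdiff_pow n p).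
      have Ed : / RtoC (INR (fact (S n))) * (RtoC (INR (S n)) * p ^ n) = p ^ n / RtoC (INR (fact n)).
        have n1 := INR_fact_nz n.
        have n2 : RtoC (INR (S n)) <> 0.
          by move=> h; have := RtoC_inj _ _ h; apply: not_0_INR.
        rewrite fact_simpl mult_INR RtoC_mult; by field.
      rewrite Ed in H; apply: cdiff_unique_ext H _.
      by exists 1%R; split; [lra | move=> y _; rewrite /Cdiv Cmult_comm].
  have h3 := has_sum_tail f' s' 1 h2.
  have -> : E p = s'; last exact: h1.
  have := has_sum_unique _ _ _ (HE p) h3.
  by move=> ->; rewrite /=; ring.
suff -> : Cexp z = E z by exact: HE.
have E0 : E 0 = 1.
  apply: has_sum_unique (HE 0) _.
  have -> : (1 : C) = sumC (fun n => 0 ^ n / RtoC (INR (fact n))) (O :: nil).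
    by rewrite /= /fact /=; field.
  apply: has_sum_finite; first by repeat constructor; case.
  move=> [|n] h; first by case: h; left.
  rewrite /= /Cdiv; ring.
have P w : cdiff (fun w => E w * Cexp (- w)) w 0.
  have h1 : cdiff (fun w => Cexp (- w)) w (Cexp (- w) * (- (1))).
    apply: (cdiff_comp (fun w => - w) Cexp); last exact: cdiff_Cexp.
    apply: (cdiff_unique_ext (fun w => 0 + (-(1)) * w)); first exact: cdiff_affine.
    by exists 1%R; split; [lra | move=> y _; ring].
  have := cdiff_mult _ _ _ _ _ (dE w) h1.
  by have -> : E w * Cexp (- w) + E w * (Cexp (- w) * - (1)) = 0 by ring.
have := seg_ftc (fun w => E w * Cexp (- w)) (fun _ => 0) 0 z (fun t _ => P _).
have -> : seg (fun _ => 0) 0 z = 0.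
  rewrite (seg_ftc (fun _ => 0)); [ring|by move=> t _; exact: cdiff_const|].
  by move=> t _; apply: cdiff_ccont (cdiff_const _ _).
move=> /(_ ltac:(by move=> t _; apply: cdiff_ccont (cdiff_const _ _))).
have -> : - RtoC 0 = 0 by ring.
rewrite E0 Cexp_0 Cexp_opp => H.
have n := Cexp_nz z.
have H2 : E z * / Cexp z = 1.
  transitivity (E z * / Cexp z - 1 * 1 + 1); first ring.
  by rewrite -H; ring.
transitivity (E z * / Cexp z * Cexp z); first by rewrite H2; ring.
by field.
Qed.

(** * Characters and Gauss sums *)

(** The factor r is the part of k prime to n, obtained by dividing k repeatedly by its gcd with n.
    The last clause says, without mentioning primes, that k has no prime factors beyond those of n
    and r. *)
Lemma exists_coprime_part (n : Z) (k : nat) : (1 <= k)%nat ->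
  exists r : Z, rel_prime r n /\ forall d, rel_prime d n -> rel_prime d r -> rel_prime d (Z.of_nat k).
Proof.
elim: k {-2}k (Nat.le_refl k) => [|b IH] k Hb Hk; first lia.
have g0 := Z.gcd_nonneg (Z.of_nat k) n.
have [q Hq] := Z.gcd_divide_l (Z.of_nat k) n.
have gn := Z.gcd_divide_r (Z.of_nat k) n.
case: (Z.eq_dec (Z.gcd (Z.of_nat k) n) 1) => E.
  by exists (Z.of_nat k); split=> //; apply/Zgcd_1_rel_prime.
move: g0 gn E Hq; set g := Z.gcd _ _ => g0 gn E Hq.
have q1 : (1 <= q)%Z by nia.
have [|r [h1 h2]] := IH (Z.to_nat q) _ ltac:(lia); first nia.
exists r; split=> // d d1 d2; rewrite Hq; apply: rel_prime_mult.
- by have := h2 d d1 d2; rewrite Z2Nat.id; last lia.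
- by apply: rel_prime_sym; apply: rel_prime_div gn; apply: rel_prime_sym.
Qed.

(** Take for k the part of N prime to n. Then n + k M is prime to n, because n is prime to k M, and
    prime to k, because n is; hence it is prime to N. This lifts units modulo a divisor to units
    modulo N. *)
Lemma coprime_lift (n M : Z) (N : nat) : (1 <= N)%nat -> rel_prime n M ->
  exists k : Z, rel_prime (n + k * M) (Z.of_nat N).
Proof.
move=> HN H; have [k [h1 h2]] := exists_coprime_part n N HN.
exists k; apply: h2.
- have : rel_prime n (k * M) by apply: rel_prime_mult => //; apply: rel_prime_sym.
  move=> /rel_prime_sym /Zgcd_1_rel_prime E; apply/Zgcd_1_rel_prime.
  rewrite Z.gcd_comm; have -> : (n + k * M = k * M + 1 * n)%Z by ring.
  by rewrite Z.gcd_add_mult_diag_r Z.gcd_comm.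
- apply/Zgcd_1_rel_prime; rewrite Z.gcd_comm (Z.mul_comm k) Z.gcd_add_mult_diag_r.
  exact/Zgcd_1_rel_prime.
Qed.

Definition resum (N : nat) (f : Z -> C) : C := sumC (fun h => f (Z.of_nat h)) (seq 0 N).

Lemma periodic_mult (N : nat) (f : Z -> C) : (forall n, f (n + Z.of_nat N)%Z = f n) ->
  forall n k : Z, f (n + k * Z.of_nat N)%Z = f n.
Proof.
move=> H.
have P n (k : nat) : f (n + Z.of_nat k * Z.of_nat N)%Z = f n.
  elim: k => [|k IH]; first by rewrite /= Z.add_0_r.
  rewrite -IH -(H (n + Z.of_nat k * Z.of_nat N)%Z); congr f; lia.
move=> n k; case: (Z_le_gt_dec 0 k) => h.
- by rewrite -(Z2Nat.id k) // P.
- rewrite -(P (n + k * Z.of_nat N)%Z (Z.to_nat (- k))); congr f; rewrite Z2Nat.id; lia.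
Qed.

Lemma periodic_mod (N : nat) (f : Z -> C) : (1 <= N)%nat -> (forall n, f (n + Z.of_nat N)%Z = f n) ->
  forall n : Z, f (n mod Z.of_nat N)%Z = f n.
Proof.
move=> HN H n; rewrite -(periodic_mult N f H _ (n / Z.of_nat N)%Z); congr f.
have := Z.div_mod n (Z.of_nat N); lia.
Qed.

(** Multiplication by a unit is injective on the residues 0, ..., N - 1, hence permutes them. *)
Lemma resum_reindex (N : nat) (f : Z -> C) (a : Z) : (1 <= N)%nat ->
  (forall n, f (n + Z.of_nat N)%Z = f n) -> rel_prime a (Z.of_nat N) ->
  resum N (fun h => f (a * h)%Z) = resum N f.
Proof.
move=> HN Hf Ha; rewrite /resum.
pose g h := Z.to_nat ((a * Z.of_nat h) mod Z.of_nat N).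
have gE h : Z.of_nat (g h) = ((a * Z.of_nat h) mod Z.of_nat N)%Z.
  by rewrite /g Z2Nat.id //; apply: Z_mod_lt_pos_nonneg || (have := Z.mod_pos_bound (a * Z.of_nat h) (Z.of_nat N); lia).
have P : Permutation (map g (seq 0 N)) (seq 0 N).
  apply: NoDup_Permutation_bis.
  - apply: NoDup_map_NoDup_ForallPairs; last exact: seq_NoDup.
    move=> x y /in_seq Hx /in_seq Hy E.
    have E2 : ((a * Z.of_nat x) mod Z.of_nat N = (a * Z.of_nat y) mod Z.of_nat N)%Z by rewrite -!gE E.
    have D : (Z.of_nat N | a * (Z.of_nat x - Z.of_nat y))%Z.
      exists ((a * Z.of_nat x) / Z.of_nat N - (a * Z.of_nat y) / Z.of_nat N)%Z.
      have := Z.div_mod (a * Z.of_nat x) (Z.of_nat N); have := Z.div_mod (a * Z.of_nat y) (Z.of_nat N).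
      rewrite E2; nia.
    have [q Hq] := Gauss _ _ _ D (rel_prime_sym _ _ Ha).
    have : q = 0%Z by nia.
    nia.
  - by rewrite length_map.
  - move=> x /in_map_iff [y [<- Hy]]; apply/in_seq; split; first lia.
    have := gE y; have := Z.mod_pos_bound (a * Z.of_nat y) (Z.of_nat N); lia.
rewrite -(sumC_perm (fun h => f (Z.of_nat h)) _ _ P) sumC_map; apply: sumC_ext => h _.
by rewrite gE (periodic_mod N f HN Hf).
Qed.

Lemma resum_mult_l N c f : resum N (fun h => c * f h) = c * resum N f.
Proof. exact: sumC_mult_l. Qed.

Lemma resum_ext N f g : (forall h, f h = g h) -> resum N f = resum N g.
Proof. by move=> H; apply: sumC_ext => i _; apply: H. Qed.

(** * Roots of unity and Dirichlet characters *)

Definition root_unity (N : nat) (k : Z) : C := Cexp (twopii * RtoC (IZR k) / RtoC (INR N)).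

Section RootsOfUnity.

Variables (N : nat) (HN : (1 <= N)%nat).

Lemma INR_N_nz : RtoC (INR N) <> 0.
Proof. by move=> h; have := RtoC_inj _ _ h; apply: not_0_INR; lia. Qed.

Lemma root_unity_plus a b : root_unity N (a + b) = root_unity N a * root_unity N b.
Proof.
rewrite /root_unity -Cexp_plus plus_IZR RtoC_plus; congr Cexp; field; exact: INR_N_nz.
Qed.

Lemma root_unity_0 : root_unity N 0 = 1.
Proof. rewrite /root_unity -Cexp_0; congr Cexp; field; exact: INR_N_nz. Qed.

Lemma root_unity_N k : root_unity N (k * Z.of_nat N) = 1.
Proof.
rewrite /root_unity mult_IZR -INR_IZR_INZ RtoC_mult -{1}(Cexp_twopii_Z k); congr Cexp.
field; exact: INR_N_nz.
Qed.

Lemma root_unity_periodic k : root_unity N (k + Z.of_nat N) = root_unity N k.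
Proof. by rewrite root_unity_plus -(Z.mul_1_l (Z.of_nat N)) root_unity_N Cmult_1_r. Qed.

Lemma root_unity_eq_1 k : root_unity N k = 1 -> (Z.of_nat N | k)%Z.
Proof.
move=> /Cexp_eq_1 [j Hj]; exists j.
have nN := INR_N_nz; have np := twopii_nz.
have E : RtoC (IZR k) = RtoC (IZR j) * RtoC (INR N).
  transitivity (twopii * RtoC (IZR k) / RtoC (INR N) * RtoC (INR N) / twopii).
    by field; split.
  by rewrite Hj; field.
rewrite INR_IZR_INZ -RtoC_mult -mult_IZR in E.
by apply: eq_IZR; apply: RtoC_inj.
Qed.

Lemma root_unity_pow m (h : nat) : root_unity N (Z.of_nat h * m) = root_unity N m ^ h.
Proof.
rewrite /root_unity Cexp_pow mult_IZR -INR_IZR_INZ RtoC_mult; congr Cexp; field; exact: INR_N_nz.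
Qed.

Lemma sumC_geom (z : C) n : z <> 1 -> sumC (fun h => z ^ h) (seq 0 n) = (z ^ n - 1) / (z - 1).
Proof.
move=> nz; have n1 := Cminus_neq_0 _ _ nz.
elim: n => [|n IH]; first by rewrite /=; field.
rewrite seq_S sumC_app IH /=; by field.
Qed.

Lemma sumC_const_N (c : C) n : sumC (fun _ => c) (seq 0 n) = RtoC (INR n) * c.
Proof.
elim: n => [|n IH]; first by rewrite /=; ring.
rewrite seq_S sumC_app IH S_INR RtoC_plus /=; ring.
Qed.

Lemma resum_root_unity m : ~ (Z.of_nat N | m)%Z -> resum N (fun h => root_unity N (h * m)) = 0.
Proof.
move=> H; rewrite /resum.
rewrite (sumC_ext _ (fun h => root_unity N m ^ h)); last by move=> h _; exact: root_unity_pow.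
have n1 : root_unity N m <> 1 by move=> E; apply: H; exact: root_unity_eq_1.
rewrite sumC_geom // -root_unity_pow Z.mul_comm root_unity_N.
field; exact: Cminus_neq_0.
Qed.

Lemma resum_root_unity_dvd m : (Z.of_nat N | m)%Z -> resum N (fun h => root_unity N (h * m)) = RtoC (INR N).
Proof.
move=> [q ->]; rewrite /resum (sumC_ext _ (fun _ => 1)); first by rewrite sumC_const_N; ring.
by move=> h _; rewrite Z.mul_assoc root_unity_N.
Qed.

End RootsOfUnity.

Section Character.

Variables (N : nat) (chi : Z -> C) (HN : (1 <= N)%nat) (Hchi : dirichlet_character N chi).

Lemma char_periodic n : chi (n + Z.of_nat N)%Z = chi n.
Proof. by case: Hchi. Qed.

Lemma char_mult m n : chi (m * n)%Z = chi m * chi n.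
Proof. by case: Hchi => _ []. Qed.

Lemma char_nz n : chi n <> 0 <-> rel_prime n (Z.of_nat N).
Proof. case: Hchi => _ [_ H]; rewrite H; exact: Zgcd_1_rel_prime. Qed.

Lemma char_0 n : ~ rel_prime n (Z.of_nat N) -> chi n = 0.
Proof. by move=> h; apply: NNPP => h2; apply: h; apply/char_nz. Qed.

Lemma char_1 : chi 1%Z = 1.
Proof.
have n1 : chi 1%Z <> 0 by apply/char_nz; apply: rel_prime_sym; exact: rel_prime_1 || exact: rel_prime_sym (rel_prime_1 _).
have := char_mult 1 1; rewrite Z.mul_1_l => E.
transitivity (chi 1%Z * chi 1%Z * / chi 1%Z); first by field.
by rewrite -E; field.
Qed.

Lemma char_bounded : exists B, forall n, (Cmod (chi n) <= B)%R.
Proof.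
exists (sumR (fun h => Cmod (chi (Z.of_nat h))) (seq 0 N)) => n.
rewrite -(periodic_mod N chi HN char_periodic n).
have b := Z.mod_pos_bound n (Z.of_nat N) ltac:(lia).
rewrite -(Z2Nat.id (n mod Z.of_nat N)); last lia.
have -> : Cmod (chi (Z.of_nat (Z.to_nat (n mod Z.of_nat N)))) =
  sumR (fun h => Cmod (chi (Z.of_nat h))) (Z.to_nat (n mod Z.of_nat N) :: nil) by rewrite /=; ring.
apply: sumR_incl.
- by move=> i; exact: Cmod_ge_0.
- by repeat constructor; case.
- by move=> x [<-|[]]; apply/in_seq; lia.
Qed.

(** Powers of chi(n) are again values of chi, hence bounded, which excludes a modulus above 1. *)
Lemma char_le_1 n : (Cmod (chi n) <= 1)%R.
Proof.
have [B HB] := char_bounded.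
apply: Rnot_lt_le => h.
have P k : chi (n ^ Z.of_nat k)%Z = chi n ^ k.
  elim: k => [|k IH]; first by rewrite /= char_1.
  by rewrite Nat2Z.inj_succ Z.pow_succ_r ?char_mult ?IH //; lia.
have [k Hk] := Pow_x_infinity (Cmod (chi n)) ltac:(rewrite Rabs_pos_eq //; exact: Cmod_ge_0) (B + 1).
have := Hk k (Nat.le_refl k); rewrite -Cmod_pow -P => h2.
have := HB (n ^ Z.of_nat k)%Z; rewrite Rabs_pos_eq in h2; last exact: Cmod_ge_0.
lra.
Qed.

Lemma rel_prime_inverse n : rel_prime n (Z.of_nat N) -> exists b q : Z, (n * b = 1 + q * Z.of_nat N)%Z.
Proof. move=> /rel_prime_bezout [u v H]; exists u, (- v)%Z; lia. Qed.

Lemma Cmod_char n : rel_prime n (Z.of_nat N) -> Cmod (chi n) = 1%R.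
Proof.
move=> H; have [b [q E]] := rel_prime_inverse n H.
have E2 : chi n * chi b = 1.
  rewrite -char_mult E (periodic_mult N chi char_periodic); exact: char_1.
have : (Cmod (chi n) * Cmod (chi b) = 1)%R by rewrite -Cmod_mult E2 Cmod_1.
have := char_le_1 n; have := char_le_1 b; have := Cmod_ge_0 (chi n); have := Cmod_ge_0 (chi b); nra.
Qed.

Lemma char_conj n : rel_prime n (Z.of_nat N) -> chi n * Cconj (chi n) = 1.
Proof.
move=> H; rewrite -Cmod2_conj Cmod_char //; congr RtoC; ring.
Qed.

Lemma conj_dirichlet : dirichlet_character N (conj_character chi).
Proof.
split; first by move=> n; rewrite /conj_character char_periodic.
split; first by move=> m n; rewrite /conj_character char_mult Cmult_conj.
move=> n; rewrite /conj_character; case: Hchi => _ [_ <-]; split=> h h2; apply: h.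
- by rewrite h2 /Cconj /RtoC /=; congr (_, _); ring.
- rewrite -(Cconj_conj (chi n)) h2 /Cconj /RtoC /=; congr (_, _); ring.
Qed.

Lemma gauss_sum_resum psi : gauss_sum N psi = resum N (fun h => psi h * root_unity N h).
Proof.
rewrite /gauss_sum /resum; case: N HN => [|n] h; first lia.
rewrite sumC_seq /= Nat.sub_0_r; apply: sum_n_ext => k.
by rewrite /root_unity /twopii -INR_IZR_INZ.
Qed.

Hypothesis Hprim : primitive_character N chi.

(** Without such a, chi would be trivial on all units congruent to 1 modulo M, so its value at a
    unit would depend only on the class modulo M. Lifting classes modulo M to units modulo N would
    then define a character modulo M that induces chi. *)
Lemma primitive_witness (M : nat) : (1 <= M < N)%nat -> Nat.divide M N ->
  exists a q : Z, a = (1 + q * Z.of_nat M)%Z /\ rel_prime a (Z.of_nat N) /\ chi a <> 1.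
Proof.
move=> HM HD; apply: NNPP => Hn; case: Hprim => _ /(_ M HM HD) []; clear Hprim.
have one a q : a = (1 + q * Z.of_nat M)%Z -> rel_prime a (Z.of_nat N) -> chi a = 1.
  by move=> h1 h2; apply: NNPP => h3; apply: Hn; exists a, q.
have MN : (Z.of_nat M | Z.of_nat N)%Z by case: HD => z ->; exists (Z.of_nat z); lia.
have cop n : rel_prime n (Z.of_nat N) -> rel_prime n (Z.of_nat M).
  by move=> h; apply: rel_prime_sym; apply: rel_prime_div MN; apply: rel_prime_sym.
have congM x y q : (x = y + q * Z.of_nat M)%Z -> rel_prime x (Z.of_nat N) -> rel_prime y (Z.of_nat N) ->
    chi x = chi y.
  move=> E hx hy; have [b [p Hb]] := rel_prime_inverse y hy.
  have hb : rel_prime b (Z.of_nat N).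
    apply: bezout_rel_prime; apply: (Bezout_intro _ _ _ y (- p)); lia.
  have e1 : chi y * chi b = 1 by rewrite -char_mult Hb (periodic_mult N chi char_periodic); exact: char_1.
  have e2 : chi x * chi b = 1.
    rewrite -char_mult; case: MN => z Hz.
    apply: (one _ (p * z + q * b)%Z); first by rewrite E; nia.
    by apply: rel_prime_sym; apply: rel_prime_mult; apply: rel_prime_sym.
  have nb : chi b <> 0 by apply/char_nz.
  transitivity (chi x * chi b * / chi b); first by field.
  by rewrite e2 -e1; field.
have [k Hk] : exists k : Z -> Z, forall n, rel_prime n (Z.of_nat M) -> rel_prime (n + k n * Z.of_nat M) (Z.of_nat N).
  apply: (choice (fun n k => rel_prime n (Z.of_nat M) -> rel_prime (n + k * Z.of_nat M) (Z.of_nat N))) => n.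
  case: (classic (rel_prime n (Z.of_nat M))) => h; last by exists 0%Z.
  by have [k hk] := coprime_lift n (Z.of_nat M) N HN h; exists k.
pose psi n := match excluded_middle_informative (rel_prime n (Z.of_nat M)) with
  left _ => chi (n + k n * Z.of_nat M)%Z | right _ => RtoC 0 end.
have psi1 n : rel_prime n (Z.of_nat M) -> psi n = chi (n + k n * Z.of_nat M)%Z.
  by move=> h; rewrite /psi; case: excluded_middle_informative.
have psi0 n : ~ rel_prime n (Z.of_nat M) -> psi n = 0.
  by move=> h; rewrite /psi; case: excluded_middle_informative.
exists psi; split; last first.
  move=> n /Zgcd_1_rel_prime h; rewrite psi1; last exact: cop.
  by apply: (congM _ _ (- k n)%Z) => //; [lia | apply: Hk; exact: cop].
split; [|split].
- move=> n; case: (classic (rel_prime n (Z.of_nat M))) => h.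
    have h' : rel_prime (n + Z.of_nat M) (Z.of_nat M).
      apply: rel_prime_sym; apply/Zgcd_1_rel_prime.
      rewrite -(Z.mul_1_l (Z.of_nat M)) {1}Z.mul_1_l Z.gcd_add_mult_diag_r.
      by apply/Zgcd_1_rel_prime; apply: rel_prime_sym.
    rewrite !psi1 //.
    by apply: (congM _ _ (1 + k (n + Z.of_nat M)%Z - k n)%Z); [lia | exact: Hk | exact: Hk].
  rewrite !psi0 // => h'; apply: h; apply: rel_prime_sym; apply/Zgcd_1_rel_prime.
  move: h' => /rel_prime_sym /Zgcd_1_rel_prime.
  by rewrite -{2}(Z.mul_1_l (Z.of_nat M)) Z.gcd_add_mult_diag_r.
- move=> m n.
  case: (classic (rel_prime m (Z.of_nat M))) => hm; last first.
    rewrite (psi0 m) // psi0; first ring.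
    by move=> h; apply: hm; apply: rel_prime_div h _; exists n; lia.
  case: (classic (rel_prime n (Z.of_nat M))) => hn; last first.
    rewrite (psi0 n) // psi0; first ring.
    by move=> h; apply: hn; apply: rel_prime_div h _; exists m; lia.
  have hmn : rel_prime (m * n) (Z.of_nat M).
    by apply: rel_prime_sym; apply: rel_prime_mult; apply: rel_prime_sym.
  rewrite !psi1 // -char_mult.
  apply: (congM _ _ (k (m * n)%Z - m * k n - n * k m - k m * k n * Z.of_nat M)%Z); first nia.
  + exact: Hk.
  + by apply: rel_prime_sym; apply: rel_prime_mult; apply: rel_prime_sym; exact: Hk.
- move=> n; split=> h.
    by apply/Zgcd_1_rel_prime; apply: NNPP => h2; apply: h; exact: psi0.
  by move: h => /Zgcd_1_rel_prime h; rewrite psi1 //; apply/char_nz; exact: Hk.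
Qed.

Local Notation W := (gauss_sum N (conj_character chi)).

(** For a unit m substitute h -> m h. Otherwise a unit a with chi(a) <> 1 can be found whose
    multiplication leaves all factors e^(2 pi i h m / N) fixed; the sum equals conj chi(a) times
    itself and vanishes. *)
Theorem gauss_separable m : resum N (fun h => conj_character chi h * root_unity N (h * m)) = chi m * W.
Proof.
have [cp [cm _]] := conj_dirichlet.
rewrite gauss_sum_resum.
case: (classic (rel_prime m (Z.of_nat N))) => hm.
  rewrite -(resum_reindex N (fun h => conj_character chi h * root_unity N h) m HN) //; last first.
    by move=> n; rewrite cp root_unity_periodic.
  rewrite -resum_mult_l; apply: resum_ext => h.
  rewrite cm Cmult_assoc Cmult_assoc char_conj // Cmult_1_l.
  by rewrite Z.mul_comm.
rewrite (char_0 m hm) Cmult_0_l.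
pose g := Z.gcd m (Z.of_nat N).
have g0 : (0 <= g)%Z by exact: Z.gcd_nonneg.
have [z Hz] : (g | Z.of_nat N)%Z by exact: Z.gcd_divide_r.
have [y Hy] : (g | m)%Z by exact: Z.gcd_divide_l.
have g1 : g <> 1%Z by move=> E; apply: hm; apply/Zgcd_1_rel_prime.
clearbody g.
have gn0 : g <> 0%Z by move=> E; rewrite E in Hz; lia.
have g2 : (2 <= g)%Z by lia.
have z1 : (1 <= z)%Z by nia.
(* With g = gcd(m, N) > 1 the number z = N / g is a proper divisor; a congruent to 1 modulo z gives
   a h m congruent to h m modulo N. *)
have [||a [q [Ha [ca na]]]] := primitive_witness (Z.to_nat z).
- nia.
- exists (Z.to_nat g); nia.
rewrite Z2Nat.id in Ha; last lia.
set S := resum _ _.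
have E : S = conj_character chi a * S.
  rewrite {1}/S -(resum_reindex N (fun h => conj_character chi h * root_unity N (h * m)) a HN) //; last first.
    move=> n; rewrite cp; have -> : ((n + Z.of_nat N) * m = n * m + m * Z.of_nat N)%Z by ring.
    by rewrite root_unity_plus // root_unity_N // Cmult_1_r.
  rewrite /S -resum_mult_l; apply: resum_ext => h.
  rewrite cm -Cmult_assoc; congr (_ * (_ * _)).
  have -> : (a * h * m = h * m + (q * h * y) * Z.of_nat N)%Z by rewrite Ha Hy Hz; ring.
  by rewrite root_unity_plus // root_unity_N // Cmult_1_r.
have n1 : 1 - conj_character chi a <> 0.
  apply: Cminus_neq_0 => E1; apply: na.
  by rewrite -(Cconj_conj (chi a)) -[Cconj (chi a)]/(conj_character chi a) -E1 /Cconj /RtoC /=; congr (_, _); ring.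
transitivity ((S - conj_character chi a * S) / (1 - conj_character chi a)); first by field.
by rewrite -E; field.
Qed.

Lemma gauss_sum_nz : W <> 0.
Proof.
move=> E.
have [cp [cm _]] := conj_dirichlet.
(* Inverting the finite Fourier transform of [conj chi] at [1] gives [N]. *)
have H : resum N (fun m => root_unity N (- m) * resum N (fun h => conj_character chi h * root_unity N (h * m))) = 0.
  rewrite {1}/resum sumC_zero // => i _; rewrite gauss_separable E; ring.
have H2 : resum N (fun m => root_unity N (- m) * resum N (fun h => conj_character chi h * root_unity N (h * m))) =
   sumC (fun h => conj_character chi (Z.of_nat h) * resum N (fun m => root_unity N (m * (Z.of_nat h - 1)))) (seq 0 N).
  rewrite /resum.
  transitivity (sumC (fun m => sumC (fun h => root_unity N (- Z.of_nat m) * (conj_character chi (Z.of_nat h) * root_unity N (Z.of_nat h * Z.of_nat m))) (seq 0 N)) (seq 0 N)).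
    by apply: sumC_ext => m _; rewrite sumC_mult_l.
  rewrite sumC_swap; apply: sumC_ext => h _; rewrite -sumC_mult_l; apply: sumC_ext => m _.
  have -> : (Z.of_nat m * (Z.of_nat h - 1) = - Z.of_nat m + Z.of_nat h * Z.of_nat m)%Z by ring.
  rewrite root_unity_plus //; ring.
rewrite H2 in H.
have c1 : conj_character chi 1%Z = 1 by rewrite /conj_character char_1 /Cconj /RtoC /=; congr (_, _); ring.
have nN := INR_N_nz N HN.
(* Only [h = 1] (for [N = 1], [h = 0]) contributes. *)
pose h0 := (1 mod N)%nat.
have h0N : (h0 < N)%nat by apply: Nat.mod_upper_bound; lia.
have h01 : (Z.of_nat N | Z.of_nat h0 - 1)%Z.
  exists (- (1 / Z.of_nat N))%Z; have := Z.div_mod 1 (Z.of_nat N) ltac:(lia).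
  rewrite /h0 Nat2Z.inj_mod; lia.
have ch0 : conj_character chi (Z.of_nat h0) = 1.
  by rewrite /h0 Nat2Z.inj_mod (periodic_mod N _ HN cp).
have HS : sumC (fun h => conj_character chi (Z.of_nat h) * resum N (fun m => root_unity N (m * (Z.of_nat h - 1)))) (seq 0 N)
   = RtoC (INR N).
  have hs := has_sum_finite (fun h => conj_character chi (Z.of_nat h) * resum N (fun m => root_unity N (m * (Z.of_nat h - 1))) *
     match lt_dec h N with left _ => 1 | right _ => 0 end).
  have e1 := hs (seq 0 N) (seq_NoDup _ _) ltac:(move=> i Hi; case: (lt_dec i N) => hi; [case: Hi; apply/in_seq; lia | rewrite Cmult_0_r //]).
  have e2 := hs (h0 :: nil) ltac:(repeat constructor; case).
  rewrite (sumC_ext _ (fun h => conj_character chi (Z.of_nat h) * resum N (fun m => root_unity N (m * (Z.of_nat h - 1))))) in e1; last first.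
    by move=> i /in_seq Hi; case: (lt_dec i N) => hi; [rewrite Cmult_1_r | lia].
  apply: has_sum_unique e1 _.
  have -> : RtoC (INR N) = sumC (fun h => conj_character chi (Z.of_nat h) * resum N (fun m => root_unity N (m * (Z.of_nat h - 1))) *
     match lt_dec h N with left _ => 1 | right _ => 0 end) (h0 :: nil).
    rewrite /= ch0 resum_root_unity_dvd //; case: (lt_dec h0 N) => hh; [ring | lia].
  apply: e2 => i Hi; case: (lt_dec i N) => hi; last by rewrite Cmult_0_r.
  rewrite resum_root_unity //; first ring.
  move=> D; apply: Hi; left.
  have [w Hw] := Z.divide_sub_r _ _ _ D h01.
  have : w = 0%Z by nia.
  nia.
by apply: nN; rewrite -HS.
Qed.

End Character.

(** * The Kronecker function as a global series *)

Definition Z2C (n : Z) : C := RtoC (IZR n).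

Lemma Z2C_plus a b : Z2C (a + b) = Z2C a + Z2C b.
Proof. by rewrite /Z2C plus_IZR RtoC_plus. Qed.

Lemma Z2C_mult a b : Z2C (a * b) = Z2C a * Z2C b.
Proof. by rewrite /Z2C mult_IZR RtoC_mult. Qed.

Lemma Z2C_opp a : Z2C (- a) = - Z2C a.
Proof. by rewrite /Z2C opp_IZR RtoC_opp. Qed.

Lemma Z2C_minus a b : Z2C (a - b) = Z2C a - Z2C b.
Proof. by rewrite /Z2C minus_IZR RtoC_minus. Qed.

Lemma Z2C_nat n : Z2C (Z.of_nat n) = RtoC (INR n).
Proof. by rewrite /Z2C -INR_IZR_INZ. Qed.

Lemma Z2C_1 : Z2C 1 = 1. Proof. by []. Qed.

Lemma Z2C_0 : Z2C 0 = 0. Proof. by []. Qed.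

(** A total version of the sum; the value for a family without a sum is unspecified. *)
Definition hsum {I : Type} (f : I -> C) : C := epsilon (inhabits (RtoC 0)) (has_sum f).

Lemma hsum_correct {I} (f : I -> C) : abs_summable f -> has_sum f (hsum f).
Proof. by move=> /abs_summable_has_sum H; apply: epsilon_spec. Qed.

Lemma has_sum_hsum {I} (f : I -> C) s : has_sum f s -> hsum f = s.
Proof.
move=> H; apply: (has_sum_unique f) => //.
by apply: (epsilon_spec (inhabits (RtoC 0)) (has_sum f)); exists s.
Qed.

Lemma bounded_sums_except {I} (f g : I -> R) M L :
  (forall i, (0 <= f i)%R) -> (forall i, (0 <= g i)%R) ->
  (forall i, ~ In i L -> (f i <= g i)%R) -> bounded_sums g M -> bounded_sums f (M + sumR f L).
Proof.
move=> Hf Hg H HM K HK.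
pose inL i := match excluded_middle_informative (In i L) with left _ => true | right _ => false end.
have P K' : (sumR f K' <= sumR g K' + sumR f (filter inL K'))%R.
  elim: K' => [|x K' IH] /=; first lra.
  rewrite /inL; case: (excluded_middle_informative (In x L)) => h /=; rewrite -/inL.
  - have := Hg x; lra.
  - have := H x h; lra.
apply: Rle_trans (P K) _; apply: Rplus_le_compat; first exact: HM.
apply: sumR_incl => //; first exact: NoDup_filter.
by move=> i /filter_In [_]; rewrite /inL; case: excluded_middle_informative.
Qed.

Lemma bounded_sums_Z (g : nat -> R) B : (forall k, (0 <= g k)%R) -> bounded_sums g B ->
  bounded_sums (fun n : Z => g (Z.abs_nat n)) (B + B).
Proof.
move=> Hg HB L HL.
have [n0 Hn0] := incl_seq (map Z.abs_nat L).
have i : incl L (map Z.of_nat (seq 0 n0) ++ map (fun k => (- Z.of_nat k)%Z) (seq 0 n0)).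
  move=> x Hx; have h := Hn0 _ (in_map Z.abs_nat _ _ Hx).
  apply/in_app_iff; case: (Z_le_gt_dec 0 x) => hx; [left|right]; apply/in_map_iff;
    exists (Z.abs_nat x); split=> //; lia.
apply: Rle_trans (sumR_incl _ _ _ _ HL i) _; first by move=> k; exact: Hg.
rewrite sumR_app !sumR_map; apply: Rplus_le_compat.
- apply: Rle_trans (HB _ (seq_NoDup n0 0)); right; congr (fold_right _ _ _).
  apply: FunctionalExtensionality.functional_extensionality => k.
  apply: FunctionalExtensionality.functional_extensionality => s; by rewrite Zabs2Nat.id.
- apply: Rle_trans (HB _ (seq_NoDup n0 0)); right; congr (fold_right _ _ _).
  apply: FunctionalExtensionality.functional_extensionality => k.
  apply: FunctionalExtensionality.functional_extensionality => s.
  by have -> : Z.abs_nat (- Z.of_nat k) = k by lia.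
Qed.

Definition absR (n : Z) : R := IZR (Z.abs n).

Lemma absR_ge0 n : (0 <= absR n)%R.
Proof. by apply: IZR_le; lia. Qed.

Lemma absR_le n : (- absR n <= IZR n <= absR n)%R.
Proof. rewrite /absR -opp_IZR; split; apply: IZR_le; lia. Qed.

Lemma absR_sqr n : (absR n * absR n = IZR n * IZR n)%R.
Proof. rewrite /absR -!mult_IZR; congr IZR; lia. Qed.

(** A common summable majorant: the decay of order q^(n^2) is used only through exp(-|n|). *)
Definition ez (n : Z) : R := exp (- absR n).

Lemma exp_le_compat x y : (x <= y)%R -> (exp x <= exp y)%R.
Proof. by move=> [h| ->]; [left; exact: exp_increasing | right]. Qed.

Lemma exp_INR_mult k t : exp (INR k * t) = (exp t ^ k)%R.
Proof.
elim: k => [|k IH]; first by rewrite Rmult_0_l exp_0.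
by rewrite S_INR Rmult_plus_distr_r Rmult_1_l exp_plus IH /= Rmult_comm.
Qed.

Lemma ez_bounded : exists B, bounded_sums ez B.
Proof.
pose r := exp (- (1)).
have r0 : (0 < r)%R by exact: exp_pos.
have r1 : (r < 1)%R by rewrite -exp_0; apply: exp_increasing; lra.
exists (/ (1 - r) + / (1 - r))%R.
apply: (bounded_sums_le _ (fun n : Z => r ^ Z.abs_nat n)%R); last first.
  apply: (bounded_sums_Z (fun k => r ^ k)%R); first by move=> k; apply: pow_le; lra.
  by apply: bounded_sums_geom; lra.
move=> n; right; rewrite /ez /absR /r -exp_INR_mult; congr exp.
rewrite INR_IZR_INZ Zabs2Nat.id_abs; ring.
Qed.

Definition Zrange (n0 : nat) : list Z := map (fun k => (Z.of_nat k - Z.of_nat n0)%Z) (seq 0 (2 * n0)).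

Lemma Zrange_NoDup n0 : NoDup (Zrange n0).
Proof. by apply: FinFun.Injective_map_NoDup; [move=> x y; lia | exact: seq_NoDup]. Qed.

Lemma Zrange_out n0 n : ~ In n (Zrange n0) -> (INR n0 <= absR n)%R.
Proof.
move=> H; rewrite INR_IZR_INZ; apply: IZR_le; apply: Znot_gt_le => h; apply: H.
apply/in_map_iff; exists (Z.to_nat (n + Z.of_nat n0)); split; first lia.
apply/in_seq; lia.
Qed.

(* With [x_n = xi q^n], [Q e n] is [eta^n x_n^(n + e) / (x_n - 1)], which decays like [q^(n^2)]. *)
Definition Qden (n : Z) (tau u : C) : C := Cexp (u + twopii * Z2C n * tau) - 1.

Definition Qnum (e n : Z) (tau u v : C) : C :=
  Cexp (Z2C n * v + Z2C (n + e) * (u + twopii * Z2C n * tau)).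

Definition Q (e n : Z) (tau u v : C) : C := Qnum e n tau u v / Qden n tau u.

Lemma Cmod_Qnum e n tau u v : Cmod (Qnum e n tau u v) =
  exp (IZR n * Re v + IZR (n + e) * Re u - 2 * PI * (IZR n * IZR (n + e)) * Im tau).
Proof.
rewrite /Qnum Cmod_Cexp; congr exp; rewrite /twopii /Z2C /Re /Im /=; ring.
Qed.

Lemma Qnum_bound y0 y1 B e : (0 < y0)%R -> exists K, (0 < K)%R /\ forall n tau u v,
  (y0 <= Im tau <= y1)%R -> (Cmod u <= B)%R -> (Cmod v <= B)%R -> (Cmod (Qnum e n tau u v) <= K * ez n)%R.
Proof.
move=> Hy0.
have pp := PI_RGT_0.
pose E := absR e.
have E0 : (0 <= E)%R by exact: absR_ge0.
pose a := (2 * PI * y0)%R.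
have a0 : (0 < a)%R by rewrite /a; nra.
(* All contributions linear in |n| are collected in L, including the 1 paid for [ez]; completing the
   square bounds L t - a t^2 by L^2 / (4 a). *)
pose L := (2 * B + 2 * PI * E * y1 + 1)%R.
pose K0 := (E * B + L * L / (4 * a))%R.
exists (exp K0); split; first exact: exp_pos.
move=> n tau u v Hy Hu Hv.
rewrite Cmod_Qnum /ez -exp_plus; apply: exp_le_compat.
have B0 : (0 <= B)%R by have := Cmod_ge_0 u; lra.
have rv : (Rabs (Re v) <= B)%R by have := re_le_Cmod v; lra.
have ru : (Rabs (Re u) <= B)%R by have := re_le_Cmod u; lra.
have bv : (- B <= Re v <= B)%R by apply/Rabs_le_between.
have bu : (- B <= Re u <= B)%R by apply/Rabs_le_between.
set t := absR n.
have t0 : (0 <= t)%R by exact: absR_ge0.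
have tn := absR_le n; rewrite -/t in tn.
have te := absR_le e; rewrite -/E in te.
have tt := absR_sqr n; rewrite -/t in tt.
rewrite plus_IZR.
set x := IZR n in tn tt *; set z := IZR e in te *.
have h1 : (x * Re v <= t * B)%R by nra.
have h2 : (x * Re u <= t * B)%R by nra.
have h3 : (z * Re u <= E * B)%R by nra.
have h4 : (- (x * z) <= t * E)%R by nra.
have h5 : (- (x * z) * Im tau <= t * E * y1)%R.
  apply: (Rle_trans _ (t * E * Im tau)%R); first by apply: Rmult_le_compat_r; lra.
  by apply: Rmult_le_compat_l; [apply: Rmult_le_pos | lra].
have h6 : (t * t * y0 <= x * x * Im tau)%R.
  by rewrite tt; apply: Rmult_le_compat_l; [nra | lra].
have h7 : (L * t - a * (t * t) <= L * L / (4 * a))%R.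
  apply: (Rmult_le_reg_r (4 * a)); first lra.
  have -> : (L * L / (4 * a) * (4 * a) = L * L)%R by field; lra.
  have := Rle_0_sqr (2 * a * t - L); rewrite /Rsqr; lra.
have -> : (x * Re v + (x + z) * Re u - 2 * PI * (x * (x + z)) * Im tau =
  x * Re v + x * Re u + z * Re u + 2 * PI * (- (x * z) * Im tau) - 2 * PI * (x * x * Im tau))%R by ring.
have h8 : (2 * PI * (- (x * z) * Im tau) <= 2 * PI * (t * E * y1))%R by apply: Rmult_le_compat_l; lra.
have h9 : (2 * PI * (t * t * y0) <= 2 * PI * (x * x * Im tau))%R by apply: Rmult_le_compat_l; lra.
rewrite /K0; move: h7; rewrite /L /a; lra.
Qed.

(** Beyond a threshold uniform in tau and u, the modulus of x_n is at most 1/2 or at least 2, so x_n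
    stays away from 1. *)
Lemma Qden_bound y0 B : (0 < y0)%R -> exists n0 : nat, forall n tau u,
  (y0 <= Im tau)%R -> (Cmod u <= B)%R -> (INR n0 <= absR n)%R -> (/ 2 <= Cmod (Qden n tau u))%R.
Proof.
move=> Hy0; have pp := PI_RGT_0.
have py : (0 < 2 * PI * y0)%R by nra.
have [n0 Hn0] := INR_archimed (2 * PI * y0) (B + 1) py.
exists n0 => n tau u Hy Hu Hn.
have ru : (Rabs (Re u) <= B)%R by have := re_le_Cmod u; lra.
have bu : (- B <= Re u <= B)%R by apply/Rabs_le_between.
have M : Cmod (Cexp (u + twopii * Z2C n * tau)) = exp (Re u - 2 * PI * IZR n * Im tau).
  rewrite Cmod_Cexp; congr exp; rewrite /twopii /Z2C /Re /Im /=; ring.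
have e2 : (2 <= exp 1)%R by have := exp_ineq1_le 1; lra.
have big : (B + 1 <= 2 * PI * absR n * Im tau)%R.
  apply: (Rle_trans _ (INR n0 * (2 * PI * y0))%R); first lra.
  apply: (Rle_trans _ (absR n * (2 * PI * y0))%R); first by apply: Rmult_le_compat_r; lra.
  have := absR_ge0 n; have : (2 * PI * y0 <= 2 * PI * Im tau)%R by nra.
  nra.
have na : absR n = IZR n \/ absR n = (- IZR n)%R.
  rewrite /absR -opp_IZR; case: (Z_le_gt_dec 0 n) => h; [left|right]; congr IZR; lia.
rewrite /Qden; case: na => E; rewrite E in big.
- have : (Cmod (Cexp (u + twopii * Z2C n * tau)) <= / 2)%R.
    rewrite M; apply: (Rle_trans _ (exp (- (1)))); first by apply: exp_le_compat; lra.
    by rewrite exp_Ropp; apply: Rinv_le_contravar; lra.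
  have := Cmod_minus_le 1 (Cexp (u + twopii * Z2C n * tau)); rewrite Cmod_1 Cmod_minus_sym; lra.
- have : (2 <= Cmod (Cexp (u + twopii * Z2C n * tau)))%R.
    rewrite M; apply: Rle_trans e2 _; apply: exp_le_compat; lra.
  have := Cmod_minus_le (Cexp (u + twopii * Z2C n * tau)) 1; rewrite Cmod_1; lra.
Qed.

Lemma Q_bound y0 y1 B e : (0 < y0)%R -> exists (n0 : nat) (K : R), (0 < K)%R /\ forall n tau u v,
  (y0 <= Im tau <= y1)%R -> (Cmod u <= B)%R -> (Cmod v <= B)%R -> (INR n0 <= absR n)%R ->
  Qden n tau u <> 0 /\ (Cmod (Q e n tau u v) <= K * ez n)%R.
Proof.
move=> Hy0.
have [K [K0 HK]] := Qnum_bound y0 y1 B e Hy0.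
have [n0 Hn0] := Qden_bound y0 B Hy0.
exists n0, (K * 2)%R; split; first lra.
move=> n tau u v Hy Hu Hv Hn.
have d := Hn0 n tau u (proj1 Hy) Hu Hn.
have nz : Qden n tau u <> 0 by apply/Cmod_gt_0; lra.
split=> //; rewrite /Q Cmod_div //.
have := HK n tau u v Hy Hu Hv => h.
have c0 := Cmod_ge_0 (Qnum e n tau u v).
have : (/ Cmod (Qden n tau u) <= 2)%R.
  by have := Rinv_le_contravar (/ 2) _ ltac:(lra) d; rewrite Rinv_inv.
move=> h2; rewrite /Rdiv; nra.
Qed.

Lemma Q_summable e tau u v : (0 < Im tau)%R -> abs_summable (fun n => Q e n tau u v).
Proof.
move=> Ht.
pose B := Rmax (Cmod u) (Cmod v).
have [n0 [K [K0 HK]]] := Q_bound (Im tau) (Im tau) B e Ht.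
have [E HE] := ez_bounded.
exists (K * E + sumR (fun n => Cmod (Q e n tau u v)) (Zrange n0))%R.
apply: (bounded_sums_except _ (fun n => (K * ez n)%R)).
- by move=> i; exact: Cmod_ge_0.
- by move=> i; apply: Rmult_le_pos; [lra | left; exact: exp_pos].
- move=> i /Zrange_out Hi; apply: (proj2 (HK i tau u v _ _ _ Hi)); first lra.
  + exact: Rmax_l.
  + exact: Rmax_r.
- by apply: bounded_sums_mult_l => //; lra.
Qed.

Lemma Qnum_summable e tau u v : (0 < Im tau)%R -> abs_summable (fun n => Qnum e n tau u v).
Proof.
move=> Ht.
pose B := Rmax (Cmod u) (Cmod v).
have [K [K0 HK]] := Qnum_bound (Im tau) (Im tau) B e Ht.
have [E HE] := ez_bounded.
exists (K * E)%R; apply: (bounded_sums_le _ (fun n => (K * ez n)%R)).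
- by move=> i; apply: HK; [lra | exact: Rmax_l | exact: Rmax_r].
- by apply: bounded_sums_mult_l => //; lra.
Qed.

Lemma abs_summable_plus {I} (f g : I -> C) :
  abs_summable f -> abs_summable g -> abs_summable (fun i => f i + g i).
Proof.
move=> [M HM] [M' HM'].
apply: (abs_summable_le _ (fun i => (Cmod (f i) + Cmod (g i))%R) (M + M')).
- by move=> i; exact: Cmod_triangle.
- exact: bounded_sums_plus.
Qed.

Lemma abs_summable_mult {I} (w f : I -> C) B : (forall i, (Cmod (w i) <= B)%R) ->
  abs_summable f -> abs_summable (fun i => w i * f i).
Proof.
move=> HB [M HM].
case: (classic (exists i : I, True)) => [[i0 _]|h].
  have B0 : (0 <= B)%R by have := HB i0; have := Cmod_ge_0 (w i0); lra.
  apply: (abs_summable_le _ (fun i => (B * Cmod (f i))%R) (B * M)).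
  - by move=> i; rewrite Cmod_mult; apply: Rmult_le_compat_r; [exact: Cmod_ge_0 | exact: HB].
  - exact: bounded_sums_mult_l.
exists 0%R => L _; case: L => [|i l]; first by rewrite /=; lra.
by case: h; exists i.
Qed.

Lemma abs_summable_sumC {I J} (f : J -> I -> C) l : (forall j, In j l -> abs_summable (f j)) ->
  abs_summable (fun i => sumC (fun j => f j i) l).
Proof.
elim: l => [|j l IH] H /=.
- apply: (abs_summable_le _ (fun _ => 0%R) 0%R) => [i|L _]; first by rewrite Cmod_0; lra.
  by rewrite sumR_const; lra.
- apply: abs_summable_plus; first by apply: H; left.
  by apply: IH => k Hk; apply: H; right.
Qed.

(* The sum does not depend on [a]; a lattice translation shifts [n] and changes [a]. *)
Definition Kron (a : Z) (tau u v : C) : C := hsum (fun n => Q a n tau u v + Q (1 - a) n tau v u).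

Lemma Kron_has_sum a tau u v : (0 < Im tau)%R ->
  has_sum (fun n => Q a n tau u v + Q (1 - a) n tau v u) (Kron a tau u v).
Proof. by move=> Ht; apply: hsum_correct; apply: abs_summable_plus; exact: Q_summable. Qed.

(** * The twisted function and its elliptic property *)

Section Twisted.

Variables (N : nat) (chi : Z -> C) (HN : (1 <= N)%nat) (Hprim : primitive_character N chi).

Let Hchi : dirichlet_character N chi := proj1 Hprim.

Local Notation W := (gauss_sum N (conj_character chi)).

Local Notation cchi := (conj_character chi).

Definition shiftN (h : nat) (v : C) : C := v + twopii * RtoC (INR h) / RtoC (INR N).

Lemma shiftN_exp h v k : Cexp (Z2C k * shiftN h v) = root_unity N (Z.of_nat h * k) * Cexp (Z2C k * v).
Proof.
rewrite /root_unity -Cexp_plus mult_IZR -INR_IZR_INZ RtoC_mult; congr Cexp.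
rewrite /shiftN /Z2C; field; exact: INR_N_nz.
Qed.

Lemma Qnum_split e n tau u v : Qnum e n tau u v =
  Cexp (Z2C n * v) * (Cexp (Z2C (n + e) * u) * Cexp (Z2C (n + e) * (twopii * Z2C n * tau))).
Proof. rewrite /Qnum -!Cexp_plus; congr Cexp; ring. Qed.

Lemma Qnum_shift_r e n tau u v h : Qnum e n tau u (shiftN h v) = root_unity N (Z.of_nat h * n) * Qnum e n tau u v.
Proof. rewrite !Qnum_split shiftN_exp; ring. Qed.

Lemma Qnum_shift_l e n tau u v h : Qnum e n tau (shiftN h u) v = root_unity N (Z.of_nat h * (n + e)) * Qnum e n tau u v.
Proof. rewrite !Qnum_split shiftN_exp; ring. Qed.

Lemma Q_shift_r e n tau u v h : Q e n tau u (shiftN h v) = root_unity N (Z.of_nat h * n) * Q e n tau u v.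
Proof. rewrite /Q Qnum_shift_r /Cdiv; ring. Qed.

Lemma gauss_sumC m c : sumC (fun h => cchi (Z.of_nat h) * (root_unity N (Z.of_nat h * m) * c)) (seq 0 N) = chi m * W * c.
Proof.
rewrite -(gauss_separable N chi HN Hchi Hprim) /resum Cmult_comm -sumC_mult_l; apply: sumC_ext => h _; ring.
Qed.

Lemma W_nz : W <> 0.
Proof. exact: (gauss_sum_nz N chi HN Hchi Hprim). Qed.

Definition TA1 (a n : Z) (tau u v : C) : C := chi n * Q a n tau u v.

Definition TA2 (a n : Z) (tau u v : C) : C :=
  / W * sumC (fun h => cchi (Z.of_nat h) * Q (1 - a) n tau (shiftN h v) u) (seq 0 N).

(* [TA 0 tau u v] continues [sum_n chi(n) eta^n / (x_n - 1)]; [a] plays the same role as in [Kron]. *)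
Definition TA (a : Z) (tau u v : C) : C :=
  hsum (fun n => TA1 a n tau u v) + hsum (fun n => TA2 a n tau u v).

Lemma chi_le_1 n : (Cmod (chi n) <= 1)%R.
Proof. exact: (char_le_1 N chi HN Hchi). Qed.

Lemma TA1_summable a tau u v : (0 < Im tau)%R -> abs_summable (fun n => TA1 a n tau u v).
Proof.
move=> Ht; apply: (abs_summable_mult chi _ 1%R); first exact: chi_le_1.
exact: Q_summable.
Qed.

Lemma TA2_summable a tau u v : (0 < Im tau)%R -> abs_summable (fun n => TA2 a n tau u v).
Proof.
move=> Ht; apply: (abs_summable_mult (fun _ => / W) _ (Cmod (/ W))); first by move=> _; lra.
apply: abs_summable_sumC => h _.
apply: (abs_summable_mult (fun _ => cchi (Z.of_nat h)) _ (Cmod (cchi (Z.of_nat h)))); first by move=> _; lra.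
exact: Q_summable.
Qed.

Lemma TA1_has_sum a tau u v : (0 < Im tau)%R -> has_sum (fun n => TA1 a n tau u v) (hsum (fun n => TA1 a n tau u v)).
Proof. by move=> Ht; apply: hsum_correct; apply: TA1_summable. Qed.

Lemma TA2_has_sum a tau u v : (0 < Im tau)%R -> has_sum (fun n => TA2 a n tau u v) (hsum (fun n => TA2 a n tau u v)).
Proof. by move=> Ht; apply: hsum_correct; apply: TA2_summable. Qed.

Lemma TA_has_sum a tau u v : (0 < Im tau)%R -> has_sum (fun n => TA1 a n tau u v + TA2 a n tau u v) (TA a tau u v).
Proof. by move=> Ht; apply: has_sum_plus; [exact: TA1_has_sum | exact: TA2_has_sum]. Qed.

(** By [gauss_separable], the coefficient chi(n) in [TA1] is itself an average over torsion shifts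
    of v, so both halves average the summands of the classical function. *)
Theorem TA_Kron a tau u v : (0 < Im tau)%R ->
  TA a tau u v = / W * sumC (fun h => cchi (Z.of_nat h) * Kron a tau u (shiftN h v)) (seq 0 N).
Proof.
move=> Ht; apply: (has_sum_unique _ _ _ (TA_has_sum a tau u v Ht)).
have H : has_sum (fun n => / W * sumC (fun h => cchi (Z.of_nat h) *
    (Q a n tau u (shiftN h v) + Q (1 - a) n tau (shiftN h v) u)) (seq 0 N))
  (/ W * sumC (fun h => cchi (Z.of_nat h) * Kron a tau u (shiftN h v)) (seq 0 N)).
  apply: has_sum_mult_l.
  apply: (has_sum_sumC (fun h n => cchi (Z.of_nat h) * (Q a n tau u (shiftN h v) + Q (1 - a) n tau (shiftN h v) u))
     (fun h => cchi (Z.of_nat h) * Kron a tau u (shiftN h v))) => h _.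
  by apply: has_sum_mult_l; exact: Kron_has_sum.
apply: has_sum_ext H => n; rewrite /TA1 /TA2.
have wn := W_nz.
have -> : chi n * Q a n tau u v = / W * sumC (fun h => cchi (Z.of_nat h) * Q a n tau u (shiftN h v)) (seq 0 N).
  rewrite (sumC_ext _ (fun h => cchi (Z.of_nat h) * (root_unity N (Z.of_nat h * n) * Q a n tau u v))).
    by rewrite gauss_sumC; field.
  by move=> h _; rewrite Q_shift_r.
rewrite -Cmult_plus_distr_l -sumC_plus; congr (_ * _); apply: sumC_ext => h _; ring.
Qed.

(** Only denominators whose coefficient is nonzero are constrained: [TA1] carries chi(n) and the
    shifts in [TA2] carry conj chi(h). *)
Definition regular1 (tau u : C) : Prop := forall n, chi n <> 0 -> Qden n tau u <> 0.

Definition regular2 (tau v : C) : Prop := forall n h, chi (Z.of_nat h) <> 0 -> Qden n tau (shiftN h v) <> 0.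

Definition regular tau u : Prop := regular1 tau u /\ regular2 tau u.

Lemma cchi_0 n : chi n = 0 -> cchi n = 0.
Proof. by move=> E; rewrite /conj_character E /Cconj /RtoC /=; congr (_, _); ring. Qed.

Lemma Qnum_succ e n tau u v : Qnum (e + 1) n tau u v = (Qden n tau u + 1) * Qnum e n tau u v.
Proof.
rewrite /Qden /Qnum; have -> : Cexp (u + twopii * Z2C n * tau) - 1 + 1 = Cexp (u + twopii * Z2C n * tau) by ring.
rewrite -Cexp_plus; congr Cexp; rewrite !Z2C_plus Z2C_1; ring.
Qed.

(** Since x / (x - 1) - 1 / (x - 1) = 1, raising the exponent by one changes each term by its bare
    numerator. The changes in the two halves are the same absolutely convergent series up to an
    index shift by a, and they cancel. *)
Lemma TA_step a tau u v : (0 < Im tau)%R -> regular1 tau u -> regular2 tau v -> TA (a + 1) tau u v = TA a tau u v.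
Proof.
move=> Ht Hu Hv.
pose G n := chi (n - a)%Z * Qnum (- a) n tau v u.
have HG : abs_summable G.
  by apply: (abs_summable_mult (fun n => chi (n - a)%Z) _ 1%R); [move=> n; exact: chi_le_1 | exact: Qnum_summable].
have [s Hs] := abs_summable_has_sum G HG.
have Hs' : has_sum (fun n => G (n + a)%Z) s.
  apply: (has_sum_bij _ (fun n => (n - a)%Z) (fun n => (n + a)%Z)) => [n|n|]; try ring.
  by apply: has_sum_ext Hs => n; congr G; ring.
have E n : (TA1 (a + 1) n tau u v + TA2 (a + 1) n tau u v) - (TA1 a n tau u v + TA2 a n tau u v) = G (n + a)%Z - G n.
  have e1 : TA1 (a + 1) n tau u v - TA1 a n tau u v = G (n + a)%Z.
    rewrite /TA1 /G; have -> : (n + a - a = n)%Z by ring.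
    case: (classic (chi n = 0)) => [->|c]; first by ring.
    have d := Hu n c.
    rewrite /Q Qnum_succ; have -> : Qnum (- a) (n + a) tau v u = Qnum a n tau u v.
      rewrite /Qnum; congr Cexp; have -> : (n + a + - a = n)%Z by ring.
      rewrite Z2C_plus; ring.
    by field.
  have e2 : TA2 a n tau u v - TA2 (a + 1) n tau u v = G n.
    rewrite /TA2 /G.
    transitivity (/ W * sumC (fun h => cchi (Z.of_nat h) * (root_unity N (Z.of_nat h * (n - a)) * Qnum (- a) n tau v u)) (seq 0 N)); last first.
      by rewrite gauss_sumC; field; exact: W_nz.
    have D : forall A B : C, / W * A - / W * B = / W * (A + - (1) * B) by move=> A B; ring.
    rewrite D; congr (_ * _).
    rewrite -sumC_mult_l -sumC_plus; apply: sumC_ext => h _.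
    case: (classic (chi (Z.of_nat h) = 0)) => [/cchi_0 ->|c]; first by ring.
    have d := Hv n h c.
    have -> : (1 - a = - a + 1)%Z by ring.
    have -> : (1 - (a + 1) = - a)%Z by ring.
    rewrite /Q Qnum_succ.
    have -> : root_unity N (Z.of_nat h * (n - a)) * Qnum (- a) n tau v u = Qnum (- a) n tau (shiftN h v) u.
      by rewrite Qnum_shift_l.
    by field.
  rewrite -e1 -e2; ring.
have H1 := has_sum_minus _ _ _ _ (TA_has_sum (a + 1) tau u v Ht) (TA_has_sum a tau u v Ht).
have H2 := has_sum_minus _ _ _ _ Hs' Hs.
have := has_sum_unique _ _ _ (has_sum_ext _ _ _ E H1) H2 => E2.
transitivity (TA (a + 1) tau u v - TA a tau u v + TA a tau u v); first by ring.
rewrite E2; ring.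
Qed.

Lemma TA_indep a tau u v : (0 < Im tau)%R -> regular1 tau u -> regular2 tau v -> TA a tau u v = TA 0 tau u v.
Proof.
move=> Ht Hu Hv.
have P (k : nat) : TA (Z.of_nat k) tau u v = TA 0 tau u v.
  elim: k => [//|k IH]; rewrite -IH -(TA_step (Z.of_nat k) tau u v Ht Hu Hv) Nat2Z.inj_succ; congr TA; lia.
have M (k : nat) : TA (- Z.of_nat k) tau u v = TA 0 tau u v.
  elim: k => [//|k IH]; rewrite -IH -(TA_step (- Z.of_nat (S k)) tau u v Ht Hu Hv); congr TA; lia.
case: (Z_le_gt_dec 0 a) => h.
- by rewrite -(Z2Nat.id a).
- have -> : a = (- Z.of_nat (Z.to_nat (- a)))%Z by lia.
  exact: M.
Qed.

Lemma Cexp_Z2C_period z k : Cexp (z + twopii * Z2C k) = Cexp z.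
Proof. exact: Cexp_period. Qed.

Local Notation NZ := (Z.of_nat N).

Definition ell_factor (tau u v : C) (m n : Z) : C :=
  Cexp (- (Z2C (NZ * NZ * m * n) * (twopii * tau)) - Z2C (NZ * m) * u - Z2C (NZ * n) * v).

Lemma Qden_translate k n s tau u :
  Qden k tau (u + twopii * (Z2C n * tau + Z2C s)) = Qden (k + n) tau u.
Proof.
rewrite /Qden; congr (_ - _).
have -> : u + twopii * (Z2C n * tau + Z2C s) + twopii * Z2C k * tau =
  u + twopii * Z2C (k + n) * tau + twopii * Z2C s by rewrite Z2C_plus; ring.
exact: Cexp_Z2C_period.
Qed.

(** Translating u shifts the index in [TA1] and translating v shifts it in [TA2]. Period N of chi
    leaves the coefficients alone, and the mismatch between the two shifts appears as the change of
    offset by (m - n) N. *)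
Lemma TA_translate a tau u v m n r s : (0 < Im tau)%R ->
  TA a tau (u + twopii * (Z2C (n * NZ) * tau + Z2C s)) (v + twopii * (Z2C (m * NZ) * tau + Z2C r)) =
  ell_factor tau u v m n * TA (a + (m - n) * NZ) tau u v.
Proof.
move=> Ht; set u' := u + _; set v' := v + _.
have cN : forall x k, chi (x + k * NZ)%Z = chi x by apply: periodic_mult; case: Hchi.
rewrite {2}/TA Cmult_plus_distr_l /TA; congr (_ + _); apply: has_sum_hsum.
- apply: (has_sum_bij _ (fun k => (k - n * NZ)%Z) (fun k => (k + n * NZ)%Z)) => [k|k|]; try ring.
  apply: has_sum_ext (has_sum_mult_l (ell_factor tau u v m n) _ _ (TA1_has_sum (a + (m - n) * NZ) tau u v Ht)) => k.
  rewrite /TA1 /Q Qden_translate; have -> : (k - n * NZ + n * NZ = k)%Z by ring.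
  have -> : chi (k - n * NZ)%Z = chi k by rewrite -(cN _ n); congr chi; ring.
  have -> : Qnum a (k - n * NZ) tau u' v' = ell_factor tau u v m n * Qnum (a + (m - n) * NZ) k tau u v.
    symmetry; rewrite /Qnum /ell_factor -Cexp_plus.
    rewrite -(Cexp_Z2C_period (_ + _) ((k - n * NZ) * r + (k - n * NZ + a) * s)).
    congr Cexp; rewrite /u' /v' !(Z2C_plus, Z2C_mult, Z2C_minus); ring.
  rewrite /Cdiv; ring.
- apply: (has_sum_bij _ (fun k => (k - m * NZ)%Z) (fun k => (k + m * NZ)%Z)) => [k|k|]; try ring.
  apply: has_sum_ext (has_sum_mult_l (ell_factor tau u v m n) _ _ (TA2_has_sum (a + (m - n) * NZ) tau u v Ht)) => k.
  rewrite /TA2 Cmult_assoc (Cmult_comm (ell_factor _ _ _ _ _)) -Cmult_assoc -sumC_mult_l.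
  congr (_ * _); apply: sumC_ext => h _; rewrite Cmult_assoc (Cmult_comm (ell_factor _ _ _ _ _)) -Cmult_assoc.
  congr (_ * _).
  have sh : shiftN h v' = shiftN h v + twopii * (Z2C (m * NZ) * tau + Z2C r).
    rewrite /shiftN /v'; ring.
  rewrite /Q sh Qden_translate; have -> : (k - m * NZ + m * NZ = k)%Z by ring.
  have -> : Qnum (1 - a) (k - m * NZ) tau (shiftN h v + twopii * (Z2C (m * NZ) * tau + Z2C r)) u' =
     ell_factor tau u v m n * Qnum (1 - (a + (m - n) * NZ)) k tau (shiftN h v) u.
    symmetry; rewrite /Qnum /ell_factor -Cexp_plus.
    (* The integer periods r and s contribute multiples of 2 pi i; the term n h arises because the
       factor is formed with v and not with the shifted v. *)
    rewrite -(Cexp_Z2C_period (_ + _) ((k - m * NZ) * s + (k - m * NZ + 1 - a) * r - n * Z.of_nat h)).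
    congr Cexp.
    have E : twopii * Z2C (n * Z.of_nat h) = Z2C (NZ * n) * (shiftN h v - v).
      rewrite /shiftN !Z2C_mult !Z2C_nat; field; exact: INR_N_nz.
    rewrite [Z2C (_ - n * Z.of_nat h)]Z2C_minus.
    have -> : forall A B, A + twopii * (B - Z2C (n * Z.of_nat h)) = A + twopii * B - twopii * Z2C (n * Z.of_nat h) by move=> A B; ring.
    rewrite E /u' !(Z2C_plus, Z2C_mult, Z2C_minus, Z2C_1); ring.
  rewrite /Cdiv; ring.
Qed.

Definition Ftw (tau u v : C) : C := / 2 * (TA 0 tau u v + TA 0 tau v u).

Theorem Ftw_elliptic tau u v m n r s : (0 < Im tau)%R -> regular tau u -> regular tau v ->
  Ftw tau (u + twopii * (Z2C (n * NZ) * tau + Z2C s)) (v + twopii * (Z2C (m * NZ) * tau + Z2C r)) =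
  ell_factor tau u v m n * Ftw tau u v.
Proof.
move=> Ht [u1 u2] [v1 v2]; rewrite /Ftw !TA_translate // !(TA_indep (0 + _)) //.
have -> : ell_factor tau v u n m = ell_factor tau u v m n.
  rewrite /ell_factor; congr Cexp; rewrite !Z2C_mult; ring.
ring.
Qed.

End Twisted.

(** * Double series in the region of convergence *)

Lemma has_sum_succ (f : nat -> C) a : has_sum (fun k => f (S k)) a -> has_sum f (f O + a).
Proof.
move=> H.
pose p := fun x : unit + nat => match x with inl _ => O | inr n => S n end.
pose r := fun n : nat => match n with O => inl tt | S n => inr n end.
apply: (has_sum_bij _ p r); [by case=> [[]|n] | by case | ].
apply: has_sum_sum => //.
have := has_sum_finite (fun _ : unit => f O) (tt :: nil).
rewrite /= Cplus_0_r; apply; first by repeat constructor; case.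
by case=> h; case: h; left.
Qed.

Lemma has_sum_Z3 (f : Z -> C) a b :
  has_sum (fun k => f (Z.of_nat (S k))) a -> has_sum (fun k => f (- Z.of_nat (S k))%Z) b ->
  has_sum f (f 0%Z + a + b).
Proof.
move=> Ha Hb; apply: has_sum_Z => //.
exact: (has_sum_succ (fun k => f (Z.of_nat k))).
Qed.

Lemma Cmod_lt_1_Cexp z : (Re z < 0)%R -> (Cmod (Cexp z) < 1)%R.
Proof. by move=> h; rewrite Cmod_Cexp -exp_0; apply: exp_increasing. Qed.

Lemma Cexp_neq_1 z : (Re z <> 0)%R -> Cexp z - 1 <> 0.
Proof.
move=> h; apply: Cminus_neq_0 => E; apply: h.
by apply: exp_inv; rewrite exp_0 -Cmod_Cexp E Cmod_1.
Qed.

Lemma has_sum_geom_pos A z (k : Z) : (Re z < 0)%R ->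
  has_sum (fun j : nat => Cexp (A + Z2C (k + Z.of_nat j) * z)) (- (Cexp (A + Z2C k * z) / (Cexp z - 1))).
Proof.
move=> Hz; have nz := Cexp_neq_1 z ltac:(lra).
have H := has_sum_mult_l (Cexp (A + Z2C k * z)) _ _ (has_sum_geom (Cexp z) (Cmod_lt_1_Cexp z Hz)).
have -> : - (Cexp (A + Z2C k * z) / (Cexp z - 1)) = Cexp (A + Z2C k * z) * / (1 - Cexp z).
  field; split=> // E; apply: nz; transitivity (- (1 - Cexp z)); [ring | rewrite E; ring].
apply: has_sum_ext H => j; rewrite Cexp_pow -Cexp_plus; congr Cexp; rewrite Z2C_plus Z2C_nat; ring.
Qed.

Lemma has_sum_geom_neg A z (k : Z) : (0 < Re z)%R ->
  has_sum (fun j : nat => Cexp (A + Z2C (k - 1 - Z.of_nat j) * z)) (Cexp (A + Z2C k * z) / (Cexp z - 1)).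
Proof.
move=> Hz; have nz := Cexp_neq_1 z ltac:(lra).
have := has_sum_geom_pos A (- z) (- (k - 1)) ltac:(rewrite /Re /= -/(Re z); lra).
have n0 := Cexp_nz z.
have -> : - (Cexp (A + Z2C (- (k - 1)) * - z) / (Cexp (- z) - 1)) = Cexp (A + Z2C k * z) / (Cexp z - 1).
  rewrite Cexp_opp; have -> : Cexp (A + Z2C k * z) = Cexp (A + Z2C (- (k - 1)) * - z) * Cexp z.
    rewrite -Cexp_plus; congr Cexp; rewrite Z2C_opp Z2C_minus Z2C_1; ring.
  field; split=> //; split=> // E; apply: nz; transitivity (- (1 - Cexp z)); [ring | rewrite E; ring].
apply: has_sum_ext => j; congr Cexp; rewrite !(Z2C_plus, Z2C_opp, Z2C_minus, Z2C_1); ring.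
Qed.

(** Choose th < 1 with U, V <= th Y. With m = i + 1 and n = j + 1 the exponent is at most Y (th^2 -
    (m - th)(n - th)), and (m - th)(n - th) >= (1 - th)^2 (i + j), which separates the two
    indices. *)
Lemma exp_quad_bound Y U V : (0 < Y)%R -> (U < Y)%R -> (V < Y)%R ->
  exists K r, (0 <= K)%R /\ (0 <= r < 1)%R /\ forall i j : nat,
    (exp (INR (S i) * U + INR (S j) * V - INR (S i) * INR (S j) * Y) <= K * r ^ i * r ^ j)%R.
Proof.
move=> HY HU HV.
pose th := Rmax 0 (Rmax U V / Y).
have th0 : (0 <= th)%R by exact: Rmax_l.
have m1 : (Rmax U V < Y)%R by exact: Rmax_lub_lt.
have thE : (Rmax U V / Y * Y = Rmax U V)%R by field; lra.
have th1 : (th < 1)%R.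
  apply: Rmax_lub_lt; first lra.
  by apply: (Rmult_lt_reg_r Y) => //; rewrite thE; lra.
have tm : (Rmax U V / Y <= th)%R by exact: Rmax_r.
have Ut : (U <= th * Y)%R by have := Rmax_l U V; nra.
have Vt : (V <= th * Y)%R by have := Rmax_r U V; nra.
pose d := (Y * ((1 - th) * (1 - th)))%R.
have d0 : (0 < d)%R by rewrite /d; repeat apply: Rmult_lt_0_compat; lra.
exists (exp (Y * (th * th))), (exp (- d)); split; first by left; exact: exp_pos.
split; first by split; [left; exact: exp_pos | rewrite -exp_0; apply: exp_increasing; lra].
move=> i j; rewrite -!exp_INR_mult -!exp_plus; apply: exp_le_compat.
rewrite !S_INR; have i0 := pos_INR i; have j0 := pos_INR j.
set x := INR i in i0 *; set y := INR j in j0 *.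
have h1 : ((x + 1) * U <= (x + 1) * (th * Y))%R by apply: Rmult_le_compat_l; lra.
have h2 : ((y + 1) * V <= (y + 1) * (th * Y))%R by apply: Rmult_le_compat_l; lra.
have h3 : ((1 - th) * (1 - th) * (x + y) <= (x + 1 - th) * (y + 1 - th))%R.
  have a1 : ((1 - th) * (x + 1) <= x + 1 - th)%R by nra.
  have a2 : ((1 - th) * (y + 1) <= y + 1 - th)%R by nra.
  apply: (Rle_trans _ ((1 - th) * (x + 1) * ((1 - th) * (y + 1)))%R).
    have -> : ((1 - th) * (x + 1) * ((1 - th) * (y + 1)) = (1 - th) * (1 - th) * (x + y) + (1 - th) * (1 - th) * (x * y + 1))%R by ring.
    have : (0 <= (1 - th) * (1 - th) * (x * y + 1))%R.
      have := Rmult_le_pos _ _ i0 j0; move=> ?; repeat apply: Rmult_le_pos; lra.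
    lra.
  by apply: Rmult_le_compat => //; nra.
have h4 : (Y * ((1 - th) * (1 - th) * (x + y)) <= Y * ((x + 1 - th) * (y + 1 - th)))%R by apply: Rmult_le_compat_l; lra.
rewrite /d; lra.
Qed.

Lemma bounded_sums_geom2 K r : (0 <= K)%R -> (0 <= r < 1)%R ->
  bounded_sums (fun p : nat * nat => (K * r ^ fst p * r ^ snd p)%R) (/ (1 - r) * K * / (1 - r)).
Proof.
move=> HK Hr.
have rp n : (0 <= r ^ n)%R by apply: pow_le; lra.
apply: (bounded_sums_prod _ (fun i => (/ (1 - r) * K * r ^ i)%R)).
- by move=> [i j] /=; apply: Rmult_le_pos => //; apply: Rmult_le_pos.
- move=> i; have -> : (/ (1 - r) * K * r ^ i = (K * r ^ i) * / (1 - r))%R by ring.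
  by apply: (bounded_sums_mult_l (K * r ^ i)%R (fun n => r ^ n)%R); [apply: Rmult_le_pos | exact: bounded_sums_geom].
- apply: (bounded_sums_mult_l _ (fun n => r ^ n)%R); last exact: bounded_sums_geom.
  by apply: Rmult_le_pos => //; left; apply: Rinv_0_lt_compat; lra.
Qed.

(** Equal to -log |q|, so that |q| < |xi| < 1/|q| becomes a condition on the real part of u. *)
Definition height (tau : C) : R := (2 * PI * Im tau)%R.

Lemma height_pos tau : (0 < Im tau)%R -> (0 < height tau)%R.
Proof. by move=> h; rewrite /height; have := PI_RGT_0; nra. Qed.

Lemma Re_translate n tau u : Re (u + twopii * Z2C n * tau) = (Re u - IZR n * height tau)%R.
Proof. rewrite /twopii /Z2C /height /Re /Im /=; ring. Qed.

Lemma Re_tr_pos tau (k : nat) t : (0 < Im tau)%R -> (t < height tau)%R -> (t - IZR (Z.of_nat (S k)) * height tau < 0)%R.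
Proof.
move=> /height_pos Ht h; rewrite -INR_IZR_INZ S_INR; have := pos_INR k; nra.
Qed.

Lemma Re_tr_neg tau (k : nat) t : (0 < Im tau)%R -> (- height tau < t)%R -> (0 < t - IZR (- Z.of_nat (S k)) * height tau)%R.
Proof.
move=> /height_pos Ht h; rewrite opp_IZR -INR_IZR_INZ S_INR; have := pos_INR k; nra.
Qed.

Section DoubleSeries.

Variables (w : Z -> C) (Bw : R) (Hw : forall n, (Cmod (w n) <= Bw)%R).

Variables (tau u v : C) (Ht : (0 < Im tau)%R).

Let Y := height tau.

Hypotheses (Hu : (- Y < Re u < Y)%R) (Hv : (- Y < Re v < Y)%R).

(** The weight sits on the second index only and is arbitrary, so the same expansion serves the
    character and the classical weight 1. *)
Definition cc (m n : Z) : C := w n * Cexp (Z2C m * u + Z2C n * v + Z2C (m * n) * (twopii * tau)).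

Definition Pquad (p : nat * nat) : C := cc (Z.of_nat (S (fst p))) (Z.of_nat (S (snd p))).

Definition Mquad (p : nat * nat) : C := cc (- Z.of_nat (S (fst p))) (- Z.of_nat (S (snd p))).

Lemma Cmod_cc_le m n : (Cmod (cc m n) <= Bw * exp (IZR m * Re u + IZR n * Re v - IZR m * IZR n * Y))%R.
Proof.
rewrite /cc Cmod_mult Cmod_Cexp.
have -> : Re (Z2C m * u + Z2C n * v + Z2C (m * n) * (twopii * tau)) = (IZR m * Re u + IZR n * Re v - IZR m * IZR n * Y)%R.
  rewrite Z2C_mult /Y /height /twopii /Z2C /Re /Im /=; ring.
by apply: Rmult_le_compat_r; [left; exact: exp_pos | exact: Hw].
Qed.

Lemma Bw_ge0 : (0 <= Bw)%R.
Proof. by have := Hw 0%Z; have := Cmod_ge_0 (w 0%Z); lra. Qed.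

Lemma Pquad_summable : abs_summable Pquad.
Proof.
have [K [r [K0 [Hr H]]]] := exp_quad_bound Y (Re u) (Re v) (height_pos tau Ht) (proj2 Hu) (proj2 Hv).
have b0 := Bw_ge0.
apply: (abs_summable_le _ (fun p => (Bw * K * r ^ fst p * r ^ snd p)%R) (/ (1 - r) * (Bw * K) * / (1 - r))%R); last first.
  by apply: bounded_sums_geom2 => //; apply: Rmult_le_pos.
move=> [i j]; apply: Rle_trans (Cmod_cc_le _ _) _.
rewrite -!INR_IZR_INZ [fst _]/= [snd _]/= !Rmult_assoc; apply: Rmult_le_compat_l => //.
have := H i j; rewrite !Rmult_assoc; exact.
Qed.

Lemma Mquad_summable : abs_summable Mquad.
Proof.
have [K [r [K0 [Hr H]]]] := exp_quad_bound Y (- Re u) (- Re v) (height_pos tau Ht) ltac:(lra) ltac:(lra).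
have b0 := Bw_ge0.
apply: (abs_summable_le _ (fun p => (Bw * K * r ^ fst p * r ^ snd p)%R) (/ (1 - r) * (Bw * K) * / (1 - r))%R); last first.
  by apply: bounded_sums_geom2 => //; apply: Rmult_le_pos.
move=> [i j]; apply: Rle_trans (Cmod_cc_le _ _) _.
rewrite !opp_IZR -!INR_IZR_INZ [fst _]/= [snd _]/= !Rmult_assoc; apply: Rmult_le_compat_l => //.
have := H i j; rewrite !Rmult_assoc => h; apply: Rle_trans h.
right; congr exp; ring.
Qed.

Definition Psum : C := hsum Pquad.

Definition Msum : C := hsum Mquad.

Lemma Psum_has_sum : has_sum Pquad Psum.
Proof. exact: hsum_correct Pquad_summable. Qed.

Lemma Msum_has_sum : has_sum Mquad Msum.
Proof. exact: hsum_correct Mquad_summable. Qed.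

Lemma has_sum_swap {I J} (f : I * J -> C) s : has_sum f s -> has_sum (fun p => f (snd p, fst p)) s.
Proof.
move=> H; apply: (has_sum_bij _ (fun p : I * J => (snd p, fst p)) (fun p => (snd p, fst p))); try by case.
by apply: has_sum_ext H => -[].
Qed.

Definition bil (n : Z) : C := w n * (Cexp (Z2C n * v) / Qden n tau u).

(** Here |x_n| < 1 and 1 / (x - 1) = -1 - (x + x^2 + ...): the constant part gives -s and the rest
    sums the positive quadrant by rows. *)
Lemma bil_pos s : has_sum (fun k => w (Z.of_nat (S k)) * Cexp (Z2C (Z.of_nat (S k)) * v)) s ->
  has_sum (fun k => bil (Z.of_nat (S k))) (- s - Psum).
Proof.
move=> Hs.
have H : has_sum (fun j => - (w (Z.of_nat (S j)) * Cexp (Z2C (Z.of_nat (S j)) * v)) - bil (Z.of_nat (S j))) Psum.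
  apply: has_sum_fubini (has_sum_swap _ _ Psum_has_sum) _ => j.
  set n := Z.of_nat (S j).
  pose z := u + twopii * Z2C n * tau.
  have Rz : (Re z < 0)%R by rewrite /z Re_translate; exact: (Re_tr_pos tau j (Re u) Ht (proj2 Hu)).
  have := has_sum_mult_l (w n) _ _ (has_sum_geom_pos (Z2C n * v) z 1 Rz).
  have -> : w n * - (Cexp (Z2C n * v + Z2C 1 * z) / (Cexp z - 1)) = - (w n * Cexp (Z2C n * v)) - bil n.
    rewrite /bil /Qden -/z Z2C_1 Cmult_1_l Cexp_plus; field; apply: Cexp_neq_1; lra.
  apply: has_sum_ext => i; rewrite /Pquad /cc; cbn [fst snd]; rewrite -/n; congr (_ * Cexp _).
  have -> : (1 + Z.of_nat i = Z.of_nat (S i))%Z by lia.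
  rewrite /z Z2C_mult; ring.
have := has_sum_minus _ _ _ _ (has_sum_opp _ _ Hs) H.
apply: has_sum_ext => k; ring.
Qed.

Lemma bil_neg : has_sum (fun k => bil (- Z.of_nat (S k))) Msum.
Proof.
apply: has_sum_fubini (has_sum_swap _ _ Msum_has_sum) _ => j.
set n := (- Z.of_nat (S j))%Z.
pose z := u + twopii * Z2C n * tau.
have Rz : (0 < Re z)%R by rewrite /z Re_translate; exact: (Re_tr_neg tau j (Re u) Ht (proj1 Hu)).
have := has_sum_mult_l (w n) _ _ (has_sum_geom_neg (Z2C n * v) z 0 Rz).
have -> : w n * (Cexp (Z2C n * v + Z2C 0 * z) / (Cexp z - 1)) = bil n.
  by rewrite /bil /Qden -/z Z2C_0 Cmult_0_l Cplus_0_r.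
apply: has_sum_ext => i; rewrite /Mquad /cc; cbn [fst snd]; rewrite -/n; congr (_ * Cexp _).
have -> : (0 - 1 - Z.of_nat i = - Z.of_nat (S i))%Z by lia.
rewrite /z Z2C_mult; ring.
Qed.

Lemma abs_summable_inj {I J} (f : I -> C) (p : J -> I) :
  (forall x y, p x = p y -> x = y) -> abs_summable f -> abs_summable (fun j => f (p j)).
Proof. by move=> inj [M HM]; exists M; apply: (bounded_sums_inj (fun i => Cmod (f i)) p M inj HM). Qed.

(** The diagonal goes to the first part. Rows of the two parts are geometric series starting at the
    diagonal, which is how [TA1] and [TA2] appear. *)
Lemma split_quadrant (f : nat * nat -> C) s : abs_summable f -> has_sum f s ->
  exists a b, s = a + b /\ has_sum (fun p => f (fst p + snd p, fst p)%nat) a /\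
    has_sum (fun p => f (fst p, S (fst p + snd p))%nat) b.
Proof.
move=> Hf Hs.
have [a Ha] := abs_summable_has_sum _ (abs_summable_inj f (fun p : nat * nat => (fst p + snd p, fst p)%nat)
  ltac:(by move=> [x y] [x' y'] /= [e1 e2]; congr (_, _); lia) Hf).
have [b Hb] := abs_summable_has_sum _ (abs_summable_inj f (fun p : nat * nat => (fst p, S (fst p + snd p))%nat)
  ltac:(by move=> [x y] [x' y'] /= [e1 e2]; congr (_, _); lia) Hf).
exists a, b; split=> //; apply: has_sum_unique Hs _.
pose p (x : nat * nat + nat * nat) := match x with
  inl q => (fst q + snd q, fst q)%nat | inr q => (fst q, S (fst q + snd q))%nat end.
pose r (q : nat * nat) : nat * nat + nat * nat := match le_lt_dec (snd q) (fst q) with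
  left _ => inl (snd q, fst q - snd q)%nat | right _ => inr (fst q, snd q - fst q - 1)%nat end.
apply: (has_sum_bij _ p r).
- move=> [[i j]|[i j]]; rewrite /p /r; cbn [fst snd].
  + case: (le_lt_dec i (i + j)) => h; [f_equal; f_equal; lia | lia].
  + case: (le_lt_dec (S (i + j)) i) => h; [lia | f_equal; f_equal; lia].
- move=> [i j]; rewrite /p /r; cbn [fst snd]; case: (le_lt_dec j i) => h; cbn [fst snd]; congr (_, _); lia.
- exact: has_sum_sum.
Qed.

End DoubleSeries.

Section TwistedDouble.

Variables (N : nat) (chi : Z -> C) (HN : (1 <= N)%nat) (Hprim : primitive_character N chi).

Local Notation W := (gauss_sum N (conj_character chi)).

Local Notation cchi := (conj_character chi).

Variables (tau u v : C) (Ht : (0 < Im tau)%R).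

Local Notation Y := (height tau).

Hypotheses (Hu : (- Y < Re u < Y)%R) (Hv : (- Y < Re v < Y)%R).

(** The rational function that equals minus the sum of chi(n) e^(n x) over n >= 1 where this series
    converges. *)
Definition Trat (x : C) : C := / W * sumC (fun h => cchi (Z.of_nat h) * (Cexp (shiftN N h x) / (Cexp (shiftN N h x) - 1))) (seq 0 N).

Lemma Re_shiftN h x : Re (shiftN N h x) = Re x.
Proof.
have E : twopii * RtoC (INR h) / RtoC (INR N) = twopii * RtoC (INR h / INR N).
  rewrite RtoC_div; last by apply: not_0_INR; lia.
  by rewrite /Cdiv Cmult_assoc.
rewrite /shiftN E; have -> : Re (x + twopii * RtoC (INR h / INR N)) = (Re x + Re (twopii * RtoC (INR h / INR N)))%R by [].
rewrite twopii_Re im_RtoC; ring.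
Qed.

(** Gauss averaging of N geometric rows in the shifted variables produces one row with coefficients
    chi(g j). The sign [sg] lets ascending and descending expansions share the proof. *)
Lemma TA2_row (sg : C) (k : Z) (A : C) (l : Z) (g : nat -> Z) :
  (forall h, has_sum (fun j => Cexp (A + Z2C (g j) * (shiftN N h v + twopii * Z2C k * tau)))
     (sg * (Cexp (A + Z2C l * (shiftN N h v + twopii * Z2C k * tau)) / Qden k tau (shiftN N h v)))) ->
  has_sum (fun j => chi (g j) * Cexp (A + Z2C (g j) * (v + twopii * Z2C k * tau)))
    (sg * (/ W * sumC (fun h => cchi (Z.of_nat h) * (Cexp (A + Z2C l * (shiftN N h v + twopii * Z2C k * tau)) / Qden k tau (shiftN N h v))) (seq 0 N))).
Proof.
move=> H.
pose s h := sg * (Cexp (A + Z2C l * (shiftN N h v + twopii * Z2C k * tau)) / Qden k tau (shiftN N h v)).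
have H1 : has_sum (fun j => / W * sumC (fun h => cchi (Z.of_nat h) * Cexp (A + Z2C (g j) * (shiftN N h v + twopii * Z2C k * tau))) (seq 0 N))
  (/ W * sumC (fun h => cchi (Z.of_nat h) * s h) (seq 0 N)).
  apply: has_sum_mult_l.
  apply: (has_sum_sumC (fun h j => cchi (Z.of_nat h) * Cexp (A + Z2C (g j) * (shiftN N h v + twopii * Z2C k * tau)))
    (fun h => cchi (Z.of_nat h) * s h)) => h _.
  by apply: has_sum_mult_l; exact: H.
have E1 : / W * sumC (fun h => cchi (Z.of_nat h) * s h) (seq 0 N) =
   sg * (/ W * sumC (fun h => cchi (Z.of_nat h) * (Cexp (A + Z2C l * (shiftN N h v + twopii * Z2C k * tau)) / Qden k tau (shiftN N h v))) (seq 0 N)).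
  have D (x y z : C) : x * (y * z) = y * (x * z) by ring.
  rewrite (D sg) -(sumC_mult_l sg); congr (_ * _).
  apply: sumC_ext => h _; rewrite /s; ring.
rewrite E1 in H1.
apply: has_sum_ext H1 => j.
rewrite (sumC_ext _ (fun h => cchi (Z.of_nat h) * (root_unity N (Z.of_nat h * g j) * Cexp (A + Z2C (g j) * (v + twopii * Z2C k * tau))))); last first.
  move=> h _; congr (_ * _).
  have -> : Cexp (A + Z2C (g j) * (shiftN N h v + twopii * Z2C k * tau)) =
     Cexp (A + Z2C (g j) * (twopii * Z2C k * tau)) * Cexp (Z2C (g j) * shiftN N h v).
    rewrite -Cexp_plus; congr Cexp; ring.
  rewrite (shiftN_exp N HN).
  have -> : Cexp (A + Z2C (g j) * (v + twopii * Z2C k * tau)) =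
     Cexp (A + Z2C (g j) * (twopii * Z2C k * tau)) * Cexp (Z2C (g j) * v).
    rewrite -Cexp_plus; congr Cexp; ring.
  ring.
rewrite (gauss_sumC N chi HN Hprim); field; exact: (W_nz N chi HN Hprim).
Qed.

Lemma TA2_as_row k : TA2 N chi 0 k tau u v =
  / W * sumC (fun h => cchi (Z.of_nat h) * (Cexp (Z2C k * u + Z2C (k + 1) * (shiftN N h v + twopii * Z2C k * tau)) / Qden k tau (shiftN N h v))) (seq 0 N).
Proof. by rewrite /TA2 /Q /Qnum. Qed.

Theorem TA_double_series :
  TA N chi 0 tau u v = chi 0%Z / (Cexp u - 1) + Trat v - Psum chi tau u v + Msum chi tau u v.
Proof.
have cb := chi_le_1 N chi HN Hprim.
have [a [b [EP [Ha Hb]]]] := split_quadrant _ _ (Pquad_summable chi 1 cb tau u v Ht Hu Hv) (Psum_has_sum chi 1 cb tau u v Ht Hu Hv).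
have sM := Mquad_summable chi 1 cb tau u v Ht Hu Hv.
have [b' [a' [EM [Hb' Ha']]]] := split_quadrant (fun p => Mquad chi tau u v (snd p, fst p)) _
   (abs_summable_inj _ (fun p : nat * nat => (snd p, fst p)) ltac:(by move=> [x y] [x' y'] [-> ->]) sM)
   (has_sum_swap _ _ (Msum_has_sum chi 1 cb tau u v Ht Hu Hv)).
have T1p : has_sum (fun k => TA1 chi 0 (Z.of_nat (S k)) tau u v) (- a).
  have H : has_sum (fun k => - TA1 chi 0 (Z.of_nat (S k)) tau u v) a.
    apply: has_sum_fubini Ha _ => i; set n := Z.of_nat (S i).
    pose z := u + twopii * Z2C n * tau.
    have Rz : (Re z < 0)%R by rewrite /z Re_translate; exact: (Re_tr_pos tau i (Re u) Ht (proj2 Hu)).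
    have := has_sum_mult_l (chi n) _ _ (has_sum_geom_pos (Z2C n * v) z n Rz).
    have -> : chi n * - (Cexp (Z2C n * v + Z2C n * z) / (Cexp z - 1)) = - TA1 chi 0 n tau u v.
      rewrite /TA1 /Q /Qnum Z.add_0_r /Qden -/z /Cdiv; ring.
    apply: has_sum_ext => j; rewrite /Pquad /cc; cbn [fst snd]; rewrite -/n; congr (_ * Cexp _).
    have -> : Z.of_nat (S (i + j)) = (n + Z.of_nat j)%Z by rewrite /n; lia.
    rewrite /z Z2C_mult; ring.
  by apply: has_sum_ext (has_sum_opp _ _ H) => k; ring.
have T2p : has_sum (fun k => TA2 N chi 0 (Z.of_nat (S k)) tau u v) (- b).
  have H : has_sum (fun k => - TA2 N chi 0 (Z.of_nat (S k)) tau u v) b.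
    apply: has_sum_fubini Hb _ => i; set k := Z.of_nat (S i).
    have -> : - TA2 N chi 0 k tau u v = - (1) * TA2 N chi 0 k tau u v by ring.
    rewrite TA2_as_row.
    have := TA2_row (- (1)) k (Z2C k * u) (k + 1) (fun j => (k + 1 + Z.of_nat j)%Z) _.
    move=> G; apply: has_sum_ext (G _) => [j|h].
    - rewrite /Pquad /cc; cbn [fst snd]; rewrite -/k.
      have -> : Z.of_nat (S (S (i + j))) = (k + 1 + Z.of_nat j)%Z by rewrite /k; lia.
      congr (_ * Cexp _); rewrite Z2C_mult; ring.
    - set z := shiftN N h v + _.
      have Rz : (Re z < 0)%R by rewrite /z Re_translate Re_shiftN; exact: (Re_tr_pos tau i (Re v) Ht (proj2 Hv)).
      have := has_sum_geom_pos (Z2C k * u) z (k + 1) Rz.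
      by have -> : - (Cexp (Z2C k * u + Z2C (k + 1) * z) / (Cexp z - 1)) = - (1) * (Cexp (Z2C k * u + Z2C (k + 1) * z) / Qden k tau (shiftN N h v)) by rewrite /Qden -/z; ring.
  by apply: has_sum_ext (has_sum_opp _ _ H) => k; ring.
have T1m : has_sum (fun k => TA1 chi 0 (- Z.of_nat (S k)) tau u v) a'.
  apply: has_sum_fubini Ha' _ => i; set n := (- Z.of_nat (S i))%Z.
  pose z := u + twopii * Z2C n * tau.
  have Rz : (0 < Re z)%R by rewrite /z Re_translate; exact: (Re_tr_neg tau i (Re u) Ht (proj1 Hu)).
  have := has_sum_mult_l (chi n) _ _ (has_sum_geom_neg (Z2C n * v) z n Rz).
  have -> : chi n * (Cexp (Z2C n * v + Z2C n * z) / (Cexp z - 1)) = TA1 chi 0 n tau u v.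
    by rewrite /TA1 /Q /Qnum Z.add_0_r /Qden -/z.
  apply: has_sum_ext => j; rewrite /Mquad /cc; cbn [fst snd]; rewrite -/n; congr (_ * Cexp _).
  have -> : (- Z.of_nat (S (S (i + j))) = n - 1 - Z.of_nat j)%Z by rewrite /n; lia.
  rewrite /z Z2C_mult; ring.
have T2m : has_sum (fun k => TA2 N chi 0 (- Z.of_nat (S k)) tau u v) b'.
  apply: has_sum_fubini Hb' _ => i; set k := (- Z.of_nat (S i))%Z.
  have -> : TA2 N chi 0 k tau u v = 1 * TA2 N chi 0 k tau u v by ring.
  rewrite TA2_as_row.
  have := TA2_row 1 k (Z2C k * u) (k + 1) (fun j => (k + 1 - 1 - Z.of_nat j)%Z) _.
  move=> G; apply: has_sum_ext (G _) => [j|h].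
  - rewrite /Mquad /cc; cbn [fst snd]; rewrite -/k.
    have -> : (- Z.of_nat (S (i + j)) = k + 1 - 1 - Z.of_nat j)%Z by rewrite /k; lia.
    congr (_ * Cexp _); rewrite Z2C_mult; ring.
  - set z := shiftN N h v + _.
    have Rz : (0 < Re z)%R by rewrite /z Re_translate Re_shiftN; exact: (Re_tr_neg tau i (Re v) Ht (proj1 Hv)).
    by have := has_sum_geom_neg (Z2C k * u) z (k + 1) Rz; rewrite Cmult_1_l.
have S1 := has_sum_Z3 (fun k => TA1 chi 0 k tau u v) _ _ T1p T1m.
have S2 := has_sum_Z3 (fun k => TA2 N chi 0 k tau u v) _ _ T2p T2m.
rewrite /TA (has_sum_hsum _ _ S1) (has_sum_hsum _ _ S2) EP EM.
have e1 : TA1 chi 0 0 tau u v = chi 0%Z / (Cexp u - 1).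
  rewrite /TA1 /Q /Qnum /Qden Z2C_0; have -> : Cexp (0 * v + Z2C (0 + 0) * (u + twopii * 0 * tau)) = 1.
    rewrite -Cexp_0; congr Cexp; rewrite Z2C_0; ring.
  have -> : u + twopii * 0 * tau = u by ring.
  rewrite /Cdiv; ring.
have e2 : TA2 N chi 0 0 tau u v = Trat v.
  rewrite TA2_as_row /Trat; congr (_ * _); apply: sumC_ext => h _; congr (_ * _).
  rewrite /Qden Z2C_0; have -> : shiftN N h v + twopii * 0 * tau = shiftN N h v by ring.
  congr (Cexp _ / _); rewrite Z2C_1; ring.
rewrite e1 e2; ring.
Qed.

End TwistedDouble.

(** Taking logarithms of moduli turns the annuli of the region into vertical strips for u and v. *)
Lemma region_strip tau u v : kronecker_region tau u v ->
  (0 < Im tau)%R /\ (- height tau < Re u < 0)%R /\ (- height tau < Re v < 0)%R.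
Proof.
have E : Cmod (nome tau) = exp (- height tau).
  rewrite /nome Cmod_Cexp -/twopii twopii_Re /height; congr exp.
have L x y : (exp x < exp y)%R -> (x < y)%R by exact: exp_lt_inv.
move=> [Ht [[u1 u2] [v1 v2]]]; rewrite E !Cmod_Cexp -?exp_0 in u1 u2 v1 v2.
by split=> //; split; split; apply: L.
Qed.

Lemma nome_pow tau n : Cpowz (nome tau) n = Cexp (Z2C n * (twopii * tau)).
Proof. by rewrite /nome Cpowz_Cexp. Qed.

Lemma bil_term (w : Z -> C) tau u v n :
  w n * (Cpowz (Cexp v) n / (Cexp u * Cpowz (nome tau) n - 1)) = bil w tau u v n.
Proof.
rewrite /bil Cpowz_Cexp nome_pow -Cexp_plus /Qden -/(Z2C n); congr (_ * (_ / (Cexp _ - _))); ring.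
Qed.

Section Bilateral.

Variables (w : Z -> C) (Bw : R) (Hw : forall n, (Cmod (w n) <= Bw)%R).

Variables (tau u v s : C) (Ht : (0 < Im tau)%R).

Hypotheses (Hu : (- height tau < Re u < 0)%R) (Hv : (- height tau < Re v < 0)%R).

Hypothesis Hs : has_sum (fun k => w (Z.of_nat (S k)) * Cexp (Z2C (Z.of_nat (S k)) * v)) s.

Let hp := height_pos tau Ht.

Lemma bil_0 : bil w tau u v 0 = w 0%Z / (Cexp u - 1).
Proof.
rewrite /bil /Qden Z2C_0; have -> : Cexp (0 * v) = 1 by rewrite -Cexp_0; congr Cexp; ring.
have -> : u + twopii * 0 * tau = u by ring.
rewrite /Cdiv; ring.
Qed.

Lemma bil_has_sum : has_sum (bil w tau u v) (w 0%Z / (Cexp u - 1) - s - Psum w tau u v + Msum w tau u v).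
Proof.
have Hu' : (- height tau < Re u < height tau)%R by lra.
have Hv' : (- height tau < Re v < height tau)%R by lra.
have := has_sum_Z3 _ _ _ (bil_pos w Bw Hw tau u v Ht Hu' Hv' s Hs) (bil_neg w Bw Hw tau u v Ht Hu' Hv').
by rewrite bil_0; have -> : w 0%Z / (Cexp u - 1) + (- s - Psum w tau u v) + Msum w tau u v =
  w 0%Z / (Cexp u - 1) - s - Psum w tau u v + Msum w tau u v by ring.
Qed.

Lemma bil_CSeriesZ : CSeriesZ (bil w tau u v) = w 0%Z / (Cexp u - 1) - s - Psum w tau u v + Msum w tau u v.
Proof.
have Hu' : (- height tau < Re u < height tau)%R by lra.
have Hv' : (- height tau < Re v < height tau)%R by lra.
have H1 := bil_pos w Bw Hw tau u v Ht Hu' Hv' s Hs.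
have H0 := has_sum_succ (fun k => bil w tau u v (Z.of_nat k)) _ H1.
rewrite (has_sum_CSeriesZ _ _ _ H0 (bil_neg w Bw Hw tau u v Ht Hu' Hv')) [Z.of_nat 0]/= bil_0; ring.
Qed.

End Bilateral.

Lemma CSeriesZ_ext f g : (forall n, f n = g n) -> CSeriesZ f = CSeriesZ g.
Proof. by move=> H; congr CSeriesZ; apply: FunctionalExtensionality.functional_extensionality. Qed.

Lemma sumC_filter {I} (f : I -> C) (b : I -> bool) l :
  sumC f (filter b l) = sumC (fun i => match b i with true => f i | false => 0 end) l.
Proof. elim: l => [|x l IH] //=; case: (b x) => /=; rewrite IH //; ring. Qed.

Lemma sumC_seq_m (f : nat -> C) n : sumC f (seq 1 n) = sum_n_m f 1 n.
Proof.
elim: n => [|n IH]; first by rewrite sum_n_m_zero //; lia.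
rewrite seq_S sumC_app IH sum_n_Sm; last lia.
by rewrite /= Cplus_0_r.
Qed.

Lemma divisor_sum_sumC n (f : nat -> C) : divisor_sum n f = sumC f (filter (fun d => (n mod d =? 0)%nat) (seq 1 n)).
Proof. by rewrite /divisor_sum -sumC_seq_m sumC_filter. Qed.

Definition divisor_pairs (k : nat) : list (nat * nat) :=
  map (fun d => (d - 1, S k / d - 1)%nat) (filter (fun d => (S k mod d =? 0)%nat) (seq 1 (S k))).

Lemma divisor_pairs_spec p k : In p (divisor_pairs k) <-> (S (fst p) * S (snd p) - 1)%nat = k.
Proof.
case: p => i j; rewrite /divisor_pairs in_map_iff; cbn [fst snd]; split.
- move=> [d [[e1 e2] /filter_In [/in_seq hd /Nat.eqb_eq hm]]].
  have d0 : d <> 0%nat by lia.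
  have := Nat.div_mod (S k) d d0; rewrite hm => E.
  have q0 : (S k / d)%nat <> 0%nat by move=> q; rewrite q in E; lia.
  have -> : S i = d by lia.
  have -> : S j = (S k / d)%nat by lia.
  lia.
- move=> E; have E2 : (S k = S j * S i)%nat by lia.
  exists (S i); split; first by rewrite E2 Nat.div_mul //; congr (_, _); lia.
  apply/filter_In; split; first by apply/in_seq; nia.
  by apply/Nat.eqb_eq; rewrite E2 Nat.Div0.mod_mul.
Qed.

Lemma divisor_pairs_NoDup k : NoDup (divisor_pairs k).
Proof.
apply: NoDup_map_NoDup_ForallPairs; last by apply: NoDup_filter; exact: seq_NoDup.
by move=> x y /filter_In [/in_seq hx _] /filter_In [/in_seq hy _] [e _]; lia.
Qed.

(** The pairs with product k + 1 are indexed by the divisors of k + 1, so the double series is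
    grouped by its power of q. *)
Lemma has_sum_divisors (f : nat -> nat -> C) s :
  has_sum (fun p => f (S (fst p)) (S (snd p))) s ->
  has_sum (fun k => divisor_sum (S k) (fun d => f d (S k / d)%nat)) s.
Proof.
move=> H; apply: has_sum_ext (has_sum_fiber _ _ divisor_pairs s divisor_pairs_NoDup (fun p k => divisor_pairs_spec p k) H).
move=> k; rewrite divisor_sum_sumC /divisor_pairs sumC_map; apply: sumC_ext.
move=> d /filter_In [/in_seq hd /Nat.eqb_eq hm]; cbn [fst snd].
have d0 : d <> 0%nat by lia.
have := Nat.div_mod (S k) d d0; rewrite hm => E.
have q0 : (S k / d)%nat <> 0%nat by move=> q; rewrite q in E; lia.
by have -> : S (d - 1) = d by [lia]; have -> : S (S k / d - 1) = (S k / d)%nat by lia.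
Qed.

Lemma divisor_sum_mult n (f : nat -> C) c : divisor_sum n f * c = divisor_sum n (fun d => f d * c).
Proof.
rewrite !divisor_sum_sumC Cmult_comm -sumC_mult_l; apply: sumC_ext => d _; ring.
Qed.

Lemma divisor_sum_ext n (f g : nat -> C) : (forall d, (1 <= d <= n)%nat -> (n mod d)%nat = 0%nat -> f d = g d) ->
  divisor_sum n f = divisor_sum n g.
Proof.
move=> H; rewrite !divisor_sum_sumC; apply: sumC_ext => d /filter_In [/in_seq hd /Nat.eqb_eq hm]; apply: H => //; lia.
Qed.

Section Region.

Variables (N : nat) (chi : Z -> C) (HN : (1 <= N)%nat) (Hprim : primitive_character N chi) (Heven : even_character chi).

Let Hchi : dirichlet_character N chi := proj1 Hprim.

Local Notation W := (gauss_sum N (conj_character chi)).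

Local Notation cchi := (conj_character chi).

Let cb := chi_le_1 N chi HN Hprim.

Lemma Trat_series x : (Re x < 0)%R ->
  has_sum (fun k => chi (Z.of_nat (S k)) * Cexp (Z2C (Z.of_nat (S k)) * x)) (- Trat N chi x).
Proof.
move=> Hx.
(* At tau = 0 and k = 0 the row of [TA2_row] is the plain character series in e^x. *)
have := TA2_row N chi HN Hprim 0 x (- (1)) 0 0 1 (fun j => (1 + Z.of_nat j)%Z).
have E h : shiftN N h x + twopii * Z2C 0 * 0 = shiftN N h x by ring.
have -> : - (1) * (/ W * sumC (fun h => cchi (Z.of_nat h) * (Cexp (0 + Z2C 1 * (shiftN N h x + twopii * Z2C 0 * 0)) / Qden 0 0 (shiftN N h x))) (seq 0 N)) = - Trat N chi x.
  have -> : forall A, - (1) * A = - A by move=> A; ring.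
  congr (- _); rewrite /Trat; congr (_ * _); apply: sumC_ext => h _; congr (_ * _).
  rewrite /Qden E; congr (Cexp _ / _); rewrite Z2C_1; ring.
move=> H; apply: has_sum_ext (H _) => [j|h].
- have -> : (1 + Z.of_nat j = Z.of_nat (S j))%Z by lia.
  congr (_ * Cexp _); rewrite Z2C_0; ring.
- rewrite /Qden E.
  have := has_sum_geom_pos 0 (shiftN N h x) 1 ltac:(by rewrite (Re_shiftN N HN)).
  by have -> : - (Cexp (0 + Z2C 1 * shiftN N h x) / (Cexp (shiftN N h x) - 1)) = - (1) * (Cexp (0 + Z2C 1 * shiftN N h x) / (Cexp (shiftN N h x) - 1)) by ring.
Qed.

Lemma chi_0_or : N = 1%nat \/ chi 0%Z = 0.
Proof.
case: (Nat.eq_dec N 1) => h; [by left | right].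
apply: (char_0 N chi Hchi) => /Zgcd_1_rel_prime; rewrite Z.gcd_0_l; lia.
Qed.

Lemma bil_chi_total tau u v : kronecker_region tau u v -> has_sum (bil chi tau u v) (TA N chi 0 tau u v) /\
  CSeriesZ (bil chi tau u v) = TA N chi 0 tau u v.
Proof.
move=> /region_strip [Ht [Hu Hv]].
have hp := height_pos tau Ht.
have Hs := Trat_series v (proj2 Hv).
rewrite (TA_double_series N chi HN Hprim tau u v Ht); [|lra|lra].
have -> : Trat N chi v = - - Trat N chi v by ring.
split.
- exact: (bil_has_sum chi 1 cb tau u v _ Ht Hu Hv Hs).
- exact: (bil_CSeriesZ chi 1 cb tau u v _ Ht Hu Hv Hs).
Qed.

Lemma region_sym tau u v : kronecker_region tau u v -> kronecker_region tau v u.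
Proof. by move=> [h1 [h2 h3]]. Qed.

Theorem twisted_kronecker_Ftw tau u v : kronecker_region tau u v ->
  Ftw N chi tau u v = twisted_kronecker chi tau u v.
Proof.
move=> H; rewrite /Ftw /twisted_kronecker.
have [_ <-] := bil_chi_total tau u v H.
have [_ <-] := bil_chi_total tau v u (region_sym _ _ _ H).
congr (_ * (_ + _)); apply: CSeriesZ_ext => n; by rewrite bil_term.
Qed.

(** Each fraction is brought to the denominator xi^N - 1 by a finite geometric sum with exponents 1
    to N; the Gauss average turns its root-of-unity factors into chi. *)
Lemma Trat_rational x : Cexp x ^ N - 1 <> 0 ->
  Trat N chi x = sumC (fun k => chi (Z.of_nat (S k)) * Cexp x ^ S k) (seq 0 N) / (Cexp x ^ N - 1).
Proof.
move=> nz.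
have hx h : Cexp (shiftN N h x) ^ N = Cexp x ^ N.
  rewrite !Cexp_pow -Z2C_nat (shiftN_exp N HN); rewrite (root_unity_N N HN (Z.of_nat h)); ring.
have E h : Cexp (shiftN N h x) / (Cexp (shiftN N h x) - 1) =
   sumC (fun k => root_unity N (Z.of_nat h * Z.of_nat (S k)) * Cexp x ^ S k) (seq 0 N) / (Cexp x ^ N - 1).
  have n1 : Cexp (shiftN N h x) <> 1.
    by move=> e; apply: nz; rewrite -(hx h) e Cpow_1_l; ring.
  have -> : sumC (fun k => root_unity N (Z.of_nat h * Z.of_nat (S k)) * Cexp x ^ S k) (seq 0 N) =
     Cexp (shiftN N h x) * sumC (fun k => Cexp (shiftN N h x) ^ k) (seq 0 N).
    rewrite -sumC_mult_l; apply: sumC_ext => k _.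
    rewrite -[Cexp (shiftN N h x) * _]/(Cexp (shiftN N h x) ^ S k) !Cexp_pow -Z2C_nat (shiftN_exp N HN).
    by [].
  rewrite (sumC_geom _ _ n1) hx; field; split=> //; exact: Cminus_neq_0.
rewrite /Trat.
rewrite (sumC_ext _ (fun h => / (Cexp x ^ N - 1) * sumC (fun k => cchi (Z.of_nat h) * (root_unity N (Z.of_nat h * Z.of_nat (S k)) * Cexp x ^ S k)) (seq 0 N))).
  rewrite sumC_mult_l sumC_swap.
  rewrite (sumC_ext _ (fun k => W * (chi (Z.of_nat (S k)) * Cexp x ^ S k))).
    rewrite sumC_mult_l; field; split=> //; exact: (W_nz N chi HN Hprim).
  move=> k _; rewrite (gauss_sumC N chi HN Hprim); ring.
move=> h _; rewrite E sumC_mult_l /Cdiv; ring.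
Qed.

(** The term h = 0 is nonzero only for N = 1, where xi^N = xi; it is exactly the term with
    chi(0). *)
Lemma polar_part x : Cexp x ^ N - 1 <> 0 ->
  sum_n (fun h => chi (Z.of_nat h) * (Cexp x ^ h / (Cexp x ^ N - 1))) N = chi 0%Z / (Cexp x - 1) + Trat N chi x.
Proof.
move=> nz; rewrite -sumC_seq -[seq 0 (S N)]/(O :: seq 1 N) [sumC _ _]/= -seq_shift sumC_map Trat_rational //.
congr (_ + _).
- case: chi_0_or => [E|->]; last by rewrite /Cdiv; ring.
  rewrite E in nz *; rewrite /= Cmult_1_r in nz *; rewrite /Cdiv; ring.
- rewrite [RHS]Cmult_comm -sumC_mult_l; apply: sumC_ext => k _; rewrite /Cdiv; ring.
Qed.

(** Twice the sinh series of the Fourier expansion. Being a combination of quadrant sums, it is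
    usable in the whole strip and not only in the region of the bilateral series. *)
Definition sinh_sum tau u v : C := Psum chi tau u v + Psum chi tau v u - (Msum chi tau u v + Msum chi tau v u).

Lemma chi_even n : chi (- n)%Z = chi n.
Proof. have -> : (- n = -1 * n)%Z by ring. by rewrite (char_mult N chi Hchi) Heven Cmult_1_l. Qed.

Section Strip.

Variables (tau u v : C) (Ht : (0 < Im tau)%R).

Hypotheses (Hu : (- height tau < Re u < height tau)%R) (Hv : (- height tau < Re v < height tau)%R).

Definition sinh_term (p : nat * nat) : C := Pquad chi tau u v p + Pquad chi tau v u (snd p, fst p) -
    (Mquad chi tau u v p + Mquad chi tau v u (snd p, fst p)).

Lemma sinh_term_has_sum : has_sum sinh_term (sinh_sum tau u v).
Proof.
apply: has_sum_minus; apply: has_sum_plus; try apply: has_sum_swap.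
- exact: (Psum_has_sum chi 1 cb).
- exact: (Psum_has_sum chi 1 cb).
- exact: (Msum_has_sum chi 1 cb).
- exact: (Msum_has_sum chi 1 cb).
Qed.

Lemma sinh_term_summable : abs_summable sinh_term.
Proof.
have opp (f : nat * nat -> C) : abs_summable f -> abs_summable (fun p => - f p).
  move=> [M HM]; exists M; apply: bounded_sums_le HM => i; by rewrite Cmod_opp; right.
have sw (f : nat * nat -> C) : abs_summable f -> abs_summable (fun p => f (snd p, fst p)).
  by move=> h; apply: (abs_summable_inj f (fun p => (snd p, fst p))) => // -[x y] [x' y'] [-> ->].
apply: abs_summable_plus; last apply: opp; apply: abs_summable_plus; try apply: sw.
- exact: (Pquad_summable chi 1 cb).
- exact: (Pquad_summable chi 1 cb).
- exact: (Mquad_summable chi 1 cb).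
- exact: (Mquad_summable chi 1 cb).
Qed.

Lemma sinh_term_sinh p : let m := Z.of_nat (S (fst p)) in let n := Z.of_nat (S (snd p)) in
  sinh_term p = 2 * ((chi n + chi m) * (Csinh (Z2C m * u + Z2C n * v) * Cexp (Z2C (m * n) * (twopii * tau)))).
Proof.
case: p => i j; rewrite /sinh_term /Pquad /Mquad /cc /Csinh; cbn [fst snd].
set m := Z.of_nat (S i); set n := Z.of_nat (S j); rewrite !chi_even.
have e1 : Cexp (Z2C m * u + Z2C n * v + Z2C (m * n) * (twopii * tau)) =
   Cexp (Z2C m * u + Z2C n * v) * Cexp (Z2C (m * n) * (twopii * tau)) by rewrite Cexp_plus.
have e2 : Cexp (Z2C n * v + Z2C m * u + Z2C (n * m) * (twopii * tau)) =
   Cexp (Z2C m * u + Z2C n * v) * Cexp (Z2C (m * n) * (twopii * tau)).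
  rewrite -Cexp_plus Z.mul_comm; congr Cexp; ring.
have e3 : Cexp (Z2C (- m) * u + Z2C (- n) * v + Z2C (- m * - n) * (twopii * tau)) =
   Cexp (- (Z2C m * u + Z2C n * v)) * Cexp (Z2C (m * n) * (twopii * tau)).
  rewrite -Cexp_plus Z.mul_opp_opp !Z2C_opp; congr Cexp; ring.
have e4 : Cexp (Z2C (- n) * v + Z2C (- m) * u + Z2C (- n * - m) * (twopii * tau)) =
   Cexp (- (Z2C m * u + Z2C n * v)) * Cexp (Z2C (m * n) * (twopii * tau)).
  rewrite -Cexp_plus Z.mul_opp_opp !Z2C_opp (Z.mul_comm n); congr Cexp; ring.
rewrite e1 e2 e3 e4; field.
Qed.

(* The region of convergence of the double series is the wider strip [|q| < |xi|, |eta| < 1/|q|]. *)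
Theorem Ftw_expansion : Cexp u ^ N - 1 <> 0 -> Cexp v ^ N - 1 <> 0 ->
  Ftw N chi tau u v = / 2 * (sum_n (fun h => chi (Z.of_nat h) * (Cexp v ^ h / (Cexp v ^ N - 1))) N +
     sum_n (fun h => chi (Z.of_nat h) * (Cexp u ^ h / (Cexp u ^ N - 1))) N) - / 2 * sinh_sum tau u v.
Proof.
move=> nu nv; rewrite !polar_part // /Ftw !(TA_double_series N chi HN Hprim) // /sinh_sum /Cdiv; ring.
Qed.

End Strip.

Lemma pow_N_neq x : (Re x < 0)%R -> Cexp x ^ N - 1 <> 0.
Proof.
move=> h; rewrite Cexp_pow; apply: Cexp_neq_1.
have -> : Re (RtoC (INR N) * x) = (INR N * Re x)%R by rewrite re_scal_l.
have : (0 < INR N)%R by apply: lt_0_INR; lia.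
nra.
Qed.

Lemma Ftw_region tau u v : kronecker_region tau u v ->
  twisted_kronecker chi tau u v = / 2 * sum_n (fun h => chi (Z.of_nat h) *
     (Cexp v ^ h / (Cexp v ^ N - 1) + Cexp u ^ h / (Cexp u ^ N - 1))) N - / 2 * sinh_sum tau u v.
Proof.
move=> H; rewrite -twisted_kronecker_Ftw //.
have [Ht [Hu Hv]] := region_strip _ _ _ H; have hp := height_pos tau Ht.
rewrite (Ftw_expansion tau u v Ht); [|lra|lra|by apply: pow_N_neq; lra|by apply: pow_N_neq; lra].
rewrite -!sumC_seq -sumC_plus; congr (_ * _ - _); apply: sumC_ext => h _; ring.
Qed.

Theorem twisted_kronecker_double_series tau u v : kronecker_region tau u v ->
  is_double_series (fun i j => (chi (Z.of_nat (S j)) + chi (Z.of_nat (S i))) *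
     (Cexp u ^ S i * Cexp v ^ S j - chi (-1)%Z * (Cpowz (Cexp u) (- Z.of_nat (S i)) * Cpowz (Cexp v) (- Z.of_nat (S j))))
     * nome tau ^ (S i * S j)) (sinh_sum tau u v).
Proof.
move=> H; have [Ht [Hu Hv]] := region_strip _ _ _ H; have hp := height_pos tau Ht.
have Hu' : (- height tau < Re u < height tau)%R by lra.
have Hv' : (- height tau < Re v < height tau)%R by lra.
have E p : sinh_term tau u v p = (chi (Z.of_nat (S (snd p))) + chi (Z.of_nat (S (fst p)))) *
     (Cexp u ^ S (fst p) * Cexp v ^ S (snd p) - chi (-1)%Z * (Cpowz (Cexp u) (- Z.of_nat (S (fst p))) * Cpowz (Cexp v) (- Z.of_nat (S (snd p)))))
     * nome tau ^ (S (fst p) * S (snd p)).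
  rewrite sinh_term_sinh Heven /Csinh !Cpowz_Cexp -!/(Z2C _) !Z2C_opp /nome !Cexp_pow -!Z2C_nat Nat2Z.inj_mul -/twopii.
  have -> : Cexp (- (Z2C (Z.of_nat (S (fst p))) * u + Z2C (Z.of_nat (S (snd p))) * v)) =
     Cexp (- Z2C (Z.of_nat (S (fst p))) * u) * Cexp (- Z2C (Z.of_nat (S (snd p))) * v).
    rewrite -Cexp_plus; congr Cexp; ring.
  rewrite Cexp_plus /Z2C; field.
apply: (has_sum_is_double_series (fun i j => (chi (Z.of_nat (S j)) + chi (Z.of_nat (S i))) *
     (Cexp u ^ S i * Cexp v ^ S j - chi (-1)%Z * (Cpowz (Cexp u) (- Z.of_nat (S i)) * Cpowz (Cexp v) (- Z.of_nat (S j))))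
     * nome tau ^ (S i * S j))).
- have [M HM] := sinh_term_summable tau u v Ht Hu' Hv'; exists M.
  by apply: bounded_sums_le HM => p; rewrite E; right.
- by apply: has_sum_ext (sinh_term_has_sum tau u v Ht Hu' Hv') => p; rewrite E.
Qed.

Theorem twisted_kronecker_fourier tau u v : kronecker_region tau u v ->
  is_series (V := C_NormedModule) (fun i => divisor_sum (S i) (fun d =>
     (chi (Z.of_nat d) + chi (Z.of_nat (S i / d))) * Csinh (INR d * u + INR (S i / d) * v)) * nome tau ^ S i)
   (/ 2 * sinh_sum tau u v).
Proof.
move=> H; have [Ht [Hu Hv]] := region_strip _ _ _ H; have hp := height_pos tau Ht.
have Hu' : (- height tau < Re u < height tau)%R by lra.
have Hv' : (- height tau < Re v < height tau)%R by lra.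
apply: has_sum_is_series.
have H1 := has_sum_mult_l (/ 2) _ _ (sinh_term_has_sum tau u v Ht Hu' Hv').
pose f m n := (chi (Z.of_nat m) + chi (Z.of_nat n)) * Csinh (INR m * u + INR n * v) * nome tau ^ (m * n).
have H2 : has_sum (fun p => f (S (fst p)) (S (snd p))) (/ 2 * sinh_sum tau u v).
  apply: has_sum_ext H1 => p; rewrite sinh_term_sinh /f /nome Cexp_pow -!Z2C_nat Nat2Z.inj_mul -/twopii; field.
apply: has_sum_ext (has_sum_divisors f _ H2) => k.
rewrite divisor_sum_mult; apply: divisor_sum_ext => d hd hm; rewrite /f; congr (_ * _ ^ _).
have := Nat.div_mod (S k) d ltac:(lia); lia.
Qed.

(** The quadrant sums are symmetric for weight 1, and 1 / (xi - 1) + eta / (eta - 1) differs from 1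
    / (xi - 1) + 1 / (eta - 1) by the constant 1; hence the symmetry of the classical function. *)
Lemma kronecker_sum tau u v : kronecker_region tau u v ->
  has_sum (fun n => Cexp (Z2C n * v) / Qden n tau u) (kronecker tau u v) /\ kronecker tau u v = kronecker tau v u.
Proof.
have key a b : kronecker_region tau a b -> has_sum (fun n => Cexp (Z2C n * b) / Qden n tau a) (kronecker tau a b) /\
   kronecker tau a b = 1 / (Cexp a - 1) + Cexp b / (Cexp b - 1) - Psum (fun _ => 1) tau a b + Msum (fun _ => 1) tau a b.
  move=> /region_strip [Ht [Hu Hv]].
  have w1 : forall n : Z, (Cmod ((fun _ => RtoC 1) n) <= 1)%R by move=> n; rewrite Cmod_1; lra.
  have Hs : has_sum (fun k => 1 * Cexp (Z2C (Z.of_nat (S k)) * b)) (- (Cexp b / (Cexp b - 1))).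
    have := has_sum_geom_pos 0 b 1 (proj2 Hv).
    have -> : - (Cexp (0 + Z2C 1 * b) / (Cexp b - 1)) = - (Cexp b / (Cexp b - 1)).
      by have -> : 0 + Z2C 1 * b = b by rewrite Z2C_1; ring.
    apply: has_sum_ext => j; rewrite Cmult_1_l; congr Cexp.
    have -> : (1 + Z.of_nat j = Z.of_nat (S j))%Z by lia.
    ring.
  have e1 := bil_CSeriesZ (fun _ => 1) 1 w1 tau a b _ Ht Hu Hv Hs.
  have h1 := bil_has_sum (fun _ => 1) 1 w1 tau a b _ Ht Hu Hv Hs.
  have E : kronecker tau a b = CSeriesZ (bil (fun _ => 1) tau a b).
    rewrite /kronecker; apply: CSeriesZ_ext => n; rewrite -bil_term Cmult_1_l; congr (_ / (_ - _)); ring.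
  rewrite E e1; split; last by ring.
  by apply: has_sum_ext h1 => n; rewrite /bil Cmult_1_l.
move=> H; have [h1 e1] := key _ _ H; have [h2 e2] := key _ _ (region_sym _ _ _ H).
split=> //; rewrite e1 e2.
have [Ht [Hu Hv]] := region_strip _ _ _ H; have hp := height_pos tau Ht.
have w1 : forall n : Z, (Cmod ((fun _ => RtoC 1) n) <= 1)%R by move=> n; rewrite Cmod_1; lra.
have eP : Psum (fun _ => 1) tau u v = Psum (fun _ => 1) tau v u.
  apply: has_sum_unique (has_sum_swap _ _ (Psum_has_sum (fun _ => 1) 1 w1 tau v u Ht ltac:(lra) ltac:(lra))).
  have := Psum_has_sum (fun _ => 1) 1 w1 tau u v Ht ltac:(lra) ltac:(lra).
  apply: has_sum_ext => p; rewrite /Pquad /cc; cbn [fst snd]; congr (_ * Cexp _); rewrite (Z.mul_comm (Z.of_nat (S (snd p)))); ring.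
have eM : Msum (fun _ => 1) tau u v = Msum (fun _ => 1) tau v u.
  apply: has_sum_unique (has_sum_swap _ _ (Msum_has_sum (fun _ => 1) 1 w1 tau v u Ht ltac:(lra) ltac:(lra))).
  have := Msum_has_sum (fun _ => 1) 1 w1 tau u v Ht ltac:(lra) ltac:(lra).
  apply: has_sum_ext => p; rewrite /Mquad /cc; cbn [fst snd]; congr (_ * Cexp _); rewrite (Z.mul_comm (- Z.of_nat (S (snd p)))); ring.
rewrite eP eM; have nu := Cexp_neq_1 u ltac:(lra); have nv := Cexp_neq_1 v ltac:(lra).
by field.
Qed.

Lemma region_shift tau u v h : kronecker_region tau u v -> kronecker_region tau (shiftN N h u) v.
Proof. rewrite /kronecker_region !Cmod_Cexp (Re_shiftN N HN); tauto. Qed.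

Lemma kronecker_shift_sum tau u v : kronecker_region tau u v ->
  sumC (fun h => cchi (Z.of_nat h) * kronecker tau u (shiftN N h v)) (seq 0 N) = W * TA N chi 0 tau u v.
Proof.
move=> H; have [Hb _] := bil_chi_total tau u v H.
apply: has_sum_unique (has_sum_mult_l W _ _ Hb).
have H1 : has_sum (fun n => sumC (fun h => cchi (Z.of_nat h) * (Cexp (Z2C n * shiftN N h v) / Qden n tau u)) (seq 0 N))
   (sumC (fun h => cchi (Z.of_nat h) * kronecker tau u (shiftN N h v)) (seq 0 N)).
  apply: (has_sum_sumC (fun h n => cchi (Z.of_nat h) * (Cexp (Z2C n * shiftN N h v) / Qden n tau u))
    (fun h => cchi (Z.of_nat h) * kronecker tau u (shiftN N h v))) => h _.
  apply: has_sum_mult_l.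
  have R := region_sym _ _ _ (region_shift tau v u h (region_sym _ _ _ H)).
  by case: (kronecker_sum tau u (shiftN N h v) R).
apply: has_sum_ext H1 => n.
rewrite (sumC_ext _ (fun h => cchi (Z.of_nat h) * (root_unity N (Z.of_nat h * n) * (Cexp (Z2C n * v) / Qden n tau u)))).
  rewrite (gauss_sumC N chi HN Hprim) /bil; ring.
by move=> h _; rewrite (shiftN_exp N HN) /Cdiv; ring.
Qed.

Theorem twisted_kronecker_average tau u v : kronecker_region tau u v ->
  twisted_kronecker chi tau u v = / (2 * W) *
    sum_n (fun h => cchi (Z.of_nat h) * (kronecker tau (u + 2 * PI * Ci * INR h / INR N) v +
          kronecker tau u (v + 2 * PI * Ci * INR h / INR N))) (N - 1).
Proof.
move=> H; have H' := region_sym _ _ _ H.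
rewrite -twisted_kronecker_Ftw // /Ftw -sumC_seq.
have -> : S (N - 1) = N by lia.
rewrite (sumC_ext _ (fun h => cchi (Z.of_nat h) * kronecker tau v (shiftN N h u) + cchi (Z.of_nat h) * kronecker tau u (shiftN N h v))).
  rewrite sumC_plus !kronecker_shift_sum //; field; exact: (W_nz N chi HN Hprim).
move=> h _; rewrite -!/twopii -/(shiftN N h u) -/(shiftN N h v).
(* Symmetry moves the shift of u into the second argument, where the averaging lemma applies. *)
have [_ ->] := kronecker_sum _ _ _ (region_shift tau u v h H); ring.
Qed.

End Region.

(** * Poles *)

Lemma Cinv_nz (z : C) : z <> 0 -> / z <> 0.
Proof. by move=> n E; apply: C1_nz; rewrite -(Cinv_r z n) E; ring. Qed.

Lemma Cmult_cancel_l (z a b : C) : z <> 0 -> z * a = z * b -> a = b.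
Proof. by move=> n E; transitivity (/ z * (z * a)); [field | rewrite E; field]. Qed.

Lemma sumC_single {J} (f : J -> C) l x : NoDup l -> In x l -> (forall y, In y l -> y <> x -> f y = 0) -> sumC f l = f x.
Proof.
elim: l => [//|a l IH] /NoDup_cons_iff [na nl] [<-|hx] H /=.
- rewrite (sumC_ext _ (fun _ => 0)) ?sumC_zero ?Cplus_0_r // => y Hy; apply: H; first by right.
  by move=> E; apply: na; rewrite -E.
- rewrite IH //; last by move=> y Hy; apply: H; right.
  rewrite H; [ring | by left | by move=> E; apply: na; rewrite E].
Qed.

Section Germs.

Context {U : NormedModule C_AbsRing}.

Implicit Types (p y : U) (f g h : U -> C).

Definition near p (P : U -> Prop) : Prop := exists d, (0 < d)%R /\ forall y, (dist y p < d)%R -> P y.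

Lemma near_and p (P R : U -> Prop) : near p P -> near p R -> near p (fun y => P y /\ R y).
Proof.
move=> [d [d0 H]] [e [e0 H']]; exists (Rmin d e); split; first exact: Rmin_glb_lt.
move=> y Hy; split; [apply: H | apply: H']; apply: Rlt_le_trans Hy _; [exact: Rmin_l | exact: Rmin_r].
Qed.

Lemma near_imp p (P R : U -> Prop) : (forall y, P y -> R y) -> near p P -> near p R.
Proof. by move=> H [d [d0 H']]; exists d; split=> // y Hy; apply: H; apply: H'. Qed.

Lemma near_at p (P : U -> Prop) : near p P -> P p.
Proof. by move=> [d [d0 H]]; apply: H; rewrite dist_self. Qed.

Lemma holo_all f p : (forall y, Fdiffable f y) -> holo f p.
Proof. by move=> H; exists 1%R; split; [lra | move=> y _; apply: H]. Qed.

Lemma holo_at f p : holo f p -> Fdiffable f p.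
Proof. exact: near_at. Qed.

Lemma holo_const c p : holo (fun _ => c) p.
Proof. by apply: holo_all => y; exact: Fdiffable_const. Qed.

Lemma holo_plus f g p : holo f p -> holo g p -> holo (fun y => f y + g y) p.
Proof. by move=> H1 H2; apply: near_imp (near_and _ _ _ H1 H2) => y [a b]; exact: Fdiffable_plus. Qed.

Lemma holo_mult f g p : holo f p -> holo g p -> holo (fun y => f y * g y) p.
Proof. by move=> H1 H2; apply: near_imp (near_and _ _ _ H1 H2) => y [a b]; exact: Fdiffable_mult. Qed.

Lemma holo_sub f g p : holo f p -> holo g p -> holo (fun y => f y - g y) p.
Proof. by move=> H1 H2; apply: near_imp (near_and _ _ _ H1 H2) => y [a b]; exact: Fdiffable_sub. Qed.

Lemma holo_Cexp f p : holo f p -> holo (fun y => Cexp (f y)) p.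
Proof. by apply: near_imp => y; exact: Fdiffable_Cexp. Qed.

Lemma holo_neq f p : holo f p -> f p <> 0 -> near p (fun y => f y <> 0).
Proof.
move=> /holo_at Hf n.
have q : (0 < Cmod (f p))%R by apply/Cmod_gt_0.
have [d [d0 H]] := Fdiffable_cont f p Hf _ q.
exists d; split=> // y Hy E; have := H y Hy; rewrite E Cmod_minus_sym.
have -> : f p - 0 = f p by ring.
lra.
Qed.

Lemma holo_inv f p : holo f p -> f p <> 0 -> holo (fun y => / f y) p.
Proof. by move=> H n; apply: near_imp (near_and _ _ _ H (holo_neq f p H n)) => y [a b]; exact: Fdiffable_inv. Qed.

Lemma holo_sumC {J} (F : J -> U -> C) l p : (forall j, In j l -> holo (F j) p) -> holo (fun y => sumC (fun j => F j y) l) p.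
Proof.
elim: l => [|j l IH] H /=; first exact: holo_const.
apply: holo_plus; first by apply: H; left.
by apply: IH => k Hk; apply: H; right.
Qed.

Lemma holo_ext f g p : holo f p -> near p (fun y => f y = g y) -> holo g p.
Proof.
move=> H1 H2; have [d [d0 H]] := near_and _ _ _ H1 H2.
exists (d / 2)%R; split; first lra.
move=> y Hy; have [h1 _] := H y ltac:(lra).
apply: Fdiffable_ext h1 _; exists (d / 2)%R; split; first lra.
move=> z Hz; apply: (proj2 (H z _)); have := dist_tri z y p; lra.
Qed.

Definition nzgerm f p : Prop := ~ near p (fun y => f y = 0).

Lemma holo_shift f p : holo f p -> near p (fun y => holo f y).
Proof.
move=> [d [d0 H]]; exists (d / 2)%R; split; first lra.
move=> y Hy; exists (d / 2)%R; split; first lra.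
move=> z Hz; apply: H; have := dist_tri z y p; lra.
Qed.

(** The identity theorem on a ball: vanishing near one point would propagate back to p. *)
Lemma nzgerm_spread f p : holo f p -> nzgerm f p -> near p (fun y => nzgerm f y).
Proof.
move=> [d [d0 H]] n; exists d; split=> // y Hy [e [e0 H0]]; apply: n.
by exists d; split=> //; apply: (identity_ball f p d y e).
Qed.

(** Germs form an integral domain: at a nearby point where f is nonzero, a vanishing product would
    force g to vanish on a neighbourhood. *)
Lemma nzgerm_mult f g p : holo f p -> holo g p -> nzgerm f p -> nzgerm g p -> nzgerm (fun y => f y * g y) p.
Proof.
move=> Hf Hg nf ng [d [d0 H]].
have [e [e0 He]] := near_and _ _ _ (holo_shift f p Hf) (nzgerm_spread g p Hg ng).
apply: nf; exists (Rmin d e); split; first exact: Rmin_glb_lt.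
move=> y Hy; apply: NNPP => fy.
have yd := Rlt_le_trans _ _ _ Hy (Rmin_l _ _).
have [h1 h2] := He y (Rlt_le_trans _ _ _ Hy (Rmin_r _ _)); apply: h2.
have [e1 [e1p H1]] := holo_neq f y h1 fy.
exists (Rmin e1 (d - dist y p)); split; first by apply: Rmin_glb_lt; lra.
move=> z Hz.
have z1 := H1 z (Rlt_le_trans _ _ _ Hz (Rmin_l _ _)).
have := H z ltac:(have := dist_tri z y p; have := Rmin_r e1 (d - dist y p); lra).
by move=> E; apply: NNPP => gz; apply: (Cmult_neq_0 _ _ z1 gz).
Qed.

Definition mero f p : Prop := exists g h, holo g p /\ holo h p /\ nzgerm h p /\
  near p (fun y => h y <> 0 -> f y = g y / h y).

Lemma mero_meromorphic_at f p : mero f p -> meromorphic_at f p.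
Proof.
move=> [g [h [H1 [H2 [H3 H4]]]]]; exists g, h; split; first exact/holo_holomorphic_at.
split; first exact/holo_holomorphic_at.
split; first by move=> /locally_near h0; apply: H3.
exact: near_locally.
Qed.

Lemma nzgerm_const_1 p : nzgerm (fun _ => 1) p.
Proof. by move=> /near_at E; apply: C1_nz. Qed.

Lemma holo_mero f p : holo f p -> mero f p.
Proof.
move=> H; exists f, (fun _ => 1); split=> //; split; first exact: holo_const.
split; first exact: nzgerm_const_1.
by exists 1%R; split; [lra | move=> y _ _; field].
Qed.

Lemma mero_plus f g p : mero f p -> mero g p -> mero (fun y => f y + g y) p.
Proof.
move=> [g1 [h1 [A1 [A2 [A3 A4]]]]] [g2 [h2 [B1 [B2 [B3 B4]]]]].
exists (fun y => g1 y * h2 y + g2 y * h1 y), (fun y => h1 y * h2 y); split.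
  by apply: holo_plus; apply: holo_mult.
split; first exact: holo_mult.
split; first exact: nzgerm_mult.
apply: near_imp (near_and _ _ _ A4 B4) => y [a b] n.
have n1 : h1 y <> 0 by move=> E; apply: n; rewrite E; ring.
have n2 : h2 y <> 0 by move=> E; apply: n; rewrite E; ring.
by rewrite a // b //; field.
Qed.

Lemma mero_sumC {J} (F : J -> U -> C) l p : (forall j, In j l -> mero (F j) p) -> mero (fun y => sumC (fun j => F j y) l) p.
Proof.
elim: l => [|j l IH] H /=; first by apply: holo_mero; exact: holo_const.
apply: mero_plus; first by apply: H; left.
by apply: IH => k Hk; apply: H; right.
Qed.

Lemma mero_ext f g p : (forall y, f y = g y) -> mero f p -> mero g p.
Proof.
move=> E [g1 [h1 [A1 [A2 [A3 A4]]]]]; exists g1, h1; split=> //; split=> //; split=> //.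
by apply: near_imp A4 => y a n; rewrite -E a.
Qed.

(* [f] has at most a simple pole along [D = 0] near [p], with polar coefficient [a] at [p]. *)
Definition sing (D : U -> C) p f (a : C) : Prop := exists c G, holo c p /\ holo G p /\ c p = a /\
  near p (fun y => D y <> 0 -> f y = c y / D y + G y).

Lemma holo_sing D p f : holo f p -> sing D p f 0.
Proof.
move=> H; exists (fun _ => 0), f; split; first exact: holo_const.
split=> //; split=> //; exists 1%R; split; first lra.
by move=> y _ n; rewrite /Cdiv Cmult_0_l Cplus_0_l.
Qed.

Lemma sing_plus D p f g a b : sing D p f a -> sing D p g b -> sing D p (fun y => f y + g y) (a + b).
Proof.
move=> [c [G [A1 [A2 [A3 A4]]]]] [c' [G' [B1 [B2 [B3 B4]]]]].
exists (fun y => c y + c' y), (fun y => G y + G' y); split; first exact: holo_plus.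
split; first exact: holo_plus.
split; first by rewrite A3 B3.
apply: near_imp (near_and _ _ _ A4 B4) => y [h1 h2] n; rewrite h1 // h2 // /Cdiv; ring.
Qed.

Lemma sing_sumC {J} D p (F : J -> U -> C) (a : J -> C) l : (forall j, In j l -> sing D p (F j) (a j)) ->
  sing D p (fun y => sumC (fun j => F j y) l) (sumC a l).
Proof.
elim: l => [|j l IH] H /=; first by apply: holo_sing; exact: holo_const.
apply: sing_plus; first by apply: H; left.
by apply: IH => k Hk; apply: H; right.
Qed.

Lemma sing_ext D p f g a : (forall y, f y = g y) -> sing D p f a -> sing D p g a.
Proof.
move=> E [c [G [A1 [A2 [A3 A4]]]]]; exists c, G; split=> //; split=> //; split=> //.
by apply: near_imp A4 => y h n; rewrite -E; apply: h.
Qed.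

(** If f agreed with g off the zeros of h, then K = D g - (c + D G) would satisfy K h D = 0 near p.
    With no zero divisors K vanishes, whereas its value at p is -a. *)
Lemma sing_not_removable D p f (a : C) g h : holo D p -> nzgerm D p -> D p = 0 -> a <> 0 -> sing D p f a ->
  holo g p -> holo h p -> nzgerm h p -> near p (fun y => h y <> 0 -> f y = g y) -> False.
Proof.
move=> HD nD D0 na [c [G [A1 [A2 [A3 A4]]]]] Hg Hh nh Hfg.
pose K y := D y * g y - (c y + D y * G y).
have HK : holo K p by apply: holo_sub; [|apply: holo_plus => //]; exact: holo_mult.
have nK : near p (fun y => K y = 0).
  apply: NNPP => n; apply: (nzgerm_mult _ _ p HK (holo_mult _ _ p Hh HD) n (nzgerm_mult _ _ p Hh HD nh nD)).
  apply: near_imp (near_and _ _ _ A4 Hfg) => y [h1 h2].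
  case: (classic (h y = 0)) => [->|hy]; first by ring.
  case: (classic (D y = 0)) => [->|Dy]; first by ring.
  rewrite /K -(h2 hy) (h1 Dy); by field.
apply: na; rewrite -A3; have := near_at _ _ nK; rewrite /K D0 => E.
transitivity (- (0 * g p - (c p + 0 * G p))); [ring | rewrite E; ring].
Qed.

End Germs.

(** Multiples of H are isolated, so small positive displacements of x avoid them; this produces the
    generic nearby points used later. *)
Lemma avoid_multiples x (H : R) : (0 < H)%R -> exists e, (0 < e)%R /\ forall t, (0 < t < e)%R -> forall n, (x + t)%R <> (IZR n * H)%R.
Proof.
move=> H0; have [a1 a2] := archimed (x / H).
have xE : (x = x / H * H)%R by field; lra.
pose k := up (x / H).
have b1 : (x < IZR k * H)%R by rewrite {1}xE; apply: Rmult_lt_compat_r.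
have b2 : (IZR k * H - H <= x)%R by rewrite /k; nra.
exists (IZR k * H - x)%R; split; first lra.
move=> t Ht n E.
have d1 : (n < k)%Z by apply: lt_IZR; apply: (Rmult_lt_reg_r H) => //; lra.
have d2 : (k - 1 < n)%Z by apply: lt_IZR; rewrite minus_IZR; apply: (Rmult_lt_reg_r H) => //; lra.
lia.
Qed.

Section Analytic.

Variables (N : nat) (chi : Z -> C) (HN : (1 <= N)%nat) (Hprim : primitive_character N chi).

Let Hchi : dirichlet_character N chi := proj1 Hprim.

Local Notation W := (gauss_sum N (conj_character chi)).

Local Notation cchi := (conj_character chi).

Local Notation shN := (shiftN N).

(* [polar_term n] collects the parts of the [n]-th summand of [Ftw] with a pole in [u]. *)
Definition polar_term1 (n : Z) (tau u v : C) : C := / 2 * (chi n * Q 0 n tau u v).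

Definition polar_term2 (n : Z) (h : nat) (tau u v : C) : C := / 2 * (/ W * (cchi (Z.of_nat h) * Q 1 n tau (shN h u) v)).

Definition polar_term (n : Z) (tau u v : C) : C := polar_term1 n tau u v + sumC (fun h => polar_term2 n h tau u v) (seq 0 N).

(** The poles in u come from the unshifted denominators of one half and from the shifted
    denominators of the other, so the terms are regrouped by the singular variable. *)
Lemma Ftw_polar_terms tau u v : (0 < Im tau)%R -> has_sum (fun n => polar_term n tau u v + polar_term n tau v u) (Ftw N chi tau u v).
Proof.
move=> Ht.
have H := has_sum_mult_l (/ 2) _ _ (has_sum_plus _ _ _ _ (TA_has_sum N chi HN Hprim 0 tau u v Ht) (TA_has_sum N chi HN Hprim 0 tau v u Ht)).
apply: has_sum_ext H => n; rewrite /polar_term /polar_term1 /TA1 /TA2 /polar_term2 !sumC_mult_l; change (1 - 0)%Z with 1%Z; ring.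
Qed.

Lemma Ftw_sym tau u v : Ftw N chi tau u v = Ftw N chi tau v u.
Proof. by rewrite /Ftw Cplus_comm. Qed.

Lemma Cmod_shiftN h u : (h < N)%nat -> (Cmod (shN h u) <= Cmod u + 2 * PI)%R.
Proof.
move=> hN; have pp := PI_RGT_0; rewrite /shiftN; apply: Rle_trans (Cmod_triangle _ _) _.
have N0 : (0 < INR N)%R by apply: lt_0_INR; lia.
have hl : (INR h <= INR N)%R by apply: le_INR; lia.
rewrite Cmod_div; last by move=> E; have := RtoC_inj _ _ E; lra.
rewrite Cmod_mult /twopii !Cmod_mult Cmod_Ci !Cmod_R !Rabs_pos_eq; try lra; try exact: pos_INR.
apply: Rplus_le_compat_l; rewrite Rmult_1_r.
apply: (Rmult_le_reg_r (INR N)) => //; rewrite /Rdiv Rmult_assoc Rinv_l; last lra.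
have := pos_INR h; nra.
Qed.

Lemma polar_term_bound y0 y1 B : (0 < y0)%R -> exists (n0 : nat) (K : R), (0 <= K)%R /\ forall n tau u v,
  (y0 <= Im tau <= y1)%R -> (Cmod u <= B)%R -> (Cmod v <= B)%R -> (INR n0 <= absR n)%R ->
  Qden n tau u <> 0 /\ (forall h, (h < N)%nat -> Qden n tau (shN h u) <> 0) /\
  (Cmod (polar_term n tau u v) <= K * ez n)%R.
Proof.
move=> Hy0; have pp := PI_RGT_0.
(* A torsion shift moves u by at most 2 pi, hence the enlarged radius. *)
have [n1 [K1 [K1p H1]]] := Q_bound y0 y1 (B + 2 * PI) 0 Hy0.
have [n2 [K2 [K2p H2]]] := Q_bound y0 y1 (B + 2 * PI) 1 Hy0.
have W0 := Cmod_ge_0 (/ W).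
exists (n1 + n2)%nat, (K1 + INR N * (Cmod (/ W) * K2))%R; split.
  have := pos_INR N => q; have : (0 <= INR N * (Cmod (/ W) * K2))%R by apply: Rmult_le_pos => //; nra.
  lra.
move=> n tau u v Hy Hu Hv; rewrite plus_INR => Hn.
have q1 := pos_INR n1; have q2 := pos_INR n2.
have [d1 b1] := H1 n tau u v Hy ltac:(lra) ltac:(lra) ltac:(lra).
have sh h : (h < N)%nat -> (Cmod (shN h u) <= B + 2 * PI)%R by move=> /(Cmod_shiftN h u); lra.
have v1 : (Cmod v <= B + 2 * PI)%R by lra.
have n1' : (INR n1 <= absR n)%R by lra.
split=> //; split; first by move=> h /sh hh; have [] := H1 n tau (shN h u) v Hy hh v1 n1'.
have c1 : forall m, (Cmod (chi m) <= 1)%R by exact: (chi_le_1 N chi HN Hprim).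
have e0 : (0 <= ez n)%R by left; exact: exp_pos.
have half : Cmod (/ 2) = (/ 2)%R by rewrite -RtoC_inv ?Cmod_R ?Rabs_pos_eq; lra.
rewrite /polar_term; apply: Rle_trans (Cmod_triangle _ _) _.
rewrite Rmult_plus_distr_r; apply: Rplus_le_compat.
- rewrite /polar_term1 2!Cmod_mult half.
  have a1 := c1 n; have a2 := Cmod_ge_0 (chi n); have a3 := Cmod_ge_0 (Q 0 n tau u v).
  have a4 : (Cmod (chi n) * Cmod (Q 0 n tau u v) <= 1 * Cmod (Q 0 n tau u v))%R by apply: Rmult_le_compat_r.
  have a5 : (0 <= Cmod (chi n) * Cmod (Q 0 n tau u v))%R by exact: Rmult_le_pos.
  lra.
- apply: Rle_trans (Cmod_sumC _ _) _.
  have -> : (INR N * (Cmod (/ W) * K2) * ez n = sumR (fun _ : nat => Cmod (/ W) * K2 * ez n) (seq 0 N))%R.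
    by rewrite sumR_const length_seq; ring.
  apply: sumR_le => h /in_seq Hh.
  have [_ b2] := H2 n tau (shN h u) v Hy (sh h ltac:(lia)) ltac:(lra) ltac:(lra).
  rewrite /polar_term2 3!Cmod_mult half.
  have -> : Cmod (cchi (Z.of_nat h)) = Cmod (chi (Z.of_nat h)) by rewrite /conj_character Cmod_conj.
  have := c1 (Z.of_nat h); have a1 := Cmod_ge_0 (chi (Z.of_nat h)); have a2 := Cmod_ge_0 (Q 1 n tau (shN h u) v).
  move=> a3.
  have a4 : (Cmod (chi (Z.of_nat h)) * Cmod (Q 1 n tau (shN h u) v) <= 1 * (K2 * ez n))%R by apply: Rmult_le_compat.
  have a5 : (Cmod (/ W) * (Cmod (chi (Z.of_nat h)) * Cmod (Q 1 n tau (shN h u) v)) <= Cmod (/ W) * (K2 * ez n))%R.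
    by apply: Rmult_le_compat_l => //; lra.
  have a6 : (0 <= Cmod (/ W) * (Cmod (chi (Z.of_nat h)) * Cmod (Q 1 n tau (shN h u) v)))%R.
    by apply: Rmult_le_pos => //; apply: Rmult_le_pos.
  lra.
Qed.

Context {U : NormedModule C_AbsRing}.

Variables (T X Y : U -> C).

Hypotheses (HT : forall y, Fdiffable T y) (HX : forall y, Fdiffable X y) (HY : forall y, Fdiffable Y y).

Implicit Types (p y : U).

Lemma holo_Qnum e n (X' Y' : U -> C) p : holo X' p -> holo Y' p -> holo (fun y => Qnum e n (T y) (X' y) (Y' y)) p.
Proof.
move=> hX hY; apply: holo_Cexp; apply: holo_plus; first by apply: holo_mult => //; exact: holo_const.
apply: holo_mult; first exact: holo_const.
apply: holo_plus => //; apply: holo_mult; first exact: holo_const.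
exact: holo_all.
Qed.

Lemma holo_Qden n (X' : U -> C) p : holo X' p -> holo (fun y => Qden n (T y) (X' y)) p.
Proof.
move=> hX; apply: holo_sub; last exact: holo_const.
apply: holo_Cexp; apply: holo_plus => //; apply: holo_mult; first exact: holo_const.
exact: holo_all.
Qed.

Lemma holo_Q e n (X' Y' : U -> C) p : holo X' p -> holo Y' p -> Qden n (T p) (X' p) <> 0 ->
  holo (fun y => Q e n (T y) (X' y) (Y' y)) p.
Proof.
move=> hX hY hn; apply: holo_mult; first exact: holo_Qnum.
by apply: (holo_inv (fun y => Qden n (T y) (X' y))) => //; exact: holo_Qden.
Qed.

Lemma holo_shiftN h (X' : U -> C) p : holo X' p -> holo (fun y => shN h (X' y)) p.
Proof. by move=> H; apply: holo_plus => //; exact: holo_const. Qed.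

Lemma holo_polar_term n p (X' Y' : U -> C) : holo X' p -> holo Y' p -> (chi n <> 0 -> Qden n (T p) (X' p) <> 0) ->
  (forall h, (h < N)%nat -> chi (Z.of_nat h) <> 0 -> Qden n (T p) (shN h (X' p)) <> 0) ->
  holo (fun y => polar_term n (T y) (X' y) (Y' y)) p.
Proof.
move=> hX hY H1 H2; apply: holo_plus.
- apply: holo_mult; first exact: holo_const.
  case: (classic (chi n = 0)) => [->|c].
    by apply: (holo_ext (fun _ => 0)); [exact: holo_const | exists 1%R; split; [lra | move=> y _; ring]].
  by apply: holo_mult; [exact: holo_const | apply: holo_Q => //; exact: H1].
- apply: holo_sumC => h /in_seq Hh.
  apply: holo_mult; first exact: holo_const.
  apply: holo_mult; first exact: holo_const.
  case: (classic (chi (Z.of_nat h) = 0)) => [/(cchi_0 chi) ->|c].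
    by apply: (holo_ext (fun _ => 0)); [exact: holo_const | exists 1%R; split; [lra | move=> y _; ring]].
  apply: holo_mult; first exact: holo_const.
  by apply: holo_Q => //; [exact: holo_shiftN | apply: H2 => //; lia].
Qed.

(** Ftw in coordinates given by everywhere differentiable functions on a normed space: one analysis
    covers joint dependence on (tau, u, v), dependence on (u, v) for fixed tau, and one-variable
    slices. *)
Definition FU (y : U) : C := Ftw N chi (T y) (X y) (Y y).

(* Away from finitely many indices the series converges uniformly near [p]. *)
Lemma FU_rest p : (0 < Im (T p))%R -> exists n0 : nat,
  holo (fun y => FU y - sumC (fun n => polar_term n (T y) (X y) (Y y) + polar_term n (T y) (Y y) (X y)) (Zrange n0)) p /\
  (forall n, ~ In n (Zrange n0) -> Qden n (T p) (X p) <> 0 /\ (forall h, (h < N)%nat -> Qden n (T p) (shN h (X p)) <> 0)).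
Proof.
move=> Ht.
pose y0 := (Im (T p) / 2)%R. pose y1 := (2 * Im (T p))%R. pose B := (Cmod (X p) + Cmod (Y p) + 1)%R.
have y0p : (0 < y0)%R by rewrite /y0; lra.
have [d1 [d1p h1]] := Fdiffable_cont T p (HT p) y0 y0p.
have [d2 [d2p h2]] := Fdiffable_cont X p (HX p) 1 Rlt_0_1.
have [d3 [d3p h3]] := Fdiffable_cont Y p (HY p) 1 Rlt_0_1.
pose d := Rmin d1 (Rmin d2 d3).
have dp : (0 < d)%R by repeat apply: Rmin_glb_lt.
have c1 := Cmod_ge_0 (X p); have c2 := Cmod_ge_0 (Y p).
have inB y : (dist y p < d)%R -> (y0 <= Im (T y) <= y1)%R /\ (Cmod (X y) <= B)%R /\ (Cmod (Y y) <= B)%R.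
  move=> Hy.
  have Hy1 := Rlt_le_trans _ _ _ Hy (Rmin_l _ _).
  have Hy23 := Rlt_le_trans _ _ _ Hy (Rmin_r _ _).
  have Hy2 := Rlt_le_trans _ _ _ Hy23 (Rmin_l _ _).
  have Hy3 := Rlt_le_trans _ _ _ Hy23 (Rmin_r _ _).
  have t := h1 y Hy1; have s := snd_le_Cmod (T y - T p).
  have /Rabs_le_between ss : (Rabs (Im (T y) - Im (T p)) <= Cmod (T y - T p))%R by exact: s.
  split; first by rewrite /y1; move: t ss; rewrite /y0; lra.
  have := h2 y Hy2; have := h3 y Hy3.
  have := Cmod_minus_le (X y) (X p); have := Cmod_minus_le (Y y) (Y p); rewrite /B; lra.
have [n0 [K [K0 HK]]] := polar_term_bound y0 y1 B y0p.
have [E HE] := ez_bounded.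
exists n0; split; last first.
  move=> n /Zrange_out Hn; have [a [b c]] := inB p ltac:(by rewrite dist_self).
  by have [g1 [g2 _]] := HK n (T p) (X p) (Y p) a b c Hn.
pose L := Zrange n0.
pose f n y := match in_dec Z.eq_dec n L with left _ => RtoC 0 |
   right _ => polar_term n (T y) (X y) (Y y) + polar_term n (T y) (Y y) (X y) end.
have Hs y : (dist y p < d)%R -> has_sum (fun n => f n y)
   (FU y - sumC (fun n => polar_term n (T y) (X y) (Y y) + polar_term n (T y) (Y y) (X y)) L).
  move=> Hy; have [a _] := inB y Hy.
  pose g n := match in_dec Z.eq_dec n L with left _ => polar_term n (T y) (X y) (Y y) + polar_term n (T y) (Y y) (X y) | right _ => RtoC 0 end.
  have Hg : has_sum g (sumC (fun n => polar_term n (T y) (X y) (Y y) + polar_term n (T y) (Y y) (X y)) L).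
    have -> : sumC (fun n => polar_term n (T y) (X y) (Y y) + polar_term n (T y) (Y y) (X y)) L = sumC g L.
      by apply: sumC_ext => n Hn; rewrite /g; case: in_dec.
    apply: has_sum_finite; first exact: Zrange_NoDup.
    by move=> n Hn; rewrite /g; case: in_dec.
  apply: has_sum_ext (has_sum_minus _ _ _ _ (Ftw_polar_terms (T y) (X y) (Y y) ltac:(lra)) Hg) => n.
  rewrite /f /g; case: in_dec => _; ring.
exists (d / 2)%R; split; first lra.
move=> z Hz.
apply: (Fdiffable_series f _ z (d / 2) (fun n => (2 * K * ez n)%R) (2 * K * E)); first lra.
- by apply: bounded_sums_mult_l => //; lra.
- move=> n y Hy.
  have Hyp : (dist y p < d)%R by have := dist_tri y z p; lra.
  have [a [b c]] := inB y Hyp.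
  rewrite /f; case: in_dec => Hn.
    split; first exact: Fdiffable_const.
    rewrite Cmod_0; have : (0 < ez n)%R by exact: exp_pos.
    by move=> e; apply: Rmult_le_pos; lra.
  have Hn' := Zrange_out _ _ Hn.
  have [g1 [g2 g3]] := HK n (T y) (X y) (Y y) a b c Hn'.
  have [g4 [g5 g6]] := HK n (T y) (Y y) (X y) a c b Hn'.
  split.
    apply: Fdiffable_plus; apply: holo_at; apply: holo_polar_term => //; try exact: holo_all.
    + by move=> h hh _; apply: g2.
    + by move=> h hh _; apply: g5.
  apply: Rle_trans (Cmod_triangle _ _) _; lra.
- move=> y Hy; apply: Hs; have := dist_tri y z p; lra.
Qed.

(** Only the representatives h < N occurring in the finite sums are constrained; periodicity later
    recovers all h. *)
Definition regN (tau u : C) : Prop := (forall n, chi n <> 0 -> Qden n tau u <> 0) /\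
  (forall n h, (h < N)%nat -> chi (Z.of_nat h) <> 0 -> Qden n tau (shN h u) <> 0).

Theorem FU_holo p : (0 < Im (T p))%R -> regN (T p) (X p) -> regN (T p) (Y p) -> holo FU p.
Proof.
move=> Ht [x1 x2] [v1 v2]; have [n0 [H _]] := FU_rest p Ht.
have hX : holo X p by exact: holo_all.
have hY : holo Y p by exact: holo_all.
have H2 : holo (fun y => sumC (fun n => polar_term n (T y) (X y) (Y y) + polar_term n (T y) (Y y) (X y)) (Zrange n0)) p.
  apply: (holo_sumC (fun n y => polar_term n (T y) (X y) (Y y) + polar_term n (T y) (Y y) (X y))) => n _; apply: holo_plus; apply: holo_polar_term => //.
  - exact: x1.
  - by move=> h; apply: x2.
  - exact: v1.
  - by move=> h; apply: v2.
apply: holo_ext (holo_plus _ _ _ H H2) _; exists 1%R; split; first lra.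
move=> y _; ring.
Qed.

Variable dX : U.

Hypotheses (dXT : forall y t, T (line y dX t) = T y) (dXX : forall y t, X (line y dX t) = X y + t).

(** Moving by a small real t along dX multiplies the exponential by e^t, so it cannot equal 1 at
    both points. *)
Lemma nzgerm_Qden n c p : nzgerm (fun y => Qden n (T y) (X y + c)) p.
Proof.
move=> [d [d0 H]].
have H0 := H p ltac:(rewrite dist_self; lra).
have nd := norm_ge_0 dX.
pose t := (d / (2 * (norm dX + 1)))%R.
have t0 : (0 < t)%R by apply: Rdiv_lt_0_compat; lra.
have tE : (t * (norm dX + 1) = d / 2)%R by rewrite /t; field; lra.
have dl := dist_line p dX (RtoC t) 0; rewrite line_0 in dl.
have t' : RtoC t - 0 = RtoC t by ring.
rewrite t' Cmod_R Rabs_pos_eq in dl; last lra.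
have := H (line p dX (RtoC t)) ltac:(nra).
rewrite /Qden dXT dXX.
have -> : X p + RtoC t + c + twopii * Z2C n * T p = (X p + c + twopii * Z2C n * T p) + RtoC t by ring.
rewrite Cexp_plus; rewrite /Qden in H0.
have E1 : Cexp (X p + c + twopii * Z2C n * T p) = 1.
  by transitivity (Cexp (X p + c + twopii * Z2C n * T p) - 1 + 1); [ring | rewrite H0; ring].
rewrite E1 => E2.
have E3 : Cexp (RtoC t) = 1 by transitivity (1 * Cexp (RtoC t) - 1 + 1); [ring | rewrite E2; ring].
have : exp t = 1%R by rewrite -[t in exp t](re_RtoC t) -Cmod_Cexp E3 Cmod_1.
by have := exp_ineq1_le t; lra.
Qed.

Lemma mero_polar_term n p : mero (fun y => polar_term n (T y) (X y) (Y y)) p.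
Proof.
have mQ (a : C) e c : mero (fun y => a * Q e n (T y) (X y + c) (Y y)) p.
  exists (fun y => a * Qnum e n (T y) (X y + c) (Y y)), (fun y => Qden n (T y) (X y + c)); split.
    apply: holo_mult; first exact: holo_const.
    apply: holo_Qnum; last exact: holo_all.
    by apply: holo_plus; [exact: holo_all | exact: holo_const].
  split; first by apply: (holo_Qden n (fun y => X y + c)); apply: holo_plus; [exact: holo_all | exact: holo_const].
  split; first exact: nzgerm_Qden.
  by exists 1%R; split; [lra | move=> y _ _; rewrite /Q /Cdiv; ring].
apply: mero_plus.
- apply: mero_ext (mQ (/ 2 * chi n) 0%Z 0) => y; rewrite /polar_term1.
  have -> : X y + 0 = X y by ring.
  ring.
- apply: (mero_sumC (fun h y => polar_term2 n h (T y) (X y) (Y y))) => h _.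
  apply: mero_ext (mQ (/ 2 * (/ W * cchi (Z.of_nat h))) 1%Z (twopii * RtoC (INR h) / RtoC (INR N))) => y.
  rewrite /polar_term2 /shiftN; ring.
Qed.

Lemma Qden_shiftN_0 n tau u : Qden n tau (shN 0 u) = Qden n tau u.
Proof. rewrite /shiftN; congr Qden; rewrite /Cdiv /=; ring. Qed.

Lemma not_regN tau u : ~ regN tau u -> exists n h, (h < N)%nat /\ Qden n tau (shN h u) = 0 /\
  ((h = 0%nat /\ chi n <> 0) \/ chi (Z.of_nat h) <> 0).
Proof.
move=> H; apply: NNPP => K; apply: H; split=> [n c|n h hN c] E; apply: K.
- exists n, 0%nat; rewrite Qden_shiftN_0; split; [lia | split=> //; by left].
- by exists n, h; split=> //; split=> //; right.
Qed.

(** A denominator with shift h occurs in [polar_term2], and for h = 0 also in [polar_term1], which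
    contributes chi(n). *)
Definition polar_coefficient (n : Z) (h : nat) : C :=
  / 2 * ((match Nat.eq_dec h 0 with left _ => chi n | right _ => RtoC 0 end) + / W * cchi (Z.of_nat h)).

Lemma chi_level_1 n : N = 1%nat -> chi n = 1.
Proof.
move=> E; rewrite -(char_1 N chi Hchi).
have := periodic_mult N chi (char_periodic N chi Hchi) 1 (n - 1); rewrite E => <-; congr chi; lia.
Qed.

(** For N = 1 the two contributions add up to 2 before halving. For N > 1, chi(0) = 0 leaves exactly
    one of them, and it is nonzero by assumption. *)
Lemma polar_coefficient_nz n h : (h < N)%nat -> (h = 0%nat /\ chi n <> 0) \/ chi (Z.of_nat h) <> 0 ->
  polar_coefficient n h <> 0.
Proof.
move=> hN H.
have h2 : / 2 <> 0 by apply: Cinv_nz => E; have := RtoC_inj _ _ E; lra.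
have wn := W_nz N chi HN Hprim.
apply: Cmult_neq_0 => //.
case: (Nat.eq_dec N 1) => N1.
- have h0 : h = 0%nat by lia.
  have W1 : W = 1.
    rewrite N1 /gauss_sum sum_O /conj_character (chi_level_1 _ N1) /=.
    have -> : (2 * PI * Ci * 0 / 1)%C = 0 by rewrite /Cdiv; ring.
    rewrite Cexp_0 /Cconj /RtoC /Cmult /=; congr (_, _); ring.
  rewrite h0 W1 /conj_character !(chi_level_1 _ N1).
  have -> : Cconj 1 = 1 by rewrite /Cconj /RtoC /=; congr (_, _); ring.
  have -> : 1 + / 1 * 1 = 2 by field.
  by move=> E; have := RtoC_inj _ _ E; lra.
- have c0 : chi 0%Z = 0.
    apply: (char_0 N chi Hchi) => /Zgcd_1_rel_prime; rewrite Z.gcd_0_l; lia.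
  case: h hN H => [|h] hN.
    rewrite /= c0 (cchi_0 chi _ c0); case=> [[_ c]|//].
    by have -> : chi n + / W * 0 = chi n by ring.
  case=> [[//]|c]; rewrite Cplus_0_l; apply: Cmult_neq_0; first exact: Cinv_nz.
  move=> E; apply: c; rewrite -(Cconj_conj (chi _)); have -> : Cconj (chi (Z.of_nat (S h))) = 0 by [].
  by rewrite /Cconj /RtoC /=; congr (_, _); ring.
Qed.

(** Writing u in terms of 1 and tau, the imaginary part determines n and the real part determines h
    modulo N. Each polar line thus belongs to one pair (n, h), which excludes cancellation between
    different pairs. *)
Lemma Qden_zero_unique tau u n n' h h' : (0 < Im tau)%R -> (h < N)%nat -> (h' < N)%nat ->
  Qden n tau (shN h u) = 0 -> Qden n' tau (shN h' u) = 0 -> n = n' /\ h = h'.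
Proof.
move=> Ht hN hN' E E'.
have eq1 m k : Qden m tau (shN k u) = 0 -> exists j, u = twopii * (Z2C j - RtoC (INR k) / RtoC (INR N) - Z2C m * tau).
  rewrite /Qden => F.
  have /Cexp_eq_1 [j Hj] : Cexp (shN k u + twopii * Z2C m * tau) = 1.
    by transitivity (Cexp (shN k u + twopii * Z2C m * tau) - 1 + 1); [ring | rewrite F; ring].
  exists j; move: Hj; rewrite /shiftN -/(Z2C j) => Hj.
  transitivity (u + twopii * RtoC (INR k) / RtoC (INR N) + twopii * Z2C m * tau - twopii * RtoC (INR k) / RtoC (INR N) - twopii * Z2C m * tau).
    by ring.
  rewrite Hj /Cdiv; ring.
have [j Hj] := eq1 _ _ E; have [j' Hj'] := eq1 _ _ E'.
have N0 : (0 < INR N)%R by apply: lt_0_INR; lia.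
have H2 : Z2C j - RtoC (INR h) / RtoC (INR N) - Z2C n * tau = Z2C j' - RtoC (INR h') / RtoC (INR N) - Z2C n' * tau.
  by apply: (Cmult_cancel_l _ _ _ twopii_nz); rewrite -Hj -Hj'.
rewrite -!RtoC_div in H2; try lra.
have I2 := f_equal Im H2; have R2 := f_equal Re H2.
rewrite /Im /Re /Z2C /RtoC /= in I2 R2.
have en : n = n'.
  apply: eq_IZR; rewrite /Im in Ht; nra.
split=> //; rewrite -en in R2.
have R3 : (IZR (j * Z.of_nat N + Z.of_nat h') = IZR (j' * Z.of_nat N + Z.of_nat h))%R.
  rewrite !plus_IZR !mult_IZR -!INR_IZR_INZ.
  have a1 : (INR h / INR N * INR N = INR h)%R by field; lra.
  have a2 : (INR h' / INR N * INR N = INR h')%R by field; lra.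
  nra.
have := eq_IZR _ _ R3 => R4; have : (j = j')%Z by nia.
by move=> F; rewrite F in R4; lia.
Qed.

Lemma sing_polar_term n h p : (0 < Im (T p))%R -> (h < N)%nat -> Qden n (T p) (shN h (X p)) = 0 ->
  forall m, sing (fun y => Qden n (T y) (shN h (X y))) p (fun y => polar_term m (T y) (X y) (Y y))
    (match Z.eq_dec m n with left _ => polar_coefficient n h * Qnum 0 n (T p) (shN h (X p)) (Y p) | right _ => RtoC 0 end).
Proof.
move=> Ht hN E m; set D := fun y => Qden n (T y) (shN h (X y)).
have uq m' h' : (h' < N)%nat -> Qden m' (T p) (shN h' (X p)) = 0 -> m' = n /\ h' = h.
  by move=> hh E'; apply: Qden_zero_unique E' E.
have hX := holo_all _ p HX; have hY := holo_all _ p HY.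
have sQ e h' (c : C) : m = n -> h' = h -> sing D p (fun y => c * Q e m (T y) (shN h' (X y)) (Y y)) (c * Qnum e n (T p) (shN h (X p)) (Y p)).
  move=> -> ->; exists (fun y => c * Qnum e n (T y) (shN h (X y)) (Y y)), (fun _ => 0); split.
    apply: holo_mult; first exact: holo_const.
    by apply: holo_Qnum => //; exact: holo_shiftN.
  split; first exact: holo_const.
  by split=> //; exists 1%R; split; [lra | move=> y _ _; rewrite /Q /D /Cdiv; ring].
have hQ e h' (c : C) : (h' < N)%nat -> ~ (m = n /\ h' = h) -> sing D p (fun y => c * Q e m (T y) (shN h' (X y)) (Y y)) 0.
  move=> hh nn; apply: holo_sing; apply: holo_mult; first exact: holo_const.
  by apply: holo_Q => //; [exact: holo_shiftN | move=> /(uq _ _ hh)].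
pose a1 := match Z.eq_dec m n with left _ => match Nat.eq_dec h 0 with left _ => / 2 * chi n * Qnum 0 n (T p) (shN h (X p)) (Y p) | right _ => RtoC 0 end | right _ => RtoC 0 end.
pose a2 h' := match Z.eq_dec m n with left _ => match Nat.eq_dec h' h with left _ =>
   / 2 * (/ W * cchi (Z.of_nat h)) * Qnum 1 n (T p) (shN h (X p)) (Y p) | right _ => RtoC 0 end | right _ => RtoC 0 end.
have S1 : sing D p (fun y => polar_term1 m (T y) (X y) (Y y)) a1.
  have e1 : forall y, / 2 * chi m * Q 0 m (T y) (shN 0 (X y)) (Y y) = polar_term1 m (T y) (X y) (Y y).
    move=> y; rewrite /polar_term1; have -> : shN 0 (X y) = X y by rewrite /shiftN /Cdiv /=; ring.
    ring.
  apply: sing_ext e1 _; rewrite /a1; case: Z.eq_dec => [mn|nn]; last by apply: hQ; [lia | case].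
  case: Nat.eq_dec => [h0|nh]; last by apply: hQ; [lia | move=> [_ h0]; apply: nh].
  by rewrite {1}mn; apply: sQ.
have S2 h' : In h' (seq 0 N) -> sing D p (fun y => polar_term2 m h' (T y) (X y) (Y y)) (a2 h').
  move=> /in_seq hh.
  have e1 : forall y, / 2 * (/ W * cchi (Z.of_nat h')) * Q 1 m (T y) (shN h' (X y)) (Y y) = polar_term2 m h' (T y) (X y) (Y y).
    move=> y; rewrite /polar_term2; ring.
  apply: sing_ext e1 _; rewrite /a2; case: Z.eq_dec => [mn|nn]; last by apply: hQ; [lia | case].
  case: Nat.eq_dec => [h0|nh]; last by apply: hQ; [lia | move=> [_ h0]; apply: nh].
  by rewrite h0; apply: sQ.
have S3 := sing_plus _ _ _ _ _ _ S1 (sing_sumC D p (fun h' y => polar_term2 m h' (T y) (X y) (Y y)) a2 _ S2).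
suff E2 : a1 + sumC a2 (seq 0 N) = match Z.eq_dec m n with left _ => polar_coefficient n h * Qnum 0 n (T p) (shN h (X p)) (Y p) | right _ => RtoC 0 end.
  by rewrite -E2.
rewrite (sumC_single a2 _ h (seq_NoDup _ _)); first last.
- by move=> y _ ny; rewrite /a2; case: Z.eq_dec => // _; case: Nat.eq_dec.
- by apply/in_seq; lia.
(* On the polar line x_n = 1, so the two exponents give the same numerator and the coefficients can
   be added. *)
have E3 : Qnum 1 n (T p) (shN h (X p)) (Y p) = Qnum 0 n (T p) (shN h (X p)) (Y p).
  by rewrite -[1%Z]/(0 + 1)%Z Qnum_succ E; ring.
rewrite /a1 /a2; case: Z.eq_dec => _; last by ring.
case: (Nat.eq_dec h h) => // _; rewrite E3 /polar_coefficient; case: Nat.eq_dec => _; ring.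
Qed.

Lemma FU_sing n k p : (0 < Im (T p))%R -> (k < N)%nat -> Qden n (T p) (shN k (X p)) = 0 -> regN (T p) (Y p) ->
  sing (fun y => Qden n (T y) (shN k (X y))) p FU (polar_coefficient n k * Qnum 0 n (T p) (shN k (X p)) (Y p)).
Proof.
move=> Ht kN E [v1 v2]; have [n0 [Hr Hn0]] := FU_rest p Ht.
set D := fun y => Qden n (T y) (shN k (X y)).
pose a m := match Z.eq_dec m n with left _ => polar_coefficient n k * Qnum 0 n (T p) (shN k (X p)) (Y p) | right _ => RtoC 0 end.
have Hs : sing D p FU (0 + sumC (fun m => a m + 0) (Zrange n0)).
  have E2 : forall y, FU y - sumC (fun n => polar_term n (T y) (X y) (Y y) + polar_term n (T y) (Y y) (X y)) (Zrange n0) +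
    sumC (fun n => polar_term n (T y) (X y) (Y y) + polar_term n (T y) (Y y) (X y)) (Zrange n0) = FU y by move=> y; ring.
  apply: sing_ext E2 _; apply: sing_plus; first exact: holo_sing.
  apply: (sing_sumC D p (fun n y => polar_term n (T y) (X y) (Y y) + polar_term n (T y) (Y y) (X y))) => m _.
  apply: sing_plus; first exact: sing_polar_term.
  apply: holo_sing; apply: holo_polar_term; try exact: holo_all; first exact: v1.
  by move=> i; apply: v2.
have <- : 0 + sumC (fun m => a m + 0) (Zrange n0) = polar_coefficient n k * Qnum 0 n (T p) (shN k (X p)) (Y p); last exact: Hs.
rewrite Cplus_0_l (sumC_single _ _ n (Zrange_NoDup _)).
- by rewrite Cplus_0_r /a; case: Z.eq_dec.
- by apply: NNPP => /Hn0 [_ /(_ k kN)].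
- by move=> m _ mn; rewrite /a; case: Z.eq_dec => // _; ring.
Qed.

Variable dY : U.

Hypotheses (dYT : forall y t, T (line y dY t) = T y) (dYX : forall y t, X (line y dY t) = X y)
  (dYY : forall y t, Y (line y dY t) = Y y + t).

(** Torsion shifts do not change the real part, so every pole has a real part that is a multiple of
    [height tau]. *)
Lemma regN_Re tau u : (forall n, Re u <> (IZR n * height tau)%R) -> regN tau u.
Proof.
move=> H; apply: NNPP => /not_regN [n [h [hN [E _]]]]; apply: (H n).
have E1 : Cexp (shN h u + twopii * Z2C n * tau) = 1.
  by move: E; rewrite /Qden => E; transitivity (Cexp (shN h u + twopii * Z2C n * tau) - 1 + 1); [ring | rewrite E; ring].
have [j /(f_equal Re)] := Cexp_eq_1 _ E1.
rewrite re_plus (Re_shiftN N HN) => F; move: F; rewrite /twopii /Z2C /height /Re /Im /= => F.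
lra.
Qed.

(* Moving [p] to a nearby point where [Y] is regular isolates a simple pole in [X]. *)
Theorem FU_not_removable p g h : (0 < Im (T p))%R -> ~ regN (T p) (X p) ->
  holo g p -> holo h p -> nzgerm h p -> near p (fun y => h y <> 0 -> FU y = g y) -> False.
Proof.
move=> Ht /not_regN [n [k [kN [E Hc]]]] Hg Hh nh Hfg.
have [d [d0 Hd]] := near_and _ _ _ (near_and _ _ _ (holo_shift g p Hg) (holo_shift h p Hh))
   (near_and _ _ _ (nzgerm_spread h p Hh nh) Hfg).
have nd := norm_ge_0 dY.
have [e [e0 He]] := avoid_multiples (Re (Y p)) (height (T p)) (height_pos _ Ht).
have dn0 : (0 < d / (norm dY + 1))%R by apply: Rdiv_lt_0_compat; lra.
pose t := (Rmin e (d / (norm dY + 1)) / 2)%R.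
have m1 := Rmin_l e (d / (norm dY + 1)); have m2 := Rmin_r e (d / (norm dY + 1)).
have m3 : (0 < Rmin e (d / (norm dY + 1)))%R by exact: Rmin_glb_lt.
have t0 : (0 < t)%R by rewrite /t; lra.
have t1 : (t < d / (norm dY + 1))%R by rewrite /t; lra.
have tn := He t ltac:(rewrite /t; lra).
pose p1 := line p dY (RtoC t).
have pd : (dist p1 p < d)%R.
  have := dist_line p dY (RtoC t) 0; rewrite line_0.
  have -> : RtoC t - 0 = RtoC t by ring.
  rewrite Cmod_R Rabs_pos_eq; last lra.
  have : (t * (norm dY + 1) < d)%R.
    have -> : (d = d / (norm dY + 1) * (norm dY + 1))%R by field; lra.
    by apply: Rmult_lt_compat_r; lra.
  rewrite -/p1; nra.
have [[g1 h1] [n1 _]] := Hd p1 pd.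
have fg1 : near p1 (fun y => h y <> 0 -> FU y = g y).
  exists (d - dist p1 p)%R; split; first lra.
  move=> y Hy; have [_ [_ F]] := Hd y ltac:(have := dist_tri y p1 p; lra); exact: F.
have T1 : T p1 = T p by exact: dYT.
have X1 : X p1 = X p by exact: dYX.
have Y1 : regN (T p1) (Y p1).
  apply: regN_Re => m; rewrite T1 /p1 dYY; exact: tn.
have Ht1 : (0 < Im (T p1))%R by rewrite T1.
have E1 : Qden n (T p1) (shN k (X p1)) = 0 by rewrite T1 X1.
apply: (sing_not_removable (fun y => Qden n (T y) (shN k (X y))) p1 FU _ g h _ _ E1 _ (FU_sing n k p1 Ht1 kN E1 Y1)) => //.
- by apply: holo_Qden; apply: holo_shiftN; exact: holo_all.
- exact: nzgerm_Qden.
- by apply: Cmult_neq_0; [exact: polar_coefficient_nz | exact: Cexp_nz].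
Qed.

End Analytic.

Section Poles.

Variables (N : nat) (chi : Z -> C) (HN : (1 <= N)%nat) (Hprim : primitive_character N chi).

Let Hchi : dirichlet_character N chi := proj1 Hprim.

Local Notation NZ := (Z.of_nat N).

Lemma Qden_zero n tau w : Qden n tau w = 0 <-> exists j, w = twopii * (Z2C j - Z2C n * tau).
Proof.
rewrite /Qden; split=> [E|[j ->]].
- have /Cexp_eq_1 [j Hj] : Cexp (w + twopii * Z2C n * tau) = 1.
    by transitivity (Cexp (w + twopii * Z2C n * tau) - 1 + 1); [ring | rewrite E; ring].
  exists j; transitivity (w + twopii * Z2C n * tau - twopii * Z2C n * tau); first ring.
  rewrite Hj /Z2C; ring.
- have -> : twopii * (Z2C j - Z2C n * tau) + twopii * Z2C n * tau = twopii * Z2C j by ring.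
  rewrite Cexp_twopii_Z; ring.
Qed.

(** A zero of [Qden n] lies over -n tau, and undoing the shift by h gives the residue -h modulo N,
    hence the sign changes. The coprimality conditions express that the corresponding value of chi
    is nonzero. *)
Lemma polar_value_regN tau w : polar_value N tau w <-> ~ regN N chi tau w.
Proof.
have nN := INR_N_nz N HN.
split.
- move=> [r [n [[g E]|[g E]]]] [H1 H2].
  + have NZ0 : (0 < NZ)%Z by lia.
    have [b1 b2] := Z.mod_pos_bound (- r) NZ NZ0.
    pose h := Z.to_nat ((- r) mod NZ).
    have hE : Z.of_nat h = ((- r) mod NZ)%Z by rewrite /h Z2Nat.id.
    apply: (H2 (- n)%Z h); first lia.
      rewrite hE (periodic_mod N chi HN (char_periodic N chi Hchi)).
      by apply/(char_nz N chi Hchi); apply/Zgcd_1_rel_prime; rewrite Z.gcd_opp_l.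
    have rE : r = ((- ((- r) / NZ)) * NZ - Z.of_nat h)%Z.
      rewrite hE; have := Z_div_mod_eq_full (- r) NZ; lia.
    apply/Qden_zero; exists (- ((- r) / NZ))%Z.
    rewrite E /shiftN -/twopii -!/(Z2C _) {1}rE Z2C_minus Z2C_mult !Z2C_nat !Z2C_opp; field; exact: nN.
  + apply: (H1 (- n)%Z).
      by apply/(char_nz N chi Hchi); apply/Zgcd_1_rel_prime; rewrite Z.gcd_opp_l.
    apply/Qden_zero; exists r; rewrite E -/twopii -!/(Z2C _) Z2C_opp; ring.
- move=> /(not_regN N chi HN) [n [h [hN [/Qden_zero [j E] c]]]].
  have E2 : w = twopii * (Z2C j - Z2C n * tau) - twopii * RtoC (INR h) / RtoC (INR N) by rewrite -E /shiftN; ring.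
  case: c => [[h0 c]|c].
  + exists j, (- n)%Z; right; split.
      by rewrite Z.gcd_opp_l; apply/Zgcd_1_rel_prime; apply/(char_nz N chi Hchi).
    rewrite E2 h0 -/twopii -!/(Z2C _) Z2C_opp Z2C_0; field; exact: nN.
  + exists (j * NZ - Z.of_nat h)%Z, (- n)%Z; left; split.
      have -> : (j * NZ - Z.of_nat h = - Z.of_nat h + j * NZ)%Z by ring.
      apply/Zgcd_1_rel_prime; apply/(char_nz N chi Hchi).
      rewrite (periodic_mult N chi (char_periodic N chi Hchi)).
      apply/(char_nz N chi Hchi)/Zgcd_1_rel_prime; rewrite Z.gcd_opp_l.
      by apply/Zgcd_1_rel_prime; apply/(char_nz N chi Hchi).
    rewrite E2 -/twopii -!/(Z2C _) Z2C_minus Z2C_mult !Z2C_nat Z2C_opp; field; exact: nN.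
Qed.

Lemma not_polar_regN tau w : ~ polar_value N tau w <-> regN N chi tau w.
Proof.
rewrite polar_value_regN; split; first exact: NNPP.
by move=> h nh; apply: nh.
Qed.

Lemma regN_regular tau w : regN N chi tau w -> regular N chi tau w.
Proof.
move=> [H1 H2]; split=> // n h c /Qden_zero [j E].
have := Nat.mod_upper_bound h N ltac:(lia) => b.
have hE := Nat.div_mod_eq h N.
apply: (H2 n (h mod N)%nat b).
  have -> : Z.of_nat (h mod N) = (Z.of_nat h mod NZ)%Z by rewrite Nat2Z.inj_mod.
  by rewrite (periodic_mod N chi HN (char_periodic N chi Hchi)).
apply/Qden_zero; exists (j - Z.of_nat (h / N))%Z.
move: E; rewrite /shiftN {1}hE plus_INR mult_INR !RtoC_plus RtoC_mult Z2C_minus Z2C_nat => E.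
have -> : twopii * (Z2C j - RtoC (INR (h / N)) - Z2C n * tau) = twopii * (Z2C j - Z2C n * tau) - twopii * RtoC (INR (h / N)) by ring.
rewrite -E; field; exact: INR_N_nz.
Qed.

Section OnSpace.

Context {U : NormedModule C_AbsRing}.

Variables (T X Y : U -> C) (dX dY : U).

Hypotheses (HT : forall y, Fdiffable T y) (HX : forall y, Fdiffable X y) (HY : forall y, Fdiffable Y y).

Hypotheses (dXT : forall y t, T (line y dX t) = T y) (dXX : forall y t, X (line y dX t) = X y + t) (dXY : forall y t, Y (line y dX t) = Y y).

Hypotheses (dYT : forall y t, T (line y dY t) = T y) (dYX : forall y t, X (line y dY t) = X y)
  (dYY : forall y t, Y (line y dY t) = Y y + t).

Local Notation G := (FU N chi T X Y).

Lemma FU_mero p : (0 < Im (T p))%R -> meromorphic_at G p.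
Proof.
move=> Ht; apply: mero_meromorphic_at; have [n0 [H _]] := FU_rest N chi HN Hprim T X Y HT HX HY p Ht.
apply: (mero_ext (fun y => (G y - sumC (fun n => polar_term N chi n (T y) (X y) (Y y) + polar_term N chi n (T y) (Y y) (X y)) (Zrange n0)) +
  sumC (fun n => polar_term N chi n (T y) (X y) (Y y) + polar_term N chi n (T y) (Y y) (X y)) (Zrange n0))).
  by move=> y; ring.
apply: mero_plus; first exact: holo_mero.
apply: (mero_sumC (fun n y => polar_term N chi n (T y) (X y) (Y y) + polar_term N chi n (T y) (Y y) (X y))) => n _.
by apply: mero_plus; [exact: (mero_polar_term N chi T X Y HT HX HY dX) | exact: (mero_polar_term N chi T Y X HT HY HX dY)].
Qed.

Lemma FU_holomorphic p : (0 < Im (T p))%R -> ~ polar_point N (T p) (X p) (Y p) -> holomorphic_at G p.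
Proof.
move=> Ht H; apply/holo_holomorphic_at; apply: FU_holo => //; apply/not_polar_regN => h; apply: H; by [left | right].
Qed.

Lemma FU_pole p : (0 < Im (T p))%R -> (pole_at G p <-> polar_point N (T p) (X p) (Y p)).
Proof.
move=> Ht; split.
- move=> [_ H]; apply: NNPP => np; apply: H.
  exists G, (fun _ => 1); split; first exact: FU_holomorphic.
  split; first by apply/holo_holomorphic_at; exact: holo_const.
  split; first by move=> /locally_near [d [d0 Hd]]; apply: C1_nz; apply: (Hd p); rewrite dist_self.
  by apply: near_locally; exists 1%R; split; [lra |].
- move=> Hp; split; first exact: FU_mero.
  move=> [g [h [/holo_holomorphic_at Hg [/holo_holomorphic_at Hh [nh /locally_near Hfg]]]]].
  have nh' : nzgerm h p by move=> H; apply: nh; exact: near_locally.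
  case: Hp => /polar_value_regN Hp.
  + exact: (FU_not_removable N chi HN Hprim T X Y HT HX HY dX dXT dXX dY dYT dYX dYY p g h).
  + apply: (FU_not_removable N chi HN Hprim T Y X HT HY HX dY dYT dYY dX dXT dXY dXX p g h) => //.
    by apply: near_imp Hfg => y H /H <-; rewrite /FU; exact: Ftw_sym.
Qed.

End OnSpace.

Section C3.

Let T (p : C3) : C := fst p.

Let X (p : C3) : C := fst (snd p).

Let Y (p : C3) : C := snd (snd p).

Let lT : is_linear (V := C_NormedModule) T := is_linear_fst (K := C_AbsRing) (U := C_NormedModule) (V := C2).

Let lX : is_linear (V := C_NormedModule) X := is_linear_comp _ _ (is_linear_snd (K := C_AbsRing) (U := C_NormedModule) (V := C2)) is_linear_fst.

Let lY : is_linear (V := C_NormedModule) Y := is_linear_comp _ _ (is_linear_snd (K := C_AbsRing) (U := C_NormedModule) (V := C2)) is_linear_snd.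

Let dX : C3 := (RtoC 0, (RtoC 1, RtoC 0)).

Let dY : C3 := (RtoC 0, (RtoC 0, RtoC 1)).

Lemma Ftw_C3 (tau u v : C) : (0 < Im tau)%R -> meromorphic_at (on_C3 (Ftw N chi)) (tau, (u, v)) /\
  (~ polar_point N tau u v -> holomorphic_at (on_C3 (Ftw N chi)) (tau, (u, v))).
Proof.
move=> Ht; split.
- apply: (FU_mero T X Y dX dY) => //; try (by move=> y; apply: Fdiffable_linear);
  by move=> y t; rewrite /T /X /Y /line /dX /dY /=; change plus with Cplus; change scal with Cmult; ring.
- move=> np; apply: (FU_holomorphic T X Y) => //; by move=> y; apply: Fdiffable_linear.
Qed.

End C3.

Section C2.

Variable tau : C.

Let T (p : C2) : C := tau.

Let X (p : C2) : C := fst p.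

Let Y (p : C2) : C := snd p.

Let lX : is_linear (V := C_NormedModule) X := is_linear_fst.

Let lY : is_linear (V := C_NormedModule) Y := is_linear_snd.

Let dX : C2 := (RtoC 1, RtoC 0).

Let dY : C2 := (RtoC 0, RtoC 1).

Lemma Ftw_C2 (u v : C) : (0 < Im tau)%R -> meromorphic_at (on_C2 (Ftw N chi tau)) (u, v) /\
  (pole_at (on_C2 (Ftw N chi tau)) (u, v) <-> polar_point N tau u v).
Proof.
move=> Ht; split.
- apply: (FU_mero T X Y dX dY) => //; try (by move=> y; apply: Fdiffable_linear); try (by move=> y; apply: Fdiffable_const);
  by move=> y t; rewrite /T /X /Y /line /dX /dY /=; change plus with Cplus; change scal with Cmult; ring.
- apply: (FU_pole T X Y dX dY) => //; try (by move=> y; apply: Fdiffable_linear); try (by move=> y; apply: Fdiffable_const);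
  by move=> y t; rewrite /T /X /Y /line /dX /dY /=; change plus with Cplus; change scal with Cmult; ring.
Qed.

End C2.

End Poles.

(** * Quasi-periodic functions without poles *)

(** One number e serves both as radius and, inverted, as local bound, so a single positive lower
    bound from compactness gives a global bound. *)
Lemma bounded_on_box (B : R -> R -> R) a b a' b' :
  (forall x y, exists e, (0 < e)%R /\ forall x' y', (Rabs (x' - x) < e)%R -> (Rabs (y' - y) < e)%R -> (B x' y' <= / e)%R) ->
  exists M, forall x y, (a <= x <= b)%R -> (a' <= y <= b')%R -> (B x y <= M)%R.
Proof.
move=> H.
pose P x y (e : posreal) := forall x' y', (Rabs (x' - x) < e)%R -> (Rabs (y' - y) < e)%R -> (B x' y' <= / e)%R.
have H' x y : exists e, P x y e by have [e [e0 he]] := H x y; exists (mkposreal e e0).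
pose delta x y := epsilon (inhabits (mkposreal 1 Rlt_0_1)) (P x y).
have Hd x y : P x y (delta x y) by exact: epsilon_spec (H' x y).
have [d hd] := compactness_value_2d a b a' b' delta.
exists (/ d)%R => x y Hx Hy; apply: NNPP => n.
apply: (hd x y Hx Hy) => -[u [v [_ [_ [h1 [h2 h3]]]]]]; apply: n.
apply: Rle_trans (Hd u v x y h1 h2) _; apply: Rinv_le_contravar => //; exact: cond_pos.
Qed.

Definition in_lattice (tau w : C) : Prop := exists p n : Z, w = twopii * (Z2C p + Z2C n * tau).

Section Lattice.

Variable tau : C.

Hypothesis Ht : (0 < Im tau)%R.

Local Notation L := (in_lattice tau).

Lemma lattice_plus w p n : L (w + twopii * (Z2C p + Z2C n * tau)) <-> L w.
Proof.
split=> -[p' [n' E]].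
- exists (p' - p)%Z, (n' - n)%Z; rewrite !Z2C_minus.
  transitivity (w + twopii * (Z2C p + Z2C n * tau) - twopii * (Z2C p + Z2C n * tau)); [ring | rewrite E; ring].
- exists (p' + p)%Z, (n' + n)%Z; rewrite !Z2C_plus E; ring.
Qed.

Lemma lattice_0 : L 0.
Proof. exists 0%Z, 0%Z; rewrite !Z2C_0; ring. Qed.

(** A lower bound for the distance of lattice points: real parts are multiples of the height, and
    points with equal real part differ by multiples of 2 pi i. *)
Definition lattice_sep : R := Rmin (2 * PI) (height tau).

Lemma lattice_sep_pos : (0 < lattice_sep)%R.
Proof. have := PI_RGT_0; have := height_pos tau Ht; rewrite /lattice_sep => h p; apply: Rmin_glb_lt; lra. Qed.

Lemma lattice_small w : L w -> (Cmod w < lattice_sep)%R -> w = 0.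
Proof.
move=> [p [n E]] Hw.
have w1 := Rlt_le_trans _ _ _ Hw (Rmin_l _ _); have w2 := Rlt_le_trans _ _ _ Hw (Rmin_r _ _).
have pp := PI_RGT_0; have hp := height_pos tau Ht.
have reE : Re w = (- (IZR n * height tau))%R by rewrite E /twopii /Z2C /height /Re /Im /=; ring.
have imE : Im w = (2 * PI * (IZR p + IZR n * Re tau))%R by rewrite E /twopii /Z2C /height /Re /Im /=; ring.
have small (k : Z) (H : R) : (0 < H)%R -> (Rabs (IZR k * H) < H)%R -> k = 0%Z.
  move=> H0; rewrite Rabs_mult (Rabs_pos_eq H); last lra.
  rewrite -abs_IZR => h.
  have : (IZR (Z.abs k) < 1)%R by apply: (Rmult_lt_reg_r H) => //; lra.
  by move=> /lt_IZR; lia.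
have n0 : n = 0%Z.
  apply: (small n (height tau)) => //; rewrite -Rabs_Ropp -reE.
  exact: Rle_lt_trans (fst_le_Cmod w) w2.
have p0 : p = 0%Z.
  apply: (small p (2 * PI)%R); first lra.
  have -> : (IZR p * (2 * PI) = Im w)%R by rewrite imE n0; ring.
  exact: Rle_lt_trans (snd_le_Cmod w) w1.
rewrite E n0 p0 !Z2C_0; ring.
Qed.

Lemma lattice_isolated w : L w -> forall z, (Cmod (z - w) < lattice_sep)%R -> z <> w -> ~ L z.
Proof.
move=> [p [n Ew]] z Hz nz Lz; apply: nz.
have : L (z - w).
  have -> : z - w = z + twopii * (Z2C (- p) + Z2C (- n) * tau) by rewrite Ew !Z2C_opp; ring.
  by apply/lattice_plus.
move=> /lattice_small /(_ Hz) E; transitivity (z - w + w); [ring | rewrite E; ring].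
Qed.

Lemma lattice_closed z : ~ L z -> exists e, (0 < e)%R /\ forall w, (Cmod (w - z) < e)%R -> ~ L w.
Proof.
move=> nz; have dp := lattice_sep_pos.
case: (classic (exists l, L l /\ (Cmod (z - l) < lattice_sep / 2)%R)) => [[l [Ll Hl]]|N].
- have zl : (0 < Cmod (z - l))%R by apply/Cmod_gt_0; apply: Cminus_neq_0 => E; apply: nz; rewrite E.
  exists (Cmod (z - l)); split=> // w Hw Lw.
  have nw : w <> l by move=> E; rewrite E Cmod_minus_sym in Hw; lra.
  apply: (lattice_isolated l Ll w _ nw Lw).
  have := Cmod_tri_minus w z l; lra.
- exists (lattice_sep / 2)%R; split; first lra.
  by move=> w Hw Lw; apply: N; exists w; rewrite Cmod_minus_sym.
Qed.

Lemma lattice_coordinates z : exists p n x y, (0 <= x <= 1)%R /\ (0 <= y <= 1)%R /\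
  z = twopii * (RtoC x + RtoC y * tau) + twopii * (Z2C p + Z2C n * tau).
Proof.
have pp := PI_RGT_0.
pose Y := (- Re z / height tau)%R. pose X := (Im z / (2 * PI) - Y * Re tau)%R.
have fl (t : R) : exists (k : Z) s, (0 <= s <= 1)%R /\ t = (s + IZR k)%R.
  exists (up t - 1)%Z, (t - IZR (up t - 1))%R; rewrite minus_IZR; have := archimed t; split; lra.
have [n [y [Hy Ey]]] := fl Y; have [p [x [Hx Ex]]] := fl X.
exists p, n, x, y; split=> //; split=> //.
have -> : twopii * (RtoC x + RtoC y * tau) + twopii * (Z2C p + Z2C n * tau) = twopii * (RtoC (x + IZR p) + RtoC (y + IZR n) * tau).
  rewrite !RtoC_plus /Z2C; ring.
rewrite -Ex -Ey.
have hp := height_pos tau Ht; rewrite /height in hp.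
have it0 : Im tau <> 0%R by lra.
apply: injective_projections; rewrite /twopii /X /Y /height /Re /Im /=; rewrite /Im in it0; field; split; lra.
Qed.

End Lattice.

(* Multiplying [f] by a suitable exponential makes its modulus doubly periodic, so that Liouville's theorem applies. *)
Theorem elliptic_zero (tau v : C) (f : C -> C) : (0 < Im tau)%R -> ~ in_lattice tau v ->
  (forall w, ~ in_lattice tau w -> cdiffable f w) ->
  (forall w p n, ~ in_lattice tau w -> f (w + twopii * (Z2C p + Z2C n * tau)) = Cexp (- (Z2C n * v)) * f w) ->
  (forall eps, (0 < eps)%R -> exists d, (0 < d)%R /\ forall w, (0 < Cmod w < d)%R -> (Cmod (w * f w) < eps)%R) ->
  forall w, ~ in_lattice tau w -> f w = 0.
Proof.
move=> Ht nv Hf Hq Hr.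
have pp := PI_RGT_0; have sp := lattice_sep_pos tau Ht; have hp := height_pos tau Ht.
(* Chosen so that al height = - Re v: translation by 2 pi i tau then multiplies e^(al w) by a factor
   of modulus |e^v|, cancelling that of the multiplier of f. *)
pose al := (- (Re v / height tau))%R.
pose g w := f w * Cexp (RtoC al * w).
have gd w : ~ in_lattice tau w -> cdiffable g w.
  move=> nw; apply: cdiffable_mult; first exact: Hf.
  by apply: cdiffable_Cexp; apply: cdiffable_mult; [exact: cdiffable_const | exact: cdiffable_id].
have gq w p n : ~ in_lattice tau w -> g (w + twopii * (Z2C p + Z2C n * tau)) = Cexp (RtoC al * (twopii * (Z2C p + Z2C n * tau)) - Z2C n * v) * g w.
  move=> nw; rewrite /g Hq // Cmult_plus_distr_l Cexp_plus.
  have -> : RtoC al * (twopii * (Z2C p + Z2C n * tau)) - Z2C n * v = RtoC al * (twopii * (Z2C p + Z2C n * tau)) + - (Z2C n * v) by ring.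
  rewrite Cexp_plus; ring.
have gm w p n : ~ in_lattice tau w -> Cmod (g (w + twopii * (Z2C p + Z2C n * tau))) = Cmod (g w).
  move=> nw; rewrite gq // Cmod_mult Cmod_Cexp.
  have -> : Re (RtoC al * (twopii * (Z2C p + Z2C n * tau)) - Z2C n * v) = 0%R.
    have E : (al * height tau = - Re v)%R by rewrite /al; field; lra.
    have -> : Re (RtoC al * (twopii * (Z2C p + Z2C n * tau)) - Z2C n * v) = (- (al * height tau) * IZR n - IZR n * Re v)%R.
      rewrite /twopii /Z2C /height /Re /Im /=; ring.
    rewrite E; ring.
  by rewrite exp_0 Rmult_1_l.
(* [w f(w)] extends by [0] at the origin, hence [f] is bounded near it. *)
have f0 : exists M e, (0 < e)%R /\ forall w, (0 < Cmod w < e)%R -> (Cmod (f w) <= M)%R.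
  have [d [d0 hd]] := Hr 1%R Rlt_0_1.
  have [||a [l Ha]] := removable_singularity (fun w => w * f w) 0 (Rmin d (lattice_sep tau)) 1.
  - exact: Rmin_glb_lt.
  - move=> w Hw nw.
    have w0 : w - 0 = w by ring.
    have wp : (0 < Cmod w)%R by apply/Cmod_gt_0.
    split; last first.
      left; apply: hd; rewrite -{2}w0; split=> //; exact: Rlt_le_trans Hw (Rmin_l _ _).
    apply: cdiffable_mult; first exact: cdiffable_id.
    apply: Hf; apply: (lattice_isolated tau Ht 0 (lattice_0 tau)) => //.
    exact: Rlt_le_trans Hw (Rmin_r _ _).
  have a0 : a = 0.
    apply: NNPP => na; have ap : (0 < Cmod a)%R by apply/Cmod_gt_0.
    have [e [e0 he]] := cdiff_ccont _ _ _ Ha (Cmod a / 2)%R ltac:(lra).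
    have [d' [d'0 hd']] := Hr (Cmod a / 2)%R ltac:(lra).
    pose t := (Rmin e d' / 2)%R.
    have m1 := Rmin_l e d'; have m2 := Rmin_r e d'; have m3 : (0 < Rmin e d')%R by exact: Rmin_glb_lt.
    have t0 : (0 < t)%R by rewrite /t; lra.
    have tm : Cmod (RtoC t) = t by rewrite Cmod_R Rabs_pos_eq; lra.
    have := he (RtoC t); have := hd' (RtoC t); rewrite tm.
    have -> : RtoC t - 0 = RtoC t by ring.
    rewrite tm; case: classic_eq_dec => [E|_]; first by have := RtoC_inj _ _ E; lra.
    case: classic_eq_dec => [_|//] h1 h2.
    have := h1 ltac:(rewrite /t; lra); have := h2 ltac:(rewrite /t; lra).
    have := Cmod_tri_minus a (RtoC t * f (RtoC t)) 0.
    have -> : RtoC t * f (RtoC t) - 0 = RtoC t * f (RtoC t) by ring.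
    have -> : a - 0 = a by ring.
    rewrite (Cmod_minus_sym a); lra.
  have [e [e0 he]] := cdiff_lip _ _ _ Ha.
  exists (Cmod l + 1)%R, e; split=> // w [w0 we].
  have := he w; have -> : w - 0 = w by ring.
  move=> /(_ we); case: classic_eq_dec => [E|_]; first by rewrite E Cmod_0 in w0; lra.
  case: classic_eq_dec => [_|//]; rewrite a0.
  have -> : w * f w - 0 = w * f w by ring.
  rewrite Cmod_mult => h; apply: (Rmult_le_reg_l (Cmod w)) => //; lra.
have gloc z : exists M e, (0 < e)%R /\ forall w, (Cmod (w - z) < e)%R -> ~ in_lattice tau w -> (Cmod (g w) <= M)%R.
  case: (classic (in_lattice tau z)) => [[p [n Ez]]|nz].
  - have [M [e [e0 he]]] := f0.
    exists (M * exp (Rabs al * e))%R, e; split=> // w Hw nw.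
    have nwz : ~ in_lattice tau (w - z).
      have -> : w - z = w + twopii * (Z2C (- p) + Z2C (- n) * tau) by rewrite Ez !Z2C_opp; ring.
      by move=> /lattice_plus.
    have wE : w = w - z + twopii * (Z2C p + Z2C n * tau) by rewrite -Ez; ring.
    rewrite wE gm // /g Cmod_mult Cmod_Cexp.
    have wp : (0 < Cmod (w - z))%R.
      apply/Cmod_gt_0 => E; apply: nwz; rewrite E; exact: lattice_0.
    apply: Rmult_le_compat; [exact: Cmod_ge_0 | left; exact: exp_pos | exact: he |].
    apply: exp_le_compat; apply: Rle_trans (Rle_abs _) _.
    have -> : Re (RtoC al * (w - z)) = (al * Re (w - z))%R by rewrite /Re /=; ring.
    rewrite Rabs_mult; apply: Rmult_le_compat_l; first exact: Rabs_pos.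
    have := fst_le_Cmod (w - z); rewrite -/(Re (w - z)); lra.
  - have [e [e0 he]] := cdiffable_ccont _ _ (gd z nz) 1%R Rlt_0_1.
    exists (Cmod (g z) + 1)%R, e; split=> // w Hw _.
    have := he w Hw; have := Cmod_minus_le (g w) (g z); lra.
have [M HM] : exists M, forall w, ~ in_lattice tau w -> (Cmod (g w) <= M)%R.
  pose B x y := let w := twopii * (RtoC x + RtoC y * tau) in
     match excluded_middle_informative (in_lattice tau w) with left _ => 0%R | right _ => Cmod (g w) end.
  have [|M HM] := bounded_on_box B 0 1 0 1.
    move=> x y; have [M [e [e0 he]]] := gloc (twopii * (RtoC x + RtoC y * tau)).
    pose c := (2 * PI * (1 + Cmod tau))%R.
    have c0 : (0 < c)%R by have := Cmod_ge_0 tau; rewrite /c; nra.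
    pose M' := (Rabs M + 1)%R.
    have M0 : (0 < M')%R by have := Rabs_pos M; rewrite /M'; lra.
    exists (Rmin (e / c) (/ M'))%R.
    have ep : (0 < Rmin (e / c) (/ M'))%R.
      by apply: Rmin_glb_lt; [exact: Rdiv_lt_0_compat | exact: Rinv_0_lt_compat].
    split=> // x' y' Hx Hy.
    have big : (M' <= / Rmin (e / c) (/ M'))%R.
      rewrite -{1}(Rinv_inv M'); apply: Rinv_le_contravar => //; exact: Rmin_r.
    apply: Rle_trans _ big; rewrite /B; case: excluded_middle_informative => [_|nw]; first by lra.
    apply: Rle_trans (he _ _ nw) _; last by have := Rle_abs M; rewrite /M'; lra.
    have -> : twopii * (RtoC x' + RtoC y' * tau) - twopii * (RtoC x + RtoC y * tau) = twopii * (RtoC (x' - x) + RtoC (y' - y) * tau).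
      rewrite !RtoC_minus; ring.
    have tp : Cmod twopii = (2 * PI)%R.
      rewrite /twopii !Cmod_mult Cmod_Ci !Cmod_R !Rabs_pos_eq; lra.
    rewrite Cmod_mult tp.
    have h1 := Rlt_le_trans _ _ _ Hx (Rmin_l _ _); have h2 := Rlt_le_trans _ _ _ Hy (Rmin_l _ _).
    have eE : (e = 2 * PI * (e / c * (1 + Cmod tau)))%R by rewrite /c; field; split; [have := Cmod_ge_0 tau|]; lra.
    rewrite eE; apply: Rmult_lt_compat_l; first lra.
    apply: Rle_lt_trans (Cmod_triangle _ _) _; rewrite Cmod_mult !Cmod_R.
    have := Cmod_ge_0 tau; nra.
  exists M => w nw; have [p [n [x [y [Hx [Hy E]]]]]] := lattice_coordinates tau Ht w.
  have nw' : ~ in_lattice tau (twopii * (RtoC x + RtoC y * tau)) by move=> h; apply: nw; rewrite E; apply/lattice_plus.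
  rewrite E gm //; have := HM x y Hx Hy; rewrite /B; by case: excluded_middle_informative.
pose ok z a := cdiffable (fun w => match classic_eq_dec w z with left _ => a | right _ => g w end) z.
have Hok z : in_lattice tau z -> exists a, ok z a.
  move=> Lz; apply: (removable_singularity g z (lattice_sep tau) M) => // w Hw nw.
  have nl := lattice_isolated tau Ht z Lz w Hw nw.
  by split; [exact: gd | exact: HM].
pose val z := epsilon (inhabits (RtoC 0)) (ok z).
pose G w := match excluded_middle_informative (in_lattice tau w) with left _ => val w | right _ => g w end.
have Gg w : ~ in_lattice tau w -> G w = g w by move=> nw; rewrite /G; case: excluded_middle_informative.
have Gd z : cdiffable G z.
  case: (classic (in_lattice tau z)) => Lz.
  - apply: cdiffable_ext (epsilon_spec (inhabits (RtoC 0)) (ok z) (Hok z Lz)) _.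
    exists (lattice_sep tau); split=> // w Hw; case: classic_eq_dec => [->|nw].
      by rewrite /G; case: excluded_middle_informative.
    by rewrite Gg //; exact: (lattice_isolated tau Ht z Lz).
  - have [e [e0 he]] := lattice_closed tau Ht z Lz.
    apply: cdiffable_ext (gd z Lz) _; exists e; split=> // w Hw.
    by rewrite Gg //; apply: he.
have GM z : (Cmod (G z) <= M)%R.
  case: (classic (in_lattice tau z)) => Lz; last by rewrite Gg //; exact: HM.
  apply: Rnot_lt_le => h.
  have [e [e0 he]] := cdiffable_ccont _ _ (Gd z) (Cmod (G z) - M)%R ltac:(lra).
  pose t := (Rmin e (lattice_sep tau) / 2)%R.
  have m1 := Rmin_l e (lattice_sep tau); have m2 := Rmin_r e (lattice_sep tau); have m3 : (0 < Rmin e (lattice_sep tau))%R by exact: Rmin_glb_lt.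
  have t0 : (0 < t)%R by rewrite /t; lra.
  have tE : z + RtoC t - z = RtoC t by ring.
  have tm : Cmod (z + RtoC t - z) = t by rewrite tE Cmod_R Rabs_pos_eq; lra.
  have nw : ~ in_lattice tau (z + RtoC t).
    apply: (lattice_isolated tau Ht z Lz); first by rewrite tm /t; lra.
    move=> E; have F : RtoC t = 0 by rewrite -tE E; ring.
    have := RtoC_inj _ _ F; lra.
  have := he (z + RtoC t) ltac:(rewrite tm /t; lra); rewrite (Gg _ nw).
  have := HM _ nw; have := Cmod_minus_le (G z) (g (z + RtoC t)); rewrite Cmod_minus_sym; lra.
have Gc := liouville G M Gd GM.
have gc w : ~ in_lattice tau w -> g w = G 0 by move=> nw; rewrite -Gg.
have G0 : G 0 = 0.
  apply: NNPP => n0.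
  have per p n : Cexp (RtoC al * (twopii * (Z2C p + Z2C n * tau)) - Z2C n * v) = 1.
    apply: (Cmult_cancel_l (G 0)) => //.
    have nv' : ~ in_lattice tau (v + twopii * (Z2C p + Z2C n * tau)) by move=> /lattice_plus.
    rewrite -{1}(gc v nv) Cmult_comm -gq // gc //; ring.
  have [k Hk] := Cexp_eq_1 _ (per 1%Z 0%Z); have [k' Hk'] := Cexp_eq_1 _ (per 0%Z 1%Z).
  have ak : RtoC al = Z2C k.
    apply: (Cmult_cancel_l twopii); first exact: twopii_nz.
    rewrite /Z2C -Hk !Z2C_0 Z2C_1; ring.
  apply: nv; exists (- k')%Z, k; rewrite -ak Z2C_opp.
  transitivity (RtoC al * (twopii * tau) - twopii * Z2C k'); last by ring.
  rewrite /Z2C -Hk' !Z2C_0 Z2C_1; ring.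
move=> w nw; have := gc w nw; rewrite G0 /g => E.
apply: NNPP => nf; exact: (Cmult_neq_0 _ _ nf (Cexp_nz _) E).
Qed.

(** * The classical Kronecker function *)

Definition one_char : Z -> C := fun _ => 1.

Lemma one_char_primitive : primitive_character 1 one_char.
Proof.
split; last by move=> M HM; lia.
split=> //; split; first by move=> m n; rewrite /one_char; ring.
move=> n; split=> _; [exact: Z.gcd_1_r | exact: C1_nz].
Qed.

Local Notation H11 := (Nat.le_refl 1).

Local Notation HP := one_char_primitive.

Definition kron (tau u v : C) : C := Ftw 1 one_char tau u v.

Lemma polar_value_1 tau w : polar_value 1 tau w <-> in_lattice tau w.
Proof.
split.
- move=> [r [n [[_ ->]|[_ ->]]]]; exists r, n; first (transitivity (twopii * Z2C r / 1 + twopii * Z2C n * tau); [by [] | field]); last (rewrite -/twopii -!/(Z2C _); ring).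
- move=> [p [n ->]]; exists p, n; right; split; first exact: Z.gcd_1_r.
  rewrite -/twopii -!/(Z2C _); ring.
Qed.

Lemma regN_1 tau w : ~ in_lattice tau w -> regN 1 one_char tau w.
Proof. by move=> H; apply/(not_polar_regN 1 one_char H11 HP) => /polar_value_1. Qed.

Lemma regular_1 tau w : ~ in_lattice tau w -> regular 1 one_char tau w.
Proof. by move=> /regN_1; exact: (regN_regular 1 one_char H11 HP). Qed.

Lemma kron_elliptic tau u v m n r s : (0 < Im tau)%R -> ~ in_lattice tau u -> ~ in_lattice tau v ->
  kron tau (u + twopii * (Z2C n * tau + Z2C s)) (v + twopii * (Z2C m * tau + Z2C r)) =
  Cexp (- (Z2C (m * n) * (twopii * tau)) - Z2C m * u - Z2C n * v) * kron tau u v.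
Proof.
move=> Ht nu nv.
have := Ftw_elliptic 1 one_char H11 HP tau u v m n r s Ht (regular_1 _ _ nu) (regular_1 _ _ nv).
by rewrite /ell_factor !Z.mul_1_r !Z.mul_1_l.
Qed.

Lemma gauss_sum_one : gauss_sum 1 (conj_character one_char) = 1.
Proof.
rewrite /gauss_sum sum_O /conj_character /one_char.
have -> : (2 * PI * Ci * INR 0 / INR 1)%C = 0 by rewrite /Cdiv /=; ring.
rewrite Cexp_0 /Cconj /RtoC /Cmult /=; congr (_, _); ring.
Qed.

Lemma TA_one a tau u v : (0 < Im tau)%R -> TA 1 one_char a tau u v = Kron a tau u v.
Proof.
move=> Ht; rewrite (TA_Kron 1 one_char H11 HP) // gauss_sum_one /=.
have -> : conj_character one_char 0 = 1 by rewrite /conj_character /one_char /Cconj /RtoC /=; congr (_, _); ring.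
have -> : shiftN 1 0 v = v by rewrite /shiftN /Cdiv /=; ring.
by field; exact: C1_nz.
Qed.

(** Exchanging u and v in [Kron] turns the offset a into 1 - a, so independence of the offset makes
    the symmetrization in [kron] an average of equal terms. *)
Lemma Kron_kron tau u v : (0 < Im tau)%R -> ~ in_lattice tau u -> ~ in_lattice tau v -> Kron 0 tau u v = kron tau u v.
Proof.
move=> Ht nu nv; rewrite /kron /Ftw !TA_one //.
have [u1 _] := regular_1 _ _ nu; have [_ v2] := regular_1 _ _ nv.
have E : Kron 1 tau u v = Kron 0 tau u v by rewrite -!TA_one //; exact: TA_indep H11 HP _ _ _ _ Ht u1 v2.
have -> : Kron 0 tau v u = Kron 1 tau u v.
  rewrite /Kron; apply: has_sum_hsum; apply: has_sum_ext (Kron_has_sum 1 tau u v Ht) => n.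
  change (1 - 1)%Z with 0%Z; change (1 - 0)%Z with 1%Z; ring.
rewrite E; field; move=> F; have := RtoC_inj _ _ F; lra.
Qed.

Lemma kron_cdiffable tau u v : (0 < Im tau)%R -> ~ in_lattice tau u -> ~ in_lattice tau v -> cdiffable (fun w => kron tau w v) u.
Proof.
move=> Ht nu nv; apply/Fdiffable_C.
apply: (holo_at (U := C_NormedModule)); apply: (FU_holo (U := C_NormedModule) 1 one_char H11 HP (fun _ => tau) (fun w => w) (fun _ => v)) => //.
- by move=> y; exact: Fdiffable_const.
- by move=> y; apply/Fdiffable_C; exact: cdiffable_id.
- by move=> y; exact: Fdiffable_const.
- exact: regN_1.
- exact: regN_1.
Qed.

Lemma ccont_mult f g z : ccont f z -> ccont g z -> ccont (fun w => f w * g w) z.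
Proof.
move=> Hf Hg eps He.
pose B := (Cmod (f z) + Cmod (g z) + 1)%R.
have f0 := Cmod_ge_0 (f z); have g0 := Cmod_ge_0 (g z).
have B0 : (1 <= B)%R by rewrite /B; lra.
pose e := Rmin 1 (eps / (2 * B)).
have e0 : (0 < e)%R by apply: Rmin_glb_lt; [lra | apply: Rdiv_lt_0_compat; lra].
have e1 : (e <= 1)%R by exact: Rmin_l.
have e2 : (e * (2 * B) <= eps)%R.
  apply: Rle_trans (Rmult_le_compat_r (2 * B) _ _ _ (Rmin_r _ _)) _; first lra.
  by right; field; lra.
have [d1 [p1 h1]] := Hf e e0; have [d2 [p2 h2]] := Hg e e0.
exists (Rmin d1 d2); split; first exact: Rmin_glb_lt.
move=> y Hy.
have a1 := h1 y (Rlt_le_trans _ _ _ Hy (Rmin_l _ _)); have a2 := h2 y (Rlt_le_trans _ _ _ Hy (Rmin_r _ _)).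
have -> : f y * g y - f z * g z = (f y - f z) * (g y - g z) + (f z * (g y - g z) + (f y - f z) * g z) by ring.
apply: Rle_lt_trans (Cmod_triangle _ _) _.
have := Cmod_triangle (f z * (g y - g z)) ((f y - f z) * g z).
rewrite !Cmod_mult.
have c1 := Cmod_ge_0 (f y - f z); have c2 := Cmod_ge_0 (g y - g z).
have q1 : (Cmod (f y - f z) * Cmod (g y - g z) <= e * 1)%R by apply: Rmult_le_compat; lra.
have q2 : (Cmod (f z) * Cmod (g y - g z) <= Cmod (f z) * e)%R by apply: Rmult_le_compat_l; lra.
have q3 : (Cmod (f y - f z) * Cmod (g z) <= e * Cmod (g z))%R by apply: Rmult_le_compat_r; lra.
have : (e * (Cmod (f z) + Cmod (g z) + 1) * 2 <= eps)%R by rewrite -/B; lra.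
have : (0 < e * (Cmod (f z) + Cmod (g z) + 1))%R by rewrite -/B; apply: Rmult_lt_0_compat; lra.
lra.
Qed.

Lemma ccont_div f g z : ccont f z -> ccont g z -> g z <> 0 -> ccont (fun w => f w / g w) z.
Proof.
move=> Hf Hg nz; apply: ccont_mult => // eps He.
have [e [e0 he]] := cdiff_ccont _ _ _ (cdiff_inv (g z) nz) eps He.
have [d [d0 hd]] := Hg e e0.
by exists d; split=> // y /hd /he.
Qed.

(** Near 0 the function is c / (e^u - 1) + G with c(0) equal to the polar coefficient 1, and e^u - 1
    behaves like u. *)
Lemma kron_residue tau v : (0 < Im tau)%R -> ~ in_lattice tau v -> forall eps, (0 < eps)%R ->
  exists d, (0 < d)%R /\ forall u, (0 < Cmod u < d)%R -> (Cmod (u * kron tau u v - 1) < eps)%R.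
Proof.
move=> Ht nv eps He.
have cst c y : Fdiffable (U := C_NormedModule) (fun _ => c) y by exact: Fdiffable_const.
have idd y : Fdiffable (U := C_NormedModule) (fun w => w) y by apply/Fdiffable_C; exact: cdiffable_id.
have sh w : shiftN 1 0 w = w by rewrite /shiftN /Cdiv /=; ring.
have D0 : Qden 0 tau (shiftN 1 0 0) = 0.
  rewrite sh; apply/Qden_zero; exists 0%Z; rewrite Z2C_0; ring.
have [c [G [Hc [HG [ca HcG]]]]] := FU_sing (U := C_NormedModule) 1 one_char H11 HP (fun _ => tau) (fun w => w) (fun _ => v)
  (cst tau) idd (cst v) 0%Z 0%nat (RtoC 0) Ht Nat.lt_0_1 D0 (regN_1 _ _ nv).
pose c' : C -> C := c; pose G' : C -> C := G.
have c1 : c' 0 = 1.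
  rewrite /c' ca /polar_coefficient gauss_sum_one /Qnum Z2C_0 sh /=.
  have -> : conj_character one_char 0 = 1 by rewrite /conj_character /one_char /Cconj /RtoC /=; congr (_, _); ring.
  have -> : Z2C 0 * v + Z2C (0 + 0) * (0 + twopii * 0 * tau) = 0 by rewrite !Z2C_0; ring.
  rewrite Cexp_0 /one_char; field.
pose D w := Qden 0 tau w.
have DE w : D w = Cexp w - 1.
  rewrite /D /Qden Z2C_0; congr (Cexp _ - _); ring.
have Dne (w : C) : w <> 0 -> (Cmod w < lattice_sep tau)%R -> D w <> 0.
  move=> nw Hw /Qden_zero [j E].
  apply: nw; apply: (lattice_small tau Ht w) => //; exists j, 0%Z; rewrite E Z2C_0; ring.
(* [w / D w] and its inverse extend continuously by [1] at [0]. *)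
pose q w := match classic_eq_dec w (RtoC 0) with left _ => RtoC 1 | right _ => D w / w end.
have qc : ccont q 0.
  move=> e e0; have [d [d0 hd]] := cdiff_Cexp_0 (e / 2)%R ltac:(lra).
  exists d; split=> // y Hy; have := hd y Hy; rewrite /q; case: classic_eq_dec => [->|ny].
    by move=> _; case: classic_eq_dec => // _; rewrite (_ : RtoC 1 - RtoC 1 = 0) ?Cmod_0 //; ring.
  case: classic_eq_dec => // _; rewrite Cexp_0 DE => h.
  have y0 : y - 0 = y by ring.
  rewrite y0 in h.
  have yp : (0 < Cmod y)%R by apply/Cmod_gt_0.
  have E : Cexp y - 1 - 1 * y = y * ((Cexp y - 1) / y - 1) by field.
  rewrite E Cmod_mult in h.
  have : (Cmod ((Cexp y - 1) / y - 1) <= e / 2)%R by apply: (Rmult_le_reg_l (Cmod y)) => //; lra.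
  lra.
have q0 : q 0 = 1 by rewrite /q; case: classic_eq_dec.
have Hcc : ccont c' 0 by apply: cdiffable_ccont; apply/Fdiffable_C; exact: (holo_at (U := C_NormedModule)).
have HGc : ccont G' 0 by apply: cdiffable_ccont; apply/Fdiffable_C; exact: (holo_at (U := C_NormedModule)).
have wc : ccont (fun w => w) 0 by apply: cdiffable_ccont; exact: cdiffable_id.
have Hm : ccont (fun w => c' w / q w + w * G' w) 0.
  have A := ccont_div c' q 0 Hcc qc ltac:(rewrite q0; exact: C1_nz).
  have B := ccont_mult _ _ _ wc HGc.
  move=> e e0; have [d1 [p1 h1]] := A (e / 2)%R ltac:(lra); have [d2 [p2 h2]] := B (e / 2)%R ltac:(lra).
  exists (Rmin d1 d2); split; first exact: Rmin_glb_lt.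
  move=> y Hy; have a1 := h1 y (Rlt_le_trans _ _ _ Hy (Rmin_l _ _)); have a2 := h2 y (Rlt_le_trans _ _ _ Hy (Rmin_r _ _)).
  have -> : c' y / q y + y * G' y - (c' 0 / q 0 + 0 * G' 0) = (c' y / q y - c' 0 / q 0) + (y * G' y - 0 * G' 0) by ring.
  apply: Rle_lt_trans (Cmod_triangle _ _) _; lra.
have [d1 [p1 h1]] := Hm eps He; have [d2 [p2 h2]] := HcG.
have sp := lattice_sep_pos tau Ht.
exists (Rmin d1 (Rmin d2 (lattice_sep tau))); split; first by apply: Rmin_glb_lt => //; exact: Rmin_glb_lt.
move=> w [w0 Hw].
have nw : w <> 0 by apply/Cmod_gt_0.
have ww : w - 0 = w by ring.
have Hw23 := Rlt_le_trans _ _ _ Hw (Rmin_r _ _).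
have := h1 w ltac:(rewrite ww; exact: Rlt_le_trans Hw (Rmin_l _ _)).
have Dw := Dne w nw (Rlt_le_trans _ _ _ Hw23 (Rmin_r _ _)).
have := h2 w; rewrite sh -/(D w) => /(_ _ Dw) => F.
have -> : kron tau w v = c' w / D w + G' w.
  apply: F; rewrite /dist; change (Cmod (minus w (RtoC 0)) < d2)%R.
  have -> : minus w (RtoC 0) = w - 0 by [].
  rewrite ww; exact: Rlt_le_trans Hw23 (Rmin_l _ _).
rewrite q0 c1 /q; case: classic_eq_dec => // _.
have -> : c' w / (D w / w) + w * G' w - (1 / 1 + 0 * G' 0) = w * (c' w / D w + G' w) - 1 by field; split => //; exact: C1_nz.
by [].
Qed.

(** * Modularity *)

Section Modular.

Variables (tau : C) (a b c d : Z).

Hypotheses (Ht : (0 < Im tau)%R) (Hdet : (a * d - b * c = 1)%Z).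

Local Notation j := (Z2C c * tau + Z2C d).

Local Notation tau' := ((Z2C a * tau + Z2C b) / j).

Lemma automorphy_nz : j <> 0.
Proof.
move=> E; have E1 := f_equal Im E; have E2 := f_equal Re E.
have c0 : c = 0%Z.
  apply: eq_IZR; move: E1; rewrite /Z2C /Im /= => E1; have Ht1 : (0 < snd tau)%R by exact: Ht.
  nra.
have d0 : d = 0%Z.
  apply: eq_IZR; move: E2; rewrite c0 /Z2C /Re /= => E2; lra.
have := Hdet; rewrite c0 d0; lia.
Qed.

Lemma modular_upper : (0 < Im tau')%R.
Proof.
have jn := automorphy_nz.
have jc : (0 < Cmod j)%R by apply/Cmod_gt_0.
have jm : Cconj j <> 0 by move=> E; apply: jn; rewrite -(Cconj_conj j) E /Cconj /RtoC /=; congr (_, _); ring.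
have E : tau' = ((Z2C a * tau + Z2C b) * Cconj j) * RtoC (/ (Cmod j * Cmod j)).
  rewrite RtoC_inv; last nra.
  have -> : RtoC (Cmod j * Cmod j) = j * Cconj j by rewrite -Cmod2_conj; congr RtoC; ring.
  by field.
have p : (0 < / (Cmod j * Cmod j))%R by apply: Rinv_0_lt_compat; nra.
have dr : (IZR a * IZR d - IZR b * IZR c = 1)%R by rewrite -!mult_IZR -minus_IZR Hdet.
have -> : (Im tau' = Im tau * / (Cmod j * Cmod j))%R.
  rewrite E; set s := (/ (Cmod j * Cmod j))%R; rewrite /Z2C /Im /Cconj /=; rewrite /Im.
  transitivity ((IZR a * IZR d - IZR b * IZR c) * (snd tau * s))%R; first by ring.
  by rewrite dr Rmult_1_l.
exact: Rmult_lt_0_compat.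
Qed.

Lemma modular_lattice_shift w p n : (w + twopii * (Z2C p + Z2C n * tau)) / j =
  w / j + twopii * (Z2C (n * d - p * c) * tau' + Z2C (p * a - n * b)).
Proof.
have jn := automorphy_nz.
have dr : Z2C a * Z2C d - Z2C b * Z2C c = 1 by rewrite -!Z2C_mult -Z2C_minus Hdet.
have -> : Z2C p + Z2C n * tau = (Z2C a * Z2C d - Z2C b * Z2C c) * (Z2C p + Z2C n * tau) by rewrite dr; ring.
rewrite !Z2C_minus !Z2C_mult; by field.
Qed.

Lemma in_lattice_modular w : in_lattice tau' (w / j) <-> in_lattice tau w.
Proof.
have jn := automorphy_nz.
split=> -[p [n E]].
- exists (p * d + n * b)%Z, (p * c + n * a)%Z; transitivity (w / j * j); first by field.
  rewrite E !Z2C_plus !Z2C_mult; by field.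
- exists (p * a - n * b)%Z, (n * d - p * c)%Z; rewrite E.
  have -> : twopii * (Z2C p + Z2C n * tau) = 0 + twopii * (Z2C p + Z2C n * tau) by ring.
  rewrite modular_lattice_shift; by field.
Qed.

Theorem kron_modular u v : ~ in_lattice tau u -> ~ in_lattice tau v ->
  kron tau' (u / j) (v / j) = j * Cexp (Z2C c * u * v / (twopii * j)) * kron tau u v.
Proof.
move=> nu nv.
have jn := automorphy_nz; have Ht' := modular_upper; have tn := twopii_nz.
have nv' : ~ in_lattice tau' (v / j) by move/in_lattice_modular.
pose ex w := Cexp (- (Z2C c * w * v / (twopii * j))).
pose f w := kron tau' (w / j) (v / j) * ex w / j - kron tau w v.
have exd w : cdiffable ex w.
  apply: cdiffable_Cexp; apply: (cdiffable_ext (fun w => (- (Z2C c * v / (twopii * j))) * w)).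
    by apply: cdiffable_mult; [exact: cdiffable_const | exact: cdiffable_id].
  by exists 1%R; split; [lra | move=> y _; field].
suff f0 : f u = 0.
  have E : kron tau' (u / j) (v / j) * ex u / j = kron tau u v.
    by transitivity (f u + kron tau u v); [rewrite /f; ring | rewrite f0; ring].
  have ee : Cexp (Z2C c * u * v / (twopii * j)) * ex u = 1.
    by rewrite /ex -Cexp_plus -Cexp_0; congr Cexp; ring.
  rewrite -E; transitivity (kron tau' (u / j) (v / j) * (Cexp (Z2C c * u * v / (twopii * j)) * ex u)); first by rewrite ee; ring.
  by field.
apply: (elliptic_zero tau v f) nu => // [w nw|w p n nw|eps He].
- apply: cdiffable_minus; last exact: kron_cdiffable.
  have nw' : ~ in_lattice tau' (w / j) by move/in_lattice_modular.
  apply: cdiffable_mult; last exact: cdiffable_const.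
  apply: cdiffable_mult => //.
  have [l Hl] := kron_cdiffable tau' (w / j) (v / j) Ht' nw' nv'.
  have [l2 Hl2] : cdiffable (fun w => w / j) w by apply: cdiffable_mult; [exact: cdiffable_id | exact: cdiffable_const].
  by eexists; apply: (cdiff_comp (fun w => w / j) (fun w => kron tau' w (v / j))) Hl2 Hl.
- have nw' : ~ in_lattice tau' (w / j) by move/in_lattice_modular.
  have E1 : kron tau (w + twopii * (Z2C p + Z2C n * tau)) v = Cexp (- (Z2C n * v)) * kron tau w v.
    have := kron_elliptic tau w v 0 n 0 p Ht nw nv.
    have -> : v + twopii * (Z2C 0 * tau + Z2C 0) = v by rewrite Z2C_0; ring.
    have -> : Z2C n * tau + Z2C p = Z2C p + Z2C n * tau by ring.
    by move=> ->; congr (Cexp _ * _); rewrite Z.mul_0_l Z2C_0; ring.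
  have E2 : kron tau' ((w + twopii * (Z2C p + Z2C n * tau)) / j) (v / j) = Cexp (- (Z2C (n * d - p * c) * (v / j))) * kron tau' (w / j) (v / j).
    rewrite modular_lattice_shift.
    have := kron_elliptic tau' (w / j) (v / j) 0 (n * d - p * c) 0 (p * a - n * b) Ht' nw' nv'.
    have -> : v / j + twopii * (Z2C 0 * tau' + Z2C 0) = v / j by rewrite Z2C_0; ring.
    by move=> ->; congr (Cexp _ * _); rewrite Z.mul_0_l Z2C_0; ring.
  have E3 : ex (w + twopii * (Z2C p + Z2C n * tau)) = Cexp (- (Z2C c * (Z2C p + Z2C n * tau) * v / j)) * ex w.
    rewrite /ex -Cexp_plus; congr Cexp; by field.
  (* The p-dependence and the tau-dependence of the two exponents cancel, leaving the multiplier of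
     the right-hand side. *)
  have E4 : Cexp (- (Z2C (n * d - p * c) * (v / j))) * Cexp (- (Z2C c * (Z2C p + Z2C n * tau) * v / j)) = Cexp (- (Z2C n * v)).
    rewrite -Cexp_plus; congr Cexp; rewrite Z2C_minus !Z2C_mult; by field.
  rewrite /f E1 E2 E3 -E4; by field.
- have jc : (0 < Cmod j)%R by apply/Cmod_gt_0.
  have ex0 : ex 0 = 1 by rewrite /ex -Cexp_0; congr Cexp; field.
  have [e1 [p1 h1]] := cdiffable_ccont _ _ (exd 0) (Rmin 1 (eps / 4))%R ltac:(apply: Rmin_glb_lt; lra).
  have [e2 [p2 h2]] := kron_residue tau' (v / j) Ht' nv' (Rmin 1 (eps / 8))%R ltac:(apply: Rmin_glb_lt; lra).
  have [e3 [p3 h3]] := kron_residue tau v Ht nv (eps / 4)%R ltac:(lra).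
  have p4 : (0 < e2 * Cmod j)%R by exact: Rmult_lt_0_compat.
  exists (Rmin e1 (Rmin (e2 * Cmod j) e3)); split; first by repeat apply: Rmin_glb_lt.
  move=> w [w0 Hw].
  have Hw1 := Rlt_le_trans _ _ _ Hw (Rmin_l _ _). have Hw23 := Rlt_le_trans _ _ _ Hw (Rmin_r _ _).
  have Hw2 := Rlt_le_trans _ _ _ Hw23 (Rmin_l _ _). have Hw3 := Rlt_le_trans _ _ _ Hw23 (Rmin_r _ _).
  have q1 := h1 w; have q2 := h2 (w / j); have q3 := h3 w (conj w0 Hw3).
  have w00 : w - 0 = w by ring.
  rewrite w00 ex0 in q1; have {}q1 := q1 Hw1.
  rewrite Cmod_div // in q2.
  have wj : (Cmod w / Cmod j < e2)%R.
    apply: (Rmult_lt_reg_r (Cmod j)) => //; have -> : (Cmod w / Cmod j * Cmod j = Cmod w)%R by field; lra.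
    exact: Hw2.
  have {}q2 := q2 (conj (Rdiv_lt_0_compat _ _ w0 jc) wj).
  set A := w / j * kron tau' (w / j) (v / j) in q2.
  (* Both functions have residue 1 in w, since dividing by j compensates the scaled variable; each
     bracket is a deviation from 1 that tends to zero. *)
  have -> : w * f w = (A - 1) * (ex w - 1) + ((A - 1) + (ex w - 1)) - (w * kron tau w v - 1).
    by rewrite /f /A; field.
  apply: Rle_lt_trans (Cmod_tri_minus _ 0 _) _.
  have m1 := Rmin_l 1 (eps / 4); have m2 := Rmin_r 1 (eps / 4); have m3 := Rmin_r 1 (eps / 8).
  have -> : forall z : C, z - 0 = z by move=> z; ring.
  have -> : forall z : C, 0 - z = - z by move=> z; ring.
  rewrite Cmod_opp.
  have t1 := Cmod_triangle ((A - 1) * (ex w - 1)) ((A - 1) + (ex w - 1)).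
  have t2 := Cmod_triangle (A - 1) (ex w - 1).
  rewrite Cmod_mult in t1.
  have := Cmod_ge_0 (A - 1); have := Cmod_ge_0 (ex w - 1); nra.
Qed.

End Modular.

Section TwistedModular.

Variables (N : nat) (chi : Z -> C) (HN : (1 <= N)%nat) (Hprim : primitive_character N chi).

Let Hchi : dirichlet_character N chi := proj1 Hprim.

Local Notation NZ := (Z.of_nat N).

Local Notation cchi := (conj_character chi).

Variables (tau : C) (a b c d : Z).

Hypotheses (Ht : (0 < Im tau)%R) (Hdet : (a * d - b * c = 1)%Z) (HNc : (NZ | c)%Z).

Local Notation j := (Z2C c * tau + Z2C d).

Local Notation tau' := ((Z2C a * tau + Z2C b) / j).

(** A condition on the real part alone, hence stable under all torsion shifts, which therefore never
    meet the lattice. *)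
Definition generic (w : C) : Prop := forall n, Re w <> (IZR n * height tau)%R.

Lemma generic_shift w x : generic w -> ~ in_lattice tau (w + twopii * RtoC x).
Proof.
move=> H [p [n /(f_equal Re) E]]; apply: (H (- n)%Z); rewrite opp_IZR.
move: E; rewrite /twopii /Z2C /height /Re /Im /= => E; lra.
Qed.

Lemma generic_not_in_lattice w : generic w -> ~ in_lattice tau w.
Proof.
move=> /generic_shift H; have -> : w = w + twopii * RtoC 0 by ring.
exact: H.
Qed.

Lemma lower_right_unit : rel_prime d NZ.
Proof.
case: HNc => c' E; apply: bezout_rel_prime; apply: (Bezout_intro _ _ _ a (- (b * c'))%Z).
rewrite -Hdet E; ring.
Qed.

Local Notation Ef u v := (Cexp (Z2C c * u * v / (twopii * j))).

(** With c = c' N, the point v/j + 2 pi i h/N is V/j, where V is v shifted by 2 pi i d h/N and by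
    the lattice vector 2 pi i h c' tau. The elliptic factor of the latter cancels the change in the
    exponential, and conj chi(h) = chi(d) conj chi(d h) permits reindexing by d h. *)
Lemma TA_modular u v : generic u -> generic v ->
  TA N chi 0 tau' (u / j) (v / j) = chi d * j * Ef u v * TA N chi 0 tau u v.
Proof.
move=> gu gv.
have jn := automorphy_nz tau a b c d Ht Hdet; have Ht' := modular_upper tau a b c d Ht Hdet.
have tn := twopii_nz; have nN := INR_N_nz N HN; have hp := height_pos tau Ht.
have nu := generic_not_in_lattice u gu.
rewrite !(TA_Kron N chi HN Hprim) //.
pose Phi (x : Z) := kron tau u (v + twopii * RtoC (IZR x / INR N)).
have rn : INR N <> 0%R by apply: not_0_INR; lia.
have divE (x : R) : RtoC (x / INR N) = RtoC x / RtoC (INR N) by exact: RtoC_div.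
have step h : In h (seq 0 N) -> cchi (Z.of_nat h) * Kron 0 tau' (u / j) (shiftN N h (v / j)) =
    (chi d * j * Ef u v) * (cchi (d * Z.of_nat h)%Z * Phi (d * Z.of_nat h)%Z).
  move=> _; case: HNc => c' Ec.
  pose V0 := v + twopii * RtoC (IZR (d * Z.of_nat h) / INR N).
  pose V := V0 + twopii * (Z2C (Z.of_nat h * c') * tau + Z2C 0).
  have nV0 : ~ in_lattice tau V0 by exact: generic_shift.
  have nV : ~ in_lattice tau V.
    rewrite /V; have -> : Z2C (Z.of_nat h * c') * tau + Z2C 0 = Z2C 0 + Z2C (Z.of_nat h * c') * tau by ring.
    by move/lattice_plus.
  have VE : V = v + twopii * RtoC (INR h) / RtoC (INR N) * j.
    rewrite /V /V0 divE -/(Z2C _) Z2C_0 Ec !Z2C_mult !Z2C_nat; by field.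
  have sE : shiftN N h (v / j) = V / j by rewrite VE /shiftN; field.
  rewrite sE Kron_kron //; try by rewrite in_lattice_modular.
  rewrite kron_modular //.
  have -> : kron tau u V = Cexp (- (Z2C (Z.of_nat h * c') * u)) * Phi (d * Z.of_nat h)%Z.
    have := kron_elliptic tau u V0 (Z.of_nat h * c') 0 0 0 Ht nu nV0.
    have -> : u + twopii * (Z2C 0 * tau + Z2C 0) = u by rewrite Z2C_0; ring.
    by rewrite -/V => ->; congr (Cexp _ * _); rewrite Z.mul_0_r Z2C_0; ring.
  have eE : Ef u V * Cexp (- (Z2C (Z.of_nat h * c') * u)) = Ef u v.
    rewrite -Cexp_plus; congr Cexp; rewrite VE Z2C_mult Z2C_nat.
    have -> : Z2C c = Z2C c' * RtoC (INR N) by rewrite Ec Z2C_mult Z2C_nat.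
    have jn' : Z2C c' * RtoC (INR N) * tau + Z2C d <> 0.
      by move=> E; apply: jn; rewrite Ec Z2C_mult Z2C_nat.
    by field.
  have cE : cchi (Z.of_nat h) = chi d * cchi (d * Z.of_nat h)%Z.
    rewrite /conj_character (char_mult N chi Hchi) Cmult_conj Cmult_assoc.
    rewrite (char_conj N chi HN Hchi d lower_right_unit); ring.
  rewrite cE -eE; ring.
rewrite (sumC_ext _ _ _ step) sumC_mult_l.
have R1 := resum_reindex N (fun x => cchi x * Phi x) d HN _ lower_right_unit.
rewrite /resum in R1; rewrite R1; last first.
  have [cp _] := conj_dirichlet N chi Hchi.
  move=> n; rewrite cp; congr (_ * _).
  rewrite /Phi plus_IZR -INR_IZR_INZ.
  have -> : (v + twopii * RtoC ((IZR n + INR N) / INR N)) = (v + twopii * RtoC (IZR n / INR N)) + twopii * (Z2C 0 * tau + Z2C 1).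
    rewrite !divE RtoC_plus Z2C_0 Z2C_1; by field.
  have := kron_elliptic tau u (v + twopii * RtoC (IZR n / INR N)) 0 0 1 0 Ht nu (generic_shift _ _ gv).
  have -> : u + twopii * (Z2C 0 * tau + Z2C 0) = u by rewrite Z2C_0; ring.
  move=> ->.
  have -> : - (Z2C (0 * 0) * (twopii * tau)) - Z2C 0 * u - Z2C 0 * (v + twopii * RtoC (IZR n / INR N)) = 0 by rewrite Z.mul_0_l !Z2C_0; ring.
  rewrite Cexp_0; ring.
have -> : sumC (fun h => cchi (Z.of_nat h) * Kron 0 tau u (shiftN N h v)) (seq 0 N) = sumC (fun h => cchi (Z.of_nat h) * Phi (Z.of_nat h)) (seq 0 N).
  apply: sumC_ext => h _; congr (_ * _).
  have sE : shiftN N h v = v + twopii * RtoC (IZR (Z.of_nat h) / INR N).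
    rewrite /shiftN divE -INR_IZR_INZ /Cdiv; ring.
  rewrite Kron_kron // sE //; exact: generic_shift.
ring.
Qed.

Lemma Ftw_modular_generic u v : generic u -> generic v ->
  Ftw N chi tau' (u / j) (v / j) = chi d * j * Ef u v * Ftw N chi tau u v.
Proof.
move=> gu gv; rewrite /Ftw !TA_modular //.
have -> : Z2C c * v * u = Z2C c * u * v by ring.
ring.
Qed.

(** Multiplying by j transforms the coordinates by the matrix. As N divides c, both a and d are
    units modulo N, so each of the two coprimality conditions is carried to itself. *)
Lemma polar_value_modular w : polar_value N tau' (w / j) -> polar_value N tau w.
Proof.
have jn := automorphy_nz tau a b c d Ht Hdet; have nN := INR_N_nz N HN.
have gcd_chi x : Z.gcd x NZ = 1%Z <-> chi x <> 0 by case: Hchi => _ [_ ->].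
have wE : w = w / j * j by field.
case: HNc => c' Ec.
have cper := periodic_mult N chi (char_periodic N chi Hchi).
have mul_nz x y : chi x <> 0 -> chi y <> 0 -> chi (x * y)%Z <> 0.
  by move=> hx hy; rewrite (char_mult N chi Hchi); exact: Cmult_neq_0.
have dn : chi d <> 0 by apply/(char_nz N chi Hchi); exact: lower_right_unit.
have an : chi a <> 0.
  move=> a0; have := cper (a * d)%Z (- (b * c'))%Z.
  have -> : (a * d + - (b * c') * NZ = 1)%Z by rewrite -Hdet Ec; ring.
  rewrite (char_mult N chi Hchi) a0 (char_1 N chi Hchi) Cmult_0_l; exact: C1_nz.
move=> [r [n [[/gcd_chi g E]|[/gcd_chi g E]]]].
- exists (r * d + n * b * NZ)%Z, (r * c' + n * a)%Z; left; split.
    by apply/gcd_chi; rewrite cper; exact: mul_nz.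
  rewrite wE E -/twopii -!/(Z2C _) !Z2C_plus !Z2C_mult !Z2C_nat.
  have -> : j = Z2C c' * RtoC (INR N) * tau + Z2C d by rewrite Ec Z2C_mult Z2C_nat.
  field; split=> // E2; apply: jn; by rewrite Ec Z2C_mult Z2C_nat.
- exists (r * d + n * b)%Z, (r * c + n * a)%Z; right; split.
    have -> : (r * c + n * a = n * a + (r * c') * NZ)%Z by rewrite Ec; ring.
    by apply/gcd_chi; rewrite cper; exact: mul_nz.
  rewrite wE E -/twopii -!/(Z2C _) !Z2C_plus !Z2C_mult; by field.
Qed.

(* Both sides are continuous at [(u, v)] and agree at generic points nearby. *)
Theorem Ftw_modular u v : ~ polar_point N tau u v ->
  Ftw N chi tau' (u / j) (v / j) = chi d * j * Ef u v * Ftw N chi tau u v.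
Proof.
move=> np.
have jn := automorphy_nz tau a b c d Ht Hdet; have Ht' := modular_upper tau a b c d Ht Hdet.
have nu : ~ polar_value N tau u by move=> h; apply: np; left.
have nv : ~ polar_value N tau v by move=> h; apply: np; right.
have reg w : ~ polar_value N tau w -> regN N chi tau w by move=> h; apply/(not_polar_regN N chi HN Hprim).
have reg' w : ~ polar_value N tau w -> regN N chi tau' (w / j).
  by move=> h; apply/(not_polar_regN N chi HN Hprim) => /polar_value_modular.
have cst k y : Fdiffable (U := C_NormedModule) (fun _ => k) y by exact: Fdiffable_const.
have aff w y : Fdiffable (U := C_NormedModule) (fun t => w + t) y.
  by apply/Fdiffable_C; apply: cdiffable_plus; [exact: cdiffable_const | exact: cdiffable_id].
have affj w y : Fdiffable (U := C_NormedModule) (fun t => (w + t) / j) y.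
  by apply/Fdiffable_C; apply: cdiffable_mult; [apply/Fdiffable_C; exact: aff | exact: cdiffable_const].
have z0 w : w + 0 = w by ring.
have L0 : cdiffable (fun t => Ftw N chi tau' ((u + t) / j) ((v + t) / j)) 0.
  apply/Fdiffable_C; apply: (holo_at (U := C_NormedModule)).
  apply: (FU_holo (U := C_NormedModule) N chi HN Hprim (fun _ => tau') (fun t => (u + t) / j) (fun t => (v + t) / j)) => //; rewrite z0; exact: reg'.
have R0 : cdiffable (fun t => chi d * j * Ef (u + t) (v + t) * Ftw N chi tau (u + t) (v + t)) 0.
  apply: cdiffable_mult.
    apply: cdiffable_mult; first exact: cdiffable_const.
    apply: cdiffable_Cexp; apply: cdiffable_mult; last exact: cdiffable_const.
    apply: cdiffable_mult; last by apply/Fdiffable_C; exact: aff.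
    by apply: cdiffable_mult; [exact: cdiffable_const | apply/Fdiffable_C; exact: aff].
  apply/Fdiffable_C; apply: (holo_at (U := C_NormedModule)).
  apply: (FU_holo (U := C_NormedModule) N chi HN Hprim (fun _ => tau) (fun t => u + t) (fun t => v + t)) => //; rewrite z0; exact: reg.
have D0 := cdiffable_ccont _ _ (cdiffable_minus _ _ _ L0 R0).
rewrite -{1}(z0 u) -{1}(z0 v) -{2}(z0 u) -{2}(z0 v).
have : (Ftw N chi tau' ((u + 0) / j) ((v + 0) / j)) - (chi d * j * Ef (u + 0) (v + 0) * Ftw N chi tau (u + 0) (v + 0)) = 0.
  apply: NNPP => ne; have pe : (0 < Cmod (Ftw N chi tau' ((u + 0) / j) ((v + 0) / j) - chi d * j * Ef (u + 0) (v + 0) * Ftw N chi tau (u + 0) (v + 0)))%R by apply/Cmod_gt_0.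
  have [e [e0 he]] := D0 _ pe.
  have [e1 [p1 h1]] := avoid_multiples (Re u) (height tau) (height_pos tau Ht).
  have [e2 [p2 h2]] := avoid_multiples (Re v) (height tau) (height_pos tau Ht).
  pose m := Rmin e (Rmin e1 e2).
  have m0 : (0 < m)%R by repeat apply: Rmin_glb_lt.
  have l1 : (m <= e)%R by exact: Rmin_l.
  have l2 : (m <= e1)%R by apply: Rle_trans (Rmin_r _ _) (Rmin_l _ _).
  have l3 : (m <= e2)%R by apply: Rle_trans (Rmin_r _ _) (Rmin_r _ _).
  have t0 : RtoC (m / 2) - 0 = RtoC (m / 2) by ring.
  have := he (RtoC (m / 2)); rewrite t0 Cmod_R Rabs_pos_eq; last lra.
  move=> /(_ ltac:(lra)).
  rewrite Ftw_modular_generic.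
  - set A := chi d * j * _ * _; set B := _ - _ * _.
    have -> : A - A - B = - B by ring.
    rewrite Cmod_opp /B; lra.
  - move=> n; rewrite re_plus re_RtoC; apply: h1; lra.
  - move=> n; rewrite re_plus re_RtoC; apply: h2; lra.
rewrite !z0 => E.
transitivity (Ftw N chi tau' (u / j) (v / j) - chi d * j * Ef u v * Ftw N chi tau u v + chi d * j * Ef u v * Ftw N chi tau u v); first by ring.
rewrite E; ring.
Qed.

End TwistedModular.

(** * Bernoulli numbers *)

Definition bern (x : R) (n : nat) : R := (bernoulli_poly n x / INR (fact n))%R.

Lemma bernoulli_upto_poly x n k : (k <= n)%nat -> bernoulli_upto x n k = bernoulli_poly k x.
Proof.
elim: n => [|m IH] Hk; first by have -> : k = 0%nat by lia.
case: (Nat.eq_dec k (S m)) => [->|nk] //.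
rewrite [LHS]/=; have -> : (k <=? m)%nat = true by apply/Nat.leb_le; lia.
apply: IH; lia.
Qed.

Lemma bernoulli_poly_S x m : bernoulli_poly (S m) x =
  (x ^ S m - sum_n (fun j => Binomial.C (S (S m)) j * bernoulli_upto x m j) m / INR (S (S m)))%R.
Proof.
transitivity (if (S m <=? m)%nat then bernoulli_upto x m (S m) else
  (x ^ S m - sum_n (fun j => Binomial.C (S (S m)) j * bernoulli_upto x m j) m / INR (S (S m)))%R); first by [].
have -> // : (S m <=? m)%nat = false by apply/Nat.leb_gt; lia.
Qed.

Lemma sumR_ext {I} (f g : I -> R) l : (forall i, In i l -> f i = g i) -> sumR f l = sumR g l.
Proof.
elim: l => [|x l IH] //= H; rewrite H; last by left.
by rewrite IH // => i Hi; apply: H; right.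
Qed.

Lemma sumR_1 {I} (f : I -> R) a : sumR f (a :: nil) = f a.
Proof. by rewrite /= Rplus_0_r. Qed.

Lemma bernoulli_recursion x n :
  sumR (fun j => (Binomial.C (S n) j * bernoulli_poly j x)%R) (seq 0 (S n)) = (INR (S n) * x ^ n)%R.
Proof.
case: n => [|m].
  rewrite /= /Binomial.C /bernoulli_poly /=; field.
rewrite seq_S sumR_app sumR_1.
have n0 : INR (S (S m)) <> 0%R by apply: not_0_INR.
have -> : Binomial.C (S (S m)) (0 + S m) = INR (S (S m)).
  rewrite /Binomial.C (_ : (S (S m) - (0 + S m) = 1)%nat); last lia.
  rewrite fact_simpl mult_INR.
  have := INR_fact_neq_0 (S m) => fn; rewrite Nat.add_0_l (_ : INR (fact 1) = 1%R) //.
  by field.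
rewrite Nat.add_0_l bernoulli_poly_S.
rewrite -sumR_seq (_ : sumR (fun j => Binomial.C (S (S m)) j * bernoulli_upto x m j)%R (seq 0 (S m)) =
   sumR (fun j => Binomial.C (S (S m)) j * bernoulli_poly j x)%R (seq 0 (S m))).
  by field.
apply: sumR_ext => i /in_seq Hi; rewrite bernoulli_upto_poly //; lia.
Qed.

Lemma bern_recursion x n :
  sumR (fun j => (bern x j / INR (fact (S n - j)))%R) (seq 0 (S n)) = (x ^ n / INR (fact n))%R.
Proof.
have fn k : INR (fact k) <> 0%R by exact: INR_fact_neq_0.
have n0 : INR (S n) <> 0%R by apply: not_0_INR.
rewrite (sumR_ext _ (fun j => / INR (fact (S n)) * (Binomial.C (S n) j * bernoulli_poly j x))%R).
  rewrite sumR_mult_l bernoulli_recursion fact_simpl mult_INR; by field.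
move=> j _; rewrite /bern /Binomial.C; by field.
Qed.

Lemma bern_0 x : bern x 0 = 1%R.
Proof. rewrite /bern /bernoulli_poly /=; field. Qed.

Lemma fact_ge_2 k : (2 <= k)%nat -> (2 <= INR (fact k))%R.
Proof.
move=> h; have -> : 2%R = INR (fact 2) by [].
by apply: le_INR; apply: fact_le.
Qed.

(** By strong induction: every earlier term carries a factorial of at least 2, so the total is at
    most 1 + (2^n - 1) / 2. The crude bound fixes the radius 1/2 below. *)
Lemma bern_bound x n : (Rabs x <= 1)%R -> (Rabs (bern x n) <= 2 ^ n)%R.
Proof.
move=> Hx; elim/(well_founded_induction Wf_nat.lt_wf): n => n IH.
have := bern_recursion x n; rewrite seq_S sumR_app Nat.add_0_l sumR_1.
rewrite (_ : (S n - n = 1)%nat); last lia.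
rewrite (_ : INR (fact 1) = 1%R) // => E.
have fn : (1 <= INR (fact n))%R by apply: (le_INR 1); exact: lt_O_fact.
have xn : (Rabs (x ^ n / INR (fact n)) <= 1)%R.
  rewrite Rabs_div; last lra.
  rewrite -RPow_abs (Rabs_pos_eq (INR _)); last lra.
  apply: (Rmult_le_reg_r (INR (fact n))); first lra.
  have -> : (Rabs x ^ n / INR (fact n) * INR (fact n) = Rabs x ^ n)%R by field; lra.
  have : (Rabs x ^ n <= 1 ^ n)%R by apply: pow_incr; split=> //; exact: Rabs_pos.
  rewrite pow1; lra.
have geo m : (sumR (fun j => 2 ^ j) (seq 0 m) = 2 ^ m - 1)%R.
  elim: m => [|m IHm]; first by rewrite /=; ring.
  rewrite seq_S sumR_app IHm /=; ring.
have S1 : (Rabs (sumR (fun j => bern x j / INR (fact (S n - j))) (seq 0 n)) <= (2 ^ n - 1) / 2)%R.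
  rewrite -geo; apply: Rle_trans (_ : _ <= sumR (fun j => Rabs (bern x j / INR (fact (S n - j)))) (seq 0 n))%R _.
    elim: (seq 0 n) => [|a l IHl] /=; first by rewrite Rabs_R0; lra.
    apply: Rle_trans (Rabs_triang _ _) _; exact: Rplus_le_compat_l.
  have -> : (sumR (fun j => 2 ^ j) (seq 0 n) / 2 = sumR (fun j => / 2 * 2 ^ j) (seq 0 n))%R.
    by rewrite (sumR_mult_l (/ 2)); set A := sumR _ _; field.
  apply: sumR_le => j /in_seq Hj.
  have f2 := fact_ge_2 (S n - j) ltac:(lia).
  rewrite Rabs_div; last lra.
  rewrite (Rabs_pos_eq (INR _)); last lra.
  have b := IH j ltac:(lia); have b0 := Rabs_pos (bern x j).
  have i0 : (0 <= / INR (fact (S n - j)) <= / 2)%R.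
    by split; [left; apply: Rinv_0_lt_compat; lra | apply: Rinv_le_contravar; lra].
  rewrite /Rdiv Rmult_comm; apply: Rmult_le_compat; lra.
have p2 : (1 <= 2 ^ n)%R by apply: pow_R1_Rle; lra.
have bE : (bern x n = x ^ n / INR (fact n) - sumR (fun j => bern x j / INR (fact (S n - j))) (seq 0 n))%R.
  by rewrite -E; field.
rewrite bE; apply: Rle_trans (Rabs_triang _ _) _; rewrite Rabs_Ropp; lra.
Qed.

Lemma abs_summable_prod {I J} (f : I -> C) (g : J -> C) : abs_summable f -> abs_summable g ->
  abs_summable (fun p : I * J => f (fst p) * g (snd p)).
Proof.
move=> [M HM] [M' HM']; exists (M' * M)%R.
apply: (bounded_sums_prod _ (fun i => Cmod (f i) * M')%R) => [x|i|].
- exact: Cmod_ge_0.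
- apply: bounded_sums_le (bounded_sums_mult_l _ _ _ (Cmod_ge_0 (f i)) HM') => j /=; rewrite Cmod_mult; lra.
- have M0 : (0 <= M')%R by apply: (HM' nil); constructor.
  apply: bounded_sums_le (bounded_sums_mult_l _ _ _ M0 HM) => i /=; lra.
Qed.

Lemma has_sum_prod {I J} (f : I -> C) (g : J -> C) a b : abs_summable f -> abs_summable g -> has_sum f a -> has_sum g b ->
  has_sum (fun p : I * J => f (fst p) * g (snd p)) (a * b).
Proof.
move=> sf sg Hf Hg; have [s Hs] := abs_summable_has_sum _ (abs_summable_prod f g sf sg).
have := has_sum_fubini _ (fun i => f i * b) s Hs.
move=> /(_ (fun i => has_sum_mult_l (f i) _ _ Hg)) H.
have := has_sum_unique _ _ _ H (has_sum_ext _ _ _ _ (has_sum_mult_l b _ _ Hf)).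
move=> E; rewrite Cmult_comm -E // => i; ring.
Qed.

Lemma abs_summable_Cexp z : abs_summable (fun n => z ^ n / RtoC (INR (fact n))).
Proof.
have [B HB] := exp_terms_bounded (Cmod z) (Cmod_ge_0 z); exists B.
apply: bounded_sums_le HB => n; rewrite Cmod_div; last exact: INR_fact_nz.
rewrite Cmod_pow Cmod_R Rabs_pos_eq; [lra | exact: pos_INR].
Qed.

(** In the Cauchy product of the series with e^t - 1, [bern_recursion] says that the coefficient of
    t^(n+1) is x^n / n!, so the product is t e^(xt). The radius 1/2 comes from [bern_bound] and is
    enough near the origin. *)
Theorem bernoulli_generating x (t : C) : (Rabs x <= 1)%R -> (Cmod t < / 2)%R -> Cexp t <> 1 ->
  has_sum (fun k => RtoC (bern x k) * t ^ k) (t * (Cexp (RtoC x * t) / (Cexp t - 1))).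
Proof.
move=> Hx Ht nt; have nt1 := Cminus_neq_0 _ _ nt.
have sA : abs_summable (fun k => RtoC (bern x k) * t ^ k).
  have t0 := Cmod_ge_0 t.
  exists (/ (1 - 2 * Cmod t))%R; apply: bounded_sums_le (bounded_sums_geom (2 * Cmod t)%R ltac:(lra)) => k /=.
  rewrite Cmod_mult Cmod_R Cmod_pow Rpow_mult_distr; apply: Rmult_le_compat_r; first exact: pow_le.
  exact: bern_bound.
pose E i := t ^ S i / RtoC (INR (fact (S i))).
have [M0 HM0] := abs_summable_Cexp t.
have sE : abs_summable E by exists M0; apply: (bounded_sums_inj _ S M0 _ HM0) => a b []. 
have HE : has_sum E (Cexp t - 1).
  have [a Ha] := abs_summable_has_sum E sE.
  have := has_sum_unique _ _ _ (has_sum_succ (fun n => t ^ n / RtoC (INR (fact n))) a Ha) (has_sum_Cexp t) => Ea.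
  have -> : Cexp t - 1 = a; last exact: Ha.
  rewrite -Ea [fact 0]/= [t ^ 0]/= [INR 1]/=; field.
have [F HF] := abs_summable_has_sum _ sA.
have HP := has_sum_prod _ _ _ _ sA sE HF HE.
pose fib n := map (fun k => (k, n - k)%nat) (seq 0 (S n)).
have H2 := has_sum_fiber _ (fun p : nat * nat => (fst p + snd p)%nat) fib _ _ _ HP.
have H3 : has_sum (fun n => t * ((RtoC x * t) ^ n / RtoC (INR (fact n)))) (F * (Cexp t - 1)).
  apply: has_sum_ext (H2 _ _) => [n|n|p n].
  - rewrite /fib sumC_map.
    rewrite (sumC_ext _ (fun k => t ^ S n * RtoC (bern x k / INR (fact (S n - k))))).
      rewrite sumC_mult_l (_ : sumC (fun k => RtoC (bern x k / INR (fact (S n - k)))) (seq 0 (S n)) = RtoC (sumR (fun k => bern x k / INR (fact (S n - k)))%R (seq 0 (S n)))).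
        rewrite bern_recursion RtoC_div; last exact: INR_fact_neq_0.
        rewrite Cpow_mult_l RtoC_pow [t ^ S n]/=; rewrite /Cdiv; ring.
      elim: (seq 0 (S n)) => [//|a l IHl] /=; by rewrite IHl RtoC_plus.
    move=> k /in_seq Hk; cbn [fst snd]; rewrite /E.
    have -> : (S n - k = S (n - k))%nat by lia.
    rewrite RtoC_div; last exact: INR_fact_neq_0.
    have -> : (S n = k + S (n - k))%nat by lia.
    rewrite Cpow_add_r /Cdiv.
    ring.
  - apply: FinFun.Injective_map_NoDup; last exact: seq_NoDup.
    by move=> a b [].
  - rewrite /fib in_map_iff; split.
      by move=> [k [E1 /in_seq Hk]]; rewrite -E1; cbn [fst snd]; lia.
    case: p => [a b]; cbn [fst snd] => <-; exists a; split; first by congr (_, _); lia.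
    by apply/in_seq; lia.
have H4 := has_sum_mult_l t _ _ (has_sum_Cexp (RtoC x * t)).
have E4 := has_sum_unique _ _ _ H3 H4.
have -> : t * (Cexp (RtoC x * t) / (Cexp t - 1)) = F; last exact: HF.
by transitivity (F * (Cexp t - 1) / (Cexp t - 1)); [rewrite E4; field | field].
Qed.

(** * The polar part at the origin *)

Lemma Cpow_opp (t : C) k : (- t) ^ k = if Nat.odd k then - t ^ k else t ^ k.
Proof.
elim: k => [//|k IH]; rewrite Nat.odd_succ -Nat.negb_odd /= IH; case: (Nat.odd k) => /=; ring.
Qed.

Lemma Cexp_eq_1_small (t : C) : t <> 0 -> (Cmod t < 2 * PI)%R -> Cexp t <> 1.
Proof.
move=> nt Ht /Cexp_eq_1 [k E]; apply: nt.
have pp := PI_RGT_0.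
have k0 : k = 0%Z.
  move: Ht; rewrite E /twopii !Cmod_mult Cmod_Ci !Cmod_R -(abs_IZR k) Rabs_pos_eq; last lra.
  rewrite Rabs_pos_eq; last lra.
  move=> h; have : (IZR (Z.abs k) < 1)%R by nra.
  by move=> /lt_IZR; lia.
rewrite E k0; ring.
Qed.

Section PolarPart.

Variables (N : nat) (chi : Z -> C) (HN : (1 <= N)%nat) (Hprim : primitive_character N chi) (Heven : even_character chi).

Let Hchi : dirichlet_character N chi := proj1 Hprim.

Definition Ppart (u : C) : C := sum_n (fun h => chi (Z.of_nat h) * (Cexp u ^ h / (Cexp u ^ N - 1))) N.

(** Reflection h -> N - h preserves the range 0, ..., N and, for an even N-periodic character, the
    coefficients. *)
Lemma Ppart_odd u : Cexp u ^ N - 1 <> 0 -> Ppart (- u) = - Ppart u.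
Proof.
move=> nz; rewrite /Ppart -!sumC_seq.
have e0 := Cexp_nz u; have ei : Cexp (- u) = / Cexp u.
  rewrite -(Cmult_1_l (/ Cexp u)) -Cexp_0 -(Cplus_opp_r u) Cexp_plus; by field.
have pn k : Cexp u ^ k <> 0 by exact: Cpow_nz.
have rev : Permutation (map (fun h => (N - h)%nat) (seq 0 (S N))) (seq 0 (S N)).
  apply: NoDup_Permutation.
  - apply: NoDup_map_NoDup_ForallPairs; last exact: seq_NoDup.
    move=> x y /in_seq hx /in_seq hy; lia.
  - exact: seq_NoDup.
  - move=> x; rewrite in_map_iff in_seq; split.
      by move=> [y [<- /in_seq hy]]; lia.
    by move=> hx; exists (N - x)%nat; rewrite in_seq; lia.
rewrite -(sumC_perm _ _ _ rev) sumC_map.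
rewrite (_ : - sumC _ _ = -(1) * sumC (fun h => chi (Z.of_nat h) * (Cexp u ^ h / (Cexp u ^ N - 1))) (seq 0 (S N))); last by ring.
rewrite -sumC_mult_l; apply: sumC_ext => h /in_seq Hh.
have -> : chi (Z.of_nat (N - h)) = chi (Z.of_nat h).
  rewrite -(chi_even N chi Hprim Heven (Z.of_nat h)) -(char_periodic N chi Hchi (- Z.of_nat h)); congr chi; lia.
rewrite ei.
have -> : (/ Cexp u) ^ (N - h) = Cexp u ^ h / Cexp u ^ N.
  rewrite Cpow_inv //; have -> : Cexp u ^ N = Cexp u ^ h * Cexp u ^ (N - h) by rewrite -Cpow_add_r; congr (_ ^ _); lia.
  by field; split.
rewrite Cpow_inv //.
have n2 : 1 - Cexp u ^ N <> 0 by move=> E; apply: nz; transitivity (- (1 - Cexp u ^ N)); [ring | rewrite E; ring].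
by field; split => //; split.
Qed.

(* [Ppart] is odd, hence the odd part of [(sum_(h < N) chi(h) xi^h + chi(0)) / (xi^N - 1)], which has the
   Laurent coefficients [beta k] in the variable [t = N u] after multiplication by [t]. *)
Definition beta (k : nat) : C :=
  sumC (fun h => chi (Z.of_nat h) * RtoC (bern (INR h / INR N) k)) (seq 0 N) + chi 0%Z * RtoC (bern 0 k).

(** This is separability of the Gauss sum at m = 0, followed by conjugation. *)
Lemma sum_chi : N <> 1%nat -> sumC (fun h => chi (Z.of_nat h)) (seq 0 N) = 0.
Proof.
move=> n1.
have c0 : chi 0%Z = 0 by case: (chi_0_or N chi HN Hprim).
have H := gauss_separable N chi HN Hchi Hprim 0; rewrite c0 Cmult_0_l /resum in H.
have cz : Cconj 0 = 0 by rewrite /Cconj /RtoC /=; congr (_, _); ring.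
rewrite -cz -H -[LHS]Cconj_conj; congr Cconj.
elim: (seq 0 N) => [|a l IH] /=; first exact: cz.
by rewrite Cplus_conj IH Z.mul_0_r root_unity_0 // Cmult_1_r.
Qed.

Lemma beta_0 : beta 0 = 2 * chi 0%Z.
Proof.
rewrite /beta (sumC_ext _ (fun h => chi (Z.of_nat h))); last by move=> h _; rewrite bern_0; ring.
rewrite bern_0; case: (Nat.eq_dec N 1) => N1.
  rewrite N1 /=; ring.
rewrite sum_chi //; case: (chi_0_or N chi HN Hprim) => // ->; ring.
Qed.

(* For [N = 1], both [G] and [H] have a constant term. *)
Definition level_factor : C := match Nat.eq_dec N 1 with left _ => RtoC 2 | right _ => RtoC 1 end.

(** The constant term in q of the sum of G for conj chi and H for chi in weight k. *)
Definition const_term (k : nat) : C := - (level_factor * twisted_bernoulli N chi k / (2 * INR k)).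

Lemma const_term_beta n u : const_term (S n) * (u ^ n / INR (fact n)) = - / 2 * (beta (S n) * (RtoC (INR N) * u) ^ n).
Proof.
have fn := INR_fact_nz n; have nN := INR_N_nz N HN.
have Sn : RtoC (INR (S n)) <> 0 by move=> E; have := RtoC_inj _ _ E; apply: not_0_INR.
have bE x : RtoC (bern x (S n)) = RtoC (bernoulli_poly (S n) x) / (RtoC (INR (S n)) * RtoC (INR (fact n))).
  rewrite /bern RtoC_div; last exact: INR_fact_neq_0.
  by rewrite fact_simpl mult_INR RtoC_mult.
have bS : beta (S n) = (sumC (fun h => chi (Z.of_nat h) * RtoC (bernoulli_poly (S n) (INR h / INR N))) (seq 0 N) + chi 0%Z * RtoC (bernoulli_poly (S n) 0)) / (RtoC (INR (S n)) * RtoC (INR (fact n))).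
  rewrite /beta bE (sumC_ext _ (fun h => / (RtoC (INR (S n)) * RtoC (INR (fact n))) * (chi (Z.of_nat h) * RtoC (bernoulli_poly (S n) (INR h / INR N))))).
    rewrite sumC_mult_l /Cdiv; ring.
  move=> h _; rewrite bE /Cdiv; ring.
have tb : twisted_bernoulli N chi (S n) = RtoC (INR N) ^ n * sumC (fun h => chi (Z.of_nat h) * RtoC (bernoulli_poly (S n) (INR h / INR N))) (seq 0 N).
  rewrite /twisted_bernoulli -sumC_seq; congr (_ * sumC _ (seq 0 _)); last lia.
  by rewrite Nat.sub_succ Nat.sub_0_r.
rewrite /const_term tb bS Cpow_mult_l /level_factor.
case: Nat.eq_dec => N1.
- have -> : sumC (fun h => chi (Z.of_nat h) * RtoC (bernoulli_poly (S n) (INR h / INR N))) (seq 0 N) = chi 0%Z * RtoC (bernoulli_poly (S n) 0).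
    rewrite N1; have r0 : (INR 0 / INR 1 = 0)%R by rewrite /=; field.
    transitivity (chi 0%Z * RtoC (bernoulli_poly (S n) (INR 0 / INR 1)) + 0); first by [].
    by rewrite r0; ring.
  by field; split.
- by case: (chi_0_or N chi HN Hprim) => // ->; field; split.
Qed.

Lemma beta_generating u : let t := RtoC (INR N) * u in (Cmod t < / 2)%R -> Cexp t <> 1 ->
  has_sum (fun k => beta k * t ^ k) (t * Ppart u - chi 0%Z * t).
Proof.
move=> t Ht nt; have nN := INR_N_nz N HN; have nt1 := Cminus_neq_0 _ _ nt.
have N0 : (0 < INR N)%R by apply: lt_0_INR; lia.
have G h : In h (seq 0 N) -> has_sum (fun k => chi (Z.of_nat h) * (RtoC (bern (INR h / INR N) k) * t ^ k))
    (chi (Z.of_nat h) * (t * (Cexp (RtoC (INR h / INR N) * t) / (Cexp t - 1)))).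
  move=> /in_seq Hh; apply: has_sum_mult_l; apply: bernoulli_generating => //.
  have hN : (INR h <= INR N)%R by apply: le_INR; lia.
  have h0 := pos_INR h.
  rewrite Rabs_pos_eq; last by apply: Rmult_le_pos => //; left; exact: Rinv_0_lt_compat.
  apply: (Rmult_le_reg_r (INR N)) => //; rewrite /Rdiv Rmult_assoc Rinv_l; lra.
have G0 : has_sum (fun k => chi 0%Z * (RtoC (bern 0 k) * t ^ k)) (chi 0%Z * (t * (Cexp (RtoC 0 * t) / (Cexp t - 1)))).
  apply: has_sum_mult_l; apply: bernoulli_generating => //; rewrite Rabs_R0; lra.
have H := has_sum_plus _ _ _ _ (has_sum_sumC (fun h k => chi (Z.of_nat h) * (RtoC (bern (INR h / INR N) k) * t ^ k)) _ _ G) G0.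
have -> : t * Ppart u - chi 0%Z * t = sumC (fun h => chi (Z.of_nat h) * (t * (Cexp (RtoC (INR h / INR N) * t) / (Cexp t - 1)))) (seq 0 N) +
   chi 0%Z * (t * (Cexp (RtoC 0 * t) / (Cexp t - 1))).
  rewrite /Ppart -sumC_seq seq_S sumC_app [sumC _ (_ :: nil)]/= Cplus_0_r.
  have tN : Cexp u ^ N = Cexp t by rewrite Cexp_pow.
  rewrite tN.
  have -> : chi (Z.of_nat N) = chi 0%Z by rewrite -(char_periodic N chi Hchi 0).
  have -> : Cexp (RtoC 0 * t) = 1 by rewrite Cmult_0_l Cexp_0.
  rewrite (sumC_ext (fun h => chi (Z.of_nat h) * (t * (Cexp (RtoC (INR h / INR N) * t) / (Cexp t - 1)))) (fun h => t * (chi (Z.of_nat h) * (Cexp u ^ h / (Cexp t - 1))))).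
    by rewrite sumC_mult_l; field.
  move=> h _; rewrite Cexp_pow.
  have -> : RtoC (INR h / INR N) * t = RtoC (INR h) * u by rewrite /t RtoC_div; [field | lra].
  by field.
apply: has_sum_ext H => k.
rewrite /beta Cmult_plus_distr_r (Cmult_comm (sumC _ _)) -sumC_mult_l; congr (_ + _); last by ring.
apply: sumC_ext => h _; ring.
Qed.

Definition polar_coeff (u : C) (r : nat) : C := if Nat.odd r then const_term (S r) * (u ^ r / INR (fact r)) else 0.

(** Since [Ppart] is odd, averaging over t and -t keeps only even k in the Bernoulli expansion,
    hence odd powers r = k - 1 of u; the coefficient at k = 0 accounts for the pole. *)
Theorem polar_series (u : C) : u <> 0 -> (Cmod (RtoC (INR N) * u) < / 2)%R ->
  has_sum (polar_coeff u) (chi 0%Z / u - / 2 * Ppart u).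
Proof.
move=> nu; set t := RtoC (INR N) * u => Ht.
have nN := INR_N_nz N HN; have nt : t <> 0 by exact: Cmult_neq_0.
have p4 : (/ 2 < 2 * PI)%R by have := PI2_1; lra.
have Ht2 : (Cmod t < 2 * PI)%R by exact: Rlt_trans Ht p4.
have e1 : Cexp t <> 1 by exact: Cexp_eq_1_small.
have e2 : Cexp (- t) <> 1.
  apply: Cexp_eq_1_small; last by rewrite Cmod_opp.
  by move=> E; apply: nt; transitivity (- - t); [ring | rewrite E; ring].
have tu : RtoC (INR N) * - u = - t by rewrite /t; ring.
have H1 := beta_generating u Ht e1; rewrite -/t in H1.
have H2 := beta_generating (- u); rewrite /= tu Cmod_opp in H2; have {}H2 := H2 Ht e2.
have Podd : Ppart (- u) = - Ppart u by apply: Ppart_odd; rewrite Cexp_pow; exact: Cminus_neq_0.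
rewrite Podd in H2.
(* The linear terms in t cancel. Dropping k = 0 removes 2 beta(0) = 4 chi(0), which explains the
   later factor 1 / (4 t). *)
have H3 := has_sum_tail _ _ 1 (has_sum_plus _ _ _ _ H1 H2).
have two : (2 : C) <> 0 by move=> E; have := RtoC_inj _ _ E; lra.
have four : (4 : C) <> 0 by move=> E; have := RtoC_inj _ _ E; lra.
have tE r : polar_coeff u r = - / (4 * t) * (beta (1 + r) * t ^ (1 + r) + beta (1 + r) * (- t) ^ (1 + r)).
  rewrite /polar_coeff Cpow_opp Nat.odd_succ -Nat.negb_odd; case: (Nat.odd r); cbn [negb]; last by ring.
  rewrite const_term_beta -/t [t ^ (1 + r)]/=.
  have f2 : (4 : C) = 2 * 2 by rewrite -RtoC_mult; congr RtoC; ring.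
  rewrite f2; change (1 + r)%nat with (S r); by field.
have H4 := has_sum_mult_l (- / (4 * t)) _ _ H3.
apply: has_sum_ext (_ : has_sum _ _) => [r|]; first by symmetry; exact: tE.
have -> : chi 0%Z / u - / 2 * Ppart u = - / (4 * t) * (t * Ppart u - chi 0%Z * t + (- t * - Ppart u - chi 0%Z * - t) - sumC (fun k => beta k * t ^ k + beta k * (- t) ^ k) (seq 0 1)).
  rewrite [sumC _ _]/= beta_0.
  have cu : chi 0%Z / u = chi 0%Z / t.
    case: (chi_0_or N chi HN Hprim) => [N1|->]; last by rewrite /Cdiv; ring.
    by rewrite /t N1 [INR 1]/= Cmult_1_l.
  rewrite cu.
  have f2 : (4 : C) = 2 * 2 by rewrite -RtoC_mult; congr RtoC; ring.
  rewrite f2; by field.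
exact: H4.
Qed.

End PolarPart.

(** * The Laurent expansion *)

Lemma cdiff_C_derive f z l : cdiff f z l -> C_derive f z = l.
Proof.
move=> H; apply: is_C_derive_unique; apply/(Fdiff_filterdiff (U := AbsRing_NormedModule C_AbsRing)).
split; first exact: (is_linear_scal_l l).
move=> eps He; have [d [d0 hd]] := H eps He; exists d; split=> // y Hy.
by have := hd y Hy; rewrite (Cmult_comm l).
Qed.

Lemma bounded_sums_Rmult_sign {I} (f : I -> R) (M : R) (L : list I) :
  (forall L', NoDup L' -> incl L' L -> (Rabs (sumR f L') <= M)%R) -> NoDup L -> (sumR (fun i => Rabs (f i)) L <= 2 * M)%R.
Proof.
move=> H HL.
have E (l : list I) : sumR (fun i => Rabs (f i)) l =
   (sumR f (filter (fun i => match Rle_dec 0 (f i) with left _ => true | right _ => false end) l) - sumR f (filter (fun i => match Rle_dec 0 (f i) with left _ => false | right _ => true end) l))%R.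
  elim: l => [|a l IH] /=; first by ring.
  rewrite IH; case: (Rle_dec 0 (f a)) => h /=.
    rewrite Rabs_pos_eq //; ring.
  rewrite Rabs_left; [ring | lra].
have F (g : I -> bool) : (Rabs (sumR f (filter g L)) <= M)%R.
  apply: H; first exact: NoDup_filter.
  by move=> x /filter_In [].
rewrite E.
have /Rabs_le_between a1 := F (fun i => match Rle_dec 0 (f i) with left _ => true | right _ => false end).
have /Rabs_le_between a2 := F (fun i => match Rle_dec 0 (f i) with left _ => false | right _ => true end).
lra.
Qed.

(** Unconditional convergence of complex families is absolute: finite sets disjoint from a suitable
    L0 have sums of modulus at most 2, so separating signs bounds the real and imaginary parts by 4
    each. *)
Lemma has_sum_abs_summable {I} (f : I -> C) s : has_sum f s -> abs_summable f.
Proof.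
move=> H; have [L0' H0'] := H 1%R Rlt_0_1.
have [L0 [N0 [i0 _]]] := nodup_over L0'.
have H0 L : NoDup L -> incl L0 L -> (Cmod (sumC f L - s) < 1)%R.
  by move=> hL hi; apply: H0' => // x hx; apply: hi; apply: i0.
have small L : NoDup (L0 ++ L) -> (Cmod (sumC f L) <= 2)%R.
  move=> hL.
  have a1 := H0 _ hL (fun x hx => in_or_app _ _ _ (or_introl hx)).
  have a2 := H0 L0 N0 (fun x hx => hx).
  have -> : sumC f L = (sumC f (L0 ++ L) - s) - (sumC f L0 - s) by rewrite sumC_app; ring.
  apply: Rle_trans (Cmod_triangle _ _) _; rewrite Cmod_opp; lra.
have part (g : C -> R) (G : forall z, (Rabs (g z) <= Cmod z)%R) (A : forall l, g (sumC f l) = sumR (fun i => g (f i)) l) L :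
   NoDup (L0 ++ L) -> (sumR (fun i => Rabs (g (f i))) L <= 4)%R.
  move=> hL; have -> : 4%R = (2 * 2)%R by ring.
  apply: bounded_sums_Rmult_sign; last by move: hL => /NoDup_app_remove_l.
  move=> L' n' h'; rewrite -A; apply: Rle_trans (G _) _; apply: small.
  apply: NoDup_app => // x hx /h' hx'.
  have [l1 [l2 E]] := in_split _ _ hx'.
  rewrite E app_assoc in hL; apply: (NoDup_remove_2 _ _ _ hL).
  by apply: in_or_app; left; apply: in_or_app; left.
have mid L : NoDup (L0 ++ L) -> (sumR (fun i => Cmod (f i)) L <= 8)%R.
  move=> hL.
  have a1 := part fst fst_le_Cmod (fun l => f_equal fst (sumC_pair f l)) L hL.
  have a2 := part snd snd_le_Cmod (fun l => f_equal snd (sumC_pair f l)) L hL.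
  apply: Rle_trans (_ : _ <= sumR (fun i => Rabs (fst (f i)) + Rabs (snd (f i)))%R L)%R _.
    by apply: sumR_le => i _; exact: Cmod_le_sum.
  rewrite sumR_plus; lra.
exists (sumR (fun i => Cmod (f i)) L0 + 8)%R => L hL.
pose A := filter (fun x => match in_dec classic_eq_dec x L0 with left _ => false | right _ => true end) L.
have nA : NoDup (L0 ++ A).
  apply: NoDup_app => //; first exact: NoDup_filter.
  by move=> x hx /filter_In [_]; case: in_dec.
apply: Rle_trans (_ : _ <= sumR (fun i => Cmod (f i)) (L0 ++ A))%R _.
  apply: sumR_incl => [i||x hx]; [exact: Cmod_ge_0 | done |].
  apply/in_app_iff; case: (in_dec classic_eq_dec x L0) => h; [by left | right].
  by apply/filter_In; split=> //; case: in_dec.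
rewrite sumR_app; have := mid A nA; lra.
Qed.

(** With x = (r + 1) y one has y^r <= e^(r y) <= e^x. *)
Lemma pow_le_exp r x : (0 <= x)%R -> (x ^ r <= INR (S r) ^ r * exp x)%R.
Proof.
move=> x0; have n0 : (0 < INR (S r))%R by apply: lt_0_INR; lia.
have -> : (x = INR (S r) * (x / INR (S r)))%R by field; lra.
set y := (x / INR (S r))%R.
have y0 : (0 <= y)%R by apply: Rmult_le_pos => //; left; exact: Rinv_0_lt_compat.
rewrite Rpow_mult_distr; apply: Rmult_le_compat_l; first by apply: pow_le; lra.
apply: Rle_trans (_ : _ <= exp y ^ r)%R _.
  by apply: pow_incr; have := exp_ineq1_le y; lra.
rewrite -exp_INR_mult; apply: exp_le_compat; rewrite S_INR; nra.
Qed.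

(** * Power-weighted double series and Eisenstein series *)

Section DivisorSeries.

Variables (N : nat) (chi : Z -> C) (HN : (1 <= N)%nat) (Hprim : primitive_character N chi) (Heven : even_character chi).

Let Hchi : dirichlet_character N chi := proj1 Hprim.

(* [q ^ (m n)] with [m n >= (m + n) / 2] absorbs exponentials in [m] and [n]. *)
Lemma nome_pow_bound Y tau (i j : nat) : (0 <= Y)%R -> (Y <= height tau)%R ->
  (Cmod (nome tau ^ (S i * S j)) <= exp (- (Y / 2)) ^ S i * exp (- (Y / 2)) ^ S j)%R.
Proof.
move=> Y0 Ht; rewrite Cmod_pow -!exp_INR_mult -exp_plus.
have -> : Cmod (nome tau) = exp (- height tau).
  rewrite /nome Cmod_Cexp; congr exp; rewrite /height /Re /Im /=; ring.
rewrite -exp_INR_mult mult_INR; apply: exp_le_compat.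
have i1 : (1 <= INR (S i))%R by rewrite S_INR; have := pos_INR i; lra.
have j1 : (1 <= INR (S j))%R by rewrite S_INR; have := pos_INR j; lra.
have ij : (INR (S i) + INR (S j) <= 2 * (INR (S i) * INR (S j)))%R by nra.
have ij0 : (0 <= INR (S i) * INR (S j))%R by nra.
have : (INR (S i) * INR (S j) * Y <= INR (S i) * INR (S j) * height tau)%R by apply: Rmult_le_compat_l.
have : ((INR (S i) + INR (S j)) * Y <= 2 * (INR (S i) * INR (S j)) * Y)%R by apply: Rmult_le_compat_r.
lra.
Qed.

Definition chi_pair (p : nat * nat) : C := chi (Z.of_nat (S (fst p))) + chi (Z.of_nat (S (snd p))).

Lemma chi_pair_bound p : (Cmod (chi_pair p) <= 2)%R.
Proof.
apply: Rle_trans (Cmod_triangle _ _) _.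
have := chi_le_1 N chi HN Hprim (Z.of_nat (S (fst p))); have := chi_le_1 N chi HN Hprim (Z.of_nat (S (snd p))); lra.
Qed.

Definition Tsum_term (r s : nat) (t : C) (p : nat * nat) : C :=
  chi_pair p * (RtoC (INR (S (fst p))) ^ r * RtoC (INR (S (snd p))) ^ s) * nome t ^ (S (fst p) * S (snd p)).

Definition Tsum (r s : nat) (t : C) : C := hsum (Tsum_term r s t).

Lemma Tsum_term_bound r s y : (0 < y)%R -> exists (B : nat * nat -> R) M, bounded_sums B M /\
  forall t p (w : C), (y <= height t)%R -> (Cmod w <= 2)%R ->
   (Cmod (w * (RtoC (INR (S (fst p))) ^ r * RtoC (INR (S (snd p))) ^ s) * nome t ^ (S (fst p) * S (snd p))) <= B p)%R.
Proof.
(* The constant in m^k <= K k e^(m y/4): powers spend half of the decay e^(-m y/2), leaving the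
   ratio rho = e^(-y/4). The majorant is uniform for height >= y, as termwise differentiation
   requires. *)
move=> y0; pose K k := (INR (S k) ^ k * (4 / y) ^ k)%R.
have K0 k : (0 <= K k)%R.
  have := pos_INR (S k) => h; apply: Rmult_le_pos; apply: pow_le => //.
  by apply: Rmult_le_pos; [lra | left; exact: Rinv_0_lt_compat].
pose rho := exp (- (y / 4)).
have r0 : (0 <= rho < 1)%R.
  by split; [left; exact: exp_pos | rewrite -exp_0; apply: exp_increasing; lra].
exists (fun p => (2 * (K r * K s)) * rho ^ fst p * rho ^ snd p)%R, (/ (1 - rho) * (2 * (K r * K s)) * / (1 - rho))%R.
split; first by apply: bounded_sums_geom2 => //; have := Rmult_le_pos _ _ (K0 r) (K0 s); lra.
move=> t [i j] w Ht Hw; cbn [fst snd].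
have pw k n : (INR (S n) ^ k <= K k * exp (y / 4) ^ S n)%R.
  have n0 := pos_INR (S n).
  have := pow_le_exp k (INR (S n) * (y / 4)) ltac:(nra).
  rewrite exp_INR_mult Rpow_mult_distr => h.
  have p4 : (0 < (4 / y) ^ k)%R by apply: pow_lt; apply: Rdiv_lt_0_compat; lra.
  have e : ((4 / y) ^ k * (y / 4) ^ k = 1)%R.
    rewrite -Rpow_mult_distr; have -> : (4 / y * (y / 4) = 1)%R by field; lra.
    exact: pow1.
  rewrite /K; transitivity ((4 / y) ^ k * (INR (S n) ^ k * (y / 4) ^ k))%R.
    right; transitivity (INR (S n) ^ k * ((4 / y) ^ k * (y / 4) ^ k))%R; [by rewrite e; ring | ring].
  apply: Rle_trans (Rmult_le_compat_l _ _ _ (Rlt_le _ _ p4) h) _; right; ring.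
have nb := nome_pow_bound y t i j ltac:(lra) Ht.
have rh n : (rho ^ S n <= rho ^ n)%R.
  have := pow_le rho n (proj1 r0) => h; rewrite /=; nra.
have sp k n : Cmod (RtoC (INR (S n)) ^ k) = (INR (S n) ^ k)%R.
  by rewrite Cmod_pow Cmod_R Rabs_pos_eq //; exact: pos_INR.
have er n : (exp (y / 4) ^ n * exp (- (y / 2)) ^ n = rho ^ n)%R.
  rewrite -Rpow_mult_distr -exp_plus /rho; congr (exp _ ^ _)%R; field.
have pos (x : R) n : (0 <= exp x ^ n)%R by apply: pow_le; left; exact: exp_pos.
rewrite 3!Cmod_mult !sp.
have step1 : (INR (S i) ^ r * INR (S j) ^ s <= (K r * exp (y / 4) ^ S i) * (K s * exp (y / 4) ^ S j))%R.
  by apply: Rmult_le_compat => //; apply: pow_le; exact: pos_INR.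
have step0 : (0 <= INR (S i) ^ r * INR (S j) ^ s)%R by apply: Rmult_le_pos; apply: pow_le; exact: pos_INR.
have step2 : (Cmod w * (INR (S i) ^ r * INR (S j) ^ s) <= 2 * ((K r * exp (y / 4) ^ S i) * (K s * exp (y / 4) ^ S j)))%R.
  by apply: Rmult_le_compat => //; exact: Cmod_ge_0.
apply: Rle_trans (Rmult_le_compat _ _ _ _ (Rmult_le_pos _ _ (Cmod_ge_0 w) step0) (Cmod_ge_0 _) step2 nb) _.
have -> : (2 * ((K r * exp (y / 4) ^ S i) * (K s * exp (y / 4) ^ S j)) * (exp (- (y / 2)) ^ S i * exp (- (y / 2)) ^ S j) =
   2 * (K r * K s) * ((exp (y / 4) ^ S i * exp (- (y / 2)) ^ S i) * (exp (y / 4) ^ S j * exp (- (y / 2)) ^ S j)))%R by ring.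
rewrite !er.
rewrite (Rmult_assoc (2 * (K r * K s))); apply: Rmult_le_compat_l.
  by have := Rmult_le_pos _ _ (K0 r) (K0 s); lra.
by apply: Rmult_le_compat => //; apply: pow_le; lra.
Qed.

Lemma weighted_summable (w : nat * nat -> C) r s t : (0 < Im t)%R -> (forall p, (Cmod (w p) <= 2)%R) ->
  abs_summable (fun p => w p * (RtoC (INR (S (fst p))) ^ r * RtoC (INR (S (snd p))) ^ s) * nome t ^ (S (fst p) * S (snd p))).
Proof.
move=> Ht Hw; have [B [M [HB H]]] := Tsum_term_bound r s (height t) (height_pos t Ht).
by exists M; apply: bounded_sums_le HB => p; apply: H => //; lra.
Qed.

Lemma Tsum_has_sum r s t : (0 < Im t)%R -> has_sum (Tsum_term r s t) (Tsum r s t).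
Proof. by move=> Ht; apply: hsum_correct; apply: weighted_summable => //; exact: chi_pair_bound. Qed.

Lemma Tsum_sym r s t : (0 < Im t)%R -> Tsum r s t = Tsum s r t.
Proof.
move=> Ht; apply: has_sum_hsum; apply: has_sum_ext (has_sum_swap _ _ (Tsum_has_sum s r t Ht)) => p.
rewrite /Tsum_term /chi_pair; cbn [fst snd]; rewrite Nat.mul_comm; ring.
Qed.

Lemma nome_pow_Cexp t k : nome t ^ k = Cexp (RtoC (INR k) * twopii * t).
Proof. by rewrite /nome Cexp_pow; congr Cexp; rewrite /twopii; ring. Qed.

(** Differentiating q^(m n) in tau produces 2 pi i m n, which raises both exponents by one. The disc
    of radius half the imaginary part stays in a half-plane with a uniform majorant. *)
Lemma Tsum_cdiff r s t : (0 < Im t)%R -> cdiff (Tsum r s) t (twopii * Tsum (S r) (S s) t).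
Proof.
move=> Ht; have pp := PI_RGT_0.
pose R0 := (Im t / 2)%R. have R0p : (0 < R0)%R by rewrite /R0; lra.
pose y := (2 * PI * R0)%R. have yp : (0 < y)%R by apply: Rmult_lt_0_compat; lra.
have near y' : (Cmod (y' - t) < R0)%R -> (R0 <= Im y')%R.
  move=> H; have := snd_le_Cmod (y' - t).
  have -> : snd (y' - t) = (Im y' - Im t)%R by [].
  move=> h; have := Rle_lt_trans _ _ _ h H; move=> /Rabs_def2 [_]; rewrite /R0; lra.
have [B [M [HB HT]]] := Tsum_term_bound r s y yp.
pose f' p := twopii * Tsum_term (S r) (S s) t p.
have dT p z : cdiff (fun t => Tsum_term r s t p) z (twopii * Tsum_term (S r) (S s) z p).
  rewrite /Tsum_term; set A := chi_pair p; set m := S (fst p); set n := S (snd p).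
  have H : cdiff (fun t => A * (RtoC (INR m) ^ r * RtoC (INR n) ^ s) * Cexp (RtoC (INR (m * n)) * twopii * t)) z
     (A * (RtoC (INR m) ^ r * RtoC (INR n) ^ s) * (Cexp (RtoC (INR (m * n)) * twopii * z) * (RtoC (INR (m * n)) * twopii * 1))).
    apply: cdiff_scal; apply: (cdiff_comp (fun t => RtoC (INR (m * n)) * twopii * t) Cexp); last exact: cdiff_Cexp.
    by apply: cdiff_scal; exact: cdiff_id.
  have -> : twopii * (A * (RtoC (INR m) ^ S r * RtoC (INR n) ^ S s) * nome z ^ (m * n)) =
     A * (RtoC (INR m) ^ r * RtoC (INR n) ^ s) * (Cexp (RtoC (INR (m * n)) * twopii * z) * (RtoC (INR (m * n)) * twopii * 1)).
    have pS (x : C) k : x ^ S k = x * x ^ k by [].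
    rewrite nome_pow_Cexp mult_INR RtoC_mult !pS; ring.
  apply: cdiff_unique_ext H _; exists 1%R; split; first lra.
  by move=> x _; rewrite nome_pow_Cexp.
have [|||s' [H1 H2]] := cdiff_series (fun p t => Tsum_term r s t p) f' (Tsum r s) t R0 B M R0p HB.
- move=> p z Hz; split; first by eexists; exact: dT.
  apply: HT; last exact: chi_pair_bound.
  by rewrite /height /y; apply: Rmult_le_compat_l; [lra | exact: near].
- move=> z Hz; apply: Tsum_has_sum; have := near z Hz; lra.
- by move=> p; exact: dT.
have := has_sum_unique _ _ _ H2 (has_sum_mult_l twopii _ _ (Tsum_has_sum (S r) (S s) t Ht)).
by move=> <-.
Qed.

(** The first derivative removes the constant term, so Bernoulli numbers enter the Laurent expansion
    only on the axes r = 0 and s = 0. *)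
Lemma Dtau_iter_Tsum (f : C -> C) c r : (forall t, (0 < Im t)%R -> f t = c + Tsum r 0 t) ->
  forall i t, (0 < Im t)%R -> Dtau_iter i f t = (match i with O => c | _ => RtoC 0 end) + Tsum (i + r) i t.
Proof.
move=> Hf; elim=> [|i IH] t Ht; first exact: Hf.
rewrite [Dtau_iter _ _ _]/= (cdiff_C_derive _ t (0 + twopii * Tsum (S (i + r)) (S i) t)).
  change (S i + r)%nat with (S (i + r)); rewrite -/twopii; field; exact: twopii_nz.
have H := cdiff_plus _ _ _ _ _ (cdiff_const (match i with O => c | _ => RtoC 0 end) t) (Tsum_cdiff (i + r) i t Ht).
apply: cdiff_unique_ext H _; exists (Im t); split=> // y Hy; rewrite IH //.
have := snd_le_Cmod (y - t).
have -> : snd (y - t) = (Im y - Im t)%R by [].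
move=> h; have := Rle_lt_trans _ _ _ h Hy; move=> /Rabs_def2; lra.
Qed.

End DivisorSeries.

Lemma exp_terms_sum x : (0 <= x)%R -> bounded_sums (fun r => (x ^ r / INR (fact r))%R) (exp x).
Proof.
move=> x0 L HL.
have pos r : (0 <= x ^ r / INR (fact r))%R.
  apply: Rmult_le_pos; first exact: pow_le.
  left; apply: Rinv_0_lt_compat; exact: INR_fact_lt_0.
have Hx := has_sum_Cexp (RtoC x).
apply: Rnot_lt_le => h.
have [L0 H0] := Hx (sumR (fun r => (x ^ r / INR (fact r))%R) (L) - exp x)%R ltac:(lra).
have [L1 [N1 [i1 _]]] := nodup_over (L0 ++ L).
have := H0 L1 N1 (fun z hz => i1 z (in_or_app _ _ _ (or_introl hz))).
have -> : sumC (fun r => RtoC x ^ r / RtoC (INR (fact r))) L1 = RtoC (sumR (fun r => (x ^ r / INR (fact r))%R) L1).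
  elim: (L1) => [//|a l IH] /=; rewrite IH RtoC_plus RtoC_div ?RtoC_pow //; exact: INR_fact_neq_0.
have -> : Cexp (RtoC x) = RtoC (exp x) by rewrite /Cexp /RtoC /= cos_0 sin_0; congr (_, _); ring.
rewrite -RtoC_minus Cmod_R.
have l1 : (sumR (fun r => (x ^ r / INR (fact r))%R) (L) <= sumR (fun r => (x ^ r / INR (fact r))%R) L1)%R.
  by apply: sumR_incl => // z hz; apply: i1; apply: in_or_app; right.
move=> a; have := Rle_abs (sumR (fun r => (x ^ r / INR (fact r))%R) L1 - exp x); lra.
Qed.

Section Laurent.

Variables (N : nat) (chi : Z -> C) (HN : (1 <= N)%nat) (Hprim : primitive_character N chi) (Heven : even_character chi).

Let Hchi : dirichlet_character N chi := proj1 Hprim.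

Local Notation T := (Tsum chi).

Local Notation Tterm := (Tsum_term chi).

Lemma divisor_series (w : Z -> C) (second : bool) r t : (0 < Im t)%R -> (forall n, (Cmod (w n) <= 1)%R) ->
  has_sum (fun p : nat * nat => w (Z.of_nat (if second then S (snd p) else S (fst p))) * (RtoC (INR (S (fst p))) ^ r * RtoC (INR (S (snd p))) ^ 0) * nome t ^ (S (fst p) * S (snd p)))
   (CSeries (fun i => divisor_sum (S i) (fun d => w (Z.of_nat (if second then S i / d else d)%nat) * RtoC (INR d) ^ r) * nome t ^ S i)).
Proof.
move=> Ht Hw.
set F := fun p : nat * nat => _.
have [s Hs] : exists s, has_sum F s.
  apply: abs_summable_has_sum.
  apply: (weighted_summable (fun p => w (Z.of_nat (if second then S (snd p) else S (fst p)))) r 0 t Ht) => p.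
  apply: Rle_trans (Hw _) _; lra.
pose f (d e : nat) := w (Z.of_nat (if second then e else d)) * (RtoC (INR d) ^ r * RtoC (INR e) ^ 0) * nome t ^ (d * e).
have H := has_sum_divisors f s Hs.
rewrite (has_sum_CSeries _ s) //.
apply: has_sum_ext H => k; rewrite divisor_sum_mult.
apply: divisor_sum_ext => d Hd Hmod; rewrite /f.
have -> : (d * (S k / d) = S k)%nat by have := Nat.div_mod_eq (S k) d; rewrite Hmod Nat.add_0_r.
rewrite [_ ^ 0]/=; ring.
Qed.

(** The divisor sums with chi(d) and chi(n/d) are the two halves of the weight chi(m) + chi(n). For
    N = 1, H coincides with G and doubles the constant term. *)
Lemma eisenstein_Tsum r t : (0 < Im t)%R ->
  eisenstein_G N (conj_character chi) (S r) t + eisenstein_H N chi (S r) t = const_term N chi (S r) + T r 0 t.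
Proof.
move=> Ht.
have cw := chi_le_1 N chi HN Hprim.
have H1 := divisor_series chi false r t Ht cw; have H2 := divisor_series chi true r t Ht cw.
have HT := has_sum_unique _ _ _ (has_sum_ext _ (Tterm r 0 t) _ _ (has_sum_plus _ _ _ _ H1 H2)) (Tsum_has_sum N chi HN Hprim r 0 t Ht).
rewrite -HT; last by move=> p; rewrite /Tsum_term /chi_pair; ring.
have cc n : conj_character (conj_character chi) n = chi n by rewrite /conj_character Cconj_conj.
have e1 psi : (forall n, psi n = chi n) -> CSeries (fun i => divisor_sum (S i) (fun d => psi (Z.of_nat d) * RtoC (INR d) ^ (S r - 1)) * nome t ^ S i) =
   CSeries (fun i => divisor_sum (S i) (fun d => chi (Z.of_nat d) * RtoC (INR d) ^ r) * nome t ^ S i).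
  move=> E; rewrite Nat.sub_succ Nat.sub_0_r; rewrite /CSeries; congr (_, _); apply: Series_ext => i;
  by congr (_ (_ * _)); apply: divisor_sum_ext => d _ _; rewrite E.
have e2 psi : (forall n, psi n = chi n) -> twisted_bernoulli N psi (S r) = twisted_bernoulli N chi (S r).
  by move=> E; rewrite /twisted_bernoulli; congr (_ * _); apply: sum_n_ext => h; rewrite E.
have Sr : RtoC (INR (S r)) <> 0 by move=> E; have := RtoC_inj _ _ E; apply: not_0_INR.
rewrite /eisenstein_G (e1 _ cc) (e2 _ cc) /eisenstein_H /const_term /level_factor.
case: (Nat.eq_dec N 1) => N1.
- have -> : (N =? 1)%nat = true by apply/Nat.eqb_eq.
  have one n : chi n = 1 by exact: (chi_level_1 N chi HN Hprim).
  have cj n : conj_character chi n = chi n.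
    by rewrite /conj_character one /Cconj /RtoC /=; congr (_, _); ring.
  rewrite /eisenstein_G (e1 _ cj) (e2 _ cj).
  have -> : CSeries (fun i => divisor_sum (S i) (fun d => chi (Z.of_nat (S i / d)%nat) * RtoC (INR d) ^ r) * nome t ^ S i) =
     CSeries (fun i => divisor_sum (S i) (fun d => chi (Z.of_nat d) * RtoC (INR d) ^ r) * nome t ^ S i).
    rewrite /CSeries; congr (_, _); apply: Series_ext => i;
    by congr (_ (_ * _)); apply: divisor_sum_ext => d _ _; rewrite !one.
  field; exact: Sr.
- have -> : (N =? 1)%nat = false by apply/Nat.eqb_neq.
  rewrite Nat.sub_succ Nat.sub_0_r; field; exact: Sr.
Qed.

Definition odd_weight (p : nat * nat) : C := if Nat.odd (fst p + snd p) then 1 else 0.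

Lemma sinh_series (a b : C) :
  has_sum (fun p : nat * nat => odd_weight p * ((a ^ fst p / RtoC (INR (fact (fst p)))) * (b ^ snd p / RtoC (INR (fact (snd p)))))) (Csinh (a + b)).
Proof.
have H x y := has_sum_prod _ _ _ _ (abs_summable_Cexp x) (abs_summable_Cexp y) (has_sum_Cexp x) (has_sum_Cexp y).
have D := has_sum_mult_l (/ 2) _ _ (has_sum_minus _ _ _ _ (H a b) (H (- a) (- b))).
have -> : Csinh (a + b) = / 2 * (Cexp a * Cexp b - Cexp (- a) * Cexp (- b)).
  rewrite -!Cexp_plus /Csinh; have -> : - (a + b) = - a + - b by ring.
  rewrite /Cdiv; ring.
apply: has_sum_ext D => -[r s]; cbn [fst snd]; rewrite /odd_weight; cbn [fst snd].
have fr := INR_fact_nz r; have fs := INR_fact_nz s.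
rewrite !Cpow_opp Nat.odd_add; case: (Nat.odd r); case: (Nat.odd s); cbn [xorb]; by field; split.
Qed.

(** Places a one-variable expansion on the axis s = 0, so that the polar parts can be added to the
    double series in u and v. *)
Lemma has_sum_axis (g : nat -> C) a : has_sum g a -> has_sum (fun p : nat * nat => match snd p with O => g (fst p) | _ => RtoC 0 end) a.
Proof.
move=> H; pose d0 (n : nat) := match n with O => RtoC 1 | _ => RtoC 0 end.
have H0 : has_sum d0 1.
  have -> : RtoC 1 = sumC d0 (0%nat :: nil) by rewrite /= Cplus_0_r.
  apply: has_sum_finite; first by constructor => //; constructor.
  by case=> // h; case: h; left.
have := has_sum_prod _ _ _ _ (has_sum_abs_summable _ _ H) (has_sum_abs_summable _ _ H0) H H0.
rewrite Cmult_1_r; apply: has_sum_ext => -[r s]; cbn [fst snd]; case: s => [|s]; rewrite /d0; ring.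
Qed.

(** Expanding sinh gives a family over (m, n) and (r, s), which is absolutely summable: u and v cost
    e^(Y (m + n)/8) against the decay e^(-Y (m + n)/2). Fubini in one order gives the sinh series,
    in the other the coefficients [Tsum]. *)
Lemma sinh_double_series tau u v : (0 < Im tau)%R -> (Cmod u <= height tau / 8)%R -> (Cmod v <= height tau / 8)%R ->
  has_sum (fun rs => odd_weight rs * (T (fst rs) (snd rs) tau * ((u ^ fst rs / RtoC (INR (fact (fst rs)))) * (v ^ snd rs / RtoC (INR (fact (snd rs)))))))
    (/ 2 * sinh_sum chi tau u v).
Proof.
move=> Ht Hu Hv; have hp := height_pos tau Ht; set Y := height tau in Hu Hv hp.
pose ef (rs : nat * nat) (a b : C) := (a ^ fst rs / RtoC (INR (fact (fst rs)))) * (b ^ snd rs / RtoC (INR (fact (snd rs)))).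
pose f (x : (nat * nat) * (nat * nat)) := odd_weight (snd x) * (Tterm (fst (snd x)) (snd (snd x)) tau (fst x) * ef (snd x) u v).
pose m (p : nat * nat) := RtoC (INR (S (fst p))). pose n (p : nat * nat) := RtoC (INR (S (snd p))).
pose c (p : nat * nat) := chi_pair chi p * nome tau ^ (S (fst p) * S (snd p)).
have fE x : f x = c (fst x) * (odd_weight (snd x) * ef (snd x) (m (fst x) * u) (n (fst x) * v)).
  rewrite /f /c /ef /Tsum_term /m /n !Cpow_mult_l /Cdiv; ring.
have strip w : (Cmod w <= Y / 8)%R -> (- Y < Re w < Y)%R.
  move=> Hw; have /Rabs_le_between := fst_le_Cmod w; rewrite -/(Re w); lra.
have inner p : has_sum (fun rs => f (p, rs)) (/ 2 * sinh_term chi tau u v p).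
  have H := has_sum_mult_l (c p) _ _ (sinh_series (m p * u) (n p * v)).
  have -> : / 2 * sinh_term chi tau u v p = c p * Csinh (m p * u + n p * v).
    rewrite (sinh_term_sinh N chi Hprim Heven) !Z2C_nat -/(m p) -/(n p).
    rewrite /c /chi_pair (nome_pow_Cexp tau) -Nat2Z.inj_mul Z2C_nat.
    have -> : RtoC (INR (S (fst p) * S (snd p))) * (twopii * tau) = RtoC (INR (S (fst p) * S (snd p))) * twopii * tau by ring.
    field.
  by apply: has_sum_ext H => rs; rewrite fE.
have sf : abs_summable f.
  pose g p := (2 * (exp (Y / 8) ^ S (fst p) * exp (Y / 8) ^ S (snd p)) * (exp (- (Y / 2)) ^ S (fst p) * exp (- (Y / 2)) ^ S (snd p)))%R.
  pose rho := exp (- (Y / 4)).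
  have r0 : (0 <= rho < 1)%R.
    by split; [left; exact: exp_pos | rewrite -exp_0; apply: exp_increasing; lra].
  exists (/ (1 - rho) * 2 * / (1 - rho))%R.
  apply: (bounded_sums_prod _ g) => [x|p|]; first exact: Cmod_ge_0.
  - have i0 := pos_INR (S (fst p)); have j0 := pos_INR (S (snd p)).
    have u0 := Cmod_ge_0 u; have v0 := Cmod_ge_0 v.
    pose X := (INR (S (fst p)) * Cmod u)%R. pose Z := (INR (S (snd p)) * Cmod v)%R.
    have X0 : (0 <= X)%R by exact: Rmult_le_pos.
    have Z0 : (0 <= Z)%R by exact: Rmult_le_pos.
    have eX : (exp X <= exp (Y / 8) ^ S (fst p))%R.
      by rewrite -exp_INR_mult; apply: exp_le_compat; apply: Rmult_le_compat_l.
    have eZ : (exp Z <= exp (Y / 8) ^ S (snd p))%R.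
      by rewrite -exp_INR_mult; apply: exp_le_compat; apply: Rmult_le_compat_l.
    have cb : (Cmod (c p) <= 2 * (exp (- (Y / 2)) ^ S (fst p) * exp (- (Y / 2)) ^ S (snd p)))%R.
      rewrite /c Cmod_mult; apply: Rmult_le_compat; try exact: Cmod_ge_0; first exact: (chi_pair_bound N chi HN Hprim).
      apply: nome_pow_bound; rewrite -/Y; lra.
    have Hb : bounded_sums (fun rs : nat * nat => (Cmod (c p) * (X ^ fst rs / INR (fact (fst rs)) * (Z ^ snd rs / INR (fact (snd rs)))))%R) (Cmod (c p) * (exp Z * exp X))%R.
      apply: bounded_sums_mult_l; first exact: Cmod_ge_0.
      apply: (bounded_sums_prod _ (fun r => (exp Z * (X ^ r / INR (fact r)))%R)) => [[r s]|r|].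
      + cbn [fst snd]; apply: Rmult_le_pos; apply: Rmult_le_pos; try exact: pow_le; left; apply: Rinv_0_lt_compat; exact: INR_fact_lt_0.
      + cbn [fst snd]; rewrite Rmult_comm; apply: bounded_sums_mult_l; last exact: exp_terms_sum.
        apply: Rmult_le_pos; first exact: pow_le.
        left; apply: Rinv_0_lt_compat; exact: INR_fact_lt_0.
      + by apply: bounded_sums_mult_l; [left; exact: exp_pos | exact: exp_terms_sum].
    have Mb : (Cmod (c p) * (exp Z * exp X) <= g p)%R.
      rewrite /g; set A := (exp (- (Y / 2)) ^ S (fst p) * exp (- (Y / 2)) ^ S (snd p))%R in cb *.
      have a1 : (exp Z * exp X <= exp (Y / 8) ^ S (snd p) * exp (Y / 8) ^ S (fst p))%R.
        by apply: Rmult_le_compat => //; left; exact: exp_pos.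
      have a0 : (0 <= exp Z * exp X)%R by apply: Rmult_le_pos; left; exact: exp_pos.
      have := Rmult_le_compat _ _ _ _ (Cmod_ge_0 (c p)) a0 cb a1; lra.
    move=> L HL; apply: Rle_trans (_ : _ <= Cmod (c p) * (exp Z * exp X))%R Mb.
    apply: Rle_trans (Hb L HL); apply: sumR_le => -[r s] _; rewrite fE; cbn [fst snd].
    rewrite Cmod_mult; apply: Rmult_le_compat_l; first exact: Cmod_ge_0.
    rewrite Cmod_mult /ef; cbn [fst snd].
    have w1 : (Cmod (odd_weight (r, s)) <= 1)%R.
      by rewrite /odd_weight; case: Nat.odd; rewrite ?Cmod_1 ?Cmod_0; lra.
    have eE : Cmod ((m p * u) ^ r / RtoC (INR (fact r)) * ((n p * v) ^ s / RtoC (INR (fact s)))) = (X ^ r / INR (fact r) * (Z ^ s / INR (fact s)))%R.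
      rewrite Cmod_mult !Cmod_div; try exact: INR_fact_nz.
      rewrite !Cmod_pow !Cmod_mult /m /n !Cmod_R !(Rabs_pos_eq (INR _)) //; exact: pos_INR.
    rewrite eE; have e0 : (0 <= X ^ r / INR (fact r) * (Z ^ s / INR (fact s)))%R by rewrite -eE; exact: Cmod_ge_0.
    have := Rmult_le_compat_r _ _ _ e0 w1; lra.
  - apply: bounded_sums_le (bounded_sums_geom2 2 rho ltac:(lra) r0) => p.
    have er k : (exp (Y / 8) ^ k * exp (- (Y / 2)) ^ k <= rho ^ k)%R.
      rewrite -Rpow_mult_distr -exp_plus; apply: pow_incr; split; first by left; exact: exp_pos.
      apply: exp_le_compat; lra.
    have rh k : (rho ^ S k <= rho ^ k)%R.
      have := pow_le rho k (proj1 r0) => h; rewrite /=; nra.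
    have a1 := Rle_trans _ _ _ (er (S (fst p))) (rh (fst p)); have a2 := Rle_trans _ _ _ (er (S (snd p))) (rh (snd p)).
    have q0 k : (0 <= exp (Y / 8) ^ k * exp (- (Y / 2)) ^ k)%R by apply: Rmult_le_pos; apply: pow_le; left; exact: exp_pos.
    have := Rmult_le_compat _ _ _ _ (q0 _) (q0 _) a1 a2; rewrite /g; lra.
have [s Hs] := abs_summable_has_sum f sf.
have E1 : s = / 2 * sinh_sum chi tau u v.
  apply: (has_sum_unique _ _ _ (has_sum_fubini f _ s Hs inner)); apply: has_sum_mult_l.
  by apply: (sinh_term_has_sum N chi HN Hprim) => //; exact: strip.
rewrite -E1; apply: (has_sum_fubini (fun x : (nat * nat) * (nat * nat) => f (snd x, fst x)) _ s (has_sum_swap f s Hs)) => rs.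
have H := has_sum_mult_l (odd_weight rs * ef rs u v) _ _ (Tsum_has_sum N chi HN Hprim (fst rs) (snd rs) tau Ht).
have -> : odd_weight rs * (T (fst rs) (snd rs) tau * (u ^ fst rs / RtoC (INR (fact (fst rs))) * (v ^ snd rs / RtoC (INR (fact (snd rs)))))) =
  odd_weight rs * ef rs u v * T (fst rs) (snd rs) tau by rewrite /ef; ring.
apply: has_sum_ext H => p; rewrite /f; cbn [fst snd]; ring.
Qed.

Theorem Ftw_laurent tau : (0 < Im tau)%R ->
  exists delta : R, (0 < delta)%R /\
  forall u v : C, (0 < Cmod u < delta)%R -> (0 < Cmod v < delta)%R ->
  exists S4 : C,
    is_double_series
      (fun r s =>
         if Nat.odd (r + s) then
           let k := (Nat.max r s - Nat.min r s + 1)%nat in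
           Dtau_iter (Nat.min r s)
             (fun t => eisenstein_G N (conj_character chi) k t
                       + eisenstein_H N chi k t) tau
           * (u ^ r / INR (fact r)) * (v ^ s / INR (fact s))
         else 0) S4 /\
    Ftw N chi tau u v = chi 0%Z * (1 / u + 1 / v) - S4.
Proof.
move=> Ht; have hp := height_pos tau Ht.
have N0 : (0 < INR N)%R by apply: lt_0_INR; lia.
(* The first bound is the one required by the sinh expansion, the second puts N u and N v within the
   Bernoulli radius 1/2. *)
pose delta := Rmin (height tau / 8) (/ (2 * INR N)).
have d1 : (delta <= height tau / 8)%R by exact: Rmin_l.
have d2 : (delta <= / (2 * INR N))%R by exact: Rmin_r.
exists delta; split; first by apply: Rmin_glb_lt; [lra | apply: Rinv_0_lt_compat; lra].
have pc w : (0 < Cmod w < delta)%R -> w <> 0 /\ (Cmod (RtoC (INR N) * w) < / 2)%R /\ Cexp w ^ N - 1 <> 0 /\ (- height tau < Re w < height tau)%R.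
  move=> [w0 w1]; have nw : w <> 0 by apply/Cmod_gt_0.
  have small : (Cmod (RtoC (INR N) * w) < / 2)%R.
    rewrite Cmod_mult Cmod_R Rabs_pos_eq; last lra.
    have -> : (/ 2 = INR N * / (2 * INR N))%R by field; lra.
    by apply: Rmult_lt_compat_l => //; lra.
  split=> //; split=> //; split.
    rewrite Cexp_pow; apply: Cminus_neq_0; apply: Cexp_eq_1_small.
      by apply: Cmult_neq_0 => //; exact: (INR_N_nz N HN).
    by have := PI2_1; move: small; lra.
  have /Rabs_le_between := fst_le_Cmod w; rewrite -/(Re w); lra.
move=> u v Hu Hv.
have [nu [su [eu bu]]] := pc u Hu; have [nv [sv [ev bv]]] := pc v Hv.
have HD := sinh_double_series tau u v Ht ltac:(lra) ltac:(lra).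
have HU := polar_series N chi HN Hprim Heven u nu su.
have HV := polar_series N chi HN Hprim Heven v nv sv.
have HU2 := has_sum_axis _ _ HU; have HV2 := has_sum_swap _ _ (has_sum_axis _ _ HV).
have HS := has_sum_plus _ _ _ _ HD (has_sum_plus _ _ _ _ HU2 HV2).
set S4 := _ + _ in HS; exists S4; split; last first.
  rewrite (Ftw_expansion N chi HN Hprim) // -/(Ppart N chi u) -/(Ppart N chi v) /S4 /Cdiv; ring.
set a := fun r s : nat => _.
have HS' : has_sum (fun x : nat * nat => a (fst x) (snd x)) S4.
  apply: has_sum_ext HS => -[r s]; cbn [fst snd]; rewrite /a /odd_weight; cbn [fst snd].
  have key : (Dtau_iter (Nat.min r s) (fun t => eisenstein_G N (conj_character chi) (Nat.max r s - Nat.min r s + 1) t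
     + eisenstein_H N chi (Nat.max r s - Nat.min r s + 1) t) tau) =
     (match Nat.min r s with O => const_term N chi (S (Nat.max r s)) | _ => RtoC 0 end) + T r s tau.
    have -> : (Nat.max r s - Nat.min r s + 1 = S (Nat.max r s - Nat.min r s))%nat by lia.
    rewrite (Dtau_iter_Tsum N chi HN Hprim _ _ _ (fun t Ht => eisenstein_Tsum _ t Ht)) //.
    congr (_ + _).
      case: (Nat.eq_dec (Nat.min r s) 0) => [e0|n0]; last by case: (Nat.min r s) n0.
      by rewrite e0 Nat.sub_0_r.
    have -> : (Nat.min r s + (Nat.max r s - Nat.min r s) = Nat.max r s)%nat by lia.
    case: (Nat.le_ge_cases r s) => h.
      by rewrite Nat.max_r // Nat.min_l // (Tsum_sym N chi HN Hprim).
    by rewrite Nat.max_l // Nat.min_r.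
  rewrite key /polar_coeff.
  (* The origin has even degree, each axis collects a constant term from one polar part, and
     interior terms consist of [Tsum] alone. *)
  case: r key => [|r] key; case: s key => [|s] key; rewrite ?Nat.add_0_r ?Nat.add_0_l ?Nat.min_0_r ?Nat.min_0_l ?Nat.max_0_r ?Nat.max_0_l.
  - by cbn; ring.
  - case: (Nat.odd (S s)); [rewrite [u ^ 0]/= [INR (fact 0)]/= | ]; cbn [Nat.min]; try ring; field; exact: INR_fact_nz.
  - case: (Nat.odd (S r)); [rewrite [v ^ 0]/= [INR (fact 0)]/= | ]; cbn [Nat.min]; try ring; field; exact: INR_fact_nz.
  - rewrite -Nat.succ_min_distr; case: (Nat.odd (S r + S s)); ring.
by apply: has_sum_is_double_series => //; exact: has_sum_abs_summable HS'.
Qed.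

End Laurent.

(** * The expansions in the region and the properties of the continued function, combined *)

Theorem proposition4p1 (N : nat) (chi : Z -> C)
  (hN : (1 <= N)%nat)
  (hprim : primitive_character N chi)
  (heven : even_character chi) :
  (* (1) *)
  (forall tau u v : C, kronecker_region tau u v ->
     let q := nome tau in
     let xi := Cexp u in
     let eta := Cexp v in
     exists S1 : C,
       is_double_series
         (fun i j => let m := S i in let n := S j in
            (chi (Z.of_nat n) + chi (Z.of_nat m)) *
            (xi ^ m * eta ^ n
             - chi (-1)%Z * (Cpowz xi (- Z.of_nat m) * Cpowz eta (- Z.of_nat n)))
            * q ^ (m * n)) S1 /\
       twisted_kronecker chi tau u v =
         / 2 * sum_n (fun h => chi (Z.of_nat h) *
                 (eta ^ h / (eta ^ N - 1) + xi ^ h / (xi ^ N - 1))) N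
         - / 2 * S1) /\
  (* (2) *)
  (forall tau u v : C, kronecker_region tau u v ->
     twisted_kronecker chi tau u v =
       / (2 * gauss_sum N (conj_character chi)) *
       sum_n (fun h => conj_character chi (Z.of_nat h) *
         (kronecker tau (u + 2 * PI * Ci * INR h / INR N) v +
          kronecker tau u (v + 2 * PI * Ci * INR h / INR N))) (N - 1)) /\
  (* (5) *)
  (forall tau u v : C, kronecker_region tau u v ->
     let q := nome tau in
     let xi := Cexp u in
     let eta := Cexp v in
     exists S5 : C,
       is_series (V := C_NormedModule)
         (fun i => let n := S i in
            divisor_sum n (fun d =>
              (chi (Z.of_nat d) + chi (Z.of_nat (n / d))) *
              Csinh (INR d * u + INR (n / d) * v)) * q ^ n) S5 /\
       twisted_kronecker chi tau u v =
         / 2 * sum_n (fun a => chi (Z.of_nat a) *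
                 (xi ^ a / (xi ^ N - 1) + eta ^ a / (eta ^ N - 1))) N
         - S5) /\
  (* (3), (4), (6), (7): the continued function F *)
  exists F : C -> C -> C -> C,
    (* (3) *)
    (forall tau u v : C, kronecker_region tau u v ->
       F tau u v = twisted_kronecker chi tau u v) /\
    (forall tau u v : C, (0 < Im tau)%R ->
       meromorphic_at (on_C3 F) (tau, (u, v)) /\
       (~ polar_point N tau u v -> holomorphic_at (on_C3 F) (tau, (u, v)))) /\
    (forall tau u v : C, (0 < Im tau)%R ->
       meromorphic_at (on_C2 (F tau)) (u, v) /\
       (pole_at (on_C2 (F tau)) (u, v) <-> polar_point N tau u v)) /\
    (* (4) *)
    (forall tau : C, (0 < Im tau)%R ->
       exists delta : R, (0 < delta)%R /\
       forall u v : C, (0 < Cmod u < delta)%R -> (0 < Cmod v < delta)%R ->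
       exists S4 : C,
         is_double_series
           (fun r s =>
              if Nat.odd (r + s) then
                let k := (Nat.max r s - Nat.min r s + 1)%nat in
                Dtau_iter (Nat.min r s)
                  (fun t => eisenstein_G N (conj_character chi) k t
                            + eisenstein_H N chi k t) tau
                * (u ^ r / INR (fact r)) * (v ^ s / INR (fact s))
              else 0) S4 /\
         F tau u v = chi 0%Z * (1 / u + 1 / v) - S4) /\
    (* (6) *)
    (forall (tau u v : C) (m n r s : Z), (0 < Im tau)%R ->
       ~ polar_point N tau u v ->
       F tau (u + 2 * PI * Ci * (IZR n * INR N * tau + IZR s))
             (v + 2 * PI * Ci * (IZR m * INR N * tau + IZR r)) =
       Cpowz (nome tau) (- (Z.of_nat N * Z.of_nat N * m * n))
       * Cpowz (Cexp u) (- (Z.of_nat N * m))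
       * Cpowz (Cexp v) (- (Z.of_nat N * n))
       * F tau u v) /\
    (* (7) *)
    (forall (tau u v : C) (a b c d : Z), (0 < Im tau)%R ->
       (a * d - b * c)%Z = 1%Z -> (Z.of_nat N | c)%Z ->
       ~ polar_point N tau u v ->
       let j := IZR c * tau + IZR d in
       F ((IZR a * tau + IZR b) / j) (u / j) (v / j) =
       chi d * j * Cexp (IZR c * u * v / (2 * PI * Ci * j)) * F tau u v).
Proof.
split.
  move=> tau u v H q xi eta; exists (sinh_sum chi tau u v); split; first exact: (twisted_kronecker_double_series N chi hN hprim heven).
  rewrite (Ftw_region N chi hN hprim) //.
split; first exact: (twisted_kronecker_average N chi hN hprim).
split.
  move=> tau u v H q xi eta; exists (/ 2 * sinh_sum chi tau u v); split; first exact: (twisted_kronecker_fourier N chi hN hprim heven).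
  rewrite (Ftw_region N chi hN hprim) //; congr (_ * _ - _); rewrite -!sumC_seq; apply: sumC_ext => h _; rewrite /xi /eta; ring.
exists (Ftw N chi); split; first exact: (twisted_kronecker_Ftw N chi hN hprim).
split; first exact: (Ftw_C3 N chi hN hprim).
split; first exact: (Ftw_C2 N chi hN hprim).
split; first exact: (Ftw_laurent N chi hN hprim heven).
split.
- move=> tau u v m n r s Ht np.
  have reg w : ~ polar_value N tau w -> regular N chi tau w.
    by move=> h; apply: (regN_regular N chi hN hprim); apply/(not_polar_regN N chi hN hprim).
  have ru := reg u (fun h => np (or_introl h)); have rv := reg v (fun h => np (or_intror h)).
  have := Ftw_elliptic N chi hN hprim tau u v m n r s Ht ru rv.
  rewrite !Z2C_mult !Z2C_nat => ->; congr (_ * _).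
  rewrite /nome !Cpowz_Cexp -!Cexp_plus /ell_factor; congr Cexp.
  rewrite -/twopii -!/(Z2C _) !(Z2C_opp, Z2C_mult); ring.
- move=> tau u v a b c d Ht Hdet Hc np j; exact: (Ftw_modular N chi hN hprim).
Qed.
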